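(* Let $N\ge 2$ and $a,b\in\{1,\dots,N-1\}$. Put $f(\lambda)=2\pi i\,F\bigl(\tfrac aN,\tfrac bN;1;\lambda\bigr)$ and $g(\lambda)=B\bigl(\tfrac aN,\tfrac bN\bigr)F\bigl(\tfrac aN,\tfrac bN;\tfrac aN+\tfrac bN;1-\lambda\bigr)$. Then $$\begin{pmatrix}\int_{\alpha_{N,\lambda}}\omega^{a,b}_{N,\lambda}&\int_{\beta_{N,\lambda}}\omega^{a,b}_{N,\lambda}\\ \int_{\alpha_{N,\lambda}}\nu^{a,b}_{N,\lambda}&\int_{\beta_{N,\lambda}}\nu^{a,b}_{N,\lambda}\end{pmatrix}=\begin{pmatrix}f(\lambda)&(1-\zeta_N^a)(1-\zeta_N^b)g(\lambda)\\ \frac{d}{d\lambda}f(\lambda)&(1-\zeta_N^a)(1-\zeta_N^b)\frac{d}{d\lambda}g(\lambda)\end{pmatrix},$$ as an identity of multivalued analytic functions of $\lambda$ on $\mathbb{C}\setminus\{0,1\}$ (both sides continued along the same path; for $\lambda\in(0,1)$ with the cycles transported from $\varepsilon$ along the real segment, the hypergeometric functions are given by their convergent power series).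
   Context: $X_{N,\lambda}$ ($\lambda\in\mathbb{C}\setminus\{0,1\}$) is the smooth projective curve in $\mathbb{P}^1\times\mathbb{P}^1$ with affine equation $(1-x^N)(1-y^N)=\lambda x^Ny^N$. $\zeta_N=e^{2\pi i/N}$, $\Delta_N=\mu_N\times\mu_N$ acts by $(\zeta,\zeta')(x,y)=(\zeta x,\zeta'y)$, $\xi_N=(\zeta_N,1)$, $\eta_N=(1,\zeta_N)$. Forms: $\omega_{N,\lambda}^{a,b}=N\frac{x^ay^b}{1-x^N}\frac{dx}{x}$ and $\nu_{N,\lambda}^{a,b}=\frac{b}{\lambda}x^ay^b\frac{dy}{y}$ (second kind; integrals over closed cycles are well defined). Cycles: for small real $\varepsilon>0$, $\alpha_{N,\varepsilon}$ is the loop $x(s)=1+\sqrt\varepsilon e^{-2\pi is}$, $s\in[0,1]$, with $|y(s)-1|<\sqrt\varepsilon$; $\delta_{N,\varepsilon}$ is the path $t\in[0,1]\mapsto(t^{1/N},((1-t)/(1-(1-\varepsilon)t))^{1/N})$ (nonnegative real roots); $\beta_{N,\varepsilon}=((1-\xi_N)(1-\eta_N))_*\delta_{N,\varepsilon}$. $\alpha_{N,\lambda},\beta_{N,\lambda}$ are their continuations along a path from $\varepsilon$ to $\lambda$ in $\mathbb{C}\setminus\{0,1\}$. $F(a,b;c;\lambda)=\sum_{n\ge0}\frac{(a)_n(b)_n}{(1)_n(c)_n}\lambda^n$ is the Gauss hypergeometric function ($(a)_n=\Gamma(a+n)/\Gamma(a)$), continued analytically, and $B$ is the beta function. *)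

(* Defs.v *)
From Stdlib Require Import Reals ZArith List.
From Coquelicot Require Import Coquelicot.

Open Scope R_scope.
Open Scope C_scope.

Definition Gamma (p : R) : R :=
  RInt_gen (fun t => Rpower t (p - 1) * exp (- t))%R
           (at_right 0) (Rbar_locally p_infty).

Definition Beta (p q : R) : R :=
  RInt_gen (fun t => Rpower t (p - 1) * Rpower (1 - t) (q - 1))%R
           (at_right 0) (at_left 1).

Definition pochhammer (a : R) (n : nat) : R := (Gamma (a + INR n) / Gamma a)%R.

Definition CSeries (u : nat -> C) : C :=
  (Series (fun n => fst (u n)), Series (fun n => snd (u n))).

(* Only meaningful on the disc of convergence |z| < 1. *)
Definition hyp2F1 (a b c : R) (z : C) : C :=
  CSeries (fun n =>
    RtoC ((pochhammer a n * pochhammer b n)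
          / (pochhammer 1 n * pochhammer c n))%R * z ^ n).

Definition unit_interval (u : R) : Prop := (0 <= u <= 1)%R.

Definition analytic_at (f : C -> C) (z0 : C) : Prop :=
  exists (c : nat -> C) (r : R), (0 < r)%R /\
    forall z : C, (Cmod (z - z0) < r)%R ->
      @is_pseries C_AbsRing C_NormedModule c (z - z0) (f z).

Definition eq_near (f g : C -> C) (z0 : C) : Prop :=
  exists r : R, (0 < r)%R /\
    forall z : C, (Cmod (z - z0) < r)%R -> f z = g z.

Definition parameter_path (gam : R -> C) : Prop :=
  forall u, unit_interval u ->
    filterlim gam (within unit_interval (locally u)) (locally (gam u))
    /\ gam u <> 0 /\ gam u <> 1.

(* [F u] represents the germ at [gam u] of the continuation of the germ of
   [f] at [gam 0]. *)
Definition analytic_continuation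
    (gam : R -> C) (f : C -> C) (F : R -> C -> C) : Prop :=
  eq_near (F 0%R) f (gam 0%R)
  /\ (forall u, unit_interval u -> analytic_at (F u) (gam u))
  /\ (forall u, unit_interval u -> exists d : R, (0 < d)%R /\
        forall v, unit_interval v -> (Rabs (v - u) < d)%R ->
          eq_near (F v) (F u) (gam v)).

Inductive P1 : Type := Fin (z : C) | Inf.

Definition P1_eq_dec (p q : P1) : {p = q} + {p <> q}.
Proof. decide equality; apply Ceq_dec. Defined.

Definition point : Type := (P1 * P1)%type.

Definition point_eq_dec (p q : point) : {p = q} + {p <> q}.
Proof. decide equality; apply P1_eq_dec. Defined.

Definition P1_locally (p : P1) (A : P1 -> Prop) : Prop :=
  match p with
  | Fin z => exists r : R, (0 < r)%R /\
               forall w : C, (Cmod (w - z) < r)%R -> A (Fin w)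
  | Inf => A Inf /\ exists M : R, forall w : C, (M < Cmod w)%R -> A (Fin w)
  end.

Definition hom (p : P1) : C * C :=
  match p with Fin z => (z, RtoC 1) | Inf => (RtoC 1, RtoC 0) end.

(* (1 - x^N)(1 - y^N) = lam x^N y^N, made homogeneous in each factor. *)
Definition on_curve (N : nat) (lam : C) (p : point) : Prop :=
  let (x, x0) := hom (fst p) in
  let (y, y0) := hom (snd p) in
  (x0 ^ N - x ^ N) * (y0 ^ N - y ^ N) = lam * (x ^ N * y ^ N).

Definition cis (t : R) : C := (cos t, sin t).

Definition zeta (N : nat) : C := cis (2 * PI / INR N).

Definition P1_scale (z : C) (p : P1) : P1 :=
  match p with Fin w => Fin (z * w) | Inf => Inf end.

(* For z <> 0, as is the case for roots of unity. *)
Definition act (g : C * C) (p : point) : point :=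
  (P1_scale (fst g) (fst p), P1_scale (snd g) (snd p)).

Definition xi (N : nat) : C * C := (zeta N, RtoC 1).
Definition eta (N : nat) : C * C := (RtoC 1, zeta N).

(* Only the restriction to [0,1] of a path is relevant. *)
Definition path : Type := R -> point.
Definition chain : Type := list (Z * path).

Fixpoint boundary (c : chain) (p : point) : Z :=
  match c with
  | nil => 0%Z
  | (n, sigma) :: c' =>
      ((if point_eq_dec (sigma 1%R) p then n else 0)
       - (if point_eq_dec (sigma 0%R) p then n else 0)
       + boundary c' p)%Z
  end.

Definition is_cycle (c : chain) : Prop := forall p, boundary c p = 0%Z.

Definition chain_sub (c d : chain) : chain :=
  c ++ map (fun m => (Z.opp (fst m), snd m)) d.

Definition push (g : C * C) (c : chain) : chain :=
  map (fun m => (fst m, fun s => act g (snd m s))) c.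

Definition same_chain (c d : chain) : Prop :=
  Forall2 (fun m m' => fst m = fst m' /\
             forall s, unit_interval s -> snd m s = snd m' s) c d.

(* A family of chains; the first real argument is the deformation parameter,
   the second one the parameter of the paths. *)
Definition chain_family : Type := list (Z * (R -> R -> point)).

Definition chain_at (fam : chain_family) (u : R) : chain :=
  map (fun m => (fst m, snd m u)) fam.

Definition unit_square (q : R * R) : Prop :=
  unit_interval (fst q) /\ unit_interval (snd q).

Definition continuous_on_square (H : R -> R -> point) : Prop :=
  forall u s, unit_interval u -> unit_interval s ->
    filterlim (fun q : R * R => fst (H (fst q) (snd q)))
      (within unit_square (locally (u, s))) (P1_locally (fst (H u s)))
    /\
    filterlim (fun q : R * R => snd (H (fst q) (snd q)))
      (within unit_square (locally (u, s))) (P1_locally (snd (H u s))).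

(* [c1] is a continuation along [gam] of the cycle [c0] on the fibre over
   [gam 0]: it is the end of a continuous family of cycles, the one at time
   [u] lying on the fibre over [gam u].  This determines the homology class of
   [c1], which is the parallel transport of that of [c0]. *)
Definition cycle_continuation
    (N : nat) (gam : R -> C) (c0 c1 : chain) : Prop :=
  exists fam : chain_family,
    same_chain (chain_at fam 0) c0
    /\ same_chain (chain_at fam 1) c1
    /\ List.Forall (fun m =>
         continuous_on_square (snd m)
         /\ forall u s, unit_interval u -> unit_interval s ->
              on_curve N (gam u) (snd m u s)) fam
    /\ forall u, unit_interval u -> is_cycle (chain_at fam u).

Definition is_alpha (N : nat) (eps : R) (alpha : path) : Prop :=
  forall s, unit_interval s -> exists y : C,
    alpha s = (Fin (1 + sqrt eps * cis (- (2 * PI * s))), Fin y)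
    /\ on_curve N eps (alpha s)
    /\ (Cmod (y - 1) < sqrt eps)%R.

(* [Rpower 0 _] is not 0. *)
Definition nth_root (N : nat) (t : R) : R :=
  if Rlt_dec 0 t then Rpower t (/ INR N) else 0%R.

Definition delta (N : nat) (eps : R) : path := fun t =>
  (Fin (nth_root N t), Fin (nth_root N ((1 - t) / (1 - (1 - eps) * t))%R)).

Definition alpha_chain (alpha : path) : chain := (1%Z, alpha) :: nil.

(* (1 - xi)(1 - eta) applied to delta *)
Definition beta_chain (N : nat) (eps : R) : chain :=
  let d := (1%Z, delta N eps) :: nil in
  let e := chain_sub d (push (eta N) d) in
  chain_sub e (push (xi N) e).

(* A form is given by its value as a function of (x, y, dx, dy). *)
Definition form : Type := C -> C -> C -> C -> C.

Definition omega (N a b : nat) : form := fun x y dx dy =>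
  INR N * (x ^ a * y ^ b / (1 - x ^ N)) * (dx / x).

Definition nu (lam : C) (a b : nat) : form := fun x y dx dy =>
  INR b / lam * (x ^ a * y ^ b) * (dy / y).

(* Affine on [0,1] and C^1 on (0,1), where it avoids the zeros of x and y; on
   the curve x^N = 1 is equivalent to y = 0 at affine points, so that no
   denominator of [omega] or [nu] vanishes on (0,1).  Nothing is asked of the
   derivatives at the endpoints, in view of [delta]. *)
Definition smooth_coordinates (sigma : path) (x y dx dy : R -> C) : Prop :=
  (forall s, unit_interval s -> sigma s = (Fin (x s), Fin (y s)))
  /\ forall s, (0 < s < 1)%R ->
       x s <> 0 /\ y s <> 0
       /\ @is_derive R_AbsRing C_R_NormedModule x s (dx s)
       /\ @is_derive R_AbsRing C_R_NormedModule y s (dy s)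
       /\ continuous dx s /\ continuous dy s.

Definition smooth_chain (c : chain) : Prop :=
  List.Forall (fun m => exists x y dx dy, smooth_coordinates (snd m) x y dx dy) c.

Definition is_path_integral (w : form) (sigma : path) (v : C) : Prop :=
  exists x y dx dy, smooth_coordinates sigma x y dx dy
    /\ @is_RInt_gen C_R_NormedModule
         (fun s => w (x s) (y s) (dx s) (dy s)) (at_right 0) (at_left 1) v.

Fixpoint is_chain_integral (w : form) (c : chain) (v : C) : Prop :=
  match c with
  | nil => v = 0
  | (n, sigma) :: c' => exists v1 v2 : C,
      is_path_integral w sigma v1 /\ is_chain_integral w c' v2
      /\ v = IZR n * v1 + v2
  end.

Definition f_series (N a b : nat) (z : C) : C :=
  2 * PI * Ci * hyp2F1 (INR a / INR N) (INR b / INR N) 1 z.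

Definition g_series (N a b : nat) (z : C) : C :=
  Beta (INR a / INR N) (INR b / INR N)
  * hyp2F1 (INR a / INR N) (INR b / INR N) (INR a / INR N + INR b / INR N)
      (1 - z).

(* The matrix identity at [lam], entry by entry, for branches f and g. *)
Definition period_identity
    (N a b : nat) (lam : C) (cA cB : chain) (f g : C -> C) : Prop :=
  let k := (1 - zeta N ^ a) * (1 - zeta N ^ b) in
  exists df dg : C,
    @is_derive C_AbsRing C_NormedModule f lam df
    /\ @is_derive C_AbsRing C_NormedModule g lam dg
    /\ is_chain_integral (omega N a b) cA (f lam)
    /\ is_chain_integral (omega N a b) cB (k * g lam)
    /\ is_chain_integral (nu lam a b) cA df
    /\ is_chain_integral (nu lam a b) cB (k * dg).

(* Main.v *)
(* For fixed [lambda] the form [omega] is holomorphic on the whole compact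
   curve (the factor [1 - x^N] vanishes only where [y = 0], and there [y] is a
   local coordinate), and with [x] fixed its derivative in [lambda] is [nu].
   Locally on the total space of the family a primitive of [omega] is a
   holomorphic function of [lambda] and of one coordinate, so the integral of
   [omega] along a path defines a germ in [lambda], up to contributions of the
   end points that cancel for a cycle.  Hence the period over a continuous family
   of cycles is analytic in [lambda]: by the identity theorem it is the analytic
   continuation of its initial germ, and the integral of [nu] over the final
   cycle is the derivative of the period.

   The initial germs are determined on a real segment.  On alpha, [y^b] is the
   binomial series [(1 + lambda tau)^(-b/N)] with [tau = x^N / (1 - x^N)]; the
   coefficients of the resulting series satisfy a two-term recursion given by
   exact forms, starting from a residue at [x = 1].  On beta, the four images of
   delta contribute [(1 - zeta^a)(1 - zeta^b)] times Euler's integral. *)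
Require Import Defs.
From Stdlib Require Import Reals ZArith List Lra Lia Classical Bool ClassicalEpsilon.
From Coquelicot Require Import Coquelicot.
Open Scope R_scope.
Open Scope C_scope.

(** The transported cycles are only continuous, so over intermediate fibres no integral of [omega]
    is at hand. The period is built instead from small increments: [GG q0 q1] is the germ, in the
    parameter, of the primitive of [omega] between two nearby points that move with a preferred
    coordinate held fixed, and the transport uses nothing but its local cocycle property. True
    integrals return over the last fibre, whose chain is smooth. The delicate points are the branch
    points with [y = 0], at which delta ends: [x] is no coordinate there, and one must see that the
    derivative of the primitive in the parameter still tends to 0. Two notions of analyticity have
    to meet. The continuations of the statement are power series, whereas periods are only known to
    be complex differentiable; Cauchy's formula turns the second into the first, so that isolated
    zeros can compare them. The comparison serves twice: at limit points of the transport, and at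
    [eps], where an equality of germs is drawn from real parameters. For the latter purpose the
    cycles over the single fibre [eps] are first extended to explicit families over a real
    segment. *)

Ltac cring := cbv beta; ring.
Ltac cfield := cbv beta; field; auto.

Lemma Cpow_zero (c : C) : c ^ 0 = 1.
Proof. reflexivity. Qed.

Lemma Cmod_minus_sym (x y : C) : Cmod (x - y) = Cmod (y - x).
Proof. rewrite <- Cmod_opp. f_equal. ring. Qed.

Lemma Cmod_tri_sub (x y z : C) : (Cmod (x - z) <= Cmod (x - y) + Cmod (y - z))%R.
Proof. replace (x - z) with ((x - y) + (y - z)) by ring. apply Cmod_triangle. Qed.

Lemma Cmod_sub_le (x y : C) : (Cmod (x - y) <= Cmod x + Cmod y)%R.
Proof. unfold Cminus. rewrite <- (Cmod_opp y). apply Cmod_triangle. Qed.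

Lemma Cmod_ge_sub (x y : C) : (Cmod x - Cmod y <= Cmod (x - y))%R.
Proof. generalize (Cmod_triangle (x - y) y). replace (x - y + y) with x by ring. lra. Qed.

Lemma Cmod_small_0 (x : C) : (forall e, (0 < e)%R -> (Cmod x <= e)%R) -> x = 0.
Proof.
  intros H. apply Cmod_eq_0. destruct (Req_dec (Cmod x) 0) as [|n]; [easy|].
  assert (0 < Cmod x)%R by (generalize (Cmod_ge_0 x); lra).
  specialize (H (Cmod x / 2)%R). lra.
Qed.

Lemma Ceq_sub (x y : C) : x - y = 0 -> x = y.
Proof. intros H. replace x with (x - y + y) by ring. rewrite H. ring. Qed.

Lemma Csub_neq0 (x y : C) : x <> y -> x - y <> 0.
Proof. intros H E. apply H. now apply Ceq_sub. Qed.

Lemma RtoC_neq (x y : R) : x <> y -> RtoC x <> RtoC y.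
Proof. intros H E. apply H. now apply RtoC_inj. Qed.

Lemma RtoC_INR_neq0 (n : nat) : (0 < n)%nat -> RtoC (INR n) <> 0.
Proof. intros H. apply RtoC_neq. apply not_0_INR. lia. Qed.

Lemma Im_le_Cmod (c : C) : (Rabs (Im c) <= Cmod c)%R.
Proof. eapply Rle_trans; [|apply Rmax_Cmod]. apply Rmax_r. Qed.

Lemma Cmod_le_re_im (c : C) : (Cmod c <= Rabs (Re c) + Rabs (Im c))%R.
Proof.
  assert (E : c = RtoC (Re c) + Ci * RtoC (Im c)) by (destruct c; apply injective_projections; unfold Re, Im; simpl; ring).
  rewrite E at 1. eapply Rle_trans; [apply Cmod_triangle|].
  rewrite Cmod_mult, Cmod_Ci, !Cmod_R. apply Req_le. ring.
Qed.

(** * Strict complex differentiability in two variables *)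

(* Strictness (both arguments vary) makes the partial derivatives continuous
   and the difference quotients uniform on compact sets, so that neither has to
   be assumed separately. *)
Definition D2 (f : C -> C -> C) (l z a b : C) : Prop :=
  forall e : R, (0 < e)%R -> exists d : R, (0 < d)%R /\
    forall l1 z1 l2 z2 : C,
      (Cmod (l1 - l) < d)%R -> (Cmod (z1 - z) < d)%R ->
      (Cmod (l2 - l) < d)%R -> (Cmod (z2 - z) < d)%R ->
      (Cmod (f l1 z1 - f l2 z2 - (a * (l1 - l2) + b * (z1 - z2)))
       <= e * (Cmod (l1 - l2) + Cmod (z1 - z2)))%R.

(** Encoded as the case of a function constant in the parameter, so that the one-variable rules are
    read off from those for [D2]. *)
Definition D1 (f : C -> C) (z a : C) : Prop := D2 (fun _ w => f w) 0 z 0 a.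

Lemma D1_char (f : C -> C) (z a : C) :
  D1 f z a <->
  forall e : R, (0 < e)%R -> exists d : R, (0 < d)%R /\
    forall z1 z2 : C, (Cmod (z1 - z) < d)%R -> (Cmod (z2 - z) < d)%R ->
      (Cmod (f z1 - f z2 - a * (z1 - z2)) <= e * Cmod (z1 - z2))%R.
Proof.
  split; intros H e He; destruct (H e He) as [d [Hd P]]; exists d; split; auto.
  - intros z1 z2 H1 H2. specialize (P 0 z1 0 z2).
    replace (f z1 - f z2 - a * (z1 - z2))
      with (f z1 - f z2 - (0 * (0 - 0) + a * (z1 - z2))) by ring.
    replace (Cmod (z1 - z2)) with (Cmod (0 - 0) + Cmod (z1 - z2))%R.
    + apply P; auto; replace (0 - 0) with (RtoC 0) by ring; now rewrite Cmod_0.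
    + replace (0 - 0) with (RtoC 0) by ring. rewrite Cmod_0; ring.
  - intros l1 z1 l2 z2 _ H1 _ H2.
    replace (f z1 - f z2 - (0 * (l1 - l2) + a * (z1 - z2)))
      with (f z1 - f z2 - a * (z1 - z2)) by ring.
    eapply Rle_trans; [now apply P|].
    generalize (Cmod_ge_0 (l1 - l2)); nra.
Qed.

Lemma D2_eq (f : C -> C -> C) (l z a b a' b' : C) :
  D2 f l z a b -> a = a' -> b = b' -> D2 f l z a' b'.
Proof. now intros H <- <-. Qed.

Lemma D1_eq (f : C -> C) (z a a' : C) : D1 f z a -> a = a' -> D1 f z a'.
Proof. now intros H <-. Qed.

Lemma D2_ext_near (f g : C -> C -> C) (l z a b : C) (r : R) : (0 < r)%R ->
  (forall l' z', (Cmod (l' - l) < r)%R -> (Cmod (z' - z) < r)%R -> f l' z' = g l' z') ->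
  D2 f l z a b -> D2 g l z a b.
Proof.
  intros Hr E H e He. destruct (H e He) as [d [Hd P]].
  exists (Rmin d r). split; [now apply Rmin_pos|]. intros.
  assert (Rmin d r <= d)%R by apply Rmin_l. assert (Rmin d r <= r)%R by apply Rmin_r.
  rewrite <- !E by lra. apply P; lra.
Qed.

Lemma D1_ext_near (f g : C -> C) (z a : C) (r : R) : (0 < r)%R ->
  (forall z', (Cmod (z' - z) < r)%R -> f z' = g z') -> D1 f z a -> D1 g z a.
Proof. intros Hr E. apply (D2_ext_near _ _ _ _ _ _ r Hr). intros; now apply E. Qed.

Lemma D2_ext (f g : C -> C -> C) (l z a b : C) :
  (forall l' z', f l' z' = g l' z') -> D2 f l z a b -> D2 g l z a b.
Proof. intros E. apply (D2_ext_near _ _ _ _ _ _ 1 Rlt_0_1). auto. Qed.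

Lemma D1_ext (f g : C -> C) (z a : C) :
  (forall z', f z' = g z') -> D1 f z a -> D1 g z a.
Proof. intros E. apply (D1_ext_near _ _ _ _ 1 Rlt_0_1). auto. Qed.

(** Strictness with tolerance 1 already gives a Lipschitz bound on a whole neighbourhood; continuity
    and the chain rule rest on it. *)
Lemma D2_lip (f : C -> C -> C) (l z a b : C) : D2 f l z a b ->
  exists d K : R, (0 < d)%R /\ (0 < K)%R /\
    forall l1 z1 l2 z2 : C,
      (Cmod (l1 - l) < d)%R -> (Cmod (z1 - z) < d)%R ->
      (Cmod (l2 - l) < d)%R -> (Cmod (z2 - z) < d)%R ->
      (Cmod (f l1 z1 - f l2 z2) <= K * (Cmod (l1 - l2) + Cmod (z1 - z2)))%R.
Proof.
  intros H. destruct (H 1%R Rlt_0_1) as [d [Hd P]].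
  exists d, (Cmod a + Cmod b + 1)%R.
  generalize (Cmod_ge_0 a) (Cmod_ge_0 b); intros Ha Hb.
  split; [easy|]. split; [lra|]. intros.
  replace (f l1 z1 - f l2 z2) with
    ((f l1 z1 - f l2 z2 - (a * (l1 - l2) + b * (z1 - z2)))
     + (a * (l1 - l2) + b * (z1 - z2))) by ring.
  eapply Rle_trans; [apply Cmod_triangle|].
  eapply Rle_trans; [apply Rplus_le_compat; [now apply P|apply Cmod_triangle]|].
  rewrite !Cmod_mult.
  generalize (Cmod_ge_0 (l1 - l2)) (Cmod_ge_0 (z1 - z2)). nra.
Qed.

Lemma D2_cont (f : C -> C -> C) (l z a b : C) : D2 f l z a b ->
  forall e : R, (0 < e)%R -> exists d : R, (0 < d)%R /\
    forall l1 z1 : C, (Cmod (l1 - l) < d)%R -> (Cmod (z1 - z) < d)%R ->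
      (Cmod (f l1 z1 - f l z) < e)%R.
Proof.
  intros H e He. destruct (D2_lip _ _ _ _ _ H) as [d [K [Hd [HK P]]]].
  assert (0 < e / (4 * K))%R by (apply Rdiv_lt_0_compat; lra).
  exists (Rmin d (e / (4 * K))). split; [now apply Rmin_pos|]. intros l1 z1 H1 H2.
  assert (Rmin d (e / (4 * K)) <= d)%R by apply Rmin_l.
  assert (Rmin d (e / (4 * K)) <= e / (4 * K))%R by apply Rmin_r.
  assert (Z : forall w : C, Cmod (w - w) = 0%R)
    by (intros w; replace (w - w) with (RtoC 0) by ring; apply Cmod_0).
  eapply Rle_lt_trans; [apply P; rewrite ?Z; lra|].
  assert (K * (Cmod (l1 - l) + Cmod (z1 - z)) <= K * (2 * (e / (4 * K))))%R
    by (apply Rmult_le_compat_l; lra).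
  replace (K * (2 * (e / (4 * K))))%R with (e / 2)%R in * by (field; lra). lra.
Qed.

Lemma D1_cont (f : C -> C) (z a : C) : D1 f z a ->
  forall e : R, (0 < e)%R -> exists d : R, (0 < d)%R /\
    forall z1 : C, (Cmod (z1 - z) < d)%R -> (Cmod (f z1 - f z) < e)%R.
Proof.
  intros H e He. destruct (D2_cont _ _ _ _ _ H e He) as [d [Hd P]].
  exists d. split; auto. intros z1 H1. apply (P 0 z1); auto.
  replace (0 - 0) with (RtoC 0) by ring. now rewrite Cmod_0.
Qed.

Lemma D2_const (c l z : C) : D2 (fun _ _ => c) l z 0 0.
Proof.
  intros e He. exists 1%R. split; [lra|]. intros.
  replace (c - c - (0 * (l1 - l2) + 0 * (z1 - z2))) with (RtoC 0) by ring.
  rewrite Cmod_0. generalize (Cmod_ge_0 (l1 - l2)) (Cmod_ge_0 (z1 - z2)). nra.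
Qed.

Lemma D2_fst (l z : C) : D2 (fun l' _ => l') l z 1 0.
Proof.
  intros e He. exists 1%R. split; [lra|]. intros.
  replace (l1 - l2 - (1 * (l1 - l2) + 0 * (z1 - z2))) with (RtoC 0) by ring.
  rewrite Cmod_0. generalize (Cmod_ge_0 (l1 - l2)) (Cmod_ge_0 (z1 - z2)). nra.
Qed.

Lemma D2_snd (l z : C) : D2 (fun _ z' => z') l z 0 1.
Proof.
  intros e He. exists 1%R. split; [lra|]. intros.
  replace (z1 - z2 - (0 * (l1 - l2) + 1 * (z1 - z2))) with (RtoC 0) by ring.
  rewrite Cmod_0. generalize (Cmod_ge_0 (l1 - l2)) (Cmod_ge_0 (z1 - z2)). nra.
Qed.

Lemma D2_comp (g f1 f2 : C -> C -> C) (l z c d a1 b1 a2 b2 : C) :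
  D2 g (f1 l z) (f2 l z) c d -> D2 f1 l z a1 b1 -> D2 f2 l z a2 b2 ->
  D2 (fun l' z' => g (f1 l' z') (f2 l' z')) l z (c * a1 + d * a2) (c * b1 + d * b2).
Proof.
  intros Hg H1 H2 e He.
  destruct (D2_lip _ _ _ _ _ H1) as [d1 [K1 [Hd1 [HK1 L1]]]].
  destruct (D2_lip _ _ _ _ _ H2) as [d2 [K2 [Hd2 [HK2 L2]]]].
  generalize (Cmod_ge_0 c) (Cmod_ge_0 d); intros Hc Hd.
  (* [M] adds up the factors by which the three errors get multiplied: the Lipschitz constants for
     the error of [g], the partial derivatives of [g] for those of [f1] and [f2]. *)
  set (M := (K1 + K2 + Cmod c + Cmod d + 1)%R).
  assert (HM : (0 < M)%R) by (unfold M; lra).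
  assert (He' : (0 < e / M)%R) by (apply Rdiv_lt_0_compat; lra).
  destruct (Hg _ He') as [dg [Hdg Pg]].
  destruct (H1 _ He') as [e1 [He1 P1]]. destruct (H2 _ He') as [e2 [He2 P2]].
  destruct (D2_cont _ _ _ _ _ H1 _ Hdg) as [c1 [Hc1 C1]].
  destruct (D2_cont _ _ _ _ _ H2 _ Hdg) as [c2 [Hc2 C2]].
  set (r := Rmin (Rmin (Rmin d1 d2) (Rmin e1 e2)) (Rmin c1 c2)).
  assert (Hr : (0 < r)%R) by (unfold r; repeat apply Rmin_pos; auto).
  assert (Hr' : (r <= d1 /\ r <= d2 /\ r <= e1 /\ r <= e2 /\ r <= c1 /\ r <= c2)%R).
  { unfold r. repeat split; unfold Rmin; repeat destruct Rle_dec; lra. }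
  exists r. split; [easy|]. intros l1 z1 l2 z2 A1 A2 A3 A4.
  assert (P1' : (Cmod (f1 l1 z1 - f1 l2 z2 - (a1 * (l1 - l2) + b1 * (z1 - z2)))
    <= e / M * (Cmod (l1 - l2) + Cmod (z1 - z2)))%R) by (apply P1; lra).
  assert (P2' : (Cmod (f2 l1 z1 - f2 l2 z2 - (a2 * (l1 - l2) + b2 * (z1 - z2)))
    <= e / M * (Cmod (l1 - l2) + Cmod (z1 - z2)))%R) by (apply P2; lra).
  assert (L1' : (Cmod (f1 l1 z1 - f1 l2 z2) <= K1 * (Cmod (l1 - l2) + Cmod (z1 - z2)))%R)
    by (apply L1; lra).
  assert (L2' : (Cmod (f2 l1 z1 - f2 l2 z2) <= K2 * (Cmod (l1 - l2) + Cmod (z1 - z2)))%R)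
    by (apply L2; lra).
  assert (Pg' : (Cmod (g (f1 l1 z1) (f2 l1 z1) - g (f1 l2 z2) (f2 l2 z2)
     - (c * (f1 l1 z1 - f1 l2 z2) + d * (f2 l1 z1 - f2 l2 z2)))
    <= e / M * (Cmod (f1 l1 z1 - f1 l2 z2) + Cmod (f2 l1 z1 - f2 l2 z2)))%R)
    by (apply Pg; [apply C1|apply C2|apply C1|apply C2]; lra).
  clear P1 P2 L1 L2 Pg C1 C2. rename P1' into P1, P2' into P2, L1' into L1, L2' into L2, Pg' into Pg.
  set (G := g (f1 l1 z1) (f2 l1 z1) - g (f1 l2 z2) (f2 l2 z2)) in *.
  set (F1 := f1 l1 z1 - f1 l2 z2) in *. set (F2 := f2 l1 z1 - f2 l2 z2) in *.
  replace (G - ((c * a1 + d * a2) * (l1 - l2) + (c * b1 + d * b2) * (z1 - z2)))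
    with ((G - (c * F1 + d * F2)) + (c * (F1 - (a1 * (l1 - l2) + b1 * (z1 - z2)))
          + d * (F2 - (a2 * (l1 - l2) + b2 * (z1 - z2))))) by ring.
  eapply Rle_trans; [apply Cmod_triangle|].
  eapply Rle_trans; [apply Rplus_le_compat_l, Cmod_triangle|]. rewrite !Cmod_mult.
  set (S := (Cmod (l1 - l2) + Cmod (z1 - z2))%R) in *.
  assert (HS : (0 <= S)%R)
    by (unfold S; generalize (Cmod_ge_0 (l1 - l2)) (Cmod_ge_0 (z1 - z2)); lra).
  set (E := (e / M)%R) in *.
  assert (T1 : (E * (Cmod F1 + Cmod F2) <= E * (K1 * S + K2 * S))%R)
    by (apply Rmult_le_compat_l; lra).
  assert (T2 := Rmult_le_compat_l _ _ _ Hc P1).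
  assert (T3 := Rmult_le_compat_l _ _ _ Hd P2).
  assert (T4 : (E * M = e)%R) by (unfold E; field; lra).
  assert (T5 : (E * (K1 * S + K2 * S) + (Cmod c * (E * S) + Cmod d * (E * S))
                = (E * M) * S - E * S)%R) by (unfold M; ring).
  rewrite T4 in T5. assert (0 <= E * S)%R by (apply Rmult_le_pos; lra). lra.
Qed.

Lemma D2_add (f g : C -> C -> C) (l z a b c d : C) :
  D2 f l z a b -> D2 g l z c d ->
  D2 (fun l' z' => f l' z' + g l' z') l z (a + c) (b + d).
Proof.
  intros Hf Hg.
  eapply D2_eq; [apply (D2_comp (fun u v => u + v) f g l z 1 1 a b c d); auto|ring|ring].
  intros e He. exists 1%R. split; [lra|]. intros.
  replace (l1 + z1 - (l2 + z2) - (1 * (l1 - l2) + 1 * (z1 - z2))) with (RtoC 0) by ring.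
  rewrite Cmod_0. generalize (Cmod_ge_0 (l1 - l2)) (Cmod_ge_0 (z1 - z2)). nra.
Qed.

Lemma D2_mul (f g : C -> C -> C) (l z a b c d : C) :
  D2 f l z a b -> D2 g l z c d ->
  D2 (fun l' z' => f l' z' * g l' z') l z
    (a * g l z + f l z * c) (b * g l z + f l z * d).
Proof.
  intros Hf Hg.
  eapply D2_eq; [apply (D2_comp (fun u v => u * v) f g l z (g l z) (f l z) a b c d); auto|ring|ring].
  generalize (f l z) (g l z). intros u v e He.
  (* The error is a sum of two products in which one factor is a distance to the centre, so the
     radius [e] itself is small enough. *)
  exists e. split; [lra|]. intros u1 v1 u2 v2 H1 H2 H3 H4.
  replace (u1 * v1 - u2 * v2 - (v * (u1 - u2) + u * (v1 - v2)))
    with ((v1 - v) * (u1 - u2) + (u2 - u) * (v1 - v2)) by ring.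
  eapply Rle_trans; [apply Cmod_triangle|]. rewrite !Cmod_mult.
  generalize (Cmod_ge_0 (u1 - u2)) (Cmod_ge_0 (v1 - v2)). nra.
Qed.

Lemma D2_opp (f : C -> C -> C) (l z a b : C) :
  D2 f l z a b -> D2 (fun l' z' => - f l' z') l z (- a) (- b).
Proof.
  intros H. apply D2_ext with (fun l' z' => (- (1)) * f l' z').
  - intros; ring.
  - eapply D2_eq; [apply D2_mul; [apply D2_const|exact H]|cring|cring].
Qed.

Lemma D2_sub (f g : C -> C -> C) (l z a b c d : C) :
  D2 f l z a b -> D2 g l z c d ->
  D2 (fun l' z' => f l' z' - g l' z') l z (a - c) (b - d).
Proof. intros Hf Hg. apply D2_add; [easy|]. now apply D2_opp. Qed.

Lemma D1_inv (z : C) : z <> 0 -> D1 Cinv z (- / (z * z)).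
Proof.
  intros Hz. apply D1_char. intros e He.
  assert (Hm : (0 < Cmod z)%R) by (now apply Cmod_gt_0).
  set (m := Cmod z) in *.
  (* Within [m / 2] of [z] all moduli lie between [m / 2] and [2 * m], which bounds the error
     quotient by [12 * d / m^3]; the 16 leaves some room. *)
  set (d := Rmin (m / 2) (e * m * m * m / 16)).
  assert (Hd : (0 < d)%R).
  { apply Rmin_pos; [lra|].
    assert (0 < e * m * m * m)%R by (repeat apply Rmult_lt_0_compat; auto). lra. }
  assert (Hd1 : (d <= m / 2)%R) by apply Rmin_l.
  assert (Hd2 : (d <= e * m * m * m / 16)%R) by apply Rmin_r.
  exists d. split; [easy|]. intros z1 z2 H1 H2.
  assert (N1 : (m / 2 <= Cmod z1)%R).
  { generalize (Cmod_ge_sub z (z - z1)). replace (z - (z - z1)) with z1 by ring.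
    rewrite (Cmod_minus_sym z z1). fold m. lra. }
  assert (N2 : (m / 2 <= Cmod z2)%R).
  { generalize (Cmod_ge_sub z (z - z2)). replace (z - (z - z2)) with z2 by ring.
    rewrite (Cmod_minus_sym z z2). fold m. lra. }
  assert (Z1 : z1 <> 0) by (apply Cmod_gt_0; lra).
  assert (Z2 : z2 <> 0) by (apply Cmod_gt_0; lra).
  replace (/ z1 - / z2 - - / (z * z) * (z1 - z2))
    with ((z1 - z2) * ((z1 * (z2 - z) + z * (z1 - z)) / (z * z * (z1 * z2))))
    by (field; auto).
  rewrite Cmod_mult, Rmult_comm. apply Rmult_le_compat_r; [apply Cmod_ge_0|].
  rewrite Cmod_div by (repeat apply Cmult_neq_0; auto). rewrite !Cmod_mult. fold m.
  assert (P1 : (Cmod z1 <= 2 * m)%R).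
  { generalize (Cmod_triangle z (z1 - z)). replace (z + (z1 - z)) with z1 by ring. fold m. lra. }
  assert (T : (Cmod (z1 * (z2 - z) + z * (z1 - z)) <= 3 * m * d)%R).
  { eapply Rle_trans; [apply Cmod_triangle|]. rewrite !Cmod_mult. fold m.
    generalize (Cmod_ge_0 z1) (Cmod_ge_0 (z2 - z)) (Cmod_ge_0 (z1 - z)). nra. }
  apply Rle_trans with (3 * m * d / (m * m * (m / 2 * (m / 2))))%R.
  - apply Rmult_le_compat; [apply Cmod_ge_0| | easy |].
    + left. apply Rinv_0_lt_compat. repeat apply Rmult_lt_0_compat; lra.
    + apply Rinv_le_contravar.
      * repeat apply Rmult_lt_0_compat; lra.
      * apply Rmult_le_compat_l; [nra|]. apply Rmult_le_compat; lra.
  - replace (3 * m * d / (m * m * (m / 2 * (m / 2))))%R with (12 * d / (m * m * m))%R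
      by (field; lra).
    apply Rmult_le_reg_r with (m * m * m)%R; [repeat apply Rmult_lt_0_compat; lra|].
    replace (12 * d / (m * m * m) * (m * m * m))%R with (12 * d)%R by (field; lra).
    assert (0 < e * m * m * m)%R by (repeat apply Rmult_lt_0_compat; auto). lra.
Qed.

Lemma D2_of_D1 (g : C -> C) (f : C -> C -> C) (l z c a b : C) :
  D1 g (f l z) c -> D2 f l z a b ->
  D2 (fun l' z' => g (f l' z')) l z (c * a) (c * b).
Proof.
  intros Hg Hf.
  eapply D2_eq; [apply (D2_comp (fun _ w => g w) (fun _ _ => 0) f l z 0 c 0 0 a b)|cring|cring];
    auto using D2_const.
Qed.

Lemma D2_inv (f : C -> C -> C) (l z a b : C) : f l z <> 0 ->
  D2 f l z a b ->
  D2 (fun l' z' => / f l' z') l z (- a / (f l z * f l z)) (- b / (f l z * f l z)).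
Proof.
  intros H0 H. eapply D2_eq; [eapply D2_of_D1; [apply D1_inv, H0|exact H]|cfield|cfield].
Qed.

Lemma D2_div (f g : C -> C -> C) (l z a b c d : C) : g l z <> 0 ->
  D2 f l z a b -> D2 g l z c d ->
  D2 (fun l' z' => f l' z' / g l' z') l z
    ((a * g l z - f l z * c) / (g l z * g l z)) ((b * g l z - f l z * d) / (g l z * g l z)).
Proof.
  intros H0 Hf Hg.
  eapply D2_eq; [apply D2_mul; [exact Hf|apply D2_inv; [exact H0|exact Hg]]|cfield|cfield].
Qed.

Lemma D2_pow (f : C -> C -> C) (n : nat) (l z a b : C) :
  D2 f l z a b ->
  D2 (fun l' z' => f l' z' ^ n) l z
    (INR n * f l z ^ (pred n) * a) (INR n * f l z ^ (pred n) * b).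
Proof.
  intros H. induction n as [|n IH].
  - change (RtoC (INR 0)) with (RtoC 0). eapply D2_eq; [apply (D2_const 1)|cring|cring].
  - eapply D2_eq; [exact (D2_mul f (fun l' z' => f l' z' ^ n) l z a b _ _ H IH)| |];
      rewrite S_INR, RtoC_plus; (destruct n as [|n];
      [change (RtoC (INR 0)) with (RtoC 0)|
       change (Init.Nat.pred (S (S n))) with (S n); change (Init.Nat.pred (S n)) with n]);
      cbv beta; rewrite ?Cpow_S; change (Init.Nat.pred 1) with 0%nat; rewrite ?Cpow_zero; ring.
Qed.

Lemma D2_slice1 (f : C -> C -> C) (l z a b : C) : D2 f l z a b -> D1 (fun l' => f l' z) l a.
Proof.
  intros H.
  eapply D2_eq; [apply (D2_comp f (fun _ w => w) (fun _ _ => z) 0 l a b 0 1 0 0);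
    auto using D2_const, D2_snd|cring|cring].
Qed.

Lemma D2_slice2 (f : C -> C -> C) (l z a b : C) : D2 f l z a b -> D1 (fun z' => f l z') z b.
Proof.
  intros H.
  eapply D2_eq; [apply (D2_comp f (fun _ _ => l) (fun _ w => w) 0 z a b 0 0 0 1);
    auto using D2_const, D2_snd|cring|cring].
Qed.

Lemma D1_comp2 (g : C -> C -> C) (f1 f2 : C -> C) (z c d a b : C) :
  D2 g (f1 z) (f2 z) c d -> D1 f1 z a -> D1 f2 z b ->
  D1 (fun w => g (f1 w) (f2 w)) z (c * a + d * b).
Proof.
  intros Hg H1 H2. eapply D2_eq; [apply (D2_comp g _ _ 0 z c d 0 a 0 b Hg H1 H2)|cring|cring].
Qed.

Lemma D1_const (c z : C) : D1 (fun _ => c) z 0.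
Proof. apply D2_const. Qed.
Lemma D1_id (z : C) : D1 (fun w => w) z 1.
Proof. apply D2_snd. Qed.
Lemma D1_comp (g f : C -> C) (z c a : C) :
  D1 g (f z) c -> D1 f z a -> D1 (fun w => g (f w)) z (c * a).
Proof.
  intros Hg Hf. eapply D2_eq; [apply (D2_of_D1 g _ 0 z c 0 a Hg Hf)|cring|cring].
Qed.
Lemma D1_add (f g : C -> C) (z a b : C) :
  D1 f z a -> D1 g z b -> D1 (fun w => f w + g w) z (a + b).
Proof. intros Hf Hg. eapply D2_eq; [apply (D2_add _ _ _ _ _ _ _ _ Hf Hg)|cring|cring]. Qed.
Lemma D1_sub (f g : C -> C) (z a b : C) :
  D1 f z a -> D1 g z b -> D1 (fun w => f w - g w) z (a - b).
Proof. intros Hf Hg. eapply D2_eq; [apply (D2_sub _ _ _ _ _ _ _ _ Hf Hg)|cring|cring]. Qed.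
Lemma D1_opp (f : C -> C) (z a : C) : D1 f z a -> D1 (fun w => - f w) z (- a).
Proof. intros Hf. eapply D2_eq; [apply (D2_opp _ _ _ _ _ Hf)|cring|cring]. Qed.
Lemma D1_mul (f g : C -> C) (z a b : C) :
  D1 f z a -> D1 g z b -> D1 (fun w => f w * g w) z (a * g z + f z * b).
Proof. intros Hf Hg. eapply D2_eq; [apply (D2_mul _ _ _ _ _ _ _ _ Hf Hg)|cring|cring]. Qed.
Lemma D1_div (f g : C -> C) (z a b : C) : g z <> 0 ->
  D1 f z a -> D1 g z b -> D1 (fun w => f w / g w) z ((a * g z - f z * b) / (g z * g z)).
Proof.
  intros H0 Hf Hg. eapply D2_eq; [apply (D2_div _ _ _ _ _ _ _ _ H0 Hf Hg)|cfield|cfield].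
Qed.
Lemma D1_pow (f : C -> C) (n : nat) (z a : C) :
  D1 f z a -> D1 (fun w => f w ^ n) z (INR n * f z ^ (pred n) * a).
Proof. intros Hf. eapply D2_eq; [apply (D2_pow _ n _ _ _ _ Hf)|cring|cring]. Qed.

Lemma D1_unique (f : C -> C) (z a b : C) : D1 f z a -> D1 f z b -> a = b.
Proof.
  intros Ha Hb. apply Ceq_sub, Cmod_small_0. intros e He.
  destruct (proj1 (D1_char f z a) Ha (e / 2)%R) as [d1 [Hd1 P1]]; [lra|].
  destruct (proj1 (D1_char f z b) Hb (e / 2)%R) as [d2 [Hd2 P2]]; [lra|].
  set (d := (Rmin d1 d2 / 2)%R).
  assert (Hd : (0 < d)%R) by (unfold d; assert (0 < Rmin d1 d2)%R by (now apply Rmin_pos); lra).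
  assert (d < d1 /\ d < d2)%R as [I1 I2].
  { assert (Rmin d1 d2 <= d1)%R by apply Rmin_l. assert (Rmin d1 d2 <= d2)%R by apply Rmin_r.
    unfold d in *; lra. }
  specialize (P1 (z + d) z). specialize (P2 (z + d) z).
  replace (z + d - z) with (RtoC d) in * by ring.
  replace (z - z) with (RtoC 0) in * by ring.
  rewrite Cmod_R, Rabs_pos_eq, Cmod_0 in * by lra.
  specialize (P1 I1 Hd1). specialize (P2 I2 Hd2).
  assert (T : (Cmod ((a - b) * d) <= e * d)%R).
  { replace ((a - b) * d) with ((f (z + d) - f z - b * d) - (f (z + d) - f z - a * d)) by ring.
    eapply Rle_trans; [apply Cmod_sub_le|]. lra. }
  rewrite Cmod_mult, Cmod_R, Rabs_pos_eq in T by lra.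
  apply Rmult_le_reg_r with d; auto.
Qed.

(** Strictness with tolerance half of [Cmod a] prevents [f z1 - f z2] from vanishing before
    [z1 - z2] does; no inverse function theorem is involved. *)
Lemma D1_locally_injective (f : C -> C) (z a : C) : a <> 0 -> D1 f z a ->
  exists d : R, (0 < d)%R /\ forall z1 z2 : C,
    (Cmod (z1 - z) < d)%R -> (Cmod (z2 - z) < d)%R -> f z1 = f z2 -> z1 = z2.
Proof.
  intros Ha H. assert (Hm : (0 < Cmod a)%R) by now apply Cmod_gt_0.
  destruct (proj1 (D1_char f z a) H (Cmod a / 2)%R) as [d [Hd P]]; [lra|].
  exists d. split; auto. intros z1 z2 H1 H2 E. specialize (P z1 z2 H1 H2).
  replace (f z1 - f z2 - a * (z1 - z2)) with (- (a * (z1 - z2))) in P by (rewrite E; ring).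
  rewrite Cmod_opp, Cmod_mult in P. apply Ceq_sub, Cmod_eq_0.
  generalize (Cmod_ge_0 (z1 - z2)). nra.
Qed.

(** The derivative of the [N]-th power does not vanish at [y]. This is how a point of the curve
    close to a chart centre is recognised as lying on the branch of the chart. *)
Lemma root_locally_unique (N : nat) (y : C) : (1 <= N)%nat -> y <> 0 ->
  exists d : R, (0 < d)%R /\ forall z1 z2 : C,
    (Cmod (z1 - y) < d)%R -> (Cmod (z2 - y) < d)%R -> z1 ^ N = z2 ^ N -> z1 = z2.
Proof.
  intros HN Hy. apply (D1_locally_injective (fun w => w ^ N) y (INR N * y ^ pred N * 1)).
  - repeat apply Cmult_neq_0; auto using Cpow_nz.
    + now apply RtoC_INR_neq0.
    + apply RtoC_neq; lra.
  - apply D1_pow, D1_id.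
Qed.

Definition holo_near (f : C -> C) (z : C) : Prop :=
  exists (r : R) (f' : C -> C), (0 < r)%R /\
    forall w : C, (Cmod (w - z) < r)%R -> D1 f w (f' w).

(** * Induction along the unit interval *)

(** Supremum argument in the shape of an analytic continuation: the second hypothesis is the open
    step to the right, the third the passage to a limit from the left. *)
Lemma real_induction (P : R -> Prop) :
  P 0%R ->
  (forall t, (0 <= t < 1)%R -> P t ->
     exists d, (0 < d)%R /\ forall s, (t <= s < t + d)%R -> (s <= 1)%R -> P s) ->
  (forall t, (0 < t <= 1)%R -> (forall s, (0 <= s < t)%R -> P s) -> P t) ->
  forall t, unit_interval t -> P t.
Proof.
  intros H0 Hop Hcl.
  set (E := fun x : R => (0 <= x <= 1)%R /\ forall s, (0 <= s <= x)%R -> P s).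
  destruct (completeness E) as [m [Hub Hlub]].
  { exists 1%R. intros x [Hx _]. lra. }
  { exists 0%R. split; [lra|]. intros s Hs. replace s with 0%R by lra. easy. }
  assert (M0 : (0 <= m)%R).
  { apply Hub. split; [lra|]. intros s Hs. replace s with 0%R by lra. easy. }
  assert (M1 : (m <= 1)%R) by (apply Hlub; intros x [Hx _]; lra).
  assert (Hlt : forall s, (0 <= s < m)%R -> P s).
  { intros s Hs. apply NNPP. intros N.
    assert (m <= s)%R; [|lra]. apply Hlub. intros x [Hx Px].
    destruct (Rle_dec x s); [easy|]. exfalso. apply N, Px. lra. }
  assert (Pm : P m).
  { destruct (Req_dec m 0) as [->|n]; [easy|]. apply Hcl; [lra|easy]. }
  destruct (Req_dec m 1) as [E1|n].
  - intros t Ht. unfold unit_interval in Ht.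
    destruct (Rle_lt_or_eq_dec t 1) as [h|h]; [lra| |].
    + apply Hlt. lra.
    + rewrite h, <- E1. easy.
  - exfalso. destruct (Hop m) as [d [Hd Q]]; [lra|easy|].
    set (x := Rmin (m + d / 2) 1).
    assert (Hx : (m < x)%R) by (unfold x; apply Rmin_glb_lt; lra).
    assert (Hx1 : (x <= 1)%R) by apply Rmin_r.
    assert (Hx2 : (x <= m + d / 2)%R) by apply Rmin_l.
    assert (x <= m)%R; [|lra]. apply Hub. split; [lra|]. intros s Hs.
    destruct (Rlt_dec s m); [apply Hlt; lra|]. apply Q; lra.
Qed.

(** Compactness of the interval without partitions: a property of intervals that is additive and
    holds for small intervals around each point holds for the whole. *)
Lemma cousin (P : R -> R -> Prop) :
  (forall a b c, (0 <= a <= b)%R -> (b <= c <= 1)%R -> P a b -> P b c -> P a c) ->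
  (forall t, unit_interval t -> exists d, (0 < d)%R /\
     forall a b, (0 <= a <= t)%R -> (t <= b <= 1)%R -> (t - d < a)%R -> (b < t + d)%R -> P a b) ->
  P 0%R 1%R.
Proof.
  intros Hadd Hloc. unfold unit_interval in Hloc.
  apply (real_induction (fun t => P 0%R t)); unfold unit_interval; [| | |lra].
  - destruct (Hloc 0%R) as [d [Hd H]]; [lra|]. apply H; lra.
  - intros t Ht Pt. destruct (Hloc t) as [d [Hd H]]; [lra|].
    exists d. split; auto. intros s Hs Hs1.
    apply Hadd with t; try lra; auto. apply H; lra.
  - intros t Ht Pt. destruct (Hloc t) as [d [Hd H]]; [lra|].
    set (s := Rmax 0 (t - d / 2)).
    assert (s0 : (0 <= s)%R) by apply Rmax_l.
    assert (s1 : (t - d / 2 <= s)%R) by apply Rmax_r.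
    assert (s2 : (s < t)%R) by (unfold s; apply Rmax_lub_lt; lra).
    apply Hadd with s; try lra; [apply Pt; lra|apply H; lra].
Qed.

(** * Complex-valued functions of a real variable *)

Definition ccont (f : R -> C) (t : R) : Prop :=
  forall e, (0 < e)%R -> exists d, (0 < d)%R /\
    forall s, (Rabs (s - t) < d)%R -> (Cmod (f s - f t) < e)%R.

Lemma C_ball_of_Cmod (x y : C) (e : R) : (Cmod (y - x) < e)%R -> @ball C_UniformSpace x e y.
Proof. apply C_NormedModule_mixin_compat1. Qed.

(** The uniform structure of [C] is that of a product, so its balls are squares; the factor 2 rounds
    up [sqrt 2]. *)
Lemma Cmod_of_C_ball (x y : C) (e : posreal) :
  @ball C_UniformSpace x e y -> (Cmod (y - x) < 2 * e)%R.
Proof.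
  intros H. apply (Rlt_le_trans _ (sqrt 2 * e)%R).
  - apply (C_NormedModule_mixin_compat2 x y e H).
  - apply Rmult_le_compat_r; [left; apply cond_pos|].
    apply Rsqr_incr_0_var; [|lra]. rewrite Rsqr_sqrt by lra. unfold Rsqr. lra.
Qed.

Lemma locally_C_iff (z : C) (P : C -> Prop) :
  @locally C_UniformSpace z P <->
  exists r, (0 < r)%R /\ forall w, (Cmod (w - z) < r)%R -> P w.
Proof.
  split.
  - intros [e He]. exists e. split; [apply cond_pos|]. intros w Hw.
    apply He, C_ball_of_Cmod, Hw.
  - intros [r [Hr H]]. assert (Hr2 : (0 < r / 2)%R) by lra.
    exists (mkposreal _ Hr2). intros w Hw. apply H.
    generalize (Cmod_of_C_ball _ _ _ Hw). simpl. lra.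
Qed.

Lemma ccont_continuous (f : R -> C) (t : R) :
  ccont f t <-> @continuous R_UniformSpace C_UniformSpace f t.
Proof.
  split.
  - intros H P HP. apply locally_C_iff in HP. destruct HP as [r [Hr HP]].
    destruct (H r Hr) as [d [Hd Q]]. exists (mkposreal d Hd). intros s Hs. apply HP, Q, Hs.
  - intros H e He.
    destruct (H (fun w => (Cmod (w - f t) < e)%R)) as [d Hd].
    + apply locally_C_iff. exists e. auto.
    + exists d. split; [apply cond_pos|]. intros s Hs. apply Hd, Hs.
Qed.

Lemma ccont_const (c : C) (t : R) : ccont (fun _ => c) t.
Proof.
  intros e He. exists 1%R. split; [lra|]. intros.
  replace (c - c) with (RtoC 0) by ring. now rewrite Cmod_0.
Qed.

Lemma ccont_RtoC (t : R) : ccont RtoC t.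
Proof.
  intros e He. exists e. split; [lra|]. intros s Hs.
  rewrite <- RtoC_minus, Cmod_R. easy.
Qed.

Lemma ccont_D2 (f : C -> C -> C) (u v : R -> C) (t : R) (a b : C) :
  D2 f (u t) (v t) a b -> ccont u t -> ccont v t -> ccont (fun s => f (u s) (v s)) t.
Proof.
  intros H Hu Hv e He. destruct (D2_cont _ _ _ _ _ H e He) as [d [Hd P]].
  destruct (Hu d Hd) as [d1 [H1 P1]]. destruct (Hv d Hd) as [d2 [H2 P2]].
  exists (Rmin d1 d2). split; [now apply Rmin_pos|]. intros s Hs.
  assert (Rmin d1 d2 <= d1)%R by apply Rmin_l. assert (Rmin d1 d2 <= d2)%R by apply Rmin_r.
  apply P; [apply P1|apply P2]; lra.
Qed.

Lemma ccont_D1 (f : C -> C) (u : R -> C) (t : R) (a : C) :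
  D1 f (u t) a -> ccont u t -> ccont (fun s => f (u s)) t.
Proof.
  intros H Hu. apply (ccont_D2 (fun _ w => f w) (fun _ => 0) u t 0 a); auto using ccont_const.
Qed.

Lemma ccont_add (u v : R -> C) (t : R) : ccont u t -> ccont v t -> ccont (fun s => u s + v s) t.
Proof. exact (ccont_D2 Cplus u v t _ _ (D2_add _ _ _ _ _ _ _ _ (D2_fst _ _) (D2_snd _ _))). Qed.
Lemma ccont_sub (u v : R -> C) (t : R) : ccont u t -> ccont v t -> ccont (fun s => u s - v s) t.
Proof. exact (ccont_D2 Cminus u v t _ _ (D2_sub _ _ _ _ _ _ _ _ (D2_fst _ _) (D2_snd _ _))). Qed.
Lemma ccont_mul (u v : R -> C) (t : R) : ccont u t -> ccont v t -> ccont (fun s => u s * v s) t.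
Proof. exact (ccont_D2 Cmult u v t _ _ (D2_mul _ _ _ _ _ _ _ _ (D2_fst _ _) (D2_snd _ _))). Qed.
Lemma ccont_inv (u : R -> C) (t : R) : u t <> 0 -> ccont u t -> ccont (fun s => / u s) t.
Proof. intros H. apply (ccont_D1 Cinv _ _ _ (D1_inv _ H)). Qed.
Lemma ccont_pow (u : R -> C) (n : nat) (t : R) : ccont u t -> ccont (fun s => u s ^ n) t.
Proof. exact (ccont_D1 (fun w => w ^ n) u t _ (D1_pow _ n _ _ (D1_id _))). Qed.

Lemma ccont_ext_near (f g : R -> C) (t r : R) : (0 < r)%R ->
  (forall s, (Rabs (s - t) < r)%R -> f s = g s) -> ccont f t -> ccont g t.
Proof.
  intros Hr E H e He. destruct (H e He) as [d [Hd P]].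
  exists (Rmin d r). split; [now apply Rmin_pos|]. intros s Hs.
  assert (Rmin d r <= d)%R by apply Rmin_l. assert (Rmin d r <= r)%R by apply Rmin_r.
  rewrite <- !E; [apply P; lra| |lra]. replace (t - t)%R with 0%R by ring. now rewrite Rabs_R0.
Qed.

Definition rder (f : R -> C) (t : R) (v : C) : Prop :=
  forall e, (0 < e)%R -> exists d, (0 < d)%R /\
    forall s, (Rabs (s - t) < d)%R ->
      (Cmod (f s - f t - v * RtoC (s - t)) <= e * Rabs (s - t))%R.

Lemma C_R_norm (z : C) : @norm R_AbsRing C_R_NormedModule z = Cmod z.
Proof.
  unfold norm; simpl. unfold prod_norm, Cmod. f_equal. unfold norm; simpl. unfold abs; simpl.
  generalize (Rsqr_abs (fst z)) (Rsqr_abs (snd z)). unfold Rsqr. lra.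
Qed.

Lemma C_R_scal (r : R) (z : C) : @scal R_AbsRing C_R_NormedModule r z = RtoC r * z.
Proof.
  destruct z as [x y]. unfold scal; simpl. unfold prod_scal, scal; simpl. unfold mult; simpl.
  unfold Cmult, RtoC; simpl. f_equal; ring.
Qed.

Lemma rder_is_derive (f : R -> C) (t : R) (v : C) :
  rder f t v <-> @is_derive R_AbsRing C_R_NormedModule f t v.
Proof.
  assert (E : forall s, @norm R_AbsRing C_R_NormedModule
      (@minus C_R_NormedModule (@minus C_R_NormedModule (f s) (f t))
        (@scal R_AbsRing C_R_NormedModule (minus s t) v))
      = Cmod (f s - f t - v * RtoC (s - t))).
  { intros s. rewrite C_R_norm, C_R_scal, (Cmult_comm v). reflexivity. }
  split.
  - intros H. split; [apply is_linear_scal_l|].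
    intros x Hx e. assert (Ex : t = x) by exact (is_filter_lim_locally_unique (K := R_AbsRing) (V := AbsRing_NormedModule R_AbsRing) t x Hx). subst x.
    destruct (H e (cond_pos e)) as [d [Hd P]]. exists (mkposreal d Hd).
    intros s Hs. rewrite E. apply P, Hs.
  - intros [_ H] e He. specialize (H t (fun P HP => HP) (mkposreal e He)).
    destruct H as [d Hd]. exists d. split; [apply cond_pos|]. intros s Hs.
    rewrite <- E. apply Hd, Hs.
Qed.

Lemma rder_ccont (f : R -> C) (t : R) (v : C) : rder f t v -> ccont f t.
Proof.
  intros H e He. destruct (H 1%R Rlt_0_1) as [d [Hd P]].
  generalize (Cmod_ge_0 v); intros Hv.
  assert (H1 : (0 < e / (Cmod v + 1))%R) by (apply Rdiv_lt_0_compat; lra).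
  exists (Rmin d (e / (Cmod v + 1))). split; [now apply Rmin_pos|]. intros s Hs.
  assert (Rmin d (e / (Cmod v + 1)) <= d)%R by apply Rmin_l.
  assert (Rmin d (e / (Cmod v + 1)) <= e / (Cmod v + 1))%R by apply Rmin_r.
  replace (f s - f t) with ((f s - f t - v * RtoC (s - t)) + v * RtoC (s - t)) by ring.
  eapply Rle_lt_trans; [apply Cmod_triangle|]. rewrite Cmod_mult, Cmod_R.
  specialize (P s ltac:(lra)).
  apply Rle_lt_trans with ((Cmod v + 1) * Rabs (s - t))%R; [lra|].
  apply Rlt_le_trans with ((Cmod v + 1) * (e / (Cmod v + 1)))%R.
  - apply Rmult_lt_compat_l; lra.
  - apply Req_le. field. lra.
Qed.

Lemma rder_eq (f : R -> C) (t : R) (v w : C) : rder f t v -> v = w -> rder f t w.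
Proof. now intros H <-. Qed.

Lemma rder_ext_near (f g : R -> C) (t r : R) (v : C) : (0 < r)%R ->
  (forall s, (Rabs (s - t) < r)%R -> f s = g s) -> rder f t v -> rder g t v.
Proof.
  intros Hr E H e He. destruct (H e He) as [d [Hd P]].
  exists (Rmin d r). split; [now apply Rmin_pos|]. intros s Hs.
  assert (Rmin d r <= d)%R by apply Rmin_l. assert (Rmin d r <= r)%R by apply Rmin_r.
  rewrite <- !E; [apply P; lra| |lra]. replace (t - t)%R with 0%R by ring. now rewrite Rabs_R0.
Qed.

Lemma rder_D2 (f : C -> C -> C) (u v : R -> C) (t : R) (a b u' v' : C) :
  D2 f (u t) (v t) a b -> rder u t u' -> rder v t v' ->
  rder (fun s => f (u s) (v s)) t (a * u' + b * v').
Proof.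
  intros H Hu Hv e He.
  generalize (Cmod_ge_0 a) (Cmod_ge_0 b) (Cmod_ge_0 u') (Cmod_ge_0 v'); intros Ha Hb Hu' Hv'.
  set (M := (Cmod a + Cmod b + Cmod u' + Cmod v' + 3)%R).
  assert (HM : (3 <= M)%R) by (unfold M; lra).
  assert (Hf : (0 < e / M)%R) by (apply Rdiv_lt_0_compat; lra).
  set (f' := Rmin 1 (e / M)).
  assert (Hf' : (0 < f')%R) by (apply Rmin_pos; lra).
  assert (Hf1 : (f' <= 1)%R) by apply Rmin_l. assert (Hf2 : (f' <= e / M)%R) by apply Rmin_r.
  destruct (H _ Hf') as [d [Hd P]].
  destruct (Hu _ Hf') as [d1 [H1 P1]]. destruct (Hv _ Hf') as [d2 [H2 P2]].
  destruct (rder_ccont _ _ _ Hu d Hd) as [d3 [H3 P3]].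
  destruct (rder_ccont _ _ _ Hv d Hd) as [d4 [H4 P4]].
  set (r := Rmin (Rmin d1 d2) (Rmin d3 d4)).
  assert (Hr : (0 < r)%R) by (unfold r; repeat apply Rmin_pos; auto).
  assert (Hr' : (r <= d1 /\ r <= d2 /\ r <= d3 /\ r <= d4)%R).
  { unfold r. repeat split; unfold Rmin; repeat destruct Rle_dec; lra. }
  exists r. split; auto. intros s Hs.
  specialize (P1 s ltac:(lra)). specialize (P2 s ltac:(lra)).
  assert (Z : forall w : C, (Cmod (w - w) < d)%R)
    by (intros w; replace (w - w) with (RtoC 0) by ring; now rewrite Cmod_0).
  assert (P' := P (u s) (v s) (u t) (v t) (P3 s ltac:(lra)) (P4 s ltac:(lra)) (Z _) (Z _)).
  clear P. rename P' into P.
  set (h := Rabs (s - t)) in *. assert (Hh : (0 <= h)%R) by apply Rabs_pos.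
  assert (B1 : (Cmod (u s - u t) <= (Cmod u' + 1) * h)%R).
  { replace (u s - u t) with ((u s - u t - u' * RtoC (s - t)) + u' * RtoC (s - t)) by ring.
    eapply Rle_trans; [apply Cmod_triangle|]. rewrite Cmod_mult, Cmod_R. fold h. nra. }
  assert (B2 : (Cmod (v s - v t) <= (Cmod v' + 1) * h)%R).
  { replace (v s - v t) with ((v s - v t - v' * RtoC (s - t)) + v' * RtoC (s - t)) by ring.
    eapply Rle_trans; [apply Cmod_triangle|]. rewrite Cmod_mult, Cmod_R. fold h. nra. }
  replace (f (u s) (v s) - f (u t) (v t) - (a * u' + b * v') * RtoC (s - t))
    with ((f (u s) (v s) - f (u t) (v t) - (a * (u s - u t) + b * (v s - v t)))
      + (a * (u s - u t - u' * RtoC (s - t)) + b * (v s - v t - v' * RtoC (s - t)))) by ring.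
  eapply Rle_trans; [apply Cmod_triangle|].
  eapply Rle_trans; [apply Rplus_le_compat_l, Cmod_triangle|]. rewrite !Cmod_mult.
  assert (T1 := Rmult_le_compat_l _ _ _ Ha P1). assert (T2 := Rmult_le_compat_l _ _ _ Hb P2).
  assert (T3 : (f' * (Cmod (u s - u t) + Cmod (v s - v t)) <= f' * (((Cmod u' + 1) + (Cmod v' + 1)) * h))%R)
    by (apply Rmult_le_compat_l; lra).
  apply Rle_trans with (f' * M * h)%R.
  - unfold M. assert (0 <= f' * h)%R by (apply Rmult_le_pos; lra). lra.
  - apply Rmult_le_compat_r; auto. apply Rle_trans with (e / M * M)%R.
    + apply Rmult_le_compat_r; lra.
    + apply Req_le. field. lra.
Qed.

Lemma rder_D1 (f : C -> C) (u : R -> C) (t : R) (a u' : C) :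
  D1 f (u t) a -> rder u t u' -> rder (fun s => f (u s)) t (a * u').
Proof.
  intros H Hu.
  assert (Hc : rder (fun _ => 0) t 0).
  { intros e He. exists 1%R. split; [lra|]. intros s _.
    replace (0 - 0 - 0 * RtoC (s - t)) with (RtoC 0) by ring. rewrite Cmod_0.
    apply Rmult_le_pos; [lra|apply Rabs_pos]. }
  eapply rder_eq; [apply (rder_D2 (fun _ w => f w) (fun _ => 0) u t 0 a 0 u'); auto|cring].
Qed.

Lemma rder_RtoC (t : R) : rder RtoC t 1.
Proof.
  intros e He. exists 1%R. split; [lra|]. intros s _.
  replace (RtoC s - RtoC t - 1 * RtoC (s - t)) with (RtoC 0) by (rewrite RtoC_minus; ring).
  rewrite Cmod_0. apply Rmult_le_pos; [lra|apply Rabs_pos].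
Qed.

Lemma rder_const (c : C) (t : R) : rder (fun _ => c) t 0.
Proof.
  eapply rder_eq; [apply (rder_D1 (fun _ => c) RtoC t 0 1); [apply D1_const|apply rder_RtoC]|cring].
Qed.
Lemma rder_add (u v : R -> C) (t : R) (u' v' : C) :
  rder u t u' -> rder v t v' -> rder (fun s => u s + v s) t (u' + v').
Proof.
  intros Hu Hv. eapply rder_eq;
    [apply (rder_D2 Cplus u v t _ _ _ _ (D2_add _ _ _ _ _ _ _ _ (D2_fst _ _) (D2_snd _ _)) Hu Hv)|cring].
Qed.
Lemma rder_mul (u v : R -> C) (t : R) (u' v' : C) :
  rder u t u' -> rder v t v' -> rder (fun s => u s * v s) t (u' * v t + u t * v').
Proof.
  intros Hu Hv. eapply rder_eq;
    [apply (rder_D2 Cmult u v t _ _ _ _ (D2_mul _ _ _ _ _ _ _ _ (D2_fst _ _) (D2_snd _ _)) Hu Hv)|cring].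
Qed.
Lemma rder_line (p q : C) (t : R) : rder (fun s => p + RtoC s * q) t q.
Proof.
  eapply rder_eq; [apply rder_add; [apply rder_const|apply rder_mul; [apply rder_RtoC|apply rder_const]]|cring].
Qed.

Lemma rder_re_im (f : R -> C) (t : R) (v : C) : rder f t v ->
  is_derive (fun s => Re (f s)) t (Re v) /\ is_derive (fun s => Im (f s)) t (Im v).
Proof.
  intros H.
  assert (E : forall (pr : C -> R), (forall c, (Rabs (pr c) <= Cmod c)%R) ->
    (forall x y (r : R), pr (x - y * RtoC r)%C = pr x - pr y * r)%R ->
    (forall x y, pr (x - y)%C = pr x - pr y)%R ->
    is_derive (fun s => pr (f s)) t (pr v)).
  { intros pr Hpr L1 L2. split; [apply is_linear_scal_l|].
    intros x Hx e. assert (Ex : t = x) by exact (is_filter_lim_locally_unique (K := R_AbsRing) (V := AbsRing_NormedModule R_AbsRing) t x Hx). subst x.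
    destruct (H e (cond_pos e)) as [d [Hd P]]. exists (mkposreal d Hd).
    intros s Hs. specialize (P s Hs).
    unfold minus, plus, opp, scal, norm; simpl. unfold mult, abs; simpl.
    replace (pr (f s) + - pr (f t) + - ((s + - t) * pr v))%R
      with (pr (f s - f t - v * RtoC (s - t))) by (rewrite L1, L2; ring).
    eapply Rle_trans; [apply Hpr|apply P]. }
  split; apply E.
  - apply re_le_Cmod.
  - intros [? ?] [? ?] ?; unfold Re; simpl; ring.
  - intros [? ?] [? ?]; unfold Re; simpl; ring.
  - apply Im_le_Cmod.
  - intros [? ?] [? ?] ?; unfold Im; simpl; ring.
  - intros [? ?] [? ?]; unfold Im; simpl; ring.
Qed.

(** The mean value theorem fails for complex values, so it is applied to the real and the imaginary
    part. *)
Lemma rder_zero_const (f : R -> C) (a b : R) : (a < b)%R ->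
  (forall t, (a < t < b)%R -> rder f t 0) ->
  (forall t, (a <= t <= b)%R -> ccont f t) -> f a = f b.
Proof.
  intros Hab Hd Hc.
  assert (E : forall pr : C -> R, (forall c, (Rabs (pr c) <= Cmod c)%R) ->
    (forall x y, pr (x - y)%C = pr x - pr y)%R ->
    (forall t, (a < t < b)%R -> is_derive (fun s => pr (f s)) t 0%R) -> pr (f a) = pr (f b)).
  { intros pr Hpr L Hder.
    destruct (MVT_gen (fun s => pr (f s)) a b (fun _ => 0%R)) as [c [_ Hc']].
    - rewrite Rmin_left, Rmax_right by lra. intros; apply Hder; easy.
    - rewrite Rmin_left, Rmax_right by lra. intros t Ht.
      apply continuity_pt_filterlim. intros P [e He].
      destruct (Hc t Ht e (cond_pos e)) as [d [Hd' Q]].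
      exists (mkposreal d Hd'). intros s Hs. apply He.
      unfold ball; simpl. unfold AbsRing_ball, abs, minus, plus, opp; simpl.
      replace (pr (f s) + - pr (f t))%R with (pr (f s - f t)%C) by (rewrite L; ring).
      eapply Rle_lt_trans; [apply Hpr|apply Q, Hs].
    - lra. }
  apply injective_projections.
  - apply (E Re); [apply re_le_Cmod|intros [? ?] [? ?]; unfold Re; simpl; ring|].
    intros t Ht. apply (rder_re_im _ _ _ (Hd t Ht)).
  - apply (E Im); [apply Im_le_Cmod|intros [? ?] [? ?]; unfold Im; simpl; ring|].
    intros t Ht. apply (rder_re_im _ _ _ (Hd t Ht)).
Qed.

Lemma Cmod_segment (z0 z w : C) (r t : R) : unit_interval t ->
  (Cmod (z - z0) < r)%R -> (Cmod (w - z0) < r)%R ->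
  (Cmod (z + RtoC t * (w - z) - z0) < r)%R.
Proof.
  intros Ht Hz Hw. unfold unit_interval in Ht.
  replace (z + RtoC t * (w - z) - z0) with (RtoC (1 - t) * (z - z0) + RtoC t * (w - z0))
    by (rewrite RtoC_minus; ring).
  eapply Rle_lt_trans; [apply Cmod_triangle|].
  rewrite !Cmod_mult, !Cmod_R, !Rabs_pos_eq by lra.
  destruct (Rle_lt_or_eq_dec 0 t) as [h|h]; [lra|nra|]. rewrite <- h. lra.
Qed.

Lemma D1_zero_const (f : C -> C) (z0 : C) (r : R) :
  (forall z, (Cmod (z - z0) < r)%R -> D1 f z 0) ->
  forall z w, (Cmod (z - z0) < r)%R -> (Cmod (w - z0) < r)%R -> f z = f w.
Proof.
  intros H z w Hz Hw.
  assert (Hs : forall t, unit_interval t -> rder (fun t => f (z + RtoC t * (w - z))) t 0).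
  { intros t Ht. eapply rder_eq;
      [apply (rder_D1 f _ t 0 (w - z)); [apply H, Cmod_segment; auto|apply rder_line]|cring]. }
  generalize (rder_zero_const (fun t => f (z + RtoC t * (w - z))) 0 1 Rlt_0_1). cbv beta.
  intros E. replace (z + 0 * (w - z)) with z in E by ring.
  replace (z + 1 * (w - z)) with w in E by ring. apply E.
  - intros t Ht. apply Hs. unfold unit_interval; lra.
  - intros t Ht. eapply rder_ccont, Hs. unfold unit_interval; lra.
Qed.

(** * Integrals over the unit interval *)

Definition cint (f : R -> C) : C := RInt (V := C_R_CompleteNormedModule) f 0 1.

Definition ccontI (f : R -> C) : Prop := forall t, unit_interval t -> ccont f t.

Lemma ccontI_ex (f : R -> C) : ccontI f -> ex_RInt (V := C_R_CompleteNormedModule) f 0 1.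
Proof.
  intros H. apply (ex_RInt_continuous (V := C_R_CompleteNormedModule)). intros t Ht.
  rewrite Rmin_left, Rmax_right in Ht by lra. apply ccont_continuous, H, Ht.
Qed.

Lemma cint_correct (f : R -> C) : ccontI f -> is_RInt (V := C_R_NormedModule) f 0 1 (cint f).
Proof. intros H. apply (RInt_correct (V := C_R_CompleteNormedModule)), ccontI_ex, H. Qed.

Lemma cint_unique (f : R -> C) (v : C) : is_RInt (V := C_R_NormedModule) f 0 1 v -> cint f = v.
Proof. apply (is_RInt_unique (V := C_R_CompleteNormedModule)). Qed.

Lemma cint_ext (f g : R -> C) : (forall t, unit_interval t -> f t = g t) -> cint f = cint g.
Proof.
  intros H. apply (RInt_ext (V := C_R_CompleteNormedModule)). intros t Ht.
  rewrite Rmin_left, Rmax_right in Ht by lra. apply H. unfold unit_interval; lra.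
Qed.

Lemma cint_add (f g : R -> C) : ccontI f -> ccontI g ->
  cint (fun t => f t + g t) = cint f + cint g.
Proof.
  intros Hf Hg. apply cint_unique.
  apply (is_RInt_plus (V := C_R_NormedModule)); now apply cint_correct.
Qed.

(** Here [C] is a normed module over the reals only, so a complex constant has to be pulled out
    coordinate by coordinate. *)
Lemma is_RInt_Cmult (f : R -> C) (a b : R) (c v : C) :
  is_RInt (V := C_R_NormedModule) f a b v ->
  is_RInt (V := C_R_NormedModule) (fun t => c * f t) a b (c * v).
Proof.
  intros H.
  assert (H1 : is_RInt (V := R_NormedModule) (fun t => fst (f t)) a b (fst v))
    by apply (is_RInt_fct_extend_fst (U := R_NormedModule) (V := R_NormedModule) f a b v H).
  assert (H2 : is_RInt (V := R_NormedModule) (fun t => snd (f t)) a b (snd v))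
    by apply (is_RInt_fct_extend_snd (U := R_NormedModule) (V := R_NormedModule) f a b v H).
  destruct c as [p q].
  change ((p, q) * v) with ((p * fst v - q * snd v)%R, (p * snd v + q * fst v)%R).
  apply (is_RInt_fct_extend_pair (U := R_NormedModule) (V := R_NormedModule)).
  - apply (is_RInt_minus (V := R_NormedModule)); apply (is_RInt_scal (V := R_NormedModule)); easy.
  - apply (is_RInt_plus (V := R_NormedModule)); apply (is_RInt_scal (V := R_NormedModule)); easy.
Qed.

Lemma cint_scal (c : C) (f : R -> C) : ccontI f -> cint (fun t => c * f t) = c * cint f.
Proof. intros Hf. apply cint_unique, is_RInt_Cmult, cint_correct, Hf. Qed.

Lemma cint_sub (f g : R -> C) : ccontI f -> ccontI g ->
  cint (fun t => f t - g t) = cint f - cint g.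
Proof.
  intros Hf Hg. apply cint_unique.
  apply (is_RInt_minus (V := C_R_NormedModule)); now apply cint_correct.
Qed.

Lemma cint_const (c : C) : cint (fun _ => c) = c.
Proof.
  apply cint_unique. generalize (is_RInt_const (V := C_R_NormedModule) 0 1 c).
  rewrite C_R_scal. replace (RtoC (1 - 0) * c) with c; [easy|].
  replace (1 - 0)%R with 1%R by ring. ring.
Qed.

Lemma cint_bound (f : R -> C) (M : R) : ccontI f ->
  (forall t, unit_interval t -> (Cmod (f t) <= M)%R) -> (Cmod (cint f) <= M)%R.
Proof.
  intros Hf HM. rewrite <- C_R_norm.
  apply (norm_RInt_le (V := C_R_NormedModule) f (fun _ => M) 0 1 (cint f) M).
  - lra.
  - intros t Ht. rewrite C_R_norm. apply HM, Ht.
  - now apply cint_correct.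
  - generalize (is_RInt_const (V := R_NormedModule) 0 1 M).
    unfold scal; simpl. unfold mult; simpl. now replace ((1 - 0) * M)%R with M by ring.
Qed.

Lemma cint_FTC (f f' : R -> C) :
  (forall t, unit_interval t -> rder f t (f' t)) -> ccontI f' -> cint f' = f 1%R - f 0%R.
Proof.
  intros H Hc. apply cint_unique.
  apply (is_RInt_derive (V := C_R_CompleteNormedModule)); rewrite Rmin_left, Rmax_right by lra.
  - intros t Ht. apply rder_is_derive, H, Ht.
  - intros t Ht. apply ccont_continuous, Hc, Ht.
Qed.

Lemma Csub_diag (z : C) : z - z = 0.
Proof. ring. Qed.

Lemma Cmod_diag (z : C) : Cmod (z - z) = 0%R.
Proof. rewrite Csub_diag. apply Cmod_0. Qed.

(** Strictness at [(l, z)] controls the difference quotients at all nearby points, hence their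
    limits: partial derivatives are continuous at once. *)
Lemma D2_partials_close (f : C -> C -> C) (l z a b : C) : D2 f l z a b ->
  forall e, (0 < e)%R -> exists d, (0 < d)%R /\ forall l' z' a' b',
    (Cmod (l' - l) < d)%R -> (Cmod (z' - z) < d)%R -> D2 f l' z' a' b' ->
    (Cmod (a' - a) <= e)%R /\ (Cmod (b' - b) <= e)%R.
Proof.
  intros H e He. destruct (H (e / 2)%R) as [d [Hd P]]; [lra|].
  exists d. split; auto. intros l' z' a' b' Hl Hz H'.
  destruct (H' (e / 2)%R) as [d' [Hd' P']]; [lra|].
  (* Displacements below [m] stay inside both neighbourhoods, that of [(l, z)] and that of
     [(l', z')], so the two estimates apply to the same quotient. *)
  set (m := Rmin (Rmin (d - Cmod (l' - l)) (d - Cmod (z' - z))) d').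
  assert (Hm : (0 < m)%R) by (unfold m; repeat apply Rmin_pos; lra).
  assert (Hm' : (m <= d - Cmod (l' - l) /\ m <= d - Cmod (z' - z) /\ m <= d')%R).
  { unfold m. repeat split; unfold Rmin; repeat destruct Rle_dec; lra. }
  set (h := (m / 2)%R). assert (Hh : (0 < h < m)%R) by (unfold h; lra).
  assert (Ch : Cmod (RtoC h) = h) by (rewrite Cmod_R, Rabs_pos_eq; lra).
  assert (Nl : (Cmod (l' + h - l) < d)%R).
  { replace (l' + h - l) with ((l' - l) + h) by ring.
    eapply Rle_lt_trans; [apply Cmod_triangle|]. lra. }
  assert (Nz : (Cmod (z' + h - z) < d)%R).
  { replace (z' + h - z) with ((z' - z) + h) by ring.
    eapply Rle_lt_trans; [apply Cmod_triangle|]. lra. }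
  assert (D0 : forall w : C, (Cmod (w - w) < d')%R) by (intros; rewrite Cmod_diag; lra).
  assert (Dh : forall w : C, (Cmod (w + h - w) < d')%R).
  { intros w. replace (w + h - w) with (RtoC h) by ring. lra. }
  assert (G : forall c c' u v : C,
     (Cmod (u - v - c * h) <= e / 2 * h)%R -> (Cmod (u - v - c' * h) <= e / 2 * h)%R ->
     (Cmod (c' - c) <= e)%R).
  { intros c c' u v A B. apply Rmult_le_reg_r with h; [lra|].
    rewrite <- Ch at 1. rewrite <- Cmod_mult.
    replace ((c' - c) * h) with ((u - v - c * h) - (u - v - c' * h)) by ring.
    eapply Rle_trans; [apply Cmod_sub_le|]. lra. }
  split.
  - apply (G a a' (f (l' + h) z') (f l' z')).
    + generalize (P (l' + h) z' l' z' Nl Hz Hl Hz).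
      rewrite (Csub_diag z'), Cmod_0. replace (l' + h - l') with (RtoC h) by ring. rewrite Ch.
      replace (a * h + b * 0) with (a * h) by ring. lra.
    + generalize (P' (l' + h) z' l' z' (Dh _) (D0 _) (D0 _) (D0 _)).
      rewrite (Csub_diag z'), Cmod_0. replace (l' + h - l') with (RtoC h) by ring. rewrite Ch.
      replace (a' * h + b' * 0) with (a' * h) by ring. lra.
  - apply (G b b' (f l' (z' + h)) (f l' z')).
    + generalize (P l' (z' + h) l' z' Hl Nz Hl Hz).
      rewrite (Csub_diag l'), Cmod_0. replace (z' + h - z') with (RtoC h) by ring. rewrite Ch.
      replace (a * 0 + b * h) with (b * h) by ring. lra.
    + generalize (P' l' (z' + h) l' z' (D0 _) (Dh _) (D0 _) (D0 _)).
      rewrite (Csub_diag l'), Cmod_0. replace (z' + h - z') with (RtoC h) by ring. rewrite Ch.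
      replace (a' * 0 + b' * h) with (b' * h) by ring. lra.
Qed.

Lemma ccont_near (f : R -> C) (t e : R) : ccont f t -> (0 < e)%R -> exists d, (0 < d)%R /\
  forall s, (Rabs (s - t) < d)%R -> (Cmod (f s - f t) < e)%R /\ (Cmod (f s) <= Cmod (f t) + e)%R.
Proof.
  intros H He. destruct (H e He) as [d [Hd P]]. exists d. split; auto. intros s Hs.
  specialize (P s Hs). split; auto. generalize (Cmod_ge_sub (f s) (f t)). lra.
Qed.

(** The integrand with [z] entering through [p t + q t * z] serves two purposes: segments issuing
    from [z0], for primitives, and circles contracted towards a point, for Cauchy's formula. *)
Definition param_good (F F1 F2 : C -> C -> C) (c p q : R -> C) (l z : C) (e d t : R) : Prop :=
  (forall l1 z1, (Cmod (l1 - l) < d)%R -> (Cmod (z1 - z) < d)%R ->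
     D2 F l1 (p t + q t * z1) (F1 l1 (p t + q t * z1)) (F2 l1 (p t + q t * z1))) /\
  forall l1 z1 l2 z2,
    (Cmod (l1 - l) < d)%R -> (Cmod (z1 - z) < d)%R ->
    (Cmod (l2 - l) < d)%R -> (Cmod (z2 - z) < d)%R ->
    (Cmod (c t * F l1 (p t + q t * z1) - c t * F l2 (p t + q t * z2)
      - (c t * F1 l (p t + q t * z) * (l1 - l2) + c t * (q t * F2 l (p t + q t * z)) * (z1 - z2)))%C
     <= e * (Cmod (l1 - l2) + Cmod (z1 - z2)))%R.

(* Compactness of the interval turns strict differentiability at each point of
   the path [t |-> (l, p t + q t * z)] into a uniform statement. *)
Lemma param_uniform (F F1 F2 : C -> C -> C) (c p q : R -> C) (l z : C) :
  ccontI c -> ccontI p -> ccontI q ->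
  (forall t, unit_interval t -> exists r, (0 < r)%R /\ forall l' z',
     (Cmod (l' - l) < r)%R -> (Cmod (z' - (p t + q t * z)) < r)%R ->
     D2 F l' z' (F1 l' z') (F2 l' z')) ->
  forall e, (0 < e)%R -> exists d, (0 < d)%R /\ forall t, unit_interval t ->
    param_good F F1 F2 c p q l z e d t.
Proof.
  intros Hc Hp Hq HF e He.
  set (Q := param_good F F1 F2 c p q l z e).
  assert (Qmono : forall d d' t, (d' <= d)%R -> Q d t -> Q d' t).
  { intros d d' t Hd [A B]. split; intros; [apply A|apply B]; lra. }
  cut (exists d, (0 < d)%R /\ forall t, (0 <= t <= 1)%R -> Q d t); [easy|].
  apply (cousin (fun x y => exists d, (0 < d)%R /\ forall t, (x <= t <= y)%R -> Q d t)).
  { intros x y w H1 H2 [d1 [Hd1 A1]] [d2 [Hd2 A2]].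
    exists (Rmin d1 d2). split; [now apply Rmin_pos|]. intros t Ht.
    destruct (Rle_dec t y).
    - apply Qmono with d1; [apply Rmin_l|]. apply A1. lra.
    - apply Qmono with d2; [apply Rmin_r|]. apply A2. lra. }
  intros t Ht. destruct (HF t Ht) as [r [Hr DF]].
  set (w := p t + q t * z) in *.
  (* [M] still bounds [c], [q] and [Cmod z] near [t]. One factor [M] comes from [c], one from [q],
     and the 2 in [e'] accounts for the error of [F] and the variation of its partial
     derivatives. *)
  set (M := (Cmod (c t) + Cmod (q t) + Cmod z + 1)%R).
  generalize (Cmod_ge_0 (c t)) (Cmod_ge_0 (q t)) (Cmod_ge_0 z); intros M1 M2 M3.
  assert (HM : (1 <= M)%R) by (unfold M; lra).
  assert (HMM : (0 < 2 * (M * M))%R) by nra.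
  set (e' := (e / (2 * (M * M)))%R).
  assert (He' : (0 < e')%R) by (now apply Rdiv_lt_0_compat).
  assert (DFt : D2 F l w (F1 l w) (F2 l w)) by (apply DF; rewrite Cmod_diag; lra).
  destruct (DFt e' He') as [d1 [Hd1 P1]].
  destruct (D2_partials_close _ _ _ _ _ DFt e' He') as [d2 [Hd2 P2]].
  set (d0 := Rmin r (Rmin d1 d2)).
  assert (Hd0 : (0 < d0)%R) by (unfold d0; repeat apply Rmin_pos; auto).
  assert (Hd0' : (d0 <= r /\ d0 <= d1 /\ d0 <= d2)%R).
  { unfold d0. repeat split; unfold Rmin; repeat destruct Rle_dec; lra. }
  set (g := Rmin 1 (d0 / (4 * M))).
  assert (Hg0 : (0 < d0 / (4 * M))%R) by (apply Rdiv_lt_0_compat; lra).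
  assert (Hg : (0 < g)%R) by (apply Rmin_pos; lra).
  assert (Hg1 : (g <= 1)%R) by apply Rmin_l.
  assert (Hg2 : (g * M <= d0 / 4)%R).
  { apply Rle_trans with (d0 / (4 * M) * M)%R.
    - apply Rmult_le_compat_r; [lra|apply Rmin_r].
    - apply Req_le. field. lra. }
  destruct (ccont_near c t g (Hc t Ht) Hg) as [s1 [Hs1 C1]].
  destruct (ccont_near p t g (Hp t Ht) Hg) as [s2 [Hs2 C2]].
  destruct (ccont_near q t g (Hq t Ht) Hg) as [s3 [Hs3 C3]].
  set (s := Rmin s1 (Rmin s2 s3)).
  assert (Hs : (0 < s)%R) by (unfold s; repeat apply Rmin_pos; auto).
  assert (Hs' : (s <= s1 /\ s <= s2 /\ s <= s3)%R).
  { unfold s. repeat split; unfold Rmin; repeat destruct Rle_dec; lra. }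
  exists s. split; auto. intros x y Hx Hy Hxs Hys.
  exists (Rmin g d0). split; [now apply Rmin_pos|].
  assert (G1 : (Rmin g d0 <= g)%R) by apply Rmin_l. assert (G2 : (Rmin g d0 <= d0)%R) by apply Rmin_r.
  generalize dependent (Rmin g d0). intros G G1 G2 t' Ht'.
  assert (Hts : (Rabs (t' - t) < s)%R) by (apply Rabs_def1; lra).
  destruct (C1 t') as [C1a C1b]; [lra|]. destruct (C2 t') as [C2a C2b]; [lra|].
  destruct (C3 t') as [C3a C3b]; [lra|].
  assert (Bc : (Cmod (c t') <= M)%R) by (unfold M; lra).
  assert (Bq : (Cmod (q t') <= M)%R) by (unfold M; lra).
  assert (Bz : (Cmod z <= M - 1)%R) by (unfold M; lra).
  assert (near : forall z1, (Cmod (z1 - z) < g)%R -> (Cmod (p t' + q t' * z1 - w) < d0)%R).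
  { intros z1 Hz1. unfold w.
    replace (p t' + q t' * z1 - (p t + q t * z))
      with ((p t' - p t) + ((q t' - q t) * z + q t' * (z1 - z))) by ring.
    eapply Rle_lt_trans; [apply Cmod_triangle|].
    eapply Rle_lt_trans; [apply Rplus_le_compat_l, Cmod_triangle|]. rewrite !Cmod_mult.
    assert (Cmod (q t' - q t) * Cmod z <= g * (M - 1))%R
      by (apply Rmult_le_compat; try apply Cmod_ge_0; lra).
    assert (Cmod (q t') * Cmod (z1 - z) <= M * g)%R
      by (apply Rmult_le_compat; try apply Cmod_ge_0; lra).
    lra. }
  assert (Dn : forall l1 z1, (Cmod (l1 - l) < G)%R -> (Cmod (z1 - z) < G)%R ->
       D2 F l1 (p t' + q t' * z1) (F1 l1 (p t' + q t' * z1)) (F2 l1 (p t' + q t' * z1))).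
  { intros l1 z1 H1 H2. apply DF; [lra|]. specialize (near z1). lra. }
  split; [exact Dn|].
  intros l1 z1 l2 z2 A1 A2 A3 A4.
  assert (N1 := near z1 ltac:(lra)). assert (N2 := near z2 ltac:(lra)).
  assert (N0 := near z ltac:(rewrite Cmod_diag; lra)).
  assert (D0 := DF l (p t' + q t' * z) ltac:(rewrite Cmod_diag; lra) ltac:(lra)).
  destruct (P2 l (p t' + q t' * z) _ _ ltac:(rewrite Cmod_diag; lra) ltac:(lra) D0) as [Q1 Q2].
  assert (P1' := P1 l1 (p t' + q t' * z1) l2 (p t' + q t' * z2)
    ltac:(lra) ltac:(lra) ltac:(lra) ltac:(lra)).
  set (w1 := p t' + q t' * z1) in *. set (w2 := p t' + q t' * z2) in *.
  set (w0 := p t' + q t' * z) in *.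
  assert (Ew : w1 - w2 = q t' * (z1 - z2)) by (unfold w1, w2; ring). rewrite Ew in P1'.
  replace (c t' * F l1 w1 - c t' * F l2 w2
     - (c t' * F1 l w0 * (l1 - l2) + c t' * (q t' * F2 l w0) * (z1 - z2)))
    with (c t' * ((F l1 w1 - F l2 w2 - (F1 l w * (l1 - l2) + F2 l w * (q t' * (z1 - z2))))
      - ((F1 l w0 - F1 l w) * (l1 - l2) + (F2 l w0 - F2 l w) * (q t' * (z1 - z2))))) by ring.
  rewrite Cmod_mult.
  set (dl := Cmod (l1 - l2)) in *. set (dz := Cmod (z1 - z2)) in *.
  assert (Hdl : (0 <= dl)%R) by apply Cmod_ge_0. assert (Hdz : (0 <= dz)%R) by apply Cmod_ge_0.
  assert (Bqz : (Cmod (q t' * (z1 - z2)) <= M * dz)%R).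
  { rewrite Cmod_mult. now apply Rmult_le_compat_r. }
  assert (T : (Cmod ((F l1 w1 - F l2 w2 - (F1 l w * (l1 - l2) + F2 l w * (q t' * (z1 - z2))))
      - ((F1 l w0 - F1 l w) * (l1 - l2) + (F2 l w0 - F2 l w) * (q t' * (z1 - z2))))
      <= 2 * (e' * (M * (dl + dz))))%R).
  { eapply Rle_trans; [apply Cmod_sub_le|].
    eapply Rle_trans; [apply Rplus_le_compat_l, Cmod_triangle|].
    rewrite (Cmod_mult (F1 l w0 - F1 l w)), (Cmod_mult (F2 l w0 - F2 l w)). fold dl.
    assert (Cmod (F1 l w0 - F1 l w) * dl <= e' * dl)%R by (now apply Rmult_le_compat_r).
    assert (Cmod (F2 l w0 - F2 l w) * Cmod (q t' * (z1 - z2)) <= e' * (M * dz))%R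
      by (apply Rmult_le_compat; try apply Cmod_ge_0; lra).
    assert (e' * (dl + Cmod (q t' * (z1 - z2))) <= e' * (dl + M * dz))%R
      by (apply Rmult_le_compat_l; lra).
    assert (e' * dl <= e' * (M * dl))%R by (apply Rmult_le_compat_l; nra).
    lra. }
  apply Rle_trans with (M * (2 * (e' * (M * (dl + dz)))))%R.
  - apply Rmult_le_compat; try apply Cmod_ge_0; lra.
  - apply Req_le. unfold e'. field. lra.
Qed.

(** Differentiation under the integral sign: the pointwise estimate of [param_uniform] has a radius
    independent of [t], so it can be integrated. *)
Lemma param_D2 (F F1 F2 : C -> C -> C) (c p q : R -> C) (l z : C) :
  ccontI c -> ccontI p -> ccontI q ->
  (forall t, unit_interval t -> exists r, (0 < r)%R /\ forall l' z',
     (Cmod (l' - l) < r)%R -> (Cmod (z' - (p t + q t * z)) < r)%R ->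
     D2 F l' z' (F1 l' z') (F2 l' z')) ->
  ccontI (fun t => c t * F l (p t + q t * z)) /\
  ccontI (fun t => c t * F1 l (p t + q t * z)) /\
  ccontI (fun t => c t * (q t * F2 l (p t + q t * z))) /\
  D2 (fun l z => cint (fun t => c t * F l (p t + q t * z))) l z
     (cint (fun t => c t * F1 l (p t + q t * z)))
     (cint (fun t => c t * (q t * F2 l (p t + q t * z)))).
Proof.
  intros Hc Hp Hq HF.
  assert (Hw : forall z1 t, unit_interval t -> ccont (fun t => p t + q t * z1) t).
  { intros z1 t Ht. apply ccont_add; [now apply Hp|]. apply ccont_mul; [now apply Hq|apply ccont_const]. }
  assert (Dt : forall t, unit_interval t ->
     D2 F l (p t + q t * z) (F1 l (p t + q t * z)) (F2 l (p t + q t * z))).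
  { intros t Ht. destruct (HF t Ht) as [r [Hr D]]. apply D; rewrite Cmod_diag; lra. }
  assert (Cp : ccontI (fun t => F1 l (p t + q t * z)) /\ ccontI (fun t => F2 l (p t + q t * z))).
  { assert (forall t, unit_interval t -> forall e, (0 < e)%R -> exists d, (0 < d)%R /\
      forall s, (Rabs (s - t) < d)%R ->
        (Cmod (F1 l (p s + q s * z) - F1 l (p t + q t * z))%C < e)%R /\
        (Cmod (F2 l (p s + q s * z) - F2 l (p t + q t * z))%C < e)%R) as G.
    { intros t Ht e He. destruct (HF t Ht) as [r [Hr D]].
      destruct (D2_partials_close _ _ _ _ _ (Dt t Ht) (e / 2)%R) as [d [Hd P]]; [lra|].
      destruct (Hw z t Ht (Rmin r d)) as [d' [Hd' P']]; [now apply Rmin_pos|].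
      exists d'. split; auto. intros s Hs. specialize (P' s Hs).
      assert (Rmin r d <= r)%R by apply Rmin_l. assert (Rmin r d <= d)%R by apply Rmin_r.
      destruct (P l (p s + q s * z) (F1 l (p s + q s * z)) (F2 l (p s + q s * z)));
        [rewrite Cmod_diag; lra|lra|apply D; [rewrite Cmod_diag; lra|lra]|]. lra. }
    split; intros t Ht e He; destruct (G t Ht e He) as [d [Hd P]]; exists d; split; auto;
      intros s Hs; apply P, Hs. }
  destruct Cp as [Cp1 Cp2].
  assert (K1 : ccontI (fun t => c t * F1 l (p t + q t * z)))
    by (intros t Ht; apply ccont_mul; [now apply Hc|now apply Cp1]).
  assert (K2 : ccontI (fun t => c t * (q t * F2 l (p t + q t * z))))
    by (intros t Ht; apply ccont_mul; [now apply Hc|apply ccont_mul; [now apply Hq|now apply Cp2]]).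
  assert (K0 : forall l1 z1, (forall t, unit_interval t -> exists a b, D2 F l1 (p t + q t * z1) a b) ->
     ccontI (fun t => c t * F l1 (p t + q t * z1))).
  { intros l1 z1 HD t Ht. destruct (HD t Ht) as [a [b D]].
    apply ccont_mul; [now apply Hc|].
    apply (ccont_D2 F (fun _ => l1) (fun t => p t + q t * z1) t a b); auto using ccont_const. }
  split; [apply K0; intros; eauto|]. split; [exact K1|]. split; [exact K2|].
  intros e He. destruct (param_uniform F F1 F2 c p q l z Hc Hp Hq HF e He) as [d [Hd P]].
  exists d. split; auto. intros l1 z1 l2 z2 A1 A2 A3 A4.
  assert (C1 : ccontI (fun t => c t * F l1 (p t + q t * z1)))
    by (apply K0; intros t Ht; do 2 eexists; apply (proj1 (P t Ht)); auto).
  assert (C2 : ccontI (fun t => c t * F l2 (p t + q t * z2)))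
    by (apply K0; intros t Ht; do 2 eexists; apply (proj1 (P t Ht)); auto).
  rewrite (Cmult_comm _ (l1 - l2)), (Cmult_comm _ (z1 - z2)).
  rewrite <- (cint_scal (l1 - l2)), <- (cint_scal (z1 - z2)) by auto.
  assert (S1 : ccontI (fun t => (l1 - l2) * (c t * F1 l (p t + q t * z))))
    by (intros t Ht; apply ccont_mul; [apply ccont_const|now apply K1]).
  assert (S2 : ccontI (fun t => (z1 - z2) * (c t * (q t * F2 l (p t + q t * z)))))
    by (intros t Ht; apply ccont_mul; [apply ccont_const|now apply K2]).
  assert (C12 : ccontI (fun t => c t * F l1 (p t + q t * z1) - c t * F l2 (p t + q t * z2)))
    by (intros t Ht; apply ccont_sub; [now apply C1|now apply C2]).
  assert (S12 : ccontI (fun t => (l1 - l2) * (c t * F1 l (p t + q t * z))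
      + (z1 - z2) * (c t * (q t * F2 l (p t + q t * z)))))
    by (intros t Ht; apply ccont_add; [now apply S1|now apply S2]).
  rewrite <- cint_add, <- !cint_sub by auto.
  apply cint_bound.
  - intros t Ht. apply ccont_sub; [now apply C12|now apply S12].
  - intros t Ht. eapply Rle_trans; [|apply (proj2 (P t Ht) l1 z1 l2 z2 A1 A2 A3 A4)].
    apply Req_le. f_equal. ring.
Qed.

(** * Primitives depending on a parameter *)

(** Path integral of [H l] along the straight segment from [z0] to [z], rescaled to the unit
    interval. *)
Definition prim (H : C -> C -> C) (z0 l z : C) : C :=
  (z - z0) * cint (fun t => H l (z0 + RtoC t * (z - z0))).

Lemma prim_center (H : C -> C -> C) (z0 l : C) : prim H z0 l z0 = 0.
Proof. unfold prim. rewrite Csub_diag. ring. Qed.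

Lemma prim_D2 (H H1 H2 : C -> C -> C) (l0 z0 : C) (r : R) :
  (forall l z, (Cmod (l - l0) < r)%R -> (Cmod (z - z0) < r)%R -> D2 H l z (H1 l z) (H2 l z)) ->
  forall l z, (Cmod (l - l0) < r)%R -> (Cmod (z - z0) < r)%R ->
  D2 (prim H z0) l z (prim H1 z0 l z) (H l z).
Proof.
  intros D l z Hl Hz.
  set (c := fun _ : R => RtoC 1). set (p := fun t : R => z0 - RtoC t * z0).
  set (q := fun t : R => RtoC t).
  assert (Ew : forall t z, z0 + RtoC t * (z - z0) = p t + q t * z) by (intros; unfold p, q; ring).
  assert (Hseg : forall t, unit_interval t -> (Cmod (z0 + RtoC t * (z - z0) - z0) < r)%R).
  { intros t Ht. apply Cmod_segment; auto. rewrite Cmod_diag.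
    generalize (Cmod_ge_0 (z - z0)); lra. }
  destruct (param_D2 H H1 H2 c p q l z) as [K0 [K1 [K2 DJ]]].
  - intros t _. apply ccont_const.
  - intros t _. apply ccont_sub; [apply ccont_const|apply ccont_mul; [apply ccont_RtoC|apply ccont_const]].
  - intros t _. apply ccont_RtoC.
  - intros t Ht. specialize (Hseg t Ht). rewrite Ew in Hseg.
    set (m := Rmin (r - Cmod (l - l0)) (r - Cmod (p t + q t * z - z0))).
    assert (m <= r - Cmod (l - l0))%R by apply Rmin_l.
    assert (m <= r - Cmod (p t + q t * z - z0))%R by apply Rmin_r.
    exists m. split; [apply Rmin_pos; lra|]. intros l' z' A B. apply D.
    + generalize (Cmod_tri_sub l' l l0). lra.
    + generalize (Cmod_tri_sub z' (p t + q t * z) z0). lra.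
  - assert (E : forall (G : C -> C -> C) l z, cint (fun t => G l (z0 + RtoC t * (z - z0)))
        = cint (fun t => c t * G l (p t + q t * z))).
    { intros G l' z'. apply cint_ext. intros t _. rewrite Ew. unfold c. ring. }
    apply D2_ext with (fun l z => (z - z0) * cint (fun t => c t * H l (p t + q t * z))).
    { intros l' z'. unfold prim. now rewrite E. }
    eapply D2_eq.
    + apply D2_mul; [apply D2_sub; [apply D2_snd|apply (D2_const z0)]|exact DJ].
    + unfold prim. rewrite E. cring.
    + cbv beta.
      assert (T : cint (fun t => c t * H l (p t + q t * z))
         + (z - z0) * cint (fun t => c t * (q t * H2 l (p t + q t * z))) = H l z).
      { rewrite <- cint_scal, <- cint_add by
          first [exact K0|exact K2|intros t Ht; apply ccont_mul; [apply ccont_const|now apply K2]].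
        (* The two integrands of the derivative in [z] combine to the derivative of
           [t * H l (z0 + t * (z - z0))]. *)
        set (h := fun t : R => RtoC t * H l (z0 + RtoC t * (z - z0))).
        replace (H l z) with (h 1%R - h 0%R).
        2:{ unfold h. replace (z0 + 1 * (z - z0)) with z by ring. ring. }
        apply (cint_FTC h).
        - intros t Ht. eapply rder_eq.
          + apply rder_mul; [apply rder_RtoC|].
            apply (rder_D1 (fun z => H l z)); [|apply rder_line].
            eapply D2_slice2. apply D; [easy|]. now apply Hseg.
          + cbv beta. unfold c. rewrite Ew. unfold q. ring.
        - intros t Ht. apply ccont_add; [now apply K0|].
          apply ccont_mul; [apply ccont_const|now apply K2]. }
      rewrite <- T. ring.
Qed.

Lemma ccontI_bounded (f : R -> C) : ccontI f ->
  exists M, (0 < M)%R /\ forall t, unit_interval t -> (Cmod (f t) <= M)%R.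
Proof.
  intros H.
  apply (cousin (fun x y => exists M, (0 < M)%R /\ forall t, (x <= t <= y)%R -> (Cmod (f t) <= M)%R)).
  - intros a b c Ha Hb [M1 [H1 P1]] [M2 [H2 P2]]. exists (M1 + M2)%R. split; [lra|].
    intros t Ht. destruct (Rle_dec t b).
    + specialize (P1 t ltac:(lra)). lra.
    + specialize (P2 t ltac:(lra)). lra.
  - intros t Ht. destruct (ccont_near f t 1 (H t Ht) Rlt_0_1) as [d [Hd P]].
    exists d. split; auto. intros a b Ha Hb H1 H2. exists (Cmod (f t) + 1)%R.
    split; [generalize (Cmod_ge_0 (f t)); lra|]. intros s Hs. apply P. apply Rabs_def1; lra.
Qed.

(** * Power series and the identity theorem *)

Definition ctends (u : nat -> C) (L : C) : Prop :=
  forall e, (0 < e)%R -> exists n0 : nat, forall n, (n0 <= n)%nat -> (Cmod (u n - L) < e)%R.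

Fixpoint psum (a : nat -> C) (u : C) (n : nat) : C :=
  match n with O => 0 | S m => psum a u m + a m * u ^ m end.

(** A convergent power series with a Cauchy estimate kept as data: the common ground of
    [analytic_at] and [holo_near], on which the identity theorem is proved. *)
Definition psr (f : C -> C) (z0 : C) : Prop :=
  exists (a : nat -> C) (rho M : R), (0 < rho)%R /\
    (forall n, (Cmod (a n) * rho ^ n <= M)%R) /\
    forall w, (Cmod (w - z0) < rho)%R -> ctends (psum a (w - z0)) (f w).

Lemma ctends_unique (u : nat -> C) (L L' : C) : ctends u L -> ctends u L' -> L = L'.
Proof.
  intros H H'. apply Ceq_sub, Cmod_small_0. intros e He.
  destruct (H (e / 2)%R) as [n P]; [lra|]. destruct (H' (e / 2)%R) as [n' P']; [lra|].
  specialize (P (n + n')%nat ltac:(lia)). specialize (P' (n + n')%nat ltac:(lia)).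
  generalize (Cmod_tri_sub L (u (n + n')%nat) L'). rewrite (Cmod_minus_sym L (u _)). lra.
Qed.

Lemma ctends_ext (u v : nat -> C) (L : C) : (forall n, u n = v n) -> ctends u L -> ctends v L.
Proof. intros E H e He. destruct (H e He) as [n P]. exists n. intros. rewrite <- E. auto. Qed.

Lemma ctends_const (c : C) : ctends (fun _ => c) c.
Proof. intros e He. exists 0%nat. intros. rewrite Cmod_diag. lra. Qed.

Lemma ctends_sub (u v : nat -> C) (L L' : C) : ctends u L -> ctends v L' ->
  ctends (fun n => u n - v n) (L - L').
Proof.
  intros H H' e He. destruct (H (e / 2)%R) as [n P]; [lra|].
  destruct (H' (e / 2)%R) as [n' P']; [lra|]. exists (n + n')%nat. intros k Hk.
  specialize (P k ltac:(lia)). specialize (P' k ltac:(lia)).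
  replace (u k - v k - (L - L')) with ((u k - L) - (v k - L')) by ring.
  eapply Rle_lt_trans; [apply Cmod_sub_le|]. lra.
Qed.

Lemma ctends_scal (c : C) (u : nat -> C) (L : C) : ctends u L -> ctends (fun n => c * u n) (c * L).
Proof.
  intros H e He. generalize (Cmod_ge_0 c); intros Hc.
  destruct (H (e / (Cmod c + 1))%R) as [n P]; [apply Rdiv_lt_0_compat; lra|].
  exists n. intros k Hk. specialize (P k Hk).
  replace (c * u k - c * L) with (c * (u k - L)) by ring. rewrite Cmod_mult.
  apply Rle_lt_trans with ((Cmod c + 1) * Cmod (u k - L))%R.
  - apply Rmult_le_compat_r; [apply Cmod_ge_0|lra].
  - apply Rlt_le_trans with ((Cmod c + 1) * (e / (Cmod c + 1)))%R.
    + apply Rmult_lt_compat_l; lra.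
    + apply Req_le. field. lra.
Qed.

Lemma ctends_of_le (u : nat -> C) (L : C) (K x : R) : (0 <= x < 1)%R ->
  (forall n, (Cmod (u n - L) <= K * x ^ n)%R) -> ctends u L.
Proof.
  intros Hx H e He.
  assert (HK : (0 <= K)%R).
  { specialize (H 0%nat). generalize (Cmod_ge_0 (u 0%nat - L)). simpl in H. lra. }
  destruct (pow_lt_1_zero x) with (y := (e / (K + 1))%R) as [n P].
  - rewrite Rabs_pos_eq; lra.
  - apply Rdiv_lt_0_compat; lra.
  - exists n. intros k Hk. specialize (P k Hk). specialize (H k).
    rewrite Rabs_pos_eq in P by (apply pow_le; lra).
    apply Rle_lt_trans with ((K + 1) * x ^ k)%R.
    + assert (0 <= x ^ k)%R by (apply pow_le; lra). lra.
    + apply Rlt_le_trans with ((K + 1) * (e / (K + 1)))%R.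
      * apply Rmult_lt_compat_l; lra.
      * apply Req_le. field. lra.
Qed.

Lemma ctends_Cmod_le (u : nat -> C) (L : C) (B : R) : ctends u L ->
  (exists n0, forall n, (n0 <= n)%nat -> (Cmod (u n) <= B)%R) -> (Cmod L <= B)%R.
Proof.
  intros H [n0 P]. apply Rnot_lt_le. intros N.
  destruct (H (Cmod L - B)%R) as [n1 Q]; [lra|].
  specialize (P (n0 + n1)%nat ltac:(lia)). specialize (Q (n0 + n1)%nat ltac:(lia)).
  generalize (Cmod_ge_sub L (L - u (n0 + n1)%nat)).
  replace (L - (L - u (n0 + n1)%nat)) with (u (n0 + n1)%nat) by ring.
  rewrite (Cmod_minus_sym L (u _)). lra.
Qed.

Lemma psum_sub (a b : nat -> C) (u : C) (n : nat) :
  psum (fun k => a k - b k) u n = psum a u n - psum b u n.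
Proof. induction n as [|n IH]; cbn [psum]; [ring|rewrite IH; ring]. Qed.

Lemma coeff_bound_le (c : C) (r r' M : R) (n : nat) : (0 < r' <= r)%R ->
  (Cmod c * r ^ n <= M)%R -> (Cmod c * r' ^ n <= M)%R.
Proof.
  intros Hr H. eapply Rle_trans; [|exact H]. apply Rmult_le_compat_l; [apply Cmod_ge_0|].
  apply pow_incr. lra.
Qed.

Lemma psr_sub (f g : C -> C) (z0 : C) : psr f z0 -> psr g z0 -> psr (fun w => f w - g w) z0.
Proof.
  intros [a [r [M [Hr [Ha Hf]]]]] [b [r' [M' [Hr' [Hb Hg]]]]].
  assert (Hm : (0 < Rmin r r')%R) by now apply Rmin_pos.
  assert (m1 : (Rmin r r' <= r)%R) by apply Rmin_l. assert (m2 : (Rmin r r' <= r')%R) by apply Rmin_r.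
  exists (fun n => a n - b n), (Rmin r r'), (M + M')%R. split; auto. split.
  - intros n. generalize (coeff_bound_le (a n) r (Rmin r r') M n ltac:(lra) (Ha n)).
    generalize (coeff_bound_le (b n) r' (Rmin r r') M' n ltac:(lra) (Hb n)).
    generalize (Cmod_sub_le (a n) (b n)).
    assert (0 <= Rmin r r' ^ n)%R by (apply pow_le; lra). nra.
  - intros w Hw. apply ctends_ext with (fun n => psum a (w - z0) n - psum b (w - z0) n).
    + intros n. now rewrite psum_sub.
    + apply ctends_sub; [apply Hf|apply Hg]; lra.
Qed.

(** If all coefficients below degree [m] vanish, then at a zero [w] the term of degree [m] equals
    minus the tail, which is smaller by a factor proportional to the distance of [w] from [z0].
    Letting [w] tend to [z0] kills [a m]. *)
Lemma psr_zero (f : C -> C) (z0 : C) : psr f z0 ->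
  (forall e, (0 < e)%R -> exists w, w <> z0 /\ (Cmod (w - z0) < e)%R /\ f w = 0) ->
  exists r, (0 < r)%R /\ forall w, (Cmod (w - z0) < r)%R -> f w = 0.
Proof.
  intros [a [r [M [Hr [Ha Hf]]]]] Hz.
  assert (HM : (0 <= M)%R).
  { eapply Rle_trans; [|apply (Ha 0%nat)]. simpl. generalize (Cmod_ge_0 (a 0%nat)). lra. }
  assert (A0 : forall m, a m = 0).
  { intros m. induction m as [m IH] using (well_founded_induction lt_wf).
    assert (P0 : forall u n, (n <= m)%nat -> psum a u n = 0).
    { intros u n. induction n as [|n IHn]; intros Hn; cbn [psum]; [easy|].
      rewrite IHn by lia. rewrite (IH n) by lia. ring. }
    (* The subtracted [2 * x ^ n] strengthens the bound of the tail just enough for the induction on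
       [n] to close when [x <= / 2]. *)
    assert (Pm : forall u n, (Cmod u <= r / 2)%R -> (m < n)%nat ->
      (Cmod (psum a u n - a m * u ^ m) <= M * (2 * (Cmod u / r) ^ S m - 2 * (Cmod u / r) ^ n))%R).
    { intros u n Hu Hn. set (x := (Cmod u / r)%R).
      assert (Hx : (0 <= x <= / 2)%R).
      { unfold x. split.
        - apply Rmult_le_pos; [apply Cmod_ge_0|left; now apply Rinv_0_lt_compat].
        - apply Rmult_le_reg_r with r; auto.
          replace (Cmod u / r * r)%R with (Cmod u) by (field; lra). lra. }
      induction Hn as [|n Hn IHn].
      - cbn [psum]. rewrite P0 by lia. replace (0 + a m * u ^ m - a m * u ^ m) with (RtoC 0) by ring.
        rewrite Cmod_0. lra.
      - cbn [psum].
        replace (psum a u n + a n * u ^ n - a m * u ^ m)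
          with ((psum a u n - a m * u ^ m) + a n * u ^ n) by ring.
        eapply Rle_trans; [apply Cmod_triangle|].
        assert (T : (Cmod (a n * u ^ n) <= M * x ^ n)%R).
        { rewrite Cmod_mult, Cmod_pow. replace (Cmod u) with (r * x)%R by (unfold x; field; lra).
          rewrite Rpow_mult_distr, <- Rmult_assoc.
          apply Rmult_le_compat_r; [apply pow_le; lra|apply Ha]. }
        assert (Hp : (0 <= x ^ n)%R) by (apply pow_le; lra). simpl pow in *.
        assert (M * (x * x ^ n) <= M * (/ 2 * x ^ n))%R
          by (apply Rmult_le_compat_l; [easy|apply Rmult_le_compat_r; lra]).
        lra. }
    apply Cmod_small_0. intros e He.
    set (K := (2 * M / r ^ S m)%R).
    assert (Hrm : (0 < r ^ S m)%R) by now apply pow_lt.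
    assert (HK : (0 <= K)%R).
    { unfold K. apply Rmult_le_pos; [lra|]. left. now apply Rinv_0_lt_compat. }
    destruct (Hz (Rmin (r / 2) (e / (K + 1)))) as [w [Hw0 [Hw1 Hw2]]].
    { apply Rmin_pos; [lra|]. apply Rdiv_lt_0_compat; lra. }
    assert (m1 := Rmin_l (r / 2) (e / (K + 1))). assert (m2 := Rmin_r (r / 2) (e / (K + 1))).
    set (u := w - z0) in *.
    assert (Hu : (0 < Cmod u)%R) by (apply Cmod_gt_0; now apply Csub_neq0).
    assert (B : (Cmod (a m * u ^ m) <= M * (2 * (Cmod u / r) ^ S m))%R).
    { rewrite <- Cmod_opp. replace (- (a m * u ^ m)) with (0 - a m * u ^ m) by ring.
      rewrite <- Hw2. apply ctends_Cmod_le with (fun n => psum a u n - a m * u ^ m).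
      - apply ctends_sub; [apply Hf; unfold u in *; lra|apply ctends_const].
      - exists (S m). intros n Hn. eapply Rle_trans; [apply Pm; [lra|lia]|].
        apply Rmult_le_compat_l; auto.
        assert (0 <= (Cmod u / r) ^ n)%R; [|lra].
        apply pow_le. apply Rmult_le_pos; [lra|left; now apply Rinv_0_lt_compat]. }
    rewrite Cmod_mult, Cmod_pow in B. unfold Rdiv in B.
    rewrite Rpow_mult_distr, pow_inv in B.
    apply Rmult_le_reg_r with (Cmod u ^ m)%R; [now apply pow_lt|].
    eapply Rle_trans; [exact B|].
    replace (M * (2 * (Cmod u ^ S m * / r ^ S m)))%R with (K * Cmod u * Cmod u ^ m)%R
      by (unfold K; rewrite <- (tech_pow_Rmult (Cmod u)); field; lra).
    apply Rmult_le_compat_r; [apply pow_le; lra|].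
    apply Rle_trans with (K * (e / (K + 1)))%R.
    - apply Rmult_le_compat_l; lra.
    - apply Rmult_le_reg_r with (K + 1)%R; [lra|].
      replace (K * (e / (K + 1)) * (K + 1))%R with (K * e)%R by (field; lra). nra. }
  exists r. split; auto. intros w Hw. eapply ctends_unique; [apply Hf, Hw|].
  apply ctends_ext with (fun _ => 0); [|apply ctends_const].
  intros n. induction n as [|n IH]; cbn [psum]; [easy|]. rewrite <- IH, A0. ring.
Qed.

Lemma psr_identity (f g : C -> C) (z0 : C) : psr f z0 -> psr g z0 ->
  (forall e, (0 < e)%R -> exists w, w <> z0 /\ (Cmod (w - z0) < e)%R /\ f w = g w) ->
  eq_near f g z0.
Proof.
  intros Hf Hg Hz. destruct (psr_zero _ _ (psr_sub _ _ _ Hf Hg)) as [r [Hr P]].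
  - intros e He. destruct (Hz e He) as [w [A [B E]]]. exists w. rewrite E. repeat split; auto. ring.
  - exists r. split; auto. intros w Hw. apply Ceq_sub, P, Hw.
Qed.

(** * Cauchy's integral formula on a circle *)

Definition circ (r : R) (t : R) : C := RtoC r * cis (2 * PI * t).

Lemma Cmod_cis (t : R) : Cmod (cis t) = 1%R.
Proof.
  unfold Cmod, cis. simpl fst. simpl snd. rewrite <- sqrt_1. f_equal.
  generalize (sin2_cos2 t). unfold Rsqr. simpl. lra.
Qed.

Lemma cis_add (s t : R) : cis (s + t) = cis s * cis t.
Proof. unfold cis, Cmult; simpl. rewrite cos_plus, sin_plus. f_equal; ring. Qed.

Lemma cis_0 : cis 0 = 1.
Proof. unfold cis. now rewrite cos_0, sin_0. Qed.

Lemma cis_pow (t : R) (n : nat) : cis t ^ n = cis (INR n * t).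
Proof.
  induction n as [|n IH].
  - simpl. rewrite Rmult_0_l. now rewrite cis_0.
  - rewrite Cpow_S, IH, <- cis_add, S_INR. f_equal. ring.
Qed.

Lemma cis_2PI : cis (2 * PI) = 1.
Proof. unfold cis. now rewrite cos_2PI, sin_2PI. Qed.

Lemma rder_of_re_im (f : R -> C) (t a b : R) :
  is_derive (fun s => Re (f s)) t a -> is_derive (fun s => Im (f s)) t b -> rder f t (a, b).
Proof.
  intros Ha Hb e He.
  assert (G : forall (h : R -> R) c, is_derive h t c -> exists d, (0 < d)%R /\ forall s,
    (Rabs (s - t) < d)%R -> (Rabs (h s - h t - c * (s - t)) <= e / 2 * Rabs (s - t))%R).
  { intros h c [_ H]. assert (He2 : (0 < e / 2)%R) by lra.
    specialize (H t (fun P HP => HP) (mkposreal _ He2)). destruct H as [d Hd].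
    exists d. split; [apply cond_pos|]. intros s Hs. specialize (Hd s Hs).
    unfold norm, minus, plus, opp, scal in Hd; simpl in Hd. unfold abs, mult in Hd; simpl in Hd.
    replace (h s - h t - c * (s - t))%R with (h s + - h t + - ((s + - t) * c))%R by ring. exact Hd. }
  destruct (G _ _ Ha) as [d1 [H1 P1]]. destruct (G _ _ Hb) as [d2 [H2 P2]].
  exists (Rmin d1 d2). split; [now apply Rmin_pos|]. intros s Hs.
  assert (m1 := Rmin_l d1 d2). assert (m2 := Rmin_r d1 d2).
  specialize (P1 s ltac:(lra)). specialize (P2 s ltac:(lra)).
  eapply Rle_trans; [apply Cmod_le_re_im|].
  replace (Re (f s - f t - (a, b) * RtoC (s - t))) with (Re (f s) - Re (f t) - a * (s - t))%R
    by (unfold Re; simpl; ring).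
  replace (Im (f s - f t - (a, b) * RtoC (s - t))) with (Im (f s) - Im (f t) - b * (s - t))%R
    by (unfold Im; simpl; ring).
  lra.
Qed.

Lemma rder_cis (k t : R) : rder (fun s => cis (k * s)) t (Ci * RtoC k * cis (k * t)).
Proof.
  eapply rder_eq.
  - apply (rder_of_re_im _ t (- k * sin (k * t)) (k * cos (k * t)));
      unfold cis, Re, Im; simpl; auto_derive; auto; ring.
  - unfold cis, Ci, RtoC, Cmult; simpl. f_equal; ring.
Qed.

Lemma rder_circ (r t : R) : rder (circ r) t (2 * PI * Ci * circ r t).
Proof.
  unfold circ. eapply rder_eq.
  - apply rder_mul; [apply rder_const|apply rder_cis].
  - cbv beta. rewrite RtoC_mult. ring.
Qed.

Lemma Cmod_circ (r t : R) : (0 <= r)%R -> Cmod (circ r t) = r.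
Proof. intros H. unfold circ. rewrite Cmod_mult, Cmod_cis, Cmod_R, Rabs_pos_eq; lra. Qed.

Lemma circ_neq0 (r t : R) : (0 < r)%R -> circ r t <> 0.
Proof. intros H. apply Cmod_gt_0. rewrite Cmod_circ; lra. Qed.

Lemma circ_periodic (r : R) : circ r 1 = circ r 0.
Proof. unfold circ. now rewrite Rmult_0_r, Rmult_1_r, cis_0, cis_2PI. Qed.

Lemma two_pi_i_neq0 : 2 * PI * Ci <> 0.
Proof.
  repeat apply Cmult_neq_0.
  - apply RtoC_neq; lra.
  - apply RtoC_neq. generalize PI_RGT_0; lra.
  - apply Cmod_gt_0. rewrite Cmod_Ci. lra.
Qed.

(** The integrand is, up to a nonzero constant, its own derivative, and it takes the same value at
    both ends. *)
Lemma cint_circ_inv_pow (r : R) (n : nat) : (0 < r)%R -> (1 <= n)%nat ->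
  cint (fun t => (/ circ r t) ^ n) = 0.
Proof.
  intros Hr Hn.
  assert (Hd : forall t, rder (fun t => (/ circ r t) ^ n) t
     ((- (INR n * (2 * PI * Ci))) * (/ circ r t) ^ n)).
  { intros t. eapply rder_eq.
    - apply (rder_D1 (fun w => (/ w) ^ n) (circ r)).
      + apply D1_pow, D1_inv, circ_neq0, Hr.
      + apply rder_circ.
    - destruct n as [|n]; [lia|]. change (Init.Nat.pred (S n)) with n. rewrite (Cpow_S _ n).
      field. now apply circ_neq0. }
  assert (Hc : ccontI (fun t => (/ circ r t) ^ n)) by (intros t _; eapply rder_ccont, Hd).
  assert (E := cint_FTC _ _ (fun t _ => Hd t)
    ltac:(intros t Ht; apply ccont_mul; [apply ccont_const|now apply Hc])).
  rewrite cint_scal in E by easy. cbv beta in E. rewrite circ_periodic, Csub_diag in E.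
  assert (N : - (INR n * (2 * PI * Ci)) <> 0).
  { intros N. apply (Cmult_neq_0 (INR n) (2 * PI * Ci)).
    - apply RtoC_INR_neq0; lia.
    - apply two_pi_i_neq0.
    - replace (INR n * (2 * PI * Ci)) with (- - (INR n * (2 * PI * Ci))) by ring. rewrite N. ring. }
  apply NNPP. intros N'. exact (Cmult_neq_0 _ _ N N' E).
Qed.

(* Contracting the circle towards [w]: the derivative of the contracted
   integral is the integral of an exact differential. *)
Lemma cauchy_raw (f f' : C -> C) (z0 w : C) (r R' : R) : (0 < r)%R -> (r < R')%R ->
  (forall z, (Cmod (z - z0) < R')%R -> D1 f z (f' z)) -> (Cmod (w - z0) < r)%R ->
  let c := fun t => circ r t / (z0 + circ r t - w) in
  ccontI c /\ ccontI (fun t => f (z0 + circ r t)) /\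
  f w * cint c = cint (fun t => c t * f (z0 + circ r t)).
Proof.
  intros Hr HR Hf Hw c.
  set (q := fun t => z0 + circ r t - w).
  assert (Hq0 : forall t, q t <> 0).
  { intros t E. assert (A : z0 + circ r t = w) by (apply Ceq_sub; exact E).
    assert (Cmod (w - z0) = r); [|lra].
    rewrite <- A. replace (z0 + circ r t - z0) with (circ r t) by ring. apply Cmod_circ. lra. }
  assert (Hcirc : forall t, ccont (circ r) t) by (intros t; eapply rder_ccont, rder_circ).
  assert (Hz : forall t, ccont (fun t => z0 + circ r t) t)
    by (intros; apply ccont_add; [apply ccont_const|apply Hcirc]).
  assert (Hq : ccontI q) by (intros t _; apply ccont_sub; [apply Hz|apply ccont_const]).
  assert (Hc : ccontI c).
  { intros t Ht. apply ccont_mul; [apply Hcirc|]. apply ccont_inv; [apply Hq0|now apply Hq]. }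
  assert (Hfz : ccontI (fun t => f (z0 + circ r t))).
  { intros t _. apply (ccont_D1 f (fun t => z0 + circ r t) t (f' (z0 + circ r t))); auto.
    apply Hf. replace (z0 + circ r t - z0) with (circ r t) by ring. rewrite Cmod_circ; lra. }
  split; [exact Hc|]. split; [exact Hfz|].
  set (phi := fun s : C => cint (fun t => c t * f (w + q t * s))).
  assert (Hseg : forall s t, unit_interval s -> (Cmod (w + q t * RtoC s - z0) < R')%R).
  { intros s t Hs. unfold q. replace (w + (z0 + circ r t - w) * s)
      with (w + RtoC s * (z0 + circ r t - w)) by ring.
    apply Cmod_segment; auto; [lra|]. replace (z0 + circ r t - z0) with (circ r t) by ring.
    rewrite Cmod_circ; lra. }
  assert (Hp : forall s, unit_interval s ->
    ccontI (fun t => c t * (q t * f' (w + q t * RtoC s))) /\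
    D1 phi (RtoC s) (cint (fun t => c t * (q t * f' (w + q t * RtoC s))))).
  { intros s Hs.
    destruct (param_D2 (fun _ z => f z) (fun _ _ => 0) (fun _ z => f' z) c (fun _ => w) q 0 (RtoC s))
      as [_ [_ [K D]]]; auto.
    - intros t _. apply ccont_const.
    - intros t Ht. exists (R' - Cmod (w + q t * RtoC s - z0))%R.
      specialize (Hseg s t Hs). split; [lra|]. intros l' z' _ Hz'.
      apply D2_eq with (f' z' * 0) (f' z' * 1); [|ring|ring].
      apply (D2_of_D1 f (fun _ z => z)); [|apply D2_snd]. apply Hf.
      generalize (Cmod_tri_sub z' (w + q t * RtoC s) z0). lra.
    - split; [exact K|]. apply D2_slice2 in D. exact D. }
  (* Multiplied by [2 * PI * Ci * s], the integrand is the derivative in [t] of [f (w + q t * s)],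
     which closes up. The factor [s] can be cancelled only for [s > 0]; continuity of [phi] takes
     care of the end. *)
  assert (H0 : forall s, (0 < s < 1)%R -> cint (fun t => c t * (q t * f' (w + q t * RtoC s))) = 0).
  { intros s Hs. assert (Us : unit_interval s) by (unfold unit_interval; lra).
    destruct (Hp s Us) as [K _].
    assert (E : cint (fun t => (RtoC s * (2 * PI * Ci)) * (c t * (q t * f' (w + q t * RtoC s)))) = 0).
    { set (h := fun t => f (w + q t * RtoC s)).
      replace (RtoC 0) with (h 1%R - h 0%R).
      2:{ unfold h, q. rewrite circ_periodic. ring. }
      apply (cint_FTC h).
      - intros t Ht. unfold h. eapply rder_eq.
        + apply (rder_D1 f); [apply Hf, Hseg, Us|].
          apply rder_add; [apply rder_const|]. apply rder_mul; [|apply rder_const].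
          unfold q. eapply (rder_add _ (fun _ => - w) t);
            [apply rder_add; [apply rder_const|apply rder_circ]|apply rder_const].
        + unfold c. cbv beta. fold (q t). field. apply Hq0.
      - intros t Ht. apply ccont_mul; [apply ccont_const|now apply K]. }
    rewrite cint_scal in E by exact K.
    apply NNPP. intros N. revert E. apply Cmult_neq_0; auto.
    apply Cmult_neq_0; [apply RtoC_neq; lra|apply two_pi_i_neq0]. }
  assert (E : phi (RtoC 0) = phi (RtoC 1)).
  { apply (rder_zero_const (fun s => phi (RtoC s)) 0 1 Rlt_0_1).
    - intros s Hs. destruct (Hp s) as [_ D]; [unfold unit_interval; lra|].
      rewrite H0 in D by easy. exact (rder_eq _ _ _ _ (rder_D1 phi RtoC s 0 1 D (rder_RtoC s)) (Cmult_0_l 1)).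
    - intros s Hs. destruct (Hp s) as [_ D]; [exact Hs|].
      apply (ccont_D1 phi _ _ _ D), ccont_RtoC. }
  unfold phi in E.
  rewrite <- cint_scal by exact Hc.
  transitivity (cint (fun t => c t * f (w + q t * 0))).
  - apply cint_ext. intros t _. replace (w + q t * 0) with w by ring. ring.
  - rewrite E. apply cint_ext. intros t _. unfold q.
    replace (w + (z0 + circ r t - w) * 1) with (z0 + circ r t) by ring. easy.
Qed.

Lemma mean_value (f f' : C -> C) (z0 : C) (r R' : R) : (0 < r)%R -> (r < R')%R ->
  (forall z, (Cmod (z - z0) < R')%R -> D1 f z (f' z)) ->
  cint (fun t => f (z0 + circ r t)) = f z0.
Proof.
  intros Hr HR Hf. destruct (cauchy_raw f f' z0 z0 r R') as [Hc [_ E]]; auto.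
  { rewrite Cmod_diag. lra. }
  cbv zeta in E.
  assert (A : forall t, circ r t / (z0 + circ r t - z0) = 1).
  { intros t. replace (z0 + circ r t - z0) with (circ r t) by ring. field. now apply circ_neq0. }
  rewrite (cint_ext (fun t => circ r t / (z0 + circ r t - z0)) (fun _ => 1)) in E
    by (intros; apply A).
  rewrite cint_const in E. rewrite Cmult_1_r in E. rewrite E. apply cint_ext. intros t _.
  rewrite A. ring.
Qed.

(** Finite geometric expansion of the Cauchy kernel in powers of [(w - z0) / circ r t], the
    remainder being kept as an integral. *)
Lemma circ_geometric (z0 w : C) (r : R) (g : R -> C) (n : nat) : (0 < r)%R ->
  (Cmod (w - z0) < r)%R -> ccontI g ->
  ccontI (fun t => circ r t / (z0 + circ r t - w)) ->
  cint (fun t => circ r t / (z0 + circ r t - w) * g t)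
  = psum (fun k => cint (fun t => g t * (/ circ r t) ^ k)) (w - z0) n
    + (w - z0) ^ n * cint (fun t => circ r t / (z0 + circ r t - w) * (g t * (/ circ r t) ^ n)).
Proof.
  intros Hr Hw Hg Hc.
  assert (Hv : forall k, ccontI (fun t => g t * (/ circ r t) ^ k)).
  { intros k t Ht. apply ccont_mul; [now apply Hg|]. apply ccont_pow, ccont_inv.
    - now apply circ_neq0.
    - eapply rder_ccont, rder_circ. }
  assert (Hcv : forall k, ccontI (fun t => circ r t / (z0 + circ r t - w) * (g t * (/ circ r t) ^ k))).
  { intros k t Ht. apply ccont_mul; [now apply Hc|now apply Hv]. }
  induction n as [|n IH].
  - cbn [psum]. rewrite Cpow_zero, Cmult_1_l, Cplus_0_l. apply cint_ext. intros t _.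
    rewrite Cpow_zero. ring.
  - rewrite IH. cbn [psum]. rewrite <- Cplus_assoc. f_equal.
    rewrite (Cpow_S _ n).
    rewrite (Cmult_comm _ ((w - z0) ^ n)).
    replace ((w - z0) * (w - z0) ^ n * cint (fun t => circ r t / (z0 + circ r t - w) * (g t * (/ circ r t) ^ S n)))
      with ((w - z0) ^ n * ((w - z0) * cint (fun t => circ r t / (z0 + circ r t - w) * (g t * (/ circ r t) ^ S n)))) by ring.
    rewrite <- Cmult_plus_distr_l. f_equal.
    rewrite <- cint_scal by apply Hcv. rewrite <- cint_add.
    + apply cint_ext. intros t _. rewrite Cpow_S. field. split; [now apply circ_neq0|].
      intros E. assert (A : z0 + circ r t = w) by (apply Ceq_sub; exact E).
      assert (Cmod (w - z0) = r); [|lra].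
      rewrite <- A. replace (z0 + circ r t - z0) with (circ r t) by ring. apply Cmod_circ. lra.
    + apply Hv.
    + intros t Ht. apply ccont_mul; [apply ccont_const|now apply Hcv].
Qed.

Lemma circ_expand (z0 w : C) (r B : R) (g : R -> C) : (0 < r)%R ->
  (Cmod (w - z0) < r)%R -> ccontI g -> (forall t, unit_interval t -> (Cmod (g t) <= B)%R) ->
  ccontI (fun t => circ r t / (z0 + circ r t - w)) ->
  ctends (psum (fun k => cint (fun t => g t * (/ circ r t) ^ k)) (w - z0))
    (cint (fun t => circ r t / (z0 + circ r t - w) * g t)).
Proof.
  intros Hr Hw Hg HB Hc. destruct (ccontI_bounded _ Hc) as [K [HK BK]].
  apply ctends_of_le with (K * B)%R (Cmod (w - z0) / r)%R.
  { split.
    - apply Rmult_le_pos; [apply Cmod_ge_0|left; now apply Rinv_0_lt_compat].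
    - apply Rmult_lt_reg_r with r; auto.
      replace (Cmod (w - z0) / r * r)%R with (Cmod (w - z0)) by (field; lra). lra. }
  intros n. rewrite (circ_geometric z0 w r g n Hr Hw Hg Hc).
  match goal with |- (Cmod (?a - (?a + ?b)) <= _)%R => replace (a - (a + b)) with (- b) by ring end.
  rewrite Cmod_opp, Cmod_mult, Cmod_pow.
  assert (Hcv : ccontI (fun t => circ r t / (z0 + circ r t - w) * (g t * (/ circ r t) ^ n))).
  { intros t Ht. apply ccont_mul; [now apply Hc|]. apply ccont_mul; [now apply Hg|].
    apply ccont_pow, ccont_inv; [now apply circ_neq0|eapply rder_ccont, rder_circ]. }
  unfold Rdiv. rewrite Rpow_mult_distr, pow_inv.
  replace (K * B * (Cmod (w - z0) ^ n * / r ^ n))%R with (Cmod (w - z0) ^ n * (K * (B * / r ^ n)))%R by ring.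
  apply Rmult_le_compat_l; [apply pow_le, Cmod_ge_0|].
  apply cint_bound; auto. intros t Ht. rewrite !Cmod_mult.
  apply Rmult_le_compat; [apply Cmod_ge_0| |now apply BK|].
  - apply Rmult_le_pos; apply Cmod_ge_0.
  - apply Rmult_le_compat; try apply Cmod_ge_0; [now apply HB|]. apply Req_le.
    rewrite Cmod_pow, Cmod_inv by (now apply circ_neq0). rewrite Cmod_circ by lra. apply pow_inv.
Qed.

Lemma holo_near_psr (f : C -> C) (z0 : C) : holo_near f z0 -> psr f z0.
Proof.
  intros [R' [f' [HR Hf]]].
  set (r := (R' / 2)%R). assert (Hr : (0 < r)%R) by (unfold r; lra).
  assert (HrR : (r < R')%R) by (unfold r; lra).
  destruct (cauchy_raw f f' z0 z0 r R') as [_ [Hg _]]; auto.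
  { rewrite Cmod_diag. lra. }
  set (g := fun t => f (z0 + circ r t)) in *.
  destruct (ccontI_bounded g Hg) as [B [HB Bg]].
  assert (Hv : forall k, ccontI (fun t => g t * (/ circ r t) ^ k)).
  { intros k t Ht. apply ccont_mul; [now apply Hg|]. apply ccont_pow, ccont_inv.
    - now apply circ_neq0.
    - eapply rder_ccont, rder_circ. }
  assert (Hrk : forall k, (0 < r ^ k)%R) by (intros; now apply pow_lt).
  exists (fun k => cint (fun t => g t * (/ circ r t) ^ k)), r, B. split; auto. split.
  - intros k. apply Rmult_le_reg_r with (/ r ^ k)%R; [now apply Rinv_0_lt_compat|].
    rewrite Rmult_assoc, Rinv_r, Rmult_1_r by (apply Rgt_not_eq, Hrk).
    apply cint_bound; auto. intros t Ht.
    rewrite Cmod_mult, Cmod_pow, Cmod_inv by (now apply circ_neq0). rewrite Cmod_circ, pow_inv by lra.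
    apply Rmult_le_compat_r; [left; now apply Rinv_0_lt_compat|auto].
  - intros w Hw. destruct (cauchy_raw f f' z0 w r R') as [Hc [_ E]]; auto. cbv zeta in E.
    (* The kernel is normalised by expanding it too: all powers of [/ circ r t] except the zeroth
       integrate to 0. *)
    assert (K1 : cint (fun t => circ r t / (z0 + circ r t - w)) = 1).
    { eapply ctends_unique.
      - replace (cint (fun t => circ r t / (z0 + circ r t - w)))
          with (cint (fun t => circ r t / (z0 + circ r t - w) * 1))
          by (apply cint_ext; intros; ring).
        apply (circ_expand z0 w r 1 (fun _ => 1)); auto.
        + intros t _. apply ccont_const.
        + intros t _. rewrite Cmod_1. lra.
      - intros e He. exists 1%nat. intros n Hn.
        assert (P1 : psum (fun k => cint (fun t => 1 * (/ circ r t) ^ k)) (w - z0) n = 1).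
        { induction Hn as [|n Hn IH]; cbn [psum].
          - rewrite (cint_ext _ (fun _ => 1)) by (intros; rewrite Cpow_zero; ring).
            rewrite cint_const, Cpow_zero. ring.
          - rewrite IH, (cint_ext _ (fun t => (/ circ r t) ^ n)) by (intros; ring).
            rewrite cint_circ_inv_pow by auto. ring. }
        rewrite P1, Cmod_diag. lra. }
    rewrite K1, Cmult_1_r in E. rewrite E.
    apply (circ_expand z0 w r B g); auto.
Qed.

Lemma holo_near_identity (f g : C -> C) (z0 : C) : holo_near f z0 -> psr g z0 ->
  (forall e, (0 < e)%R -> exists w, w <> z0 /\ (Cmod (w - z0) < e)%R /\ f w = g w) ->
  eq_near f g z0.
Proof. intros Hf Hg. apply psr_identity; auto using holo_near_psr. Qed.

(** * Binomial series *)

Fixpoint csum (u : nat -> C) (n : nat) : C :=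
  match n with O => 0 | S m => csum u m + u m end.

Lemma psum_csum (a : nat -> C) (z : C) (n : nat) : psum a z n = csum (fun k => a k * z ^ k) n.
Proof. induction n as [|n IH]; cbn; [easy|now rewrite IH]. Qed.

Lemma csum_Cmod (u : nat -> C) (K y : R) (n : nat) : (0 <= y < 1)%R ->
  (forall k, (Cmod (u k) <= K * y ^ k)%R) -> (Cmod (csum u n) <= K / (1 - y))%R.
Proof.
  intros Hy H.
  assert (HK : (0 <= K)%R).
  { specialize (H 0%nat). generalize (Cmod_ge_0 (u 0%nat)). simpl in H. lra. }
  assert (B : (Cmod (csum u n) <= K * ((1 - y ^ n) / (1 - y)))%R).
  { induction n as [|n IH]; cbn [csum].
    - rewrite Cmod_0. simpl. apply Req_le. field. lra.
    - eapply Rle_trans; [apply Cmod_triangle|].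
      eapply Rle_trans; [apply Rplus_le_compat; [apply IH|apply H]|].
      apply Req_le. simpl. field. lra. }
  eapply Rle_trans; [exact B|]. unfold Rdiv. apply Rmult_le_compat_l; auto.
  rewrite <- (Rmult_1_l (/ (1 - y))) at 2.
  apply Rmult_le_compat_r; [left; apply Rinv_0_lt_compat; lra|].
  assert (0 <= y ^ n)%R by (apply pow_le; lra). lra.
Qed.

Lemma CSeries_ctends (u : nat -> C) (K y : R) : (0 <= y < 1)%R ->
  (forall k, (Cmod (u k) <= K * y ^ k)%R) -> ctends (csum u) (CSeries u).
Proof.
  intros Hy H.
  assert (G : forall pr : C -> R, (forall c, (Rabs (pr c) <= Cmod c)%R) ->
     is_series (fun n => pr (u n)) (Series (fun n => pr (u n)))).
  { intros pr Hpr. apply Series_correct.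
    apply (ex_series_le (K := R_AbsRing) (V := R_CompleteNormedModule) _ (fun n => K * y ^ n)%R).
    - intros n. unfold norm; simpl. unfold abs; simpl. eapply Rle_trans; [apply Hpr|apply H].
    - apply (ex_series_scal (V := R_NormedModule) K (fun n => y ^ n)%R). exists (/ (1 - y))%R.
      apply is_series_geom. rewrite Rabs_pos_eq; lra. }
  assert (S1 := G fst re_le_Cmod). assert (S2 := G snd Im_le_Cmod).
  assert (L : forall f v, is_series f v -> forall e, (0 < e)%R -> exists n0 : nat,
     forall n, (n0 <= n)%nat -> (Rabs (sum_n f n - v) < e)%R).
  { intros f v Hf e He. apply (is_lim_seq_spec (sum_n f) v) in Hf.
    destruct (Hf (mkposreal e He)) as [n0 P]. exists n0. exact P. }
  (* [sum_n] includes its upper index and [csum] does not, whence the shift. *)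
  assert (E : forall n, csum u (S n) = (sum_n (fun k => fst (u k)) n, sum_n (fun k => snd (u k)) n)).
  { intros n. induction n as [|n IH].
    - rewrite !sum_O. cbn [csum]. rewrite Cplus_0_l. now destruct (u 0%nat).
    - rewrite !sum_Sn. cbn [csum] in *. rewrite IH. now destruct (u (S n)). }
  intros e He. destruct (L _ _ S1 (e / 2)%R) as [n1 P1]; [lra|].
  destruct (L _ _ S2 (e / 2)%R) as [n2 P2]; [lra|].
  exists (S (n1 + n2)). intros n Hn. destruct n as [|n]; [lia|]. rewrite E.
  eapply Rle_lt_trans; [apply Cmod_le_re_im|].
  specialize (P1 n ltac:(lia)). specialize (P2 n ltac:(lia)).
  set (A := sum_n (fun k => fst (u k)) n) in *. set (B := sum_n (fun k => snd (u k)) n) in *.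
  unfold CSeries. set (A' := Series (fun k => fst (u k))) in *. set (B' := Series (fun k => snd (u k))) in *.
  change (Re ((A, B) - (A', B'))) with (A + - A')%R. change (Im ((A, B) - (A', B'))) with (B + - B')%R.
  replace e with (e / 2 + e / 2)%R by field. apply Rplus_lt_compat; [exact P1|exact P2].
Qed.

(* [q = 1 + (1 - x) / 4] satisfies [q^2 x < 1], and Bernoulli's inequality
   bounds [n] by a multiple of [q^n]. *)
Lemma poly_geom_bound (x : R) : (0 <= x < 1)%R -> exists K y, (0 <= K)%R /\ (0 <= y < 1)%R /\
  forall n : nat, ((INR n + 1) * (INR n + 1) * x ^ n <= K * y ^ n)%R.
Proof.
  intros Hx. set (h := ((1 - x) / 4)%R). assert (Hh : (0 < h <= / 4)%R) by (unfold h; lra).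
  set (q := (1 + h)%R).
  assert (B : forall n : nat, (INR n + 1 <= / h * q ^ n)%R).
  { intros n. apply Rmult_le_reg_l with h; [lra|].
    rewrite <- Rmult_assoc, Rinv_r, Rmult_1_l by lra.
    generalize (poly n h ltac:(lra)). fold q. intros P. nra. }
  exists (/ h * / h)%R, (q * q * x)%R.
  assert (I : (0 < / h)%R) by (apply Rinv_0_lt_compat; lra).
  split; [nra|]. split.
  - unfold q. replace x with (1 - 4 * h)%R by (unfold h; lra). split; nra.
  - intros n. rewrite !Rpow_mult_distr.
    replace (/ h * / h * (q ^ n * q ^ n * x ^ n))%R with ((/ h * q ^ n) * (/ h * q ^ n) * x ^ n)%R by ring.
    apply Rmult_le_compat_r; [apply pow_le; lra|].
    assert (0 <= INR n)%R by apply pos_INR. apply Rmult_le_compat; try lra; apply B.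
Qed.

(** Strict differentiability of a power with a constant only quadratic in [n], so that it can be
    summed over a power series. Multiplying by [x * x] avoids the exponent [n - 2]. *)
Lemma cpow_strict (z z1 z2 : C) (x d : R) (n : nat) : (0 < x)%R ->
  (Cmod z <= x)%R -> (Cmod z1 <= x)%R -> (Cmod z2 <= x)%R ->
  (Cmod (z1 - z) <= d)%R -> (Cmod (z2 - z) <= d)%R ->
  (x * x * Cmod (z1 ^ n - z2 ^ n - INR n * z ^ pred n * (z1 - z2))
   <= INR n * INR n * x ^ n * (d * Cmod (z1 - z2)))%R.
Proof.
  intros Hx H0 H1 H2 D1 D2.
  assert (Hd : (0 <= d)%R) by (generalize (Cmod_ge_0 (z1 - z)); lra).
  assert (Hpow : forall w k, (Cmod w <= x)%R -> (Cmod (w ^ k) <= x ^ k)%R).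
  { intros w k Hw. rewrite Cmod_pow. apply pow_incr. split; [apply Cmod_ge_0|easy]. }
  assert (P : forall k, (x * Cmod (z2 ^ k - z ^ k) <= INR k * x ^ k * d)%R).
  { intros k. induction k as [|k IH].
    - rewrite !Cpow_zero, Cmod_diag. simpl. lra.
    - rewrite !Cpow_S, S_INR.
      replace (z2 * z2 ^ k - z * z ^ k) with (z2 * (z2 ^ k - z ^ k) + (z2 - z) * z ^ k) by ring.
      assert (A := Cmod_triangle (z2 * (z2 ^ k - z ^ k)) ((z2 - z) * z ^ k)).
      rewrite !Cmod_mult in A.
      assert (B : (Cmod z2 * Cmod (z2 ^ k - z ^ k) <= x * Cmod (z2 ^ k - z ^ k))%R)
        by (apply Rmult_le_compat_r; [apply Cmod_ge_0|easy]).
      assert (E : (Cmod (z2 - z) * Cmod (z ^ k) <= d * x ^ k)%R)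
        by (apply Rmult_le_compat; try apply Cmod_ge_0; auto).
      simpl pow. apply Rle_trans with (x * (x * Cmod (z2 ^ k - z ^ k) + d * x ^ k))%R.
      + apply Rmult_le_compat_l; lra.
      + assert (x * (x * Cmod (z2 ^ k - z ^ k)) <= x * (INR k * x ^ k * d))%R
          by (apply Rmult_le_compat_l; lra). lra. }
  induction n as [|n IH].
  - rewrite !Cpow_zero. change (RtoC (INR 0)) with (RtoC 0).
    replace (1 - 1 - 0 * 1 * (z1 - z2)) with (RtoC 0) by ring.
    rewrite Cmod_0. simpl. lra.
  - rewrite S_INR. rewrite !(Cpow_S _ n), RtoC_plus.
    assert (Ez : INR n * z ^ pred n * z = INR n * z ^ n).
    { destruct n; [change (RtoC (INR 0)) with (RtoC 0); ring|].
      change (pred (S n)) with n. rewrite Cpow_S. ring. }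
    change (Init.Nat.pred (S n)) with n.
    replace (z1 * z1 ^ n - z2 * z2 ^ n - (INR n + 1) * z ^ n * (z1 - z2))
      with (z1 * (z1 ^ n - z2 ^ n - INR n * z ^ pred n * (z1 - z2))
        + (INR n * z ^ pred n * (z1 - z) * (z1 - z2) + (z1 - z2) * (z2 ^ n - z ^ n)))
      by (replace ((INR n + 1) * z ^ n) with (INR n * z ^ n + z ^ n) by ring; rewrite <- Ez; ring).
    set (E := Cmod (z1 ^ n - z2 ^ n - INR n * z ^ pred n * (z1 - z2))) in *.
    set (T := Cmod (z1 - z2)) in *. assert (HT : (0 <= T)%R) by apply Cmod_ge_0.
    assert (HE : (0 <= E)%R) by apply Cmod_ge_0.
    assert (Hn : (0 <= INR n)%R) by apply pos_INR.
    assert (Hxn : (0 <= x ^ n)%R) by (apply pow_le; lra).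
    eapply Rle_trans; [apply Rmult_le_compat_l; [nra|apply Cmod_triangle]|].
    eapply Rle_trans; [apply Rmult_le_compat_l; [nra|apply Rplus_le_compat_l, Cmod_triangle]|].
    rewrite !Cmod_mult. fold E T. rewrite (Cmod_R (INR n)), (Rabs_pos_eq (INR n)) by easy.
    assert (A1 : (x * x * (Cmod z1 * E) <= x * (INR n * INR n * x ^ n * (d * T)))%R).
    { replace (x * x * (Cmod z1 * E))%R with (Cmod z1 * (x * x * E))%R by ring.
      apply Rmult_le_compat; try apply Cmod_ge_0; auto. nra. }
    assert (A2 : (x * (INR n * Cmod (z ^ pred n)) <= INR n * x ^ n)%R).
    { destruct n as [|m].
      - simpl. lra.
      - change (pred (S m)) with m. specialize (Hpow z m H0). simpl pow.
        apply Rle_trans with (x * (INR (S m) * x ^ m))%R; [|lra].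
        apply Rmult_le_compat_l; [lra|]. now apply Rmult_le_compat_l. }
    assert (A3 : (x * x * (INR n * Cmod (z ^ pred n) * Cmod (z1 - z) * T) <= x * (INR n * x ^ n * (d * T)))%R).
    { replace (x * x * (INR n * Cmod (z ^ pred n) * Cmod (z1 - z) * T))%R
        with (x * ((x * (INR n * Cmod (z ^ pred n))) * (Cmod (z1 - z) * T)))%R by ring.
      apply Rmult_le_compat_l; [lra|]. apply Rmult_le_compat; auto.
      - generalize (Cmod_ge_0 (z ^ pred n)). intros. apply Rmult_le_pos; [lra|]. nra.
      - generalize (Cmod_ge_0 (z1 - z)). nra.
      - apply Rmult_le_compat_r; easy. }
    assert (A4 : (x * x * (T * Cmod (z2 ^ n - z ^ n)) <= x * (INR n * x ^ n * (d * T)))%R).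
    { replace (x * x * (T * Cmod (z2 ^ n - z ^ n)))%R with (x * (T * (x * Cmod (z2 ^ n - z ^ n))))%R by ring.
      apply Rmult_le_compat_l; [lra|].
      replace (INR n * x ^ n * (d * T))%R with (T * (INR n * x ^ n * d))%R by ring.
      apply Rmult_le_compat_l; auto. }
    simpl pow.
    assert (0 <= x * (x ^ n * (d * T)))%R
      by (apply Rmult_le_pos; [lra|]; apply Rmult_le_pos; [easy|]; now apply Rmult_le_pos).
    lra.
Qed.

(** All series to come (binomial, [f_series], [g_series]) have coefficients of modulus at most 1, so
    the open unit disc is a common domain and the coefficient bound is the only hypothesis carried
    around. *)
Definition cps (a : nat -> C) (z : C) : C := CSeries (fun n => a n * z ^ n).
Definition cps' (a : nat -> C) (z : C) : C := CSeries (fun n => a n * (INR n * z ^ pred n)).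

Lemma cps_ctends (a : nat -> C) (z : C) : (forall n, (Cmod (a n) <= 1)%R) -> (Cmod z < 1)%R ->
  ctends (psum a z) (cps a z).
Proof.
  intros Ha Hz. apply ctends_ext with (csum (fun k => a k * z ^ k)).
  { intros n. now rewrite psum_csum. }
  apply CSeries_ctends with 1%R (Cmod z).
  - split; [apply Cmod_ge_0|easy].
  - intros k. rewrite Cmod_mult, Cmod_pow. apply Rmult_le_compat_r; [apply pow_le, Cmod_ge_0|apply Ha].
Qed.

Lemma cps'_term (a : nat -> C) (z : C) : (forall n, (Cmod (a n) <= 1)%R) -> (Cmod z < 1)%R ->
  exists K y, (0 <= y < 1)%R /\ forall k, (Cmod (a k * (INR k * z ^ pred k)) <= K * y ^ k)%R.
Proof.
  intros Ha Hz. set (x := ((1 + Cmod z) / 2)%R).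
  assert (Hx : (0 < x < 1)%R) by (unfold x; generalize (Cmod_ge_0 z); lra).
  destruct (poly_geom_bound x) as [K [y [HK [Hy P]]]]; [lra|].
  exists (K / x)%R, y. split; auto. intros k.
  rewrite !Cmod_mult, Cmod_R, Cmod_pow. rewrite (Rabs_pos_eq (INR k)) by apply pos_INR.
  assert (Hk : (0 <= INR k)%R) by apply pos_INR.
  assert (A : (INR k * Cmod z ^ pred k <= INR k * (x ^ k / x))%R).
  { destruct k as [|k]; [simpl; lra|]. apply Rmult_le_compat_l; auto.
    replace (x ^ S k / x)%R with (x ^ k)%R by (simpl; field; lra).
    change (pred (S k)) with k. apply pow_incr.
    split; [apply Cmod_ge_0|unfold x; generalize (Cmod_ge_0 z); lra]. }
  apply Rle_trans with (1 * (INR k * (x ^ k / x)))%R.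
  - apply Rmult_le_compat; auto using Cmod_ge_0.
    apply Rmult_le_pos; auto. apply pow_le, Cmod_ge_0.
  - rewrite Rmult_1_l. unfold Rdiv.
    replace (K * / x * y ^ k)%R with (K * y ^ k * / x)%R by ring.
    rewrite <- Rmult_assoc. apply Rmult_le_compat_r; [left; apply Rinv_0_lt_compat; lra|].
    eapply Rle_trans; [|apply P]. apply Rmult_le_compat_r; [apply pow_le; lra|]. nra.
Qed.

(** On the disc of radius [x] halfway between [Cmod z] and 1 the termwise estimates of [cpow_strict]
    are dominated by a geometric series; the bound on partial sums passes to the limit. *)
Lemma cps_D1 (a : nat -> C) (z : C) : (forall n, (Cmod (a n) <= 1)%R) -> (Cmod z < 1)%R ->
  D1 (cps a) z (cps' a z).
Proof.
  intros Ha Hz. apply D1_char. intros e He. set (x := ((1 + Cmod z) / 2)%R).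
  assert (Hx : (0 < x < 1)%R) by (unfold x; generalize (Cmod_ge_0 z); lra).
  destruct (poly_geom_bound x) as [K [y [HK [Hy P]]]]; [lra|].
  destruct (cps'_term a z Ha Hz) as [K' [y' [Hy' P']]].
  assert (T' := CSeries_ctends _ _ _ Hy' P').
  set (B := (K / (x * x) / (1 - y))%R).
  assert (HB : (0 <= B)%R).
  { unfold B, Rdiv. repeat apply Rmult_le_pos; auto; left; apply Rinv_0_lt_compat; nra. }
  set (d := Rmin (e / (B + 1)) (x - Cmod z)).
  assert (Hd : (0 < d)%R) by (apply Rmin_pos; [apply Rdiv_lt_0_compat; lra|unfold x; lra]).
  assert (Hd1 : (d <= e / (B + 1))%R) by apply Rmin_l. assert (Hd2 : (d <= x - Cmod z)%R) by apply Rmin_r.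
  exists d. split; auto. intros z1 z2 H1 H2.
  assert (N : forall w, (Cmod (w - z) < d)%R -> (Cmod w <= x)%R).
  { intros w Hw. generalize (Cmod_triangle (w - z) z). replace (w - z + z) with w by ring. lra. }
  assert (N1 := N _ H1). assert (N2 := N _ H2).
  apply ctends_Cmod_le with (fun n => psum a z1 n - psum a z2 n
     - (z1 - z2) * csum (fun k => a k * (INR k * z ^ pred k)) n).
  - apply ctends_sub; [apply ctends_sub; apply cps_ctends; auto; lra|].
    rewrite (Cmult_comm (cps' a z)). now apply ctends_scal.
  - exists 0%nat. intros n _.
    replace (psum a z1 n - psum a z2 n - (z1 - z2) * csum (fun k => a k * (INR k * z ^ pred k)) n)
      with (csum (fun k => a k * (z1 ^ k - z2 ^ k - INR k * z ^ pred k * (z1 - z2))) n).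
    2:{ rewrite !psum_csum. induction n as [|n IH]; cbn [csum]; [ring|rewrite IH; ring]. }
    apply Rle_trans with ((K / (x * x) * (d * Cmod (z1 - z2))) / (1 - y))%R.
    + apply csum_Cmod; auto. intros k. rewrite Cmod_mult.
      assert (S := cpow_strict z z1 z2 x d k ltac:(lra) ltac:(unfold x; lra) N1 N2 ltac:(lra) ltac:(lra)).
      set (Ek := Cmod (z1 ^ k - z2 ^ k - INR k * z ^ pred k * (z1 - z2))) in *.
      assert (HE : (0 <= Ek)%R) by apply Cmod_ge_0.
      assert (Hdz : (0 <= d * Cmod (z1 - z2))%R) by (apply Rmult_le_pos; [lra|apply Cmod_ge_0]).
      apply Rle_trans with (1 * Ek)%R; [now apply Rmult_le_compat_r|].
      rewrite Rmult_1_l. apply Rmult_le_reg_l with (x * x)%R; [nra|].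
      eapply Rle_trans; [exact S|].
      replace (x * x * (K / (x * x) * (d * Cmod (z1 - z2)) * y ^ k))%R
        with ((K * y ^ k) * (d * Cmod (z1 - z2)))%R by (field; lra).
      apply Rmult_le_compat_r; auto. eapply Rle_trans; [|apply P].
      apply Rmult_le_compat_r; [apply pow_le; lra|]. generalize (pos_INR k). nra.
    + replace (K / (x * x) * (d * Cmod (z1 - z2)) / (1 - y))%R with (B * d * Cmod (z1 - z2))%R
        by (unfold B; field; lra).
      apply Rmult_le_compat_r; [apply Cmod_ge_0|].
      apply Rle_trans with (B * (e / (B + 1)))%R; [now apply Rmult_le_compat_l|].
      apply Rmult_le_reg_r with (B + 1)%R; [lra|].
      replace (B * (e / (B + 1)) * (B + 1))%R with (B * e)%R by (field; lra). nra.
Qed.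

(** [bcoef b n] is [(b)_n / n!], the coefficient of [v^n] in [(1 - v)^(-b)]; thus [Bin b] below is
    the branch of that power equal to 1 at the origin. *)
Fixpoint bcoef (b : R) (n : nat) : R :=
  match n with O => 1 | S m => bcoef b m * ((b + INR m) / (INR m + 1)) end%R.

Definition Bin (b : R) (v : C) : C := cps (fun n => RtoC (bcoef b n)) v.

Lemma bcoef_le1 (b : R) (n : nat) : (Rabs b <= 1)%R -> (Cmod (RtoC (bcoef b n)) <= 1)%R.
Proof.
  intros Hb. rewrite Cmod_R. induction n as [|n IH]; cbn [bcoef].
  - rewrite Rabs_R1. lra.
  - rewrite Rabs_mult. assert (Hn : (0 <= INR n)%R) by apply pos_INR.
    rewrite <- (Rmult_1_l 1) at 2. apply Rmult_le_compat; auto using Rabs_pos.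
    rewrite Rabs_div, (Rabs_pos_eq (INR n + 1)) by lra.
    apply Rmult_le_reg_r with (INR n + 1)%R; [lra|].
    replace (Rabs (b + INR n) / (INR n + 1) * (INR n + 1))%R with (Rabs (b + INR n)) by (field; lra).
    rewrite Rmult_1_l. eapply Rle_trans; [apply Rabs_triang|]. rewrite (Rabs_pos_eq (INR n)); lra.
Qed.

Lemma cps_at_0 (a : nat -> C) : (forall n, (Cmod (a n) <= 1)%R) -> cps a 0 = a 0%nat.
Proof.
  intros Ha. eapply ctends_unique; [apply cps_ctends; auto; rewrite Cmod_0; lra|].
  intros e He. exists 1%nat. intros n Hn.
  assert (E : psum a 0 n = a 0%nat).
  { induction Hn as [|n Hn IH]; cbn [psum]; [rewrite Cpow_zero; ring|].
    rewrite IH. destruct n; [lia|]. rewrite Cpow_S. ring. }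
  rewrite E, Cmod_diag. lra.
Qed.

Lemma Bin_0 (b : R) : (Rabs b <= 1)%R -> Bin b 0 = 1.
Proof. intros Hb. unfold Bin. rewrite cps_at_0; auto using bcoef_le1. Qed.

Lemma one_minus_neq0 (v : C) : (Cmod v < 1)%R -> 1 - v <> 0.
Proof.
  intros Hv E. assert (A : v = 1) by (symmetry; now apply Ceq_sub). rewrite A, Cmod_1 in Hv. lra.
Qed.

Lemma Bin_D1 (b : R) (v : C) : (Rabs b <= 1)%R -> (Cmod v < 1)%R ->
  D1 (Bin b) v (b * Bin b v / (1 - v)).
Proof.
  intros Hb Hv. set (a := fun n => RtoC (bcoef b n)).
  assert (Ha : forall n, (Cmod (a n) <= 1)%R) by (intros; now apply bcoef_le1).
  eapply D1_eq; [apply (cps_D1 a v Ha Hv)|].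
  destruct (cps'_term a v Ha Hv) as [K [y [Hy P]]]. assert (T := CSeries_ctends _ _ _ Hy P).
  assert (E : (1 - v) * cps' a v = b * Bin b v).
  { assert (F : forall n, (1 - v) * csum (fun k => a k * (INR k * v ^ pred k)) (S n)
        = b * psum a v n - v * (a n * (INR n * v ^ pred n))).
    { intros n. induction n as [|n IH].
      - cbn [csum psum]. change (RtoC (INR 0)) with (RtoC 0). ring.
      - cbn [csum psum] in *. rewrite Cmult_plus_distr_l, IH.
        change (pred (S n)) with n.
        assert (R1 : a (S n) * INR (S n) = a n * (b + INR n)).
        { unfold a. cbn [bcoef]. rewrite S_INR, <- !RtoC_plus, <- !RtoC_mult. f_equal. field.
          generalize (pos_INR n). lra. }
        assert (R2 : v * (a n * (INR n * v ^ Init.Nat.pred n)) = a n * INR n * v ^ n).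
        { destruct n; [change (RtoC (INR 0)) with (RtoC 0); ring|].
          change (Init.Nat.pred (S n)) with n. rewrite Cpow_S. ring. }
        rewrite R2.
        replace (a (S n) * (INR (S n) * v ^ n)) with (a (S n) * INR (S n) * v ^ n) by ring.
        rewrite R1. ring. }
    assert (T2 : ctends (fun n => (1 - v) * csum (fun k => a k * (INR k * v ^ pred k)) (S n)) ((1 - v) * cps' a v)).
    { apply ctends_scal. intros e He. destruct (T e He) as [n0 Q]. exists n0. intros. apply Q. lia. }
    apply (ctends_unique _ _ _ T2).
    apply ctends_ext with (fun n => b * psum a v n - v * (a n * (INR n * v ^ pred n))).
    { intros n. now rewrite F. }
    replace (b * Bin b v) with (b * Bin b v - v * 0) by ring.
    apply ctends_sub; [apply ctends_scal; now apply cps_ctends|]. apply ctends_scal.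
    apply ctends_of_le with K y; auto. intros n.
    replace (a n * (INR n * v ^ pred n) - 0) with (a n * (INR n * v ^ pred n)) by ring. apply P. }
  rewrite <- E. field. now apply one_minus_neq0.
Qed.

Lemma disc_const (f : C -> C) (c : C) :
  (forall v, (Cmod v < 1)%R -> D1 f v 0) -> f 0 = c -> forall v, (Cmod v < 1)%R -> f v = c.
Proof.
  intros H E v Hv. rewrite <- E. apply (D1_zero_const f 0 1).
  - intros z Hz. apply H. now replace (z - 0) with z in Hz by ring.
  - now replace (v - 0) with v by ring.
  - replace (0 - 0) with (RtoC 0) by ring. rewrite Cmod_0. lra.
Qed.

Lemma Cpow_one (n : nat) : 1 ^ n = 1.
Proof. apply Cpow_1_l. Qed.

Lemma INR_pow_pred (x : C) (n : nat) : INR n * x ^ pred n * x = INR n * x ^ n.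
Proof.
  destruct n; [change (RtoC (INR 0)) with (RtoC 0); ring|].
  change (Init.Nat.pred (S n)) with n. rewrite Cpow_S. ring.
Qed.

(** Functional equations of the binomial series come from products with zero derivative on the disc,
    instead of convolution identities. The opposite exponent is there to make the product
    constant. *)
Lemma Bin_pow_opp (N b : nat) (v : C) : (1 <= N)%nat -> (b <= N)%nat -> (Cmod v < 1)%R ->
  Bin (1 / INR N) v ^ b * Bin (- (INR b / INR N)) v = 1.
Proof.
  intros HN Hb. assert (HNr : (1 <= INR N)%R) by (change 1%R with (INR 1); now apply le_INR).
  assert (Hbr : (0 <= INR b <= INR N)%R) by (split; [apply pos_INR|now apply le_INR]).
  assert (A1 : (Rabs (1 / INR N) <= 1)%R).
  { rewrite Rabs_pos_eq.
    - apply Rmult_le_reg_r with (INR N); [lra|]. field_simplify; lra.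
    - apply Rmult_le_pos; [lra|left; apply Rinv_0_lt_compat; lra]. }
  assert (A2 : (Rabs (- (INR b / INR N)) <= 1)%R).
  { rewrite Rabs_Ropp, Rabs_pos_eq.
    - apply Rmult_le_reg_r with (INR N); [lra|]. field_simplify; lra.
    - apply Rmult_le_pos; [lra|left; apply Rinv_0_lt_compat; lra]. }
  revert v. apply disc_const.
  - intros v Hv. eapply D1_eq.
    + apply D1_mul; [apply D1_pow|]; apply Bin_D1; auto.
    + cbv beta.
      replace (INR b * Bin (1 / INR N) v ^ Init.Nat.pred b * ((1 / INR N)%R * Bin (1 / INR N) v / (1 - v)))
        with ((INR b * Bin (1 / INR N) v ^ Init.Nat.pred b * Bin (1 / INR N) v) * ((1 / INR N)%R / (1 - v)))
        by (field; now apply one_minus_neq0).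
      rewrite INR_pow_pred, RtoC_opp, !RtoC_div by lra. field.
      split; [now apply RtoC_INR_neq0|now apply one_minus_neq0].
  - rewrite !Bin_0, Cpow_one by auto. ring.
Qed.

Lemma Bin_opp (N b : nat) (v : C) : (1 <= N)%nat -> (b <= N)%nat -> (Cmod v < 1)%R ->
  Bin (INR b / INR N) v * Bin (- (INR b / INR N)) v = 1.
Proof.
  intros HN Hb. assert (HNr : (1 <= INR N)%R) by (change 1%R with (INR 1); now apply le_INR).
  assert (Hbr : (0 <= INR b <= INR N)%R) by (split; [apply pos_INR|now apply le_INR]).
  assert (A1 : (Rabs (INR b / INR N) <= 1)%R).
  { rewrite Rabs_pos_eq.
    - apply Rmult_le_reg_r with (INR N); [lra|]. field_simplify; lra.
    - apply Rmult_le_pos; [lra|left; apply Rinv_0_lt_compat; lra]. }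
  assert (A2 : (Rabs (- (INR b / INR N)) <= 1)%R) by now rewrite Rabs_Ropp.
  revert v. apply disc_const.
  - intros v Hv. eapply D1_eq.
    + apply D1_mul; apply Bin_D1; auto.
    + cbv beta. rewrite RtoC_opp. field. now apply one_minus_neq0.
  - rewrite !Bin_0 by auto. ring.
Qed.

Lemma Bin_pow (N b : nat) (v : C) : (1 <= N)%nat -> (b <= N)%nat -> (Cmod v < 1)%R ->
  Bin (1 / INR N) v ^ b = Bin (INR b / INR N) v.
Proof.
  intros HN Hb Hv. assert (E1 := Bin_pow_opp N b v HN Hb Hv). assert (E2 := Bin_opp N b v HN Hb Hv).
  set (X := Bin (1 / INR N) v ^ b) in *. set (Y := Bin (INR b / INR N) v) in *.
  set (Z := Bin (- (INR b / INR N)) v) in *.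
  transitivity (X * (Y * Z)); [rewrite E2; ring|]. transitivity (Y * (X * Z)); [ring|rewrite E1; ring].
Qed.

Lemma Bin_one (v : C) : (Cmod v < 1)%R -> Bin 1 v * (1 - v) = 1.
Proof.
  assert (A : (Rabs 1 <= 1)%R) by (rewrite Rabs_R1; lra).
  revert v. apply disc_const.
  - intros v Hv. eapply D1_eq.
    + apply D1_mul; [now apply Bin_D1|apply D1_sub; [apply (D1_const 1)|apply D1_id]].
    + cbv beta. field. now apply one_minus_neq0.
  - rewrite Bin_0 by auto. ring.
Qed.

Lemma Bin_root (N : nat) (v : C) : (1 <= N)%nat -> (Cmod v < 1)%R ->
  Bin (1 / INR N) v ^ N * (1 - v) = 1.
Proof.
  intros HN Hv. rewrite (Bin_pow N N v) by auto.
  replace (INR N / INR N)%R with 1%R by (field; apply not_0_INR; lia). now apply Bin_one.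
Qed.

(* The branch of the N-th root near 1. *)
Definition rt (N : nat) (w : C) : C := / Bin (1 / INR N) (1 - w).

Lemma rt_base_neq0 (N : nat) (v : C) : (1 <= N)%nat -> (Cmod v < 1)%R -> Bin (1 / INR N) v <> 0.
Proof.
  intros HN Hv E. assert (H := Bin_root N v HN Hv). rewrite E in H.
  destruct N; [lia|]. rewrite Cpow_S in H.
  replace (0 * 0 ^ N * (1 - v)) with (RtoC 0) in H by ring. apply RtoC_inj in H. lra.
Qed.

Lemma rt_pow (N : nat) (w : C) : (1 <= N)%nat -> (Cmod (1 - w) < 1)%R -> rt N w ^ N = w.
Proof.
  intros HN Hw. unfold rt. rewrite Cpow_inv by (now apply rt_base_neq0).
  assert (H := Bin_root N (1 - w) HN Hw). replace (1 - (1 - w)) with w in H by ring.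
  assert (Bin (1 / INR N) (1 - w) ^ N <> 0) by (now apply Cpow_nz, rt_base_neq0).
  transitivity (/ Bin (1 / INR N) (1 - w) ^ N * (Bin (1 / INR N) (1 - w) ^ N * w)).
  - rewrite H. ring.
  - field. easy.
Qed.

Lemma rt_1 (N : nat) : (1 <= N)%nat -> rt N 1 = 1.
Proof.
  intros HN. assert (HNr : (1 <= INR N)%R) by (change 1%R with (INR 1); now apply le_INR).
  unfold rt. rewrite Csub_diag. rewrite Bin_0.
  2:{ rewrite Rabs_pos_eq.
      - apply Rmult_le_reg_r with (INR N); [lra|]. field_simplify; lra.
      - apply Rmult_le_pos; [lra|left; apply Rinv_0_lt_compat; lra]. }
  rewrite <- RtoC_inv by lra. f_equal. field.
Qed.

Lemma rt_D1 (N : nat) (w : C) : (1 <= N)%nat -> (Cmod (1 - w) < 1)%R ->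
  D1 (rt N) w (rt N w / (INR N * w)).
Proof.
  intros HN Hw. assert (HNr : (1 <= INR N)%R) by (change 1%R with (INR 1); now apply le_INR).
  assert (A : (Rabs (1 / INR N) <= 1)%R).
  { rewrite Rabs_pos_eq.
    - apply Rmult_le_reg_r with (INR N); [lra|]. field_simplify; lra.
    - apply Rmult_le_pos; [lra|left; apply Rinv_0_lt_compat; lra]. }
  assert (W0 : w <> 0).
  { intros E. rewrite E in Hw. replace (1 - 0) with (RtoC 1) in Hw by ring. rewrite Cmod_1 in Hw. lra. }
  unfold rt. eapply D1_eq.
  - apply (D1_comp Cinv (fun w => Bin (1 / INR N) (1 - w))).
    + apply D1_inv. now apply rt_base_neq0.
    + apply (D1_comp (Bin (1 / INR N)) (fun w => 1 - w)).
      * now apply Bin_D1.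
      * apply D1_sub; [apply (D1_const 1)|apply D1_id].
  - cbv beta. rewrite RtoC_div by lra. replace (1 - (1 - w)) with w by ring. field.
    split; [|split]; auto; [now apply rt_base_neq0|now apply RtoC_INR_neq0].
Qed.

(** * Local charts of the family of curves *)

(* A chart [(sw, inf)] uses as coordinate [z = x] (or [y] if [sw]), inverted if
   [inf]; the other coordinate [o] is then an N-th root of
   [(1 - z^N) / cden N inf l z]. *)
Definition cden (N : nat) (inf : bool) (l z : C) : C :=
  if inf then 1 - l - z ^ N else 1 - (1 - l) * z ^ N.

(** Division by [y0 ^ N] moves the radicand close to 1, where [rt] lives; the factor [y0] then
    selects the root. The last clause of [chartok] is the domain of [rt]. *)
Definition ybr (N : nat) (inf : bool) (y0 l z : C) : C :=
  y0 * rt N ((1 - z ^ N) / cden N inf l z / y0 ^ N).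

Definition chartok (N : nat) (inf : bool) (y0 l z : C) : Prop :=
  1 - z ^ N <> 0 /\ cden N inf l z <> 0 /\ y0 <> 0 /\
  (Cmod (1 - (1 - z ^ N) / cden N inf l z / y0 ^ N) < 1)%R.

Definition cden_l (N : nat) (inf : bool) (z : C) : C := if inf then - (1) else z ^ N.
Definition cden_z (N : nat) (inf : bool) (l z : C) : C :=
  (if inf then - (1) else - (1 - l)) * (INR N * z ^ pred N).

Lemma cden_D2 (N : nat) (inf : bool) (l z : C) :
  D2 (cden N inf) l z (cden_l N inf z) (cden_z N inf l z).
Proof.
  unfold cden, cden_l, cden_z. destruct inf; eapply D2_eq.
  - apply D2_sub; [apply D2_sub; [apply (D2_const 1)|apply D2_fst]|apply (D2_pow (fun _ z => z)), D2_snd].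
  - cring.
  - cring.
  - apply D2_sub; [apply (D2_const 1)|].
    apply D2_mul; [apply D2_sub; [apply (D2_const 1)|apply D2_fst]|apply (D2_pow (fun _ z => z)), D2_snd].
  - cring.
  - cring.
Qed.

Lemma one_sub_pow_D2 (N : nat) (l z : C) :
  D2 (fun _ z => 1 - z ^ N) l z 0 (- (INR N * z ^ pred N)).
Proof.
  eapply D2_eq.
  - apply D2_sub; [apply (D2_const 1)|apply (D2_pow (fun _ z => z)), D2_snd].
  - cring.
  - cring.
Qed.

(** This and [ybr_z] come from logarithmic differentiation of [o ^ N * cden = 1 - z ^ N]. *)
Definition ybr_l (N : nat) (inf : bool) (y0 l z : C) : C :=
  - (ybr N inf y0 l z * cden_l N inf z / (INR N * cden N inf l z)).
Definition ybr_z (N : nat) (inf : bool) (y0 l z : C) : C :=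
  ybr N inf y0 l z * (- (INR N * z ^ pred N) / (1 - z ^ N) - cden_z N inf l z / cden N inf l z) / INR N.

Lemma ybr_arg_neq0 (N : nat) (inf : bool) (y0 l z : C) : chartok N inf y0 l z ->
  (1 - z ^ N) / cden N inf l z / y0 ^ N <> 0.
Proof.
  intros [A [B [Y _]]] E.
  assert (H : 1 - z ^ N = ((1 - z ^ N) / cden N inf l z / y0 ^ N) * (cden N inf l z * y0 ^ N))
    by (field; split; auto using Cpow_nz).
  rewrite E in H. apply A. rewrite H. ring.
Qed.

Lemma ybr_D2 (N : nat) (inf : bool) (y0 l z : C) : (1 <= N)%nat -> chartok N inf y0 l z ->
  D2 (ybr N inf y0) l z (ybr_l N inf y0 l z) (ybr_z N inf y0 l z).
Proof.
  intros HN Hok. assert (W := ybr_arg_neq0 _ _ _ _ _ Hok). destruct Hok as [A [B [Y K]]].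
  assert (HNn := RtoC_INR_neq0 N ltac:(lia)). assert (YN := Cpow_nz y0 N Y).
  unfold ybr_l, ybr_z, ybr. eapply D2_eq.
  - apply D2_mul; [apply (D2_const y0)|].
    apply (D2_of_D1 (rt N) (fun l z => (1 - z ^ N) / cden N inf l z / y0 ^ N)).
    + now apply rt_D1.
    + apply D2_div; [exact YN| |apply (D2_const (y0 ^ N))].
      apply D2_div; [exact B|apply one_sub_pow_D2|apply cden_D2].
  - cbv beta. field. auto.
  - cbv beta. field. auto.
Qed.

Lemma ybr_pow (N : nat) (inf : bool) (y0 l z : C) : (1 <= N)%nat -> chartok N inf y0 l z ->
  ybr N inf y0 l z ^ N * cden N inf l z = 1 - z ^ N.
Proof.
  intros HN [A [B [Y K]]]. unfold ybr. rewrite Cpow_mult_l, rt_pow by auto.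
  field. split; auto using Cpow_nz.
Qed.

Lemma ybr_neq0 (N : nat) (inf : bool) (y0 l z : C) : (1 <= N)%nat -> chartok N inf y0 l z ->
  ybr N inf y0 l z <> 0.
Proof.
  intros HN Hok E. assert (H := ybr_pow _ _ _ _ _ HN Hok). destruct Hok as [A _].
  rewrite E in H. destruct N; [lia|]. rewrite Cpow_S in H. apply A. rewrite <- H. ring.
Qed.

Definition on_chart (N : nat) (inf : bool) (l z o : C) : Prop :=
  o ^ N * cden N inf l z = 1 - z ^ N.

Lemma on_chart_den_neq0 (N : nat) (inf : bool) (l z o : C) : 1 - z ^ N <> 0 ->
  on_chart N inf l z o -> cden N inf l z <> 0.
Proof. intros A H E. apply A. rewrite <- H, E. ring. Qed.

Lemma ybr_center (N : nat) (inf : bool) (l z o : C) : (1 <= N)%nat ->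
  1 - z ^ N <> 0 -> o <> 0 -> on_chart N inf l z o ->
  ybr N inf o l z = o /\ chartok N inf o l z.
Proof.
  intros HN A O H. assert (B := on_chart_den_neq0 _ _ _ _ _ A H).
  assert (W : (1 - z ^ N) / cden N inf l z / o ^ N = 1).
  { unfold on_chart in H. rewrite <- H. field. split; auto using Cpow_nz. }
  split.
  - unfold ybr. rewrite W, rt_1 by auto. ring.
  - repeat split; auto. rewrite W, Cmod_diag. lra.
Qed.

Lemma neq0_near (f : C -> C -> C) (l z a b : C) : D2 f l z a b -> f l z <> 0 ->
  exists d, (0 < d)%R /\ forall l' z', (Cmod (l' - l) < d)%R -> (Cmod (z' - z) < d)%R -> f l' z' <> 0.
Proof.
  intros H Hn. apply Cmod_gt_0 in Hn. destruct (D2_cont _ _ _ _ _ H _ Hn) as [d [Hd P]].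
  exists d. split; auto. intros l' z' A B E. specialize (P l' z' A B). rewrite E in P.
  replace (0 - f l z) with (- f l z) in P by ring. rewrite Cmod_opp in P. lra.
Qed.

Lemma chartok_near (N : nat) (inf : bool) (y0 l z : C) : (1 <= N)%nat -> chartok N inf y0 l z ->
  exists d, (0 < d)%R /\ forall l' z', (Cmod (l' - l) < d)%R -> (Cmod (z' - z) < d)%R ->
    chartok N inf y0 l' z'.
Proof.
  intros HN [A [B [Y K]]]. assert (YN := Cpow_nz y0 N Y).
  destruct (neq0_near _ _ _ _ _ (one_sub_pow_D2 N l z) A) as [d1 [H1 P1]].
  destruct (neq0_near _ _ _ _ _ (cden_D2 N inf l z) B) as [d2 [H2 P2]].
  assert (D : exists a b, D2 (fun l z => (1 - z ^ N) / cden N inf l z / y0 ^ N) l z a b).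
  { do 2 eexists. apply D2_div; [exact YN| |apply (D2_const (y0 ^ N))].
    apply D2_div; [exact B|apply one_sub_pow_D2|apply cden_D2]. }
  destruct D as [a [b D]].
  set (e := (1 - Cmod (1 - (1 - z ^ N) / cden N inf l z / y0 ^ N))%R).
  destruct (D2_cont _ _ _ _ _ D e) as [d3 [H3 P3]]; [unfold e; lra|].
  exists (Rmin d1 (Rmin d2 d3)). split; [repeat apply Rmin_pos; auto|].
  assert (m1 := Rmin_l d1 (Rmin d2 d3)). assert (m2 := Rmin_r d1 (Rmin d2 d3)).
  assert (m3 := Rmin_l d2 d3). assert (m4 := Rmin_r d2 d3).
  intros l' z' Hl Hz. repeat split; auto.
  - apply (P1 l'); lra.
  - apply P2; lra.
  - specialize (P3 l' z' ltac:(lra) ltac:(lra)).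
    set (u := (1 - z' ^ N) / cden N inf l' z' / y0 ^ N) in *.
    set (v := (1 - z ^ N) / cden N inf l z / y0 ^ N) in *.
    generalize (Cmod_tri_sub 1 v u). rewrite (Cmod_minus_sym v u). unfold e in P3. lra.
Qed.

(** Coefficient of [dz] for [omega] in a chart, up to sign; the exponents [m] and [k] depend on the
    chart. In each chart [m >= 1], so that [z = 0] is not a pole. *)
Definition Hf (N m k : nat) (inf : bool) (y0 l z : C) : C :=
  INR N * z ^ (m - 1) * ybr N inf y0 l z ^ k / (1 - z ^ N).

(** The derivative of [Hf] in [l] at fixed [z]. In the chart with coordinate [x] it is the
    coefficient of [nu]. *)
Definition Hf1 (N m k : nat) (inf : bool) (y0 l z : C) : C :=
  - (INR k * cden_l N inf z * z ^ (m - 1) * ybr N inf y0 l z ^ k / (cden N inf l z * (1 - z ^ N))).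

Lemma Hf_D2 (N m k : nat) (inf : bool) (y0 : C) : (1 <= N)%nat ->
  exists H2 : C -> C -> C, forall l z, chartok N inf y0 l z ->
    D2 (Hf N m k inf y0) l z (Hf1 N m k inf y0 l z) (H2 l z).
Proof.
  intros HN. assert (HNn := RtoC_INR_neq0 N ltac:(lia)).
  eexists. intros l z Hok. assert (A := proj1 Hok). assert (B := proj1 (proj2 Hok)).
  unfold Hf. eapply D2_eq.
  - apply D2_div; [exact A| |apply one_sub_pow_D2].
    apply D2_mul; [apply D2_mul; [apply (D2_const (INR N))|apply (D2_pow (fun _ z => z)), D2_snd]|].
    apply D2_pow. now apply ybr_D2.
  - cbv beta. unfold Hf1, ybr_l.
    transitivity (- (cden_l N inf z * z ^ (m - 1) * (INR k * ybr N inf y0 l z ^ pred k * ybr N inf y0 l z)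
       / (cden N inf l z * (1 - z ^ N)))).
    + field. auto.
    + rewrite INR_pow_pred. field. auto.
  - reflexivity.
Qed.

Lemma Hf1_D2 (N m k : nat) (y0 : C) : (1 <= N)%nat ->
  exists H1 H2 : C -> C -> C, forall l z, chartok N false y0 l z ->
    D2 (Hf1 N m k false y0) l z (H1 l z) (H2 l z).
Proof.
  intros HN. eexists. eexists. intros l z Hok.
  assert (A := proj1 Hok). assert (B := proj1 (proj2 Hok)).
  unfold Hf1. apply D2_opp. apply D2_div.
  - now apply Cmult_neq_0.
  - apply D2_mul; [|apply D2_pow; now apply ybr_D2].
    apply D2_mul; [|apply (D2_pow (fun _ z => z)), D2_snd].
    apply D2_mul; [apply (D2_const (INR k))|].
    unfold cden_l. apply (D2_pow (fun _ z => z)), D2_snd.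
  - apply D2_mul; [apply cden_D2|apply one_sub_pow_D2].
Qed.

(** One radius for everything done in a chart: the branch exists, the primitive is differentiable,
    and the curve has no other sheet near the centre. The last point is the local uniqueness of
    roots. *)
Lemma chart_disc (N m k : nat) (inf : bool) (l0 z0 o0 : C) : (1 <= N)%nat ->
  1 - z0 ^ N <> 0 -> o0 <> 0 -> on_chart N inf l0 z0 o0 ->
  exists r, (0 < r)%R /\
    (forall l z, (Cmod (l - l0) < r)%R -> (Cmod (z - z0) < r)%R ->
      chartok N inf o0 l z /\
      D2 (prim (Hf N m k inf o0) z0) l z (prim (Hf1 N m k inf o0) z0 l z) (Hf N m k inf o0 l z)) /\
    forall l z o, (Cmod (l - l0) < r)%R -> (Cmod (z - z0) < r)%R -> (Cmod (o - o0) < r)%R ->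
      on_chart N inf l z o -> ybr N inf o0 l z = o.
Proof.
  intros HN A O H. destruct (ybr_center N inf l0 z0 o0 HN A O H) as [E Hok].
  destruct (chartok_near _ _ _ _ _ HN Hok) as [d1 [Hd1 P1]].
  destruct (root_locally_unique N o0 HN O) as [d2 [Hd2 P2]].
  destruct (D2_cont _ _ _ _ _ (ybr_D2 _ _ _ _ _ HN Hok) d2 Hd2) as [d3 [Hd3 P3]].
  set (r := Rmin d1 (Rmin d2 d3)).
  assert (m1 := Rmin_l d1 (Rmin d2 d3)). assert (m2 := Rmin_r d1 (Rmin d2 d3)).
  assert (m3 := Rmin_l d2 d3). assert (m4 := Rmin_r d2 d3). fold r in m1, m2.
  exists r. split; [unfold r; repeat apply Rmin_pos; auto|]. split.
  - destruct (Hf_D2 N m k inf o0 HN) as [H2 D]. intros l z Hl Hz. split; [apply P1; lra|].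
    apply (prim_D2 _ _ H2 l0 z0 r); auto. intros l' z' Hl' Hz'. apply D, P1; lra.
  - intros l z o Hl Hz Ho Hc. apply P2; [rewrite <- E at 2; apply P3; lra|lra|].
    assert (Hokl : chartok N inf o0 l z) by (apply P1; lra).
    assert (Q := ybr_pow _ _ _ _ _ HN Hokl). rewrite <- Hc in Q.
    set (u := ybr N inf o0 l z ^ N) in *. set (v := o ^ N) in *.
    assert (B := proj1 (proj2 Hokl)).
    transitivity (u * cden N inf l z / cden N inf l z); [field; auto|].
    rewrite Q. field. auto.
Qed.

Lemma prim_Hf1_D1 (N m k : nat) (l0 z0 o0 : C) : (1 <= N)%nat ->
  1 - z0 ^ N <> 0 -> o0 <> 0 -> on_chart N false l0 z0 o0 ->
  exists r, (0 < r)%R /\ forall z, (Cmod (z - z0) < r)%R ->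
    D1 (fun z => prim (Hf1 N m k false o0) z0 l0 z) z (Hf1 N m k false o0 l0 z).
Proof.
  intros HN A O H. destruct (ybr_center N false l0 z0 o0 HN A O H) as [E Hok].
  destruct (chartok_near _ _ _ _ _ HN Hok) as [d [Hd P]].
  destruct (Hf1_D2 N m k o0 HN) as [H1 [H2 D]].
  exists d. split; auto. intros z Hz.
  eapply D2_slice2. apply (prim_D2 _ H1 H2 l0 z0 d); auto. rewrite Cmod_diag. lra.
Qed.

(** * Points of the curve in the product of projective lines: coordinates, neighbourhoods, preferred
    charts *)

Definition mk (sw inf : bool) (z o : C) : point :=
  let P := if inf then (if Ceq_dec z 0 then Inf else Fin (/ z)) else Fin z in
  if sw then (Fin o, P) else (P, Fin o).

(** At infinity the value 0 is a default for [cfin], whereas for [cinv1] it is the true value of the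
    inverted coordinate. *)
Definition cfin (P : P1) : C := match P with Fin x => x | Inf => 0 end.
Definition cinv1 (P : P1) : C := match P with Fin x => / x | Inf => 0 end.

Definition zc (sw inf : bool) (p : point) : C :=
  let P := if sw then snd p else fst p in if inf then cinv1 P else cfin P.
Definition oc (sw : bool) (p : point) : C := cfin (if sw then fst p else snd p).

Lemma Cinv_invol (z : C) : z <> 0 -> / / z = z.
Proof.
  intros H. now field.
Qed.

Lemma Cinv_neq0 (z : C) : z <> 0 -> / z <> 0.
Proof.
  intros H E. assert (A : z * / z = 1) by (field; auto). rewrite E in A.
  replace (z * 0) with (RtoC 0) in A by ring. apply RtoC_inj in A. lra.
Qed.

Lemma zc_mk (sw inf : bool) (z o : C) : zc sw inf (mk sw inf z o) = z.
Proof.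
  unfold zc, mk. destruct inf; [destruct (Ceq_dec z 0) as [->|n]|]; destruct sw; simpl; auto using Cinv_invol.
Qed.

Lemma oc_mk (sw inf : bool) (z o : C) : oc sw (mk sw inf z o) = o.
Proof. unfold oc, mk. destruct sw; reflexivity. Qed.

Lemma on_curve_mk (N : nat) (l z o : C) (sw inf : bool) : (1 <= N)%nat ->
  on_curve N l (mk sw inf z o) <-> on_chart N inf l z o.
Proof.
  intros HN. unfold on_chart, mk, on_curve, cden.
  assert (Z0 : 0 ^ N = 0) by (destruct N; [lia|rewrite Cpow_S; ring]).
  (* The bihomogeneous equation and the chart equation differ by a nonzero factor: a sign, or the
     inverse of [z ^ N]. *)
  assert (T : forall A B A' B' u : C, u <> 0 -> A - B = u * (A' - B') -> (A = B <-> A' = B')).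
  { intros A B A' B' u Hu E. split; intros F.
    - apply Ceq_sub. rewrite F, Csub_diag in E. apply NNPP. intros N'.
      apply (Cmult_neq_0 u (A' - B') Hu N'). now rewrite <- E.
    - apply Ceq_sub. rewrite E, F, Csub_diag. ring. }
  assert (M1 : - (1) <> 0) by (apply Cmod_gt_0; rewrite Cmod_m1; lra).
  destruct inf.
  - destruct (Ceq_dec z 0) as [->|Hz].
    + destruct sw; simpl; rewrite Z0, !Cpow_one; apply (T _ _ _ _ 1);
        try (apply RtoC_neq; lra); ring.
    + assert (HzN := Cpow_nz z N Hz).
      destruct sw; simpl; rewrite !Cpow_one, Cpow_inv by auto;
        apply (T _ _ _ _ (/ z ^ N)); try (now apply Cinv_neq0); field; auto.
  - destruct sw; simpl; rewrite !Cpow_one; apply (T _ _ _ _ (- (1))); auto; ring.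
Qed.

(** A base of neighbourhoods rather than a metric: it is not symmetric, since a finite point may be
    close to infinity but infinity is never close to a finite point. *)
Definition pb (r : R) (P P' : P1) : Prop :=
  match P, P' with
  | Fin z, Fin w => (Cmod (w - z) < r)%R
  | Fin _, Inf => False
  | Inf, Inf => True
  | Inf, Fin w => (/ r < Cmod w)%R
  end.

Definition qball (r : R) (q q' : C * point) : Prop :=
  (Cmod (fst q' - fst q) < r)%R /\ pb r (fst (snd q)) (fst (snd q')) /\ pb r (snd (snd q)) (snd (snd q')).

Definition onE (N : nat) (q : C * point) : Prop :=
  on_curve N (fst q) (snd q) /\ fst q <> 0 /\ fst q <> 1.

Lemma pb_mono (r r' : R) (P P' : P1) : (0 < r' <= r)%R -> pb r' P P' -> pb r P P'.
Proof.
  intros Hr. destruct P, P'; simpl; auto; try lra.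
  assert (/ r <= / r')%R by (apply Rinv_le_contravar; lra). lra.
Qed.

Lemma pb_open (r : R) (P P' : P1) : (0 < r)%R -> pb r P P' ->
  exists r', (0 < r')%R /\ forall P'', pb r' P' P'' -> pb r P P''.
Proof.
  intros Hr. destruct P as [z|], P' as [w|]; simpl; intros H; try easy.
  - exists (r - Cmod (w - z))%R. split; [lra|]. intros [v|]; simpl; auto.
    intros Hv. generalize (Cmod_tri_sub v w z). lra.
  - exists (Cmod w - / r)%R. split; [lra|]. intros [v|]; simpl; auto.
    intros Hv. generalize (Cmod_ge_sub w (w - v)). replace (w - (w - v)) with v by ring.
    rewrite (Cmod_minus_sym w v). lra.
  - exists r. split; auto.
Qed.

Lemma qball_open (r : R) (q q1 : C * point) : (0 < r)%R -> qball r q q1 ->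
  exists r', (0 < r')%R /\ forall q2, qball r' q1 q2 -> qball r q q2.
Proof.
  intros Hr [A [B D]]. destruct (pb_open _ _ _ Hr B) as [r1 [H1 P1]].
  destruct (pb_open _ _ _ Hr D) as [r2 [H2 P2]].
  set (r3 := (r - Cmod (fst q1 - fst q))%R).
  assert (H3 : (0 < r3)%R) by (unfold r3; lra).
  exists (Rmin r3 (Rmin r1 r2)). split; [repeat apply Rmin_pos; auto|].
  assert (m1 := Rmin_l r3 (Rmin r1 r2)). assert (m2 := Rmin_r r3 (Rmin r1 r2)).
  assert (m3 := Rmin_l r1 r2). assert (m4 := Rmin_r r1 r2).
  assert (m5 : (0 < Rmin r3 (Rmin r1 r2))%R) by (repeat apply Rmin_pos; auto).
  intros q2 [A' [B' D']]. split; [|split].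
  - generalize (Cmod_tri_sub (fst q2) (fst q1) (fst q)). unfold r3 in *. lra.
  - apply P1. eapply pb_mono; [|exact B']. lra.
  - apply P2. eapply pb_mono; [|exact D']. lra.
Qed.

Lemma inv_large_iff (r : R) (w : C) : (0 < r)%R ->
  (/ r < Cmod w)%R <-> (w <> 0 /\ (Cmod (/ w) < r)%R).
Proof.
  intros Hr. assert (Ir : (0 < / r)%R) by now apply Rinv_0_lt_compat. split.
  - intros H. assert (W : w <> 0) by (apply Cmod_gt_0; lra). split; auto.
    rewrite Cmod_inv by auto. rewrite <- (Rinv_inv r). apply Rinv_lt_contravar; auto.
    apply Rmult_lt_0_compat; lra.
  - intros [W H]. assert (0 < Cmod w)%R by now apply Cmod_gt_0. rewrite Cmod_inv in H by auto.
    rewrite <- (Rinv_inv (Cmod w)). apply Rinv_lt_contravar; auto.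
    apply Rmult_lt_0_compat; auto. now apply Rinv_0_lt_compat.
Qed.

Lemma pb_Fin_iff (r : R) (o : C) (P : P1) :
  pb r (Fin o) P <-> P = Fin (cfin P) /\ (Cmod (cfin P - o) < r)%R.
Proof. destruct P; simpl; [tauto|]. split; [easy|]. now intros [H _]. Qed.

Definition zpt (inf : bool) (z : C) : P1 :=
  if inf then (if Ceq_dec z 0 then Inf else Fin (/ z)) else Fin z.
Definition zco (inf : bool) (P : P1) : C := if inf then cinv1 P else cfin P.

Lemma pb_zpt_iff (inf : bool) (r : R) (z0 : C) (P : P1) : (0 < r)%R -> (inf = true -> z0 = 0) ->
  pb r (zpt inf z0) P <-> P = zpt inf (zco inf P) /\ (Cmod (zco inf P - z0) < r)%R.
Proof.
  intros Hr Hz. destruct inf; [|apply pb_Fin_iff].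
  rewrite (Hz eq_refl). unfold zpt, zco. destruct (Ceq_dec 0 0) as [_|n]; [|easy].
  destruct P as [w|]; cbn [pb cinv1].
  - rewrite inv_large_iff by auto. replace (/ w - 0) with (/ w) by ring. split.
    + intros [W H]. split; auto. destruct (Ceq_dec (/ w) 0) as [e|_].
      * now apply Cinv_neq0 in W.
      * now rewrite Cinv_invol.
    + intros [E H]. split; auto. destruct (Ceq_dec (/ w) 0) as [e|n]; [easy|].
      intros W. injection E as E. rewrite W in n, E.
      assert (A : / 0 = 0) by (unfold Cinv; simpl; unfold RtoC; f_equal; unfold Rdiv; ring).
      easy.
  - replace (0 - 0) with (RtoC 0) by ring. rewrite Cmod_0.
    destruct (Ceq_dec 0 0) as [_|n]; [|easy]. split; auto.
Qed.

Lemma near_chart (sw inf : bool) (r : R) (z0 o0 : C) (p : point) : (0 < r)%R ->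
  (inf = true -> z0 = 0) ->
  (pb r (fst (mk sw inf z0 o0)) (fst p) /\ pb r (snd (mk sw inf z0 o0)) (snd p)) <->
  (p = mk sw inf (zc sw inf p) (oc sw p) /\
   (Cmod (zc sw inf p - z0) < r)%R /\ (Cmod (oc sw p - o0) < r)%R).
Proof.
  intros Hr Hz. destruct p as [P P'].
  change (mk sw inf z0 o0) with (if sw then (Fin o0, zpt inf z0) else (zpt inf z0, Fin o0)).
  change (mk sw inf (zc sw inf (P, P')) (oc sw (P, P')))
    with (let z := zc sw inf (P, P') in let o := oc sw (P, P') in
          if sw then (Fin o, zpt inf z) else (zpt inf z, Fin o)).
  change (zc sw inf (P, P')) with (zco inf (if sw then P' else P)).
  change (oc sw (P, P')) with (cfin (if sw then P else P')).
  destruct sw; cbn [fst snd]; cbv zeta; rewrite pb_Fin_iff, (pb_zpt_iff inf r z0) by auto.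
  - split.
    + intros [[A B] [D E]]. repeat split; auto. congruence.
    + intros [A [B D]]. injection A as A1 A2. repeat split; congruence.
  - split.
    + intros [[A B] [D E]]. repeat split; auto. congruence.
    + intros [A [B D]]. injection A as A1 A2. repeat split; congruence.
Qed.

(* Every point of the curve is used with one preferred chart: [x] where
   [y <> 0, oo], inverted at [x = oo], and [y] or [1/y] otherwise. *)
Definition kind_sw (p : point) : bool :=
  match p with
  | (Fin _, Fin y) => if Ceq_dec y 0 then true else false
  | (Fin _, Inf) => true
  | _ => false
  end.
Definition kind_inf (p : point) : bool :=
  match p with (Inf, _) => true | (_, Inf) => true | _ => false end.

Definition pz (p : point) : C := zc (kind_sw p) (kind_inf p) p.
Definition po (p : point) : C := oc (kind_sw p) p.

(** The two excluded parameters are exactly what makes the preferred chart regular. The point at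
    infinity in both factors would force [l = 1]; and [1 - x ^ N = 0] with [y] finite and nonzero
    would force [l = 0]. *)
Lemma kind_spec (N : nat) (l : C) (p : point) : (1 <= N)%nat -> onE N (l, p) ->
  p = mk (kind_sw p) (kind_inf p) (pz p) (po p) /\ po p <> 0 /\ 1 - pz p ^ N <> 0 /\
  on_chart N (kind_inf p) l (pz p) (po p) /\
  (kind_inf p = true -> pz p = 0) /\ (kind_sw p = true -> pz p = 0).
Proof.
  intros HN [H [L0 L1]]. cbn [fst snd] in *.
  assert (Z0 : 0 ^ N = 0) by (destruct N; [lia|rewrite Cpow_S; ring]).
  assert (N1 : RtoC 1 <> 0) by (apply RtoC_neq; lra).
  assert (E : p = mk (kind_sw p) (kind_inf p) (pz p) (po p)).
  { unfold pz, po, mk, zc, oc. destruct p as [[x|] [y|]]; simpl; auto;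
      try (destruct (Ceq_dec y 0); simpl; auto; fail);
      try (destruct (Ceq_dec 0 0); simpl; easy).
    exfalso. unfold on_curve in H. simpl in H. rewrite Z0, Cpow_one in H. apply L1.
    transitivity ((0 - 1) * (0 - 1)); [|ring]. rewrite H. ring. }
  split; auto. assert (K := H). rewrite E in K. apply on_curve_mk in K; auto.
  assert (Zc : kind_sw p = true \/ kind_inf p = true -> pz p = 0).
  { unfold pz. destruct p as [[x|] [y|]]; simpl; unfold zc; simpl;
      try (destruct (Ceq_dec y 0) as [e|n]; simpl); auto; intros [A|A]; easy. }
  destruct (bool_dec (kind_sw p || kind_inf p)%bool true) as [b|b].
  - assert (Z : pz p = 0) by (apply Zc, orb_prop; exact b).
    assert (M : 1 - pz p ^ N <> 0) by (rewrite Z, Z0; replace (1 - 0) with (RtoC 1) by ring; auto).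
    repeat split; auto. intros O. unfold on_chart in K. rewrite O, Z0 in K. apply M. rewrite <- K. ring.
  - apply not_true_is_false in b. apply orb_false_elim in b. destruct b as [b1 b2].
    assert (O : po p <> 0).
    { revert b1. unfold po, oc. destruct p as [[x|] [y|]]; simpl; try easy.
      destruct (Ceq_dec y 0); easy. }
    repeat split; auto. intros M. unfold on_chart, cden in K. rewrite b2 in *.
    assert (P1 : pz p ^ N = 1) by (symmetry; now apply Ceq_sub).
    rewrite P1 in K. replace (1 - (1 - l) * 1) with l in K by ring. rewrite Csub_diag in K.
    apply (Cmult_neq_0 (po p ^ N) l); auto using Cpow_nz.
Qed.

(* In the chart [(sw, inf)] the form [omega] is
   [csgn sw * N z^(cm - 1) o^ck / (1 - z^N) dz]. *)
Definition cm (N a b : nat) (sw inf : bool) : nat :=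
  let a' := if sw then b else a in if inf then (N - a')%nat else a'.
Definition ck (a b : nat) (sw : bool) : nat := if sw then a else b.
Definition csgn (sw : bool) : C := if sw then - (1) else 1.

Definition CI (N a b : nat) (sw inf : bool) (z0 o0 l z : C) : C :=
  csgn sw * prim (Hf N (cm N a b sw inf) (ck a b sw) inf o0) z0 l z.
Definition Hs (N a b : nat) (sw inf : bool) (o0 l z : C) : C :=
  csgn sw * Hf N (cm N a b sw inf) (ck a b sw) inf o0 l z.
Definition CI1 (N a b : nat) (sw inf : bool) (z0 o0 l z : C) : C :=
  csgn sw * prim (Hf1 N (cm N a b sw inf) (ck a b sw) inf o0) z0 l z.

(* The primitive of [omega] centred at [q0]. *)
Definition Psi (N a b : nat) (q0 : C * point) (l : C) (p : point) : C :=
  let p0 := snd q0 in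
  CI N a b (kind_sw p0) (kind_inf p0) (pz p0) (po p0) l (zc (kind_sw p0) (kind_inf p0) p).

(* The point over [l] with the same preferred coordinate as [q1]. *)
Definition pt (N : nat) (q1 : C * point) (l : C) : point :=
  let p1 := snd q1 in
  mk (kind_sw p1) (kind_inf p1) (pz p1) (ybr N (kind_inf p1) (po p1) l (pz p1)).

(** Germ in [l] of the integral of [omega] between the moving points through [q0] and [q1], each
    keeping its own preferred coordinate. It is computed in the chart of [q0], hence meaningful only
    for nearby points. *)
Definition GG (N a b : nat) (q0 q1 : C * point) (l : C) : C := Psi N a b q0 l (pt N q1 l).

Lemma qball_chart (N : nat) (q0 q : C * point) (r : R) : (1 <= N)%nat -> onE N q0 -> (0 < r)%R ->
  let sw := kind_sw (snd q0) in let inf := kind_inf (snd q0) in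
  qball r q0 q <->
  (Cmod (fst q - fst q0) < r)%R /\ snd q = mk sw inf (zc sw inf (snd q)) (oc sw (snd q)) /\
  (Cmod (zc sw inf (snd q) - pz (snd q0)) < r)%R /\ (Cmod (oc sw (snd q) - po (snd q0)) < r)%R.
Proof.
  intros HN H Hr sw inf. destruct q0 as [l0 p0]. destruct (kind_spec N l0 p0 HN H) as [E [_ [_ [_ [Z _]]]]].
  unfold qball. cbn [fst snd] in *. rewrite E at 1 2. rewrite near_chart by auto. tauto.
Qed.

Lemma pt_near (N : nat) (q : C * point) (r : R) : (1 <= N)%nat -> onE N q -> (0 < r)%R ->
  exists r', (0 < r')%R /\ forall l, (Cmod (l - fst q) < r')%R ->
    qball r q (l, pt N q l) /\ onE N (l, pt N q l).
Proof.
  intros HN H Hr. destruct q as [l0 p0]. assert (H' := H). destruct H' as [_ [L0 L1]]. cbn [fst snd] in *.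
  destruct (kind_spec N l0 p0 HN H) as [E [O [A [K _]]]].
  destruct (ybr_center N _ l0 _ _ HN A O K) as [Ec Hok].
  destruct (chartok_near _ _ _ _ _ HN Hok) as [d1 [Hd1 P1]].
  destruct (D2_cont _ _ _ _ _ (ybr_D2 _ _ _ _ _ HN Hok) r Hr) as [d2 [Hd2 P2]].
  assert (c0 : (0 < Cmod l0)%R) by now apply Cmod_gt_0.
  assert (c1 : (0 < Cmod (l0 - 1))%R) by (apply Cmod_gt_0; now apply Csub_neq0).
  set (s := Rmin (Rmin d1 d2) (Rmin r (Rmin (Cmod l0) (Cmod (l0 - 1))))).
  assert (Hs : (0 < s)%R) by (unfold s; repeat apply Rmin_pos; auto).
  assert (Hs' : (s <= d1 /\ s <= d2 /\ s <= r /\ s <= Cmod l0 /\ s <= Cmod (l0 - 1))%R).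
  { unfold s. repeat split; unfold Rmin; repeat destruct Rle_dec; lra. }
  exists s. split; auto. intros l Hl.
  assert (Zd : (Cmod (pz p0 - pz p0) < s)%R) by (rewrite Cmod_diag; lra).
  split.
  - apply (qball_chart N (l0, p0)); auto. cbn [fst snd]. unfold pt. cbn [snd].
    rewrite zc_mk, oc_mk, Cmod_diag. repeat split; auto; try lra.
    rewrite <- Ec at 2. apply P2; lra.
  - split; [|split]; cbn [fst snd].
    + unfold pt. cbn [snd]. apply on_curve_mk; auto. apply ybr_pow; auto. apply P1; lra.
    + intros E0. rewrite E0 in Hl. replace (0 - l0) with (- l0) in Hl by ring. rewrite Cmod_opp in Hl. lra.
    + intros E1. rewrite E1, Cmod_minus_sym in Hl. lra.
Qed.

Lemma pt_self (N : nat) (q : C * point) : (1 <= N)%nat -> onE N q -> pt N q (fst q) = snd q.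
Proof.
  intros HN H. destruct q as [l0 p0]. destruct (kind_spec N l0 p0 HN H) as [E [O [A [K _]]]].
  unfold pt. cbn [fst snd]. destruct (ybr_center N _ l0 _ _ HN A O K) as [Ec _]. now rewrite Ec.
Qed.

Lemma GG_self (N a b : nat) (q : C * point) (l : C) : GG N a b q q l = 0.
Proof. unfold GG, Psi, pt. rewrite zc_mk. unfold CI. rewrite prim_center. ring. Qed.

(** Reduces the chart changes to few cases: a nearby point has the same kind of chart, or it is
    affine with nonzero coordinates and so uses [x]. The bound on [r] keeps the dependent coordinate
    away from 0. *)
Lemma kinds_near (N : nat) (q0 q1 : C * point) (r : R) : (1 <= N)%nat -> onE N q0 -> onE N q1 ->
  (0 < r <= Cmod (po (snd q0)))%R -> qball r q0 q1 ->
  (kind_sw (snd q1) = kind_sw (snd q0) /\ kind_inf (snd q1) = kind_inf (snd q0)) \/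
  (exists x y : C, snd q1 = (Fin x, Fin y) /\ x <> 0 /\ y <> 0).
Proof.
  intros HN H0 H1 Hr Hq. destruct q0 as [l0 p0], q1 as [l1 p1]. cbn [fst snd] in *.
  destruct Hq as [_ [A B]]. cbn [fst snd] in *.
  assert (Ir : (0 < / r)%R) by (apply Rinv_0_lt_compat; lra).
  assert (far : forall u v : C, (Cmod (v - u) < Cmod u)%R -> v <> 0).
  { intros u v h E. subst v. rewrite Cmod_minus_sym in h. replace (u - 0) with u in h by ring. lra. }
  assert (big : forall v : C, (/ r < Cmod v)%R -> v <> 0) by (intros v h; apply Cmod_gt_0; lra).
  destruct p0 as [[x0|] [y0|]], p1 as [[x1|] [y1|]]; cbn [fst snd pb] in A, B; try easy;
    unfold po, oc, kind_sw, kind_inf in *; cbn [fst snd cfin] in *.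
  - destruct (Ceq_dec y0 0) as [e|n]; cbn [cfin fst snd] in Hr.
    + destruct (Ceq_dec y1 0) as [e1|n1]; [left; auto|].
      right. exists x1, y1. repeat split; auto. apply (far x0). lra.
    + left. destruct (Ceq_dec y1 0) as [e1|n1]; auto. exfalso.
      apply (far y0 y1); auto. lra.
  - right. exists x1, y1. repeat split; auto. apply (far x0). lra.
  - left. auto.
  - right. exists x1, y1. repeat split; auto. apply (far y0). lra.
  - left. auto.
  - exfalso. destruct (kind_spec N l0 (Inf, Inf) HN H0) as [E _]. discriminate E.
  - exfalso. destruct (kind_spec N l0 (Inf, Inf) HN H0) as [E _]. discriminate E.
  - exfalso. destruct (kind_spec N l0 (Inf, Inf) HN H0) as [E _]. discriminate E.
  - left. auto.
Qed.

(** * Transition maps between charts *)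

Definition chT (N : nat) (sw0 inf0 sw1 inf1 : bool) (o1 l z : C) : C :=
  zc sw0 inf0 (mk sw1 inf1 z (ybr N inf1 o1 l z)).
Definition chO (N : nat) (sw0 inf0 sw1 inf1 : bool) (o1 l z : C) : C :=
  oc sw0 (mk sw1 inf1 z (ybr N inf1 o1 l z)).

(** The final equation expresses that the two chart coefficients belong to one and the same form,
    [Tz] being the derivative of the transition map along the fibre. *)
Definition chart_change (N a b : nat) (sw0 inf0 : bool) (l0 z0 o0 : C) (r0 : R)
    (sw1 inf1 : bool) (l1 z1 o1 : C) : Prop :=
  exists (r1 : R) (Tl Tz : C -> C -> C), (0 < r1)%R /\
    forall l z, (Cmod (l - l1) < r1)%R -> (Cmod (z - z1) < r1)%R ->
      let T := chT N sw0 inf0 sw1 inf1 o1 in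
      (Cmod (l - l0) < r0)%R /\ (Cmod (T l z - z0) < r0)%R /\
      D2 T l z (Tl l z) (Tz l z) /\
      Hs N a b sw0 inf0 o0 l (T l z) * Tz l z = Hs N a b sw1 inf1 o1 l z.

Lemma Cmod_open (f : C -> C -> C) (l z a b c : C) (r : R) : D2 f l z a b -> (Cmod (f l z - c) < r)%R ->
  exists d, (0 < d)%R /\ forall l' z', (Cmod (l' - l) < d)%R -> (Cmod (z' - z) < d)%R ->
    (Cmod (f l' z' - c) < r)%R.
Proof.
  intros D H. destruct (D2_cont _ _ _ _ _ D (r - Cmod (f l z - c))%R) as [d [Hd P]]; [lra|].
  exists d. split; auto. intros l' z' A B. specialize (P l' z' A B).
  generalize (Cmod_tri_sub (f l' z') (f l z) c). lra.
Qed.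

Lemma chart_change_same (N a b : nat) (sw inf : bool) (l0 z0 o0 l1 z1 o1 : C) (r0 : R) :
  (1 <= N)%nat -> 1 - z1 ^ N <> 0 -> o1 <> 0 -> on_chart N inf l1 z1 o1 ->
  (Cmod (l1 - l0) < r0)%R -> (Cmod (z1 - z0) < r0)%R -> (Cmod (o1 - o0) < r0)%R ->
  (forall l z o, (Cmod (l - l0) < r0)%R -> (Cmod (z - z0) < r0)%R -> (Cmod (o - o0) < r0)%R ->
      on_chart N inf l z o -> ybr N inf o0 l z = o) ->
  chart_change N a b sw inf l0 z0 o0 r0 sw inf l1 z1 o1.
Proof.
  intros HN A1 O1 K1 Hl Hz Ho Br.
  destruct (ybr_center N inf l1 z1 o1 HN A1 O1 K1) as [Ec Hok].
  destruct (chartok_near _ _ _ _ _ HN Hok) as [d1 [Hd1 P1]].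
  rewrite <- Ec in Ho.
  destruct (Cmod_open _ _ _ _ _ _ _ (ybr_D2 _ _ _ _ _ HN Hok) Ho) as [d2 [Hd2 P2]].
  destruct (Cmod_open _ _ _ _ _ _ _ (D2_fst l1 z1) Hl) as [d3 [Hd3 P3]].
  destruct (Cmod_open _ _ _ _ _ _ _ (D2_snd l1 z1) Hz) as [d4 [Hd4 P4]].
  set (s := Rmin (Rmin d1 d2) (Rmin d3 d4)).
  assert (Hs0 : (0 < s)%R) by (unfold s; repeat apply Rmin_pos; auto).
  assert (Hs' : (s <= d1 /\ s <= d2 /\ s <= d3 /\ s <= d4)%R).
  { unfold s. repeat split; unfold Rmin; repeat destruct Rle_dec; lra. }
  exists s, (fun _ _ => 0), (fun _ _ => 1). split; auto. intros l z A B T.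
  assert (ET : forall l z, T l z = z) by (intros; unfold T, chT; apply zc_mk).
  assert (Q3 : (Cmod (l - l0) < r0)%R) by (apply (P3 l z); lra).
  assert (Q4 : (Cmod (z - z0) < r0)%R) by (apply (P4 l z); lra).
  rewrite ET. repeat split; auto.
  - apply (D2_ext (fun _ z => z)); [intros; now rewrite ET|apply D2_snd].
  - unfold Hs, Hf. rewrite (Br l z (ybr N inf o1 l z)); auto; [ring|apply P2; lra|].
    apply ybr_pow; auto. apply P1; lra.
Qed.

Lemma Cpow_pred_mul (z : C) (m : nat) : (1 <= m)%nat -> z ^ (m - 1) * z = z ^ m.
Proof.
  intros H. destruct m; [lia|]. replace (S m - 1)%nat with m by lia. rewrite Cpow_S. ring.
Qed.

Lemma Cpow_sub (z : C) (n m : nat) : z <> 0 -> (m <= n)%nat -> z ^ (n - m) = z ^ n / z ^ m.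
Proof.
  intros Hz H. replace n with ((n - m) + m)%nat at 2 by lia. rewrite Cpow_add_r.
  field. now apply Cpow_nz.
Qed.

(* That is, [dx / (x (1 - x^N)) = - dy / (y (1 - y^N))], whence the sign [csgn]
   between the charts. *)
Lemma ybr_z_sym (N : nat) (o l x : C) : (1 <= N)%nat -> l <> 0 -> x <> 0 -> chartok N false o l x ->
  let y := ybr N false o l x in
  1 - y ^ N <> 0 /\
  ybr_z N false o l x * x * (1 - x ^ N) = - (y * (1 - y ^ N)).
Proof.
  intros HN L X Hok y. assert (P := ybr_pow _ _ _ _ _ HN Hok). fold y in P.
  destruct Hok as [A [B _]]. assert (HNn := RtoC_INR_neq0 N ltac:(lia)).
  assert (XN := Cpow_nz x N X).
  assert (E : (1 - y ^ N) * cden N false l x = l * x ^ N).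
  { replace ((1 - y ^ N) * cden N false l x) with (cden N false l x - y ^ N * cden N false l x) by ring.
    rewrite P. unfold cden. ring. }
  split.
  - intros F. rewrite F in E. apply (Cmult_neq_0 l (x ^ N) L XN). rewrite <- E. ring.
  - assert (E' : 1 - y ^ N = l * x ^ N / cden N false l x).
    { rewrite <- E. field. auto. }
    rewrite E'. unfold ybr_z. fold y.
    assert (Px : INR N * x ^ pred N * x = INR N * x ^ N) by apply INR_pow_pred.
    unfold cden_z.
    transitivity (y * (- (INR N * x ^ pred N * x) / (1 - x ^ N)
      - (- (1 - l) * (INR N * x ^ pred N * x)) / cden N false l x) / INR N * (1 - x ^ N)).
    + field. auto.
    + rewrite Px. unfold cden in *. field. auto.
Qed.

(** The second chart is the affine one in [x], so the transition map is [y], [/ y] or [/ x], and the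
    invariance of [omega] follows from [ybr_z_sym]. *)
Lemma chart_change_diff (N a b : nat) (sw0 inf0 : bool) (l0 z0 o0 l1 x1 y1 : C) (r0 : R) :
  (1 <= N)%nat -> (1 <= a <= N - 1)%nat -> (1 <= b <= N - 1)%nat ->
  (sw0 || inf0)%bool = true ->
  l1 <> 0 -> x1 <> 0 -> y1 <> 0 -> 1 - x1 ^ N <> 0 -> on_chart N false l1 x1 y1 ->
  (Cmod (l1 - l0) < r0)%R -> (Cmod (zc sw0 inf0 (Fin x1, Fin y1) - z0) < r0)%R ->
  (Cmod (oc sw0 (Fin x1, Fin y1) - o0) < r0)%R ->
  (forall l z o, (Cmod (l - l0) < r0)%R -> (Cmod (z - z0) < r0)%R -> (Cmod (o - o0) < r0)%R ->
      on_chart N inf0 l z o -> ybr N inf0 o0 l z = o) ->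
  chart_change N a b sw0 inf0 l0 z0 o0 r0 false false l1 x1 y1.
Proof.
  intros HN Ha Hb Hk L1 X1 Y1 A1 K1 Hl Hz Ho Br.
  destruct (ybr_center N false l1 x1 y1 HN A1 Y1 K1) as [Ec Hok].
  destruct (chartok_near _ _ _ _ _ HN Hok) as [d1 [Hd1 P1]].
  set (T := chT N sw0 inf0 false false y1). set (O := chO N sw0 inf0 false false y1).
  set (Y := ybr N false y1).
  assert (Y0 : forall l x, chartok N false y1 l x -> Y l x <> 0) by (intros; now apply ybr_neq0).
  set (Tl := fun l x => if sw0 then (if inf0 then - ybr_l N false y1 l x / (Y l x * Y l x) else ybr_l N false y1 l x)
                        else 0).
  set (Tz := fun l x => if sw0 then (if inf0 then - ybr_z N false y1 l x / (Y l x * Y l x) else ybr_z N false y1 l x)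
                        else - (1) / (x * x)).
  assert (DT : forall l x, chartok N false y1 l x -> x <> 0 -> D2 T l x (Tl l x) (Tz l x)).
  { intros l x Hlx Hx. unfold T, chT, Tl, Tz, zc, mk. destruct sw0, inf0; cbn [fst snd cinv1 cfin]; try discriminate Hk.
    - apply (D2_inv (ybr N false y1)); [now apply Y0|now apply ybr_D2].
    - now apply ybr_D2.
    - eapply D2_eq; [apply (D2_inv (fun _ z => z)); [exact Hx|apply D2_snd]|field; auto|field; auto]. }
  assert (DO : exists u v, D2 O l1 x1 u v).
  { unfold O, chO, oc, mk. destruct sw0; cbn [fst snd cfin].
    - do 2 eexists. apply D2_snd.
    - do 2 eexists. now apply ybr_D2. }
  destruct DO as [u [v DO]].
  assert (Tc : T l1 x1 = zc sw0 inf0 (Fin x1, Fin y1)) by (unfold T, chT, mk; now rewrite Ec).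
  assert (Oc : O l1 x1 = oc sw0 (Fin x1, Fin y1)) by (unfold O, chO, mk; now rewrite Ec).
  rewrite <- Tc in Hz. rewrite <- Oc in Ho.
  destruct (Cmod_open _ _ _ _ _ _ _ DO Ho) as [d2 [Hd2 P2]].
  destruct (Cmod_open _ _ _ _ _ _ _ (D2_fst l1 x1) Hl) as [d3 [Hd3 P3]].
  destruct (Cmod_open _ _ _ _ _ _ _ (DT l1 x1 Hok X1) Hz) as [d4 [Hd4 P4]].
  destruct (neq0_near _ _ _ _ _ (D2_fst l1 x1) L1) as [d5 [Hd5 P5]].
  destruct (neq0_near _ _ _ _ _ (D2_snd l1 x1) X1) as [d6 [Hd6 P6]].
  set (s := Rmin (Rmin d1 d2) (Rmin (Rmin d3 d4) (Rmin d5 d6))).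
  assert (Hs0 : (0 < s)%R) by (unfold s; repeat apply Rmin_pos; auto).
  assert (Hs' : (s <= d1 /\ s <= d2 /\ s <= d3 /\ s <= d4 /\ s <= d5 /\ s <= d6)%R).
  { unfold s. assert (q1 := Rmin_l (Rmin d1 d2) (Rmin (Rmin d3 d4) (Rmin d5 d6))).
    assert (q2 := Rmin_r (Rmin d1 d2) (Rmin (Rmin d3 d4) (Rmin d5 d6))).
    assert (q3 := Rmin_l d1 d2). assert (q4 := Rmin_r d1 d2).
    assert (q5 := Rmin_l (Rmin d3 d4) (Rmin d5 d6)). assert (q6 := Rmin_r (Rmin d3 d4) (Rmin d5 d6)).
    assert (q7 := Rmin_l d3 d4). assert (q8 := Rmin_r d3 d4).
    assert (q9 := Rmin_l d5 d6). assert (q10 := Rmin_r d5 d6). lra. }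
  exists s, Tl, Tz. split; auto. intros l x A B T'. change T' with T. clear T'.
  assert (Hlx : chartok N false y1 l x) by (apply P1; lra).
  assert (L : l <> 0) by (apply (P5 l x); lra). assert (X : x <> 0) by (apply (P6 l x); lra).
  assert (Q2 : (Cmod (O l x - o0) < r0)%R) by (apply P2; lra).
  assert (Q3 : (Cmod (l - l0) < r0)%R) by (apply (P3 l x); lra).
  assert (Q4 : (Cmod (T l x - z0) < r0)%R) by (apply P4; lra).
  repeat split; auto.
  assert (Yn := Y0 l x Hlx). assert (Yp : Y l x ^ N * cden N false l x = 1 - x ^ N) by (now apply ybr_pow).
  (* The transformed coordinates satisfy the equation of the first chart, so the uniqueness of its
     sheet evaluates [ybr] there without unfolding any root. *)
  assert (KO : on_chart N inf0 l (T l x) (O l x)).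
  { apply (on_curve_mk N l _ _ sw0 inf0 HN).
    replace (mk sw0 inf0 (T l x) (O l x)) with (mk false false x (Y l x)).
    - now apply on_curve_mk.
    - unfold T, O, chT, chO, mk, zc, oc. fold Y.
      destruct sw0, inf0; cbn [fst snd cinv1 cfin]; auto.
      + destruct (Ceq_dec (/ Y l x) 0) as [e|n]; [now apply Cinv_neq0 in Yn|]. now rewrite Cinv_invol.
      + destruct (Ceq_dec (/ x) 0) as [e|n]; [now apply Cinv_neq0 in X|]. now rewrite Cinv_invol. }
  assert (Eb := Br _ _ _ Q3 Q4 Q2 KO).
  destruct (ybr_z_sym N y1 l x HN L X Hlx) as [YN1 Ez]. fold Y in YN1, Ez.
  assert (AX := proj1 Hlx).
  unfold Hs, Hf. rewrite Eb. unfold cm, ck, csgn.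
  assert (XN := Cpow_nz x N X). assert (YN := Cpow_nz (Y l x) N Yn).
  assert (Px : x ^ (a - 1) = x ^ a / x) by (rewrite <- (Cpow_pred_mul x a) by lia; field; auto).
  assert (Py : Y l x ^ (b - 1) = Y l x ^ b / Y l x) by (rewrite <- (Cpow_pred_mul (Y l x) b) by lia; field; auto).
  assert (Xa := Cpow_nz x a X). assert (Yb := Cpow_nz (Y l x) b Yn).
  fold Y. unfold T, O, Tz, chT, chO, mk, zc, oc. fold Y.
  assert (Ez' : ybr_z N false y1 l x = - (Y l x * (1 - Y l x ^ N)) / (x * (1 - x ^ N))).
  { rewrite <- Ez. field. auto. }
  destruct sw0, inf0; cbn [fst snd cinv1 cfin]; try discriminate Hk.
  - rewrite Px, Ez', !Cpow_inv by auto.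
    replace (Y l x ^ (N - b - 1)) with (Y l x ^ N / Y l x ^ b / Y l x).
    2:{ rewrite <- Cpow_sub by (auto; lia). rewrite <- (Cpow_pred_mul (Y l x) (N - b)) by lia.
        field. auto. }
    assert (F : 1 - / Y l x ^ N <> 0).
    { intros F. apply YN1. replace (1 - Y l x ^ N) with (- (Y l x ^ N * (1 - / Y l x ^ N))) by (field; auto).
      rewrite F. ring. }
    assert (F' : Y l x ^ N - 1 <> 0) by (intros F'; apply YN1; replace (1 - Y l x ^ N) with (- (Y l x ^ N - 1)) by ring; rewrite F'; ring).
    field. repeat split; auto.
  - rewrite Px, Py, Ez'. field. repeat split; auto.
  - rewrite Px, !Cpow_inv by auto.
    replace (x ^ (N - a - 1)) with (x ^ N / x ^ a / x).
    2:{ rewrite <- Cpow_sub by (auto; lia). rewrite <- (Cpow_pred_mul x (N - a)) by lia.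
        field. auto. }
    assert (F' : x ^ N - 1 <> 0) by (intros F'; apply AX; replace (1 - x ^ N) with (- (x ^ N - 1)) by ring; rewrite F'; ring).
    field. repeat split; auto.
Qed.

(** * The local cocycle of periods between nearby points *)

Lemma finite_kind (x y : C) : y <> 0 ->
  let p := (Fin x, Fin y) in
  kind_sw p = false /\ kind_inf p = false /\ pz p = x /\ po p = y.
Proof.
  intros Y p. unfold p, pz, po, kind_sw, kind_inf. destruct (Ceq_dec y 0); [easy|]. repeat split.
Qed.

Lemma chart_change_near (N a b : nat) (q0 : C * point) : (2 <= N)%nat ->
  (1 <= a <= N - 1)%nat -> (1 <= b <= N - 1)%nat -> onE N q0 ->
  let p0 := snd q0 in
  exists r, (0 < r)%R /\
    (forall l z, (Cmod (l - fst q0) < r)%R -> (Cmod (z - pz p0) < r)%R ->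
      D2 (CI N a b (kind_sw p0) (kind_inf p0) (pz p0) (po p0)) l z
         (CI1 N a b (kind_sw p0) (kind_inf p0) (pz p0) (po p0) l z)
         (Hs N a b (kind_sw p0) (kind_inf p0) (po p0) l z)) /\
    forall q1, onE N q1 -> qball r q0 q1 ->
      let p1 := snd q1 in
      chart_change N a b (kind_sw p0) (kind_inf p0) (fst q0) (pz p0) (po p0) r
        (kind_sw p1) (kind_inf p1) (fst q1) (pz p1) (po p1).
Proof.
  intros HN Ha Hb H0. assert (HN1 : (1 <= N)%nat) by lia. destruct q0 as [l0 p0]. cbn [fst snd] in *. cbv zeta.
  destruct (kind_spec N l0 p0 HN1 H0) as [E0 [O0 [A0 [K0 _]]]].
  destruct (chart_disc N (cm N a b (kind_sw p0) (kind_inf p0)) (ck a b (kind_sw p0)) (kind_inf p0) l0 (pz p0) (po p0) HN1 A0 O0 K0)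
    as [r0 [Hr0 [Dp Br]]].
  assert (Ho : (0 < Cmod (po p0))%R) by now apply Cmod_gt_0.
  set (r := Rmin r0 (Cmod (po p0))).
  assert (Hr : (0 < r)%R) by (unfold r; now apply Rmin_pos).
  assert (m1 : (r <= r0)%R) by apply Rmin_l. assert (m2 : (r <= Cmod (po p0))%R) by apply Rmin_r.
  exists r. split; auto. split.
  - intros l z Hl Hz. destruct (Dp l z) as [_ D]; try lra.
    unfold CI, CI1, Hs. eapply D2_eq; [apply D2_mul; [apply (D2_const (csgn (kind_sw p0)))|exact D]|cring|cring].
  - intros q1 H1 Hq. destruct q1 as [l1 p1]. cbn [fst snd]. cbv zeta.
    assert (Hq' := Hq). apply (qball_chart N (l0, p0)) in Hq'; auto. cbn [fst snd] in Hq'.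
    destruct Hq' as [Bl [_ [Bz Bo]]].
    destruct (kind_spec N l1 p1 HN1 H1) as [E1 [O1 [A1 [K1 _]]]].
    assert (Br' : forall l z o, (Cmod (l - l0) < r)%R -> (Cmod (z - pz p0) < r)%R ->
       (Cmod (o - po p0) < r)%R -> on_chart N (kind_inf p0) l z o -> ybr N (kind_inf p0) (po p0) l z = o).
    { intros l z o. intros. apply Br; auto; lra. }
    destruct (kinds_near N (l0, p0) (l1, p1) r HN1 H0 H1) as [[s i]|[x [y [F [X Y]]]]]; auto; cbn [snd] in *.
    + rewrite s, i. rewrite i in K1. apply chart_change_same; auto.
      * unfold pz at 1. now rewrite s, i.
      * unfold po at 1. now rewrite s.
    + destruct (finite_kind x y Y) as [k1 [k2 [k3 k4]]]. rewrite <- F in k1, k2, k3, k4.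
      rewrite k1, k2, k3, k4 in *.
      destruct (kind_sw p0 || kind_inf p0)%bool eqn:S.
      * apply chart_change_diff; auto; try (rewrite <- F; auto). apply H1.
      * apply orb_false_elim in S. destruct S as [S1 S2]. rewrite S1, S2 in *.
        apply chart_change_same; auto.
        -- rewrite F in Bz. exact Bz.
        -- rewrite F in Bo. exact Bo.
Qed.

(** At fixed [l], the two primitives read in the chart of [q1] have the same derivative along the
    fibre. Their difference is therefore its value at the centre of that chart, which is
    [GG N a b q0 q1]. *)
Lemma GG_local (N a b : nat) (q0 : C * point) : (2 <= N)%nat ->
  (1 <= a <= N - 1)%nat -> (1 <= b <= N - 1)%nat -> onE N q0 ->
  exists r, (0 < r)%R /\ forall q1, onE N q1 -> qball r q0 q1 ->
    holo_near (GG N a b q0 q1) (fst q1) /\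
    exists r1, (0 < r1)%R /\ forall q2, onE N q2 -> qball r1 q1 q2 ->
      Psi N a b q0 (fst q2) (snd q2) = GG N a b q0 q1 (fst q2) + Psi N a b q1 (fst q2) (snd q2).
Proof.
  intros HN Ha Hb H0. assert (HN1 : (1 <= N)%nat) by lia.
  destruct (chart_change_near N a b q0 HN Ha Hb H0) as [r [Hr [Dp Hch]]].
  exists r. split; auto. intros q1 H1 Hq. specialize (Hch q1 H1 Hq). cbv zeta in Hch.
  destruct Hch as [r1 [Tl [Tz [Hr1 Ch]]]].
  destruct q0 as [l0 p0], q1 as [l1 p1]. cbn [fst snd] in *.
  set (sw0 := kind_sw p0) in *. set (inf0 := kind_inf p0) in *.
  set (z0 := pz p0) in *. set (o0 := po p0) in *.
  destruct (kind_spec N l1 p1 HN1 H1) as [E1 [O1 [A1 [K1 _]]]].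
  set (sw1 := kind_sw p1) in *. set (inf1 := kind_inf p1) in *.
  set (z1 := pz p1) in *. set (o1 := po p1) in *.
  set (T := chT N sw0 inf0 sw1 inf1 o1) in *.
  assert (GGe : forall l, GG N a b (l0, p0) (l1, p1) l = CI N a b sw0 inf0 z0 o0 l (T l z1)) by reflexivity.
  split.
  - exists r1, (fun l => CI1 N a b sw0 inf0 z0 o0 l (T l z1) * 1 + Hs N a b sw0 inf0 o0 l (T l z1) * Tl l z1).
    split; auto. intros l Hl. destruct (Ch l z1) as [B0 [B1 [DT _]]]; auto; [rewrite Cmod_diag; lra|].
    apply (D1_ext (fun l => CI N a b sw0 inf0 z0 o0 l (T l z1))); [intros; now rewrite GGe|].
    apply (D1_comp2 (CI N a b sw0 inf0 z0 o0) (fun l => l) (fun l => T l z1)).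
    + apply Dp; auto.
    + apply D1_id.
    + eapply D2_slice1, DT.
  - destruct (chart_disc N (cm N a b sw1 inf1) (ck a b sw1) inf1 l1 z1 o1 HN1 A1 O1 K1)
      as [r2 [Hr2 [Dp1 Br1]]].
    set (r3 := Rmin r1 r2). assert (m1 : (r3 <= r1)%R) by apply Rmin_l.
    assert (m2 : (r3 <= r2)%R) by apply Rmin_r. assert (Hr3 : (0 < r3)%R) by (now apply Rmin_pos).
    exists r3. split; auto. intros q2 H2 Hq2. destruct q2 as [l p]. cbn [fst snd] in *.
    apply (qball_chart N (l1, p1)) in Hq2; auto. cbn [fst snd] in Hq2.
    fold sw1 inf1 z1 o1 in Hq2. destruct Hq2 as [Bl [Ep [Bz Bo]]].
    set (z := zc sw1 inf1 p) in *. set (o := oc sw1 p) in *.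
    assert (Kp : on_chart N inf1 l z o).
    { apply (on_curve_mk N l z o sw1 inf1); auto. rewrite <- Ep. apply H2. }
    assert (Eo : ybr N inf1 o1 l z = o) by (apply Br1; auto; lra).
    rewrite GGe. unfold Psi. cbn [snd]. fold sw0 inf0 z0 o0 sw1 inf1 z1 o1 z.
    replace (zc sw0 inf0 p) with (T l z) by (unfold T, chT; now rewrite Eo, <- Ep).
    set (F := fun z => CI N a b sw0 inf0 z0 o0 l (T l z) - CI N a b sw1 inf1 z1 o1 l z).
    assert (EF : F z = F z1).
    { apply (D1_zero_const F z1 r3); auto; [|rewrite Cmod_diag; lra].
      intros w Hw. destruct (Ch l w) as [B0 [B1 [DT Id]]]; try lra.
      apply D1_eq with (Hs N a b sw0 inf0 o0 l (T l w) * Tz l w - Hs N a b sw1 inf1 o1 l w).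
      2:{ rewrite Id. ring. }
      apply D1_sub.
      - apply (D1_comp (fun z => CI N a b sw0 inf0 z0 o0 l z) (fun w => T l w)).
        + eapply D2_slice2. apply Dp; auto.
        + eapply D2_slice2. exact DT.
      - unfold CI, Hs. eapply D1_eq.
        + apply D1_mul; [apply (D1_const (csgn sw1))|].
          eapply D2_slice2. apply Dp1; lra.
        + cring. }
    unfold F in EF. unfold CI at 4 in EF. rewrite prim_center in EF.
    replace (CI N a b sw0 inf0 z0 o0 l (T l z)) with
      ((CI N a b sw0 inf0 z0 o0 l (T l z) - CI N a b sw1 inf1 z1 o1 l z) + CI N a b sw1 inf1 z1 o1 l z) by ring.
    rewrite EF. ring.
Qed.

(** For [l] close to the parameter of [q2], the moving point [pt N q2 l] remains in the
    neighbourhood of [q1]; the pointwise relation of [GG_local] applied to it becomes an equality of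
    germs. *)
Lemma GG_cocycle (N a b : nat) (q0 : C * point) : (2 <= N)%nat ->
  (1 <= a <= N - 1)%nat -> (1 <= b <= N - 1)%nat -> onE N q0 ->
  exists r, (0 < r)%R /\ forall q1, onE N q1 -> qball r q0 q1 ->
    holo_near (GG N a b q0 q1) (fst q1) /\
    exists r1, (0 < r1)%R /\ forall q2, onE N q2 -> qball r1 q1 q2 ->
      eq_near (GG N a b q0 q2) (fun l => GG N a b q0 q1 l + GG N a b q1 q2 l) (fst q2).
Proof.
  intros HN Ha Hb H0. destruct (GG_local N a b q0 HN Ha Hb H0) as [r [Hr P]].
  exists r. split; auto. intros q1 H1 Hq1. destruct (P q1 H1 Hq1) as [Hol [r1 [Hr1 Q]]].
  split; auto. exists r1. split; auto. intros q2 H2 Hq2.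
  destruct (qball_open r1 q1 q2 Hr1 Hq2) as [r2 [Hr2 P2]].
  destruct (pt_near N q2 r2) as [r3 [Hr3 P3]]; auto; [lia|].
  exists r3. split; auto. intros l Hl. destruct (P3 l Hl) as [B1 B2].
  exact (Q (l, pt N q2 l) B2 (P2 _ B1)).
Qed.

(** * Germs of periods along paths *)

Lemma eq_near_refl (f : C -> C) (z : C) : eq_near f f z.
Proof. exists 1%R. split; [lra|auto]. Qed.

Lemma eq_near_ext (f g : C -> C) (z : C) : (forall w, f w = g w) -> eq_near f g z.
Proof. intros H. exists 1%R. split; [lra|auto]. Qed.

Lemma eq_near_sym (f g : C -> C) (z : C) : eq_near f g z -> eq_near g f z.
Proof. intros [r [Hr H]]. exists r. split; auto. intros w Hw. symmetry. auto. Qed.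

Lemma eq_near_op2 (op : C -> C -> C) (f f' g g' : C -> C) (z : C) :
  eq_near f f' z -> eq_near g g' z -> eq_near (fun w => op (f w) (g w)) (fun w => op (f' w) (g' w)) z.
Proof.
  intros [r [Hr H]] [s [Hs K]]. exists (Rmin r s). split; [now apply Rmin_pos|].
  assert (m1 := Rmin_l r s). assert (m2 := Rmin_r r s). intros w Hw. rewrite H, K; auto; lra.
Qed.

Lemma eq_near_trans (f g h : C -> C) (z : C) : eq_near f g z -> eq_near g h z -> eq_near f h z.
Proof.
  intros [r [Hr H]] [s [Hs K]]. exists (Rmin r s). split; [now apply Rmin_pos|].
  assert (m1 := Rmin_l r s). assert (m2 := Rmin_r r s). intros w Hw. rewrite H, K; auto; lra.
Qed.

Lemma eq_near_at (f g : C -> C) (z : C) : eq_near f g z -> f z = g z.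
Proof. intros [r [Hr H]]. apply H. now rewrite Cmod_diag. Qed.

Lemma eq_near_open (f g : C -> C) (z : C) : eq_near f g z ->
  exists r, (0 < r)%R /\ forall w, (Cmod (w - z) < r)%R -> eq_near f g w.
Proof.
  intros [r [Hr H]]. exists r. split; auto. intros w Hw.
  exists (r - Cmod (w - z))%R. split; [lra|]. intros v Hv. apply H.
  generalize (Cmod_tri_sub v w z). lra.
Qed.

Lemma holo_near_eq (f g : C -> C) (z : C) : eq_near f g z -> holo_near f z -> holo_near g z.
Proof.
  intros [r [Hr H]] [s [f' [Hs K]]]. exists (Rmin r s / 2)%R, f'.
  assert (m0 : (0 < Rmin r s)%R) by now apply Rmin_pos.
  assert (m1 := Rmin_l r s). assert (m2 := Rmin_r r s). split; [lra|]. intros w Hw.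
  apply (D1_ext_near f g w (f' w) (Rmin r s / 2)); [lra| |apply K; lra].
  intros v Hv. apply H. generalize (Cmod_tri_sub v w z). lra.
Qed.

Lemma holo_near_add (f g : C -> C) (z : C) : holo_near f z -> holo_near g z ->
  holo_near (fun w => f w + g w) z.
Proof.
  intros [r [f' [Hr H]]] [s [g' [Hs K]]]. exists (Rmin r s), (fun w => f' w + g' w).
  assert (m1 := Rmin_l r s). assert (m2 := Rmin_r r s).
  split; [now apply Rmin_pos|]. intros w Hw. apply D1_add; [apply H|apply K]; lra.
Qed.

Lemma holo_near_sub (f g : C -> C) (z : C) : holo_near f z -> holo_near g z ->
  holo_near (fun w => f w - g w) z.
Proof.
  intros [r [f' [Hr H]]] [s [g' [Hs K]]]. exists (Rmin r s), (fun w => f' w - g' w).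
  assert (m1 := Rmin_l r s). assert (m2 := Rmin_r r s).
  split; [now apply Rmin_pos|]. intros w Hw. apply D1_sub; [apply H|apply K]; lra.
Qed.

Lemma holo_near_const (c z : C) : holo_near (fun _ => c) z.
Proof. exists 1%R, (fun _ => 0). split; [lra|]. intros. apply D1_const. Qed.

Lemma holo_near_scal (c : C) (f : C -> C) (z : C) : holo_near f z -> holo_near (fun w => c * f w) z.
Proof.
  intros [r [f' [Hr H]]]. exists r, (fun w => c * f' w). split; auto. intros w Hw.
  eapply D1_eq; [apply D1_mul; [apply (D1_const c)|apply H, Hw]|cring].
Qed.

(** All that the transport of periods uses of the curve. The radii are chosen point by point;
    compactness of the interval supplies uniformity later. *)
Definition local_cocycle (E : C * point -> Prop) (G : C * point -> C * point -> C -> C) : Prop :=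
  (forall q l, G q q l = 0) /\
  forall q0, E q0 -> exists r, (0 < r)%R /\ forall q1, E q1 -> qball r q0 q1 ->
    holo_near (G q0 q1) (fst q1) /\
    exists r1, (0 < r1)%R /\ forall q2, E q2 -> qball r1 q1 q2 ->
      eq_near (G q0 q2) (fun l => G q0 q1 l + G q1 q2 l) (fst q2).

(* [h s] is the germ at [l] of the integral of [omega] along the path from [0]
   to [s], its end points following their preferred coordinates. *)
Definition is_gp (G : C * point -> C * point -> C -> C) (l : C) (sg : path) (a b : R)
    (h : R -> C -> C) : Prop :=
  forall s, (a <= s <= b)%R ->
    holo_near (h s) l /\
    exists d, (0 < d)%R /\ forall s', (a <= s' <= b)%R -> (Rabs (s' - s) < d)%R ->
      eq_near (fun x => h s' x - h s x) (G (l, sg s) (l, sg s')) l.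

(** A relation instead of a function, because a germ matters only up to [eq_near]; [PG_unique] shows
    that it determines the germ. *)
Definition PG (G : C * point -> C * point -> C -> C) (l : C) (sg : path) (a b : R) (T : C -> C) : Prop :=
  exists h, is_gp G l sg a b h /\ eq_near (fun x => h b x - h a x) T l.

(** Two families of germs with the same local increments differ by a germ that is locally constant
    in [s], hence constant on the interval. *)
Lemma PG_unique (G : C * point -> C * point -> C -> C) (l : C) (sg : path) (T T' : C -> C) :
  PG G l sg 0 1 T -> PG G l sg 0 1 T' -> eq_near T T' l.
Proof.
  intros [h [H E]] [h' [H' E']].
  set (D := fun s x => h s x - h' s x).
  assert (K : eq_near (D 1%R) (D 0%R) l).
  { apply (cousin (fun a b => eq_near (D b) (D a) l)).
    - intros a b c _ _ A B. now apply eq_near_trans with (D b).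
    - intros t Ht. destruct (H t Ht) as [_ [d [Hd P]]]. destruct (H' t Ht) as [_ [d' [Hd' P']]].
      exists (Rmin d d'). split; [now apply Rmin_pos|].
      assert (m1 := Rmin_l d d'). assert (m2 := Rmin_r d d').
      assert (Q : forall s, (0 <= s <= 1)%R -> (Rabs (s - t) < Rmin d d')%R -> eq_near (D s) (D t) l).
      { intros s Hs Hst. assert (A := P s Hs ltac:(lra)). assert (A' := P' s Hs ltac:(lra)).
        assert (B := eq_near_trans _ _ _ _ A (eq_near_sym _ _ _ A')).
        destruct B as [r [Hr B]]. exists r. split; auto. intros w Hw. specialize (B w Hw).
        unfold D. replace (h s w) with (h s w - h t w + h t w) by ring. rewrite B. ring. }
      unfold unit_interval in Ht.
      intros a b Ha Hb H1 H2. apply eq_near_trans with (D t).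
      + apply Q; [lra|]. apply Rabs_def1; lra.
      + apply eq_near_sym, Q; [lra|]. apply Rabs_def1; lra. }
  apply eq_near_trans with (fun x => h 1%R x - h 0%R x); [now apply eq_near_sym|].
  apply eq_near_trans with (fun x => h' 1%R x - h' 0%R x); [|easy].
  destruct K as [r [Hr K]]. exists r. split; auto. intros w Hw. specialize (K w Hw). unfold D in K.
  replace (h 1%R w) with (h 1%R w - h' 1%R w + h' 1%R w) by ring. rewrite K. ring.
Qed.

Lemma PG_eq (G : C * point -> C * point -> C -> C) (l : C) (sg : path) (a b : R) (T T' : C -> C) :
  eq_near T T' l -> PG G l sg a b T -> PG G l sg a b T'.
Proof. intros E [h [H K]]. exists h. split; auto. now apply eq_near_trans with T. Qed.

Lemma PG_ext (G : C * point -> C * point -> C -> C) (l : C) (sg sg' : path) (T : C -> C) :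
  (forall s, unit_interval s -> sg s = sg' s) -> PG G l sg 0 1 T -> PG G l sg' 0 1 T.
Proof.
  intros E [h [H K]]. exists h. split; auto. intros s Hs. destruct (H s Hs) as [A [d [Hd P]]].
  split; auto. exists d. split; auto. intros s' Hs' Hd'. rewrite <- !E by auto. auto.
Qed.

Lemma PG_add (G : C * point -> C * point -> C -> C) (l : C) (sg : path) (a b c : R) (T T' : C -> C) :
  (forall q l, G q q l = 0) ->
  (a <= b <= c)%R -> PG G l sg a b T -> PG G l sg b c T' ->
  PG G l sg a c (fun x => T x + T' x).
Proof.
  intros G0 Hab [h [H E]] [h' [H' E']].
  (* The second family is shifted so as to agree with the first one at the junction [b]. *)
  set (k := fun s x => if Rle_dec s b then h s x else h' s x - h' b x + h b x).
  assert (kl : forall s x, (s <= b)%R -> k s x = h s x)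
    by (intros; unfold k; destruct (Rle_dec s b); [easy|lra]).
  assert (kr : forall s x, (b <= s)%R -> k s x = h' s x - h' b x + h b x).
  { intros s x Hs. unfold k. destruct (Rle_dec s b); [|easy]. replace s with b by lra. ring. }
  exists k. split.
  - intros s Hs. destruct (Rlt_le_dec s b) as [L|L]; [|destruct (Rlt_le_dec b s) as [L'|L']].
    + destruct (H s ltac:(lra)) as [A [d [Hd P]]]. split.
      * apply (holo_near_eq (h s)); auto. apply eq_near_ext. intros; now rewrite kl by lra.
      * exists (Rmin d (b - s)). split; [apply Rmin_pos; lra|].
        assert (m1 := Rmin_l d (b - s)). assert (m2 := Rmin_r d (b - s)).
        intros s' Hs' Hd'. assert (s' <= b)%R by (apply Rabs_def2 in Hd'; lra).
        apply eq_near_trans with (fun x => h s' x - h s x); [|apply P; lra].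
        apply eq_near_ext. intros; now rewrite !kl by lra.
    + destruct (H' s ltac:(lra)) as [A [d [Hd P]]]. split.
      * apply (holo_near_eq (fun x => h' s x - h' b x + h b x)).
        { apply eq_near_ext. intros; now rewrite kr by lra. }
        apply holo_near_add; [apply holo_near_sub; auto; apply (H' b); lra|apply (H b); lra].
      * exists (Rmin d (s - b)). split; [apply Rmin_pos; lra|].
        assert (m1 := Rmin_l d (s - b)). assert (m2 := Rmin_r d (s - b)).
        intros s' Hs' Hd'. assert (b <= s')%R by (apply Rabs_def2 in Hd'; lra).
        apply eq_near_trans with (fun x => h' s' x - h' s x); [|apply P; lra].
        apply eq_near_ext. intros; rewrite !kr by lra. ring.
    + assert (s = b) by lra. subst s.
      destruct (H b ltac:(lra)) as [A [d [Hd P]]]. destruct (H' b ltac:(lra)) as [A' [d' [Hd' P']]]. split.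
      * apply (holo_near_eq (h b)); auto. apply eq_near_ext. intros; now rewrite kl by lra.
      * exists (Rmin d d'). split; [now apply Rmin_pos|].
        assert (m1 := Rmin_l d d'). assert (m2 := Rmin_r d d').
        intros s' Hs' Hsd. destruct (Rle_lt_dec s' b) as [M|M].
        -- apply eq_near_trans with (fun x => h s' x - h b x); [|apply P; lra].
           apply eq_near_ext. intros; now rewrite !kl by lra.
        -- apply eq_near_trans with (fun x => h' s' x - h' b x); [|apply P'; lra].
           apply eq_near_ext. intros; rewrite !kr by lra. ring.
  - apply eq_near_trans with (fun x => (h b x - h a x) + (h' c x - h' b x)).
    + apply eq_near_ext. intros x. rewrite kr, kl by lra. ring.
    + apply (eq_near_op2 Cplus); auto.
Qed.

Definition qcont2 (q : R -> R -> C * point) (u s : R) : Prop :=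
  forall r, (0 < r)%R -> exists d, (0 < d)%R /\ forall u' s', unit_interval u' -> unit_interval s' ->
    (Rabs (u' - u) < d)%R -> (Rabs (s' - s) < d)%R -> qball r (q u s) (q u' s').

(** On a short piece of the path all points, at all times near [u0], lie in one ball, and [G] from
    its centre is a primitive. The germ at time [u] is then that at time [u0] plus the drift of the
    two ends; when pieces are joined, the drifts at the junction cancel. *)
Lemma PG_family (E : C * point -> Prop) (G : C * point -> C * point -> C -> C)
    (gam : R -> C) (H : R -> R -> point) (u0 : R) :
  local_cocycle E G -> unit_interval u0 ->
  (forall u s, unit_interval u -> unit_interval s -> E (gam u, H u s)) ->
  (forall u s, unit_interval u -> unit_interval s -> qcont2 (fun u s => (gam u, H u s)) u s) ->
  exists T0, holo_near T0 (gam u0) /\ exists d, (0 < d)%R /\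
    forall u, unit_interval u -> (Rabs (u - u0) < d)%R ->
      PG G (gam u) (H u) 0 1 (fun x => T0 x
         + (G (gam u0, H u0 1%R) (gam u, H u 1%R) x - G (gam u0, H u0 0%R) (gam u, H u 0%R) x)).
Proof.
  intros [G0 HG] Hu0 HE Hc.
  apply (cousin (fun a b => exists T0, holo_near T0 (gam u0) /\ exists d, (0 < d)%R /\
    forall u, unit_interval u -> (Rabs (u - u0) < d)%R ->
      PG G (gam u) (H u) a b (fun x => T0 x
         + (G (gam u0, H u0 b) (gam u, H u b) x - G (gam u0, H u0 a) (gam u, H u a) x)))).
  - intros a b c Hab Hbc [T [HT [d [Hd P]]]] [T' [HT' [d' [Hd' P']]]].
    exists (fun x => T x + T' x). split; [now apply holo_near_add|].
    exists (Rmin d d'). split; [now apply Rmin_pos|].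
    assert (m1 := Rmin_l d d'). assert (m2 := Rmin_r d d').
    intros u Hu Hud. eapply PG_eq; [|apply (PG_add G _ _ a b c); auto; [lra|apply P; auto; lra|apply P'; auto; lra]].
    apply eq_near_ext. intros x. cbv beta. ring.
  - intros t Ht. destruct (HG _ (HE u0 t Hu0 Ht)) as [r [Hr Pr]].
    destruct (Hc u0 t Hu0 Ht r Hr) as [d [Hd Pd]].
    exists d. split; auto. intros a b Ha Hb H1 H2.
    set (qs := (gam u0, H u0 t)) in *. set (q := fun u s => (gam u, H u s)).
    assert (U : forall s, (a <= s <= b)%R -> unit_interval s)
      by (unfold unit_interval in *; intros; lra).
    assert (Bq : forall u s, unit_interval u -> (Rabs (u - u0) < d)%R -> (a <= s <= b)%R -> qball r qs (q u s)).
    { intros u s Hu Hud Hs. apply Pd; auto. apply Rabs_def1; lra. }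
    assert (Z0 : (Rabs (u0 - u0) < d)%R) by (replace (u0 - u0)%R with 0%R by ring; rewrite Rabs_R0; lra).
    exists (fun x => G qs (q u0 b) x - G qs (q u0 a) x). split.
    { apply holo_near_sub.
      - apply (Pr (q u0 b)); [apply HE; auto; apply U; lra|apply Bq; auto; lra].
      - apply (Pr (q u0 a)); [apply HE; auto; apply U; lra|apply Bq; auto; lra]. }
    (* Cocycle relation across fibres, comparing the positions of one point of the path at the times
       [u0] and [u]; it is used at the ends [a] and [b]. *)
    assert (Tr : forall s, (a <= s <= b)%R -> exists e, (0 < e)%R /\ forall u, unit_interval u -> (Rabs (u - u0) < e)%R ->
       eq_near (G qs (q u s)) (fun x => G qs (q u0 s) x + G (q u0 s) (q u s) x) (gam u)).
    { intros s Hs. destruct (Pr (q u0 s)) as [_ [r1 [Hr1 P1]]];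
        [apply HE; auto|apply Bq; auto|].
      destruct (Hc u0 s Hu0 (U s Hs) r1 Hr1) as [e [He Pe]]. exists e. split; auto.
      intros u Hu Hue. apply (P1 (q u s)); [apply HE; auto|].
      apply Pe; auto. replace (s - s)%R with 0%R by ring. rewrite Rabs_R0. lra. }
    destruct (Tr a ltac:(lra)) as [ea [Hea Pa]]. destruct (Tr b ltac:(lra)) as [eb [Heb Pb]].
    exists (Rmin d (Rmin ea eb)). split; [repeat apply Rmin_pos; auto|].
    assert (m1 := Rmin_l d (Rmin ea eb)). assert (m2 := Rmin_r d (Rmin ea eb)).
    assert (m3 := Rmin_l ea eb). assert (m4 := Rmin_r ea eb).
    intros u Hu Hud. exists (fun s => G qs (q u s)). split.
    + intros s Hs. assert (Bs : qball r qs (q u s)) by (apply Bq; auto; lra).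
      destruct (Pr (q u s)) as [Hol [r1 [Hr1 P1]]]; auto; [apply HE; auto|].
      split; [exact Hol|].
      destruct (Hc u s Hu (U s Hs) r1 Hr1) as [e [He Pe]]. exists e. split; auto.
      intros s' Hs' Hss.
      assert (K : eq_near (G qs (q u s')) (fun x => G qs (q u s) x + G (q u s) (q u s') x) (gam u)).
      { apply (P1 (q u s')); [apply HE; auto|].
        apply Pe; auto. replace (u - u)%R with 0%R by ring. rewrite Rabs_R0. lra. }
      destruct K as [v [Hv K]]. exists v. split; auto. intros w Hw. rewrite K by auto. unfold q. ring.
    + destruct (Pa u Hu ltac:(lra)) as [v [Hv Ka]]. destruct (Pb u Hu ltac:(lra)) as [v' [Hv' Kb]].
      exists (Rmin v v'). split; [now apply Rmin_pos|].
      assert (m5 := Rmin_l v v'). assert (m6 := Rmin_r v v').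
      intros w Hw. rewrite Ka, Kb by lra. unfold q. ring.
Qed.

(** * Periods of cycles *)

Fixpoint Tot (G : C * point -> C * point -> C -> C) (l : C) (c : chain) (F : C -> C) : Prop :=
  match c with
  | nil => eq_near F (fun _ => 0) l
  | (n, sg) :: c' => exists T F', PG G l sg 0 1 T /\ Tot G l c' F' /\
      eq_near F (fun x => IZR n * T x + F' x) l
  end.

Lemma Tot_eq (G : C * point -> C * point -> C -> C) (l : C) (c : chain) (F F' : C -> C) :
  eq_near F F' l -> Tot G l c F -> Tot G l c F'.
Proof.
  intros E. destruct c as [|[n sg] c]; simpl.
  - intros K. apply eq_near_trans with F; auto. now apply eq_near_sym.
  - intros [T [F1 [A [B K]]]]. exists T, F1. repeat split; auto.
    apply eq_near_trans with F; auto. now apply eq_near_sym.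
Qed.

Lemma Tot_unique (G : C * point -> C * point -> C -> C) (l : C) (c : chain) (F F' : C -> C) :
  Tot G l c F -> Tot G l c F' -> eq_near F F' l.
Proof.
  revert F F'. induction c as [|[n sg] c IH]; intros F F'; simpl.
  - intros A B. apply eq_near_trans with (fun _ => 0); auto. now apply eq_near_sym.
  - intros [T [F1 [A [B K]]]] [T' [F1' [A' [B' K']]]].
    apply eq_near_trans with (fun x => IZR n * T x + F1 x); auto.
    apply eq_near_trans with (fun x => IZR n * T' x + F1' x); [|now apply eq_near_sym].
    apply (eq_near_op2 (fun u v => IZR n * u + v)); [eapply PG_unique; eauto|now apply IH].
Qed.

Lemma Tot_same (G : C * point -> C * point -> C -> C) (l : C) (c c' : chain) (F : C -> C) :
  same_chain c c' -> Tot G l c F -> Tot G l c' F.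
Proof.
  intros S. revert F. induction S as [|[n sg] [n' sg'] c c' [E1 E2] S IH]; intros F; simpl; auto.
  simpl in E1, E2. subst n'. intros [T [F1 [A [B K]]]]. exists T, F1. repeat split; auto.
  now apply (PG_ext _ _ sg).
Qed.

Fixpoint bsum (c : chain) (phi : point -> C) : C :=
  match c with
  | nil => 0
  | (n, sg) :: c' => IZR n * (phi (sg 1%R) - phi (sg 0%R)) + bsum c' phi
  end.

Fixpoint lsum (L : list point) (f : point -> C) : C :=
  match L with nil => 0 | p :: L' => f p + lsum L' f end.

Lemma lsum_indicator (L : list point) (p : point) (n : Z) (phi : point -> C) :
  NoDup L -> In p L ->
  lsum L (fun p' => IZR (if point_eq_dec p p' then n else 0%Z) * phi p') = IZR n * phi p.
Proof.
  assert (Z0 : forall L, ~ In p L ->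
    lsum L (fun p' => IZR (if point_eq_dec p p' then n else 0%Z) * phi p') = 0).
  { clear L. induction L as [|p' L IH]; intros H; simpl; auto. rewrite IH by (intros K; apply H; now right).
    destruct (point_eq_dec p p') as [e|_]; [exfalso; apply H; now left|]. ring. }
  intros ND. induction ND as [|p' L Hp ND IH]; intros H; [easy|]. simpl.
  destruct (point_eq_dec p p') as [e|ne].
  - subst p'. rewrite Z0 by auto. ring.
  - rewrite IH by (destruct H; [congruence|auto]). ring.
Qed.

Lemma lsum_add (L : list point) (f g : point -> C) :
  lsum L (fun p => f p + g p) = lsum L f + lsum L g.
Proof. induction L as [|p L IH]; simpl; [ring|rewrite IH; ring]. Qed.

Lemma lsum_ext (L : list point) (f g : point -> C) : (forall p, f p = g p) -> lsum L f = lsum L g.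
Proof. intros E. induction L as [|p L IH]; simpl; auto. now rewrite E, IH. Qed.

(** Summation by parts over end points: contributions are regrouped according to the point at which
    they sit, so [L] must list all ends without repetition. *)
Lemma bsum_boundary (c : chain) (L : list point) (phi : point -> C) : NoDup L ->
  (forall m, In m c -> In (snd m 0%R) L /\ In (snd m 1%R) L) ->
  bsum c phi = lsum L (fun p => IZR (boundary c p) * phi p).
Proof.
  intros ND. induction c as [|[n sg] c IH]; intros H.
  - simpl. clear. induction L as [|p L IH]; simpl; auto. rewrite <- IH. ring.
  - cbn [bsum]. rewrite IH by (intros m Hm; apply H; now right).
    destruct (H (n, sg) (or_introl eq_refl)) as [A B]. cbn [snd] in A, B.
    rewrite Cmult_minus_distr_l || replace (IZR n * (phi (sg 1%R) - phi (sg 0%R)))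
      with (IZR n * phi (sg 1%R) + (- (1)) * (IZR n * phi (sg 0%R))) by ring.
    rewrite <- (lsum_indicator L (sg 1%R) n phi ND B).
    replace (- (1) * (IZR n * phi (sg 0%R))) with (IZR (- n) * phi (sg 0%R)) by (rewrite opp_IZR, RtoC_opp; ring).
    rewrite <- (lsum_indicator L (sg 0%R) (- n) phi ND A).
    rewrite <- !lsum_add. apply lsum_ext. intros p. cbn [boundary].
    rewrite plus_IZR, minus_IZR, RtoC_plus, RtoC_minus.
    destruct (point_eq_dec (sg 0%R) p); rewrite ?opp_IZR, ?RtoC_opp; ring.
Qed.

Lemma bsum_cycle (c : chain) (phi : point -> C) : is_cycle c -> bsum c phi = 0.
Proof.
  intros H. set (L0 := flat_map (fun m : Z * path => snd m 0%R :: snd m 1%R :: nil) c).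
  rewrite (bsum_boundary c (nodup point_eq_dec L0) phi).
  - induction (nodup point_eq_dec L0) as [|p L IH]; simpl; auto. rewrite IH, H. ring.
  - apply NoDup_nodup.
  - intros m Hm. split; apply nodup_In; apply in_flat_map; exists m; split; simpl; auto.
Qed.

Lemma pb_separated (P P' : P1) : P <> P' ->
  exists r, (0 < r)%R /\ forall Q, pb r P Q -> pb r P' Q -> False.
Proof.
  assert (FI : forall z, exists r, (0 < r)%R /\ forall Q, pb r (Fin z) Q -> pb r Inf Q -> False).
  { intros z. assert (Hz := Cmod_ge_0 z). exists (/ (Cmod z + 1))%R.
    assert (Hp : (0 < / (Cmod z + 1))%R) by (apply Rinv_0_lt_compat; lra). split; auto.
    assert (H1 : (/ (Cmod z + 1) <= 1)%R) by (rewrite <- Rinv_1; apply Rinv_le_contravar; lra).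
    intros [w|]; simpl; auto. rewrite Rinv_inv. intros A B.
    generalize (Cmod_triangle (w - z) z). replace (w - z + z) with w by ring. lra. }
  destruct P as [z|], P' as [z'|]; intros H.
  - assert (Hz : (0 < Cmod (z - z'))%R) by (apply Cmod_gt_0, Csub_neq0; congruence).
    exists (Cmod (z - z') / 2)%R. split; [lra|]. intros [w|]; simpl; auto. intros A B.
    generalize (Cmod_tri_sub z w z'). rewrite (Cmod_minus_sym z w). lra.
  - apply FI.
  - destruct (FI z') as [r [Hr P]]. exists r. split; auto. intros Q A B. apply (P Q); auto.
  - congruence.
Qed.

Lemma list_uniform {A : Type} (L : list A) (P : A -> R -> Prop) :
  (forall x d d', (0 < d' <= d)%R -> P x d -> P x d') ->
  (forall x, In x L -> exists d, (0 < d)%R /\ P x d) ->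
  exists d, (0 < d)%R /\ forall x, In x L -> P x d.
Proof.
  intros M. induction L as [|y L IH]; intros H.
  - exists 1%R. split; [lra|easy].
  - destruct IH as [d [Hd Q]]; [intros; apply H; now right|].
    destruct (H y (or_introl eq_refl)) as [d' [Hd' Q']].
    assert (Hm : (0 < Rmin d d')%R) by now apply Rmin_pos.
    exists (Rmin d d'). split; auto. intros x [->|Hx].
    + apply M with d'; auto. split; [auto|apply Rmin_r].
    + apply M with d; auto. split; [auto|apply Rmin_l].
Qed.

Definition good_family (E : C * point -> Prop) (gam : R -> C) (fam : chain_family) : Prop :=
  List.Forall (fun m => forall u s, unit_interval u -> unit_interval s ->
     E (gam u, snd m u s) /\ qcont2 (fun u s => (gam u, snd m u s)) u s) fam /\
  forall u, unit_interval u -> is_cycle (chain_at fam u).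

(* Ends that are distinct at [u0] stay distinct, so the contributions of the
   ends are a function of the end point at time [u], on which the boundary
   vanishes. *)
Lemma Tot_family (E : C * point -> Prop) (G : C * point -> C * point -> C -> C)
    (gam : R -> C) (fam : chain_family) (u0 : R) :
  local_cocycle E G -> good_family E gam fam -> unit_interval u0 ->
  exists F0, holo_near F0 (gam u0) /\ exists d, (0 < d)%R /\
    forall u, unit_interval u -> (Rabs (u - u0) < d)%R -> Tot G (gam u) (chain_at fam u) F0.
Proof.
  intros HG [Hf Hcy] Hu0.
  set (dd := fun (m : Z * (R -> R -> point)) u x =>
    G (gam u0, snd m u0 1%R) (gam u, snd m u 1%R) x - G (gam u0, snd m u0 0%R) (gam u, snd m u 0%R) x).
  assert (K : forall fm, List.Forall (fun m => forall u s, unit_interval u -> unit_interval s ->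
     E (gam u, snd m u s) /\ qcont2 (fun u s => (gam u, snd m u s)) u s) fm ->
    exists F0, holo_near F0 (gam u0) /\ exists d, (0 < d)%R /\
    forall u, unit_interval u -> (Rabs (u - u0) < d)%R ->
      Tot G (gam u) (chain_at fm u) (fun x => F0 x + fold_right (fun m acc => IZR (fst m) * dd m u x + acc) 0 fm)).
  { clear fam Hf Hcy. intros fm Hf. induction Hf as [|[n H] fm Hm Hf [F0 [HF0 [d [Hd P]]]]].
    - exists (fun _ => 0). split; [apply holo_near_const|]. exists 1%R. split; [lra|]. intros. simpl.
      apply eq_near_ext. intros; ring.
    - destruct (PG_family E G gam H u0 HG Hu0) as [T0 [HT0 [d' [Hd' P']]]].
      { intros; now apply Hm. } { intros; now apply Hm. }
      exists (fun x => IZR n * T0 x + F0 x). split.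
      { apply holo_near_add; auto. now apply holo_near_scal. }
      exists (Rmin d d'). split; [now apply Rmin_pos|].
      assert (m1 := Rmin_l d d'). assert (m2 := Rmin_r d d'). intros u Hu Hud. cbn [chain_at map Tot fst snd].
      eexists. eexists. split; [apply P'; auto; lra|]. split; [apply P; auto; lra|].
      apply eq_near_ext. intros x. cbn [fold_right fst snd]. unfold dd at 1. cbn [snd]. ring. }
  destruct (K fam Hf) as [F0 [HF0 [d [Hd P]]]].
  exists F0. split; auto.
  (* Here [eps] is the list of all end points of the chain, as functions of the time [u]. *)
  set (eps := flat_map (fun m : Z * (R -> R -> point) => (fun u => snd m u 0%R) :: (fun u => snd m u 1%R) :: nil) fam).
  assert (Heps : forall e, In e eps -> forall r, (0 < r)%R -> exists d, (0 < d)%R /\ forall u, unit_interval u ->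
     (Rabs (u - u0) < d)%R -> qball r (gam u0, e u0) (gam u, e u)).
  { intros e He r Hr. apply in_flat_map in He. destruct He as [m [Hm He]].
    rewrite Forall_forall in Hf.
    assert (Q : forall s, unit_interval s -> exists d, (0 < d)%R /\ forall u, unit_interval u ->
      (Rabs (u - u0) < d)%R -> qball r (gam u0, snd m u0 s) (gam u, snd m u s)).
    { intros s Hs. destruct (Hf m Hm u0 s Hu0 Hs) as [_ Hc]. destruct (Hc r Hr) as [d1 [Hd1 P1]].
      exists d1. split; auto. intros u Hu Hud. apply P1; auto.
      replace (s - s)%R with 0%R by ring. rewrite Rabs_R0. lra. }
    destruct He as [He|[He|[]]]; subst e; apply Q; unfold unit_interval; lra. }
  destruct (list_uniform (list_prod eps eps) (fun ee d => forall u, unit_interval u -> (Rabs (u - u0) < d)%R ->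
     fst ee u = snd ee u -> fst ee u0 = snd ee u0)) as [d' [Hd' P']].
  { intros ee x y Hxy Q u Hu Hud. apply (Q u); auto; lra. }
  { intros [e e'] Hee. apply in_prod_iff in Hee. destruct Hee as [He He']. cbn [fst snd].
    destruct (point_eq_dec (e u0) (e' u0)) as [eq|ne]; [exists 1%R; split; [lra|auto]|].
    assert (S : exists r, (0 < r)%R /\ forall p, qball r (gam u0, e u0) p -> qball r (gam u0, e' u0) p -> False).
    { destruct (e u0) as [A B], (e' u0) as [A' B'].
      destruct (P1_eq_dec A A') as [EA|NA].
      - assert (NB : B <> B') by congruence. destruct (pb_separated _ _ NB) as [r [Hr S]].
        exists r. split; auto. intros p [_ [_ X]] [_ [_ Y]]. eapply S; [exact X|exact Y].
      - destruct (pb_separated _ _ NA) as [r [Hr S]].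
        exists r. split; auto. intros p [_ [X _]] [_ [Y _]]. eapply S; [exact X|exact Y]. }
    destruct S as [r [Hr S]].
    destruct (Heps e He r Hr) as [d1 [Hd1 P1]]. destruct (Heps e' He' r Hr) as [d2 [Hd2 P2]].
    exists (Rmin d1 d2). split; [now apply Rmin_pos|].
    assert (m1 := Rmin_l d1 d2). assert (m2 := Rmin_r d1 d2).
    intros u Hu Hud Eu. exfalso. apply (S (gam u, e u)); [apply P1; auto; lra|].
    rewrite Eu. apply P2; auto; lra. }
  exists (Rmin d d'). split; [now apply Rmin_pos|].
  assert (m1 := Rmin_l d d'). assert (m2 := Rmin_r d d'). intros u Hu Hud.
  apply Tot_eq with (2 := P u Hu ltac:(lra)). apply eq_near_ext. intros x.
  assert (Z : fold_right (fun m acc => IZR (fst m) * dd m u x + acc) 0 fam = 0); [|rewrite Z; ring].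
  (* [back] sends an end point at time [u] to its position at time [u0]. It is well defined because
     ends that coincide at [u] already coincided at [u0]. *)
  set (back := fun p => match find (fun e : R -> point => if point_eq_dec (e u) p then true else false) eps with
                        | Some e => e u0 | None => p end).
  assert (Hback : forall e, In e eps -> back (e u) = e u0).
  { intros e He. unfold back.
    destruct (find (fun e0 : R -> point => if point_eq_dec (e0 u) (e u) then true else false) eps) as [e'|] eqn:Fd.
    - apply find_some in Fd. destruct Fd as [He' Ee].
      destruct (point_eq_dec (e' u) (e u)) as [eq|]; [|discriminate].
      apply (P' (e', e) (in_prod _ _ _ _ He' He) u); auto; lra.
    - exfalso. assert (F := find_none _ _ Fd e He). cbv beta in F.
      destruct (point_eq_dec (e u) (e u)); [discriminate|easy]. }
  set (phi := fun p => G (gam u0, back p) (gam u, p) x).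
  transitivity (bsum (chain_at fam u) phi); [|apply bsum_cycle; auto].
  assert (Hin : forall m, In m fam -> In (fun u => snd m u 0%R) eps /\ In (fun u => snd m u 1%R) eps).
  { intros m Hm. split; apply in_flat_map; exists m; split; simpl; auto. }
  assert (Hb : forall m, In m fam -> back (snd m u 0%R) = snd m u0 0%R /\ back (snd m u 1%R) = snd m u0 1%R).
  { intros m Hm. destruct (Hin m Hm) as [A B]. split; [apply (Hback _ A)|apply (Hback _ B)]. }
  clearbody back. clear - Hb. unfold chain_at. induction fam as [|m fam IH]; simpl; auto.
  rewrite IH by (intros; apply Hb; now right). f_equal.
  destruct (Hb m (or_introl eq_refl)) as [A B]. unfold phi, dd. rewrite A, B. reflexivity.
Qed.

(** The set of times at which the period has the germ [F u] is open to the right, as one germ serves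
    for all nearby times, and closed from the left by the identity theorem. *)
Lemma Tot_continuation (E : C * point -> Prop) (G : C * point -> C * point -> C -> C)
    (gam : R -> C) (fam : chain_family) (F : R -> C -> C) :
  local_cocycle E G -> good_family E gam fam ->
  (forall u, unit_interval u -> forall e, (0 < e)%R -> exists d, (0 < d)%R /\
     forall v, unit_interval v -> (Rabs (v - u) < d)%R -> (Cmod (gam v - gam u) < e)%R) ->
  (forall u, unit_interval u -> psr (F u) (gam u)) ->
  (forall u, unit_interval u -> exists d, (0 < d)%R /\ forall v, unit_interval v ->
     (Rabs (v - u) < d)%R -> eq_near (F v) (F u) (gam v)) ->
  Tot G (gam 0%R) (chain_at fam 0) (F 0%R) ->
  forall u, unit_interval u -> Tot G (gam u) (chain_at fam u) (F u).
Proof.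
  intros HG Hfam Hgam Hpsr Hcomp H0.
  apply (real_induction (fun u => Tot G (gam u) (chain_at fam u) (F u))); auto.
  - intros t Ht Pt. assert (Ut : unit_interval t) by (unfold unit_interval; lra).
    destruct (Tot_family E G gam fam t HG Hfam Ut) as [F0 [HF0 [d [Hd P]]]].
    assert (Z0 : (Rabs (t - t) < d)%R) by (replace (t - t)%R with 0%R by ring; rewrite Rabs_R0; lra).
    assert (Q := Tot_unique _ _ _ _ _ (P t Ut Z0) Pt).
    destruct (eq_near_open _ _ _ Q) as [r [Hr Q']].
    destruct (Hgam t Ut r Hr) as [d1 [Hd1 P1]]. destruct (Hcomp t Ut) as [d2 [Hd2 P2]].
    set (m := Rmin d (Rmin d1 d2)). assert (Hm : (0 < m)%R) by (unfold m; repeat apply Rmin_pos; auto).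
    assert (m1 := Rmin_l d (Rmin d1 d2)). assert (m2 := Rmin_r d (Rmin d1 d2)).
    assert (m3 := Rmin_l d1 d2). assert (m4 := Rmin_r d1 d2). fold m in m1, m2.
    exists m. split; auto. intros s Hs Hs1. assert (Us : unit_interval s) by (unfold unit_interval; lra).
    assert (Hst : (Rabs (s - t) < m)%R) by (apply Rabs_def1; lra).
    apply Tot_eq with F0; [|apply P; auto; lra].
    apply eq_near_trans with (F t); [apply Q', P1; auto; lra|].
    apply eq_near_sym, P2; auto; lra.
  - intros t Ht Pt. assert (Ut : unit_interval t) by (unfold unit_interval; lra).
    destruct (Tot_family E G gam fam t HG Hfam Ut) as [F0 [HF0 [d [Hd P]]]].
    assert (Z0 : (Rabs (t - t) < d)%R) by (replace (t - t)%R with 0%R by ring; rewrite Rabs_R0; lra).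
    destruct (Hcomp t Ut) as [d2 [Hd2 P2]].
    apply Tot_eq with F0; [|apply P; auto].
    assert (Q : forall s, (0 <= s < t)%R -> (t - Rmin d d2 < s)%R -> eq_near F0 (F t) (gam s)).
    { intros s Hs Hst. assert (m1 := Rmin_l d d2). assert (m2 := Rmin_r d d2).
      assert (Us : unit_interval s) by (unfold unit_interval; lra).
      apply eq_near_trans with (F s); [|apply P2; auto; apply Rabs_def1; lra].
      apply (Tot_unique G _ (chain_at fam s)); [apply P; auto; apply Rabs_def1; lra|apply Pt; lra]. }
    (* The path may stand still. If it meets [gam t] at some close earlier time, the equality there
       is already the claim; otherwise the points [gam s] accumulate at [gam t] without reaching it,
       as the identity theorem demands. *)
    destruct (classic (exists s, (0 <= s < t)%R /\ (t - Rmin d d2 < s)%R /\ gam s = gam t)) as [[s [A [B E0]]]|N].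
    { rewrite <- E0. now apply Q. }
    apply holo_near_identity; auto. intros e He.
    destruct (Hgam t Ut e He) as [d3 [Hd3 P3]].
    assert (Hm : (0 < Rmin d d2)%R) by now apply Rmin_pos.
    set (h := Rmin (Rmin d d2) (Rmin d3 t)). assert (Hh : (0 < h)%R) by (unfold h; repeat apply Rmin_pos; lra).
    assert (m1 := Rmin_l (Rmin d d2) (Rmin d3 t)). assert (m2 := Rmin_r (Rmin d d2) (Rmin d3 t)).
    assert (m3 := Rmin_l d3 t). assert (m4 := Rmin_r d3 t). fold h in m1, m2.
    set (s := (t - h / 2)%R).
    assert (Us : unit_interval s) by (unfold unit_interval, s; lra).
    exists (gam s). split; [|split].
    + intros E0. apply N. exists s. unfold s in *. repeat split; auto; lra.
    + apply P3; auto. unfold s. apply Rabs_def1; lra.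
    + apply eq_near_at, Q; unfold s; lra.
Qed.

(** * Periods as improper integrals *)

Lemma GG_local_cocycle (N a b : nat) : (2 <= N)%nat ->
  (1 <= a <= N - 1)%nat -> (1 <= b <= N - 1)%nat -> local_cocycle (onE N) (GG N a b).
Proof. intros HN Ha Hb. split; [intros; apply GG_self|]. intros q0 H0. now apply GG_cocycle. Qed.

Definition ccont01 (f : R -> C) (t : R) : Prop :=
  forall e, (0 < e)%R -> exists d, (0 < d)%R /\
    forall s, unit_interval s -> (Rabs (s - t) < d)%R -> (Cmod (f s - f t) < e)%R.

(** At the ends only continuity of the primitive is asked, since the derivatives of delta need not
    be bounded there. *)
Lemma is_RInt_gen_primitive (eta w : R -> C) :
  (forall s, (0 < s < 1)%R -> rder eta s (w s)) -> (forall s, (0 < s < 1)%R -> ccont w s) ->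
  ccont01 eta 0 -> ccont01 eta 1 ->
  @is_RInt_gen C_R_NormedModule w (at_right 0) (at_left 1) (eta 1%R - eta 0%R).
Proof.
  intros Hd Hw H0 H1 P HP. apply locally_C_iff in HP. destruct HP as [r [Hr HP]].
  destruct (H0 (r / 2)%R) as [d0 [Hd0 P0]]; [lra|]. destruct (H1 (r / 2)%R) as [d1 [Hd1 P1]]; [lra|].
  set (m0 := Rmin d0 1). assert (Hm0 : (0 < m0)%R) by (apply Rmin_pos; lra).
  set (m1 := Rmin d1 1). assert (Hm1 : (0 < m1)%R) by (apply Rmin_pos; lra).
  assert (a0 : (m0 <= d0)%R) by apply Rmin_l. assert (b0 : (m0 <= 1)%R) by apply Rmin_r.
  assert (a1 : (m1 <= d1)%R) by apply Rmin_l. assert (b1 : (m1 <= 1)%R) by apply Rmin_r.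
  apply Filter_prod with (fun s => (0 < s < m0)%R) (fun s => (1 - m1 < s < 1)%R).
  - exists (mkposreal _ Hm0). intros s Hs Hs0. unfold ball in Hs; simpl in Hs.
    unfold AbsRing_ball, abs, minus, plus, opp in Hs; simpl in Hs. apply Rabs_def2 in Hs. lra.
  - exists (mkposreal _ Hm1). intros s Hs Hs0. unfold ball in Hs; simpl in Hs.
    unfold AbsRing_ball, abs, minus, plus, opp in Hs; simpl in Hs. apply Rabs_def2 in Hs. lra.
  - intros s t Hs Ht. cbn [fst snd]. exists (eta t - eta s). split.
    + assert (Hst : forall u, (Rmin s t <= u <= Rmax s t)%R -> (0 < u < 1)%R).
      { intros u. unfold Rmin, Rmax. destruct (Rle_dec s t); lra. }
      apply (is_RInt_derive (V := C_R_CompleteNormedModule)).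
      * intros u Hu. apply rder_is_derive, Hd, Hst, Hu.
      * intros u Hu. apply ccont_continuous, Hw, Hst, Hu.
    + apply HP.
      replace (eta t - eta s - (eta 1%R - eta 0%R)) with ((eta t - eta 1%R) - (eta s - eta 0%R)) by ring.
      eapply Rle_lt_trans; [apply Cmod_sub_le|].
      assert (Cmod (eta t - eta 1%R) < r / 2)%R
        by (apply P1; [unfold unit_interval; lra|apply Rabs_def1; lra]).
      assert (Cmod (eta s - eta 0%R) < r / 2)%R
        by (apply P0; [unfold unit_interval; lra|apply Rabs_def1; lra]).
      lra.
Qed.

Lemma rder_unique (f : R -> C) (t : R) (v w : C) : rder f t v -> rder f t w -> v = w.
Proof.
  intros A B. apply rder_re_im in A. apply rder_re_im in B. destruct A as [A1 A2], B as [B1 B2].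
  apply injective_projections.
  - change (Re v = Re w). rewrite <- (is_derive_unique _ _ _ A1). now apply is_derive_unique.
  - change (Im v = Im w). rewrite <- (is_derive_unique _ _ _ A2). now apply is_derive_unique.
Qed.

Lemma onE_fin (N : nat) (l x y : C) : (1 <= N)%nat -> onE N (l, (Fin x, Fin y)) -> y <> 0 ->
  l <> 0 /\ 1 - x ^ N <> 0 /\ on_chart N false l x y.
Proof.
  intros HN H Y. destruct (kind_spec N l _ HN H) as [_ [_ [A [K _]]]].
  destruct (finite_kind x y Y) as [k1 [k2 [k3 k4]]]. rewrite k2, k3, k4 in K. rewrite k3 in A.
  split; [apply H|]. auto.
Qed.

Lemma GG_fin (N a b : nat) (l x y x' y' w : C) : y <> 0 -> y' <> 0 ->
  GG N a b (l, (Fin x, Fin y)) (l, (Fin x', Fin y')) w = prim (Hf N a b false y) x w x'.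
Proof.
  intros Y Y'. unfold GG, Psi, pt. cbn [snd].
  destruct (finite_kind x y Y) as [k1 [k2 [k3 k4]]]. destruct (finite_kind x' y' Y') as [j1 [j2 [j3 j4]]].
  rewrite k1, k2, k3, k4, j1, j2, j3, j4. unfold CI, cm, ck, csgn, mk, zc. cbn [fst snd cfin]. ring.
Qed.

Lemma GG_fin_D1 (N a b : nat) (l x y : C) : (1 <= N)%nat -> onE N (l, (Fin x, Fin y)) -> y <> 0 ->
  exists r, (0 < r)%R /\ forall x' y' : C, (Cmod (x' - x) < r)%R -> y' <> 0 ->
    D1 (GG N a b (l, (Fin x, Fin y)) (l, (Fin x', Fin y'))) l (prim (Hf1 N a b false y) x l x').
Proof.
  intros HN H Y. destruct (onE_fin N l x y HN H Y) as [L [A K]].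
  destruct (chart_disc N a b false l x y HN A Y K) as [r [Hr [P _]]].
  exists r. split; auto. intros x' y' Hx Hy.
  apply (D1_ext (fun w => prim (Hf N a b false y) x w x')).
  - intros w. rewrite GG_fin; auto.
  - eapply D2_slice1. apply P; auto. rewrite Cmod_diag. lra.
Qed.

(* Near a branch point with [y = 0] the chart uses [y]; passing to the
   coordinate [x] adds the exact term [x^a y^b / l]. *)
Lemma GG_deriv_small (N a b : nat) (l x0 y0 e : C) (r0 : R) : (2 <= N)%nat ->
  (1 <= a <= N - 1)%nat -> (1 <= b <= N - 1)%nat -> onE N (l, (Fin x0, Fin y0)) -> (0 < r0)%R ->
  exists r, (0 < r)%R /\ forall x y : C, onE N (l, (Fin x, Fin y)) -> x <> 0 -> y <> 0 ->
    (Cmod (x - x0) < r)%R -> (Cmod (y - y0) < r)%R ->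
    exists v, D1 (GG N a b (l, (Fin x0, Fin y0)) (l, (Fin x, Fin y))) l v /\ (Cmod v < r0)%R.
Proof.
  intros HN Ha Hb H He. assert (HN1 : (1 <= N)%nat) by lia.
  assert (L : l <> 0) by apply H.
  destruct (Ceq_dec y0 0) as [Y0|Y0].
  - subst y0. destruct (kind_spec N l _ HN1 H) as [_ [O [A [K _]]]].
    assert (k1 : kind_sw (Fin x0, Fin 0) = true /\ kind_inf (Fin x0, Fin 0) = false /\
       pz (Fin x0, Fin 0) = 0 /\ po (Fin x0, Fin 0) = x0).
    { unfold pz, po, kind_sw, kind_inf. destruct (Ceq_dec 0 0); [|easy]. repeat split. }
    destruct k1 as [k1 [k2 [k3 k4]]]. rewrite k2, k3, k4 in *.
    destruct (chart_disc N b a false l 0 x0 HN1 A O K) as [r1 [Hr1 [P Br]]].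
    destruct (prim_Hf1_D1 N b a l 0 x0 HN1 A O K) as [r2 [Hr2 P2]].
    (* Derivative in [l] at fixed [x], computed in the chart [y]: the first term comes from the
       explicit dependence on [l], the second from the motion of [y]. It vanishes at the branch
       point because [b >= 1]. *)
    set (V := fun x y => - prim (Hf1 N b a false x0) 0 l y + x ^ a * y ^ b / l).
    assert (DV : exists u v, D2 V x0 0 u v).
    { do 2 eexists. unfold V. apply D2_add.
      - apply D2_opp. apply (D2_of_D1 (fun y => prim (Hf1 N b a false x0) 0 l y) (fun _ y => y)).
        + apply P2. rewrite Cmod_diag. lra.
        + apply D2_snd.
      - apply D2_div; [exact L| |apply (D2_const l)].
        apply D2_mul; [apply (D2_pow (fun x _ => x)), D2_fst|apply (D2_pow (fun _ y => y)), D2_snd]. }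
    destruct DV as [u [v DV]].
    assert (V0 : V x0 0 = 0).
    { unfold V. rewrite prim_center. destruct b; [lia|]. rewrite (Cpow_S 0). field. auto. }
    destruct (D2_cont _ _ _ _ _ DV r0 He) as [r3 [Hr3 P3]]. rewrite V0 in P3.
    set (r := Rmin r1 r3). assert (m1 := Rmin_l r1 r3). assert (m2 := Rmin_r r1 r3). fold r in m1, m2.
    exists r. split; [unfold r; now apply Rmin_pos|]. intros x y Hxy X Y Bx By.
    destruct (onE_fin N l x y HN1 Hxy Y) as [_ [AX KX]].
    destruct (ybr_center N false l x y HN1 AX Y KX) as [Ec Hok].
    exists (V x y). split; [|replace (V x y) with (V x y - 0) by ring; apply P3; lra].
    assert (DY := D2_slice1 _ _ _ _ _ (ybr_D2 N false y l x HN1 Hok)).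
    assert (Z : (Cmod (l - l) < r1)%R) by (rewrite Cmod_diag; lra).
    destruct (P l y Z ltac:(lra)) as [_ DP].
    assert (Kx : on_chart N false l y x).
    { apply (on_curve_mk N l y x true false HN1). apply Hxy. }
    assert (Eb : ybr N false x0 l y = x) by (apply Br; auto; lra).
    apply (D1_ext (fun w => - prim (Hf N b a false x0) 0 w (ybr N false y w x))).
    { intros w. unfold GG, Psi, pt. cbn [snd]. destruct (finite_kind x y Y) as [j1 [j2 [j3 j4]]].
      rewrite k1, k2, k3, k4, j1, j2, j3, j4. unfold CI, cm, ck, csgn, mk, zc. cbn [fst snd cfin]. ring. }
    rewrite <- Ec in DP at 1.
    eapply D1_eq; [apply D1_opp; apply (D1_comp2 (prim (Hf N b a false x0) 0) (fun w => w) (fun w => ybr N false y w x)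
      l _ _ _ _ DP (D1_id l) DY)|].
    unfold V, Hf, ybr_l. rewrite Ec, Eb. unfold cden_l.
    destruct (ybr_z_sym N y l x HN1 L X Hok) as [YN _]. rewrite Ec in YN.
    assert (Py : y ^ (b - 1) * y = y ^ b) by (apply Cpow_pred_mul; lia).
    assert (XN := Cpow_nz x N X).
    assert (Dn : cden N false l x = l * x ^ N / (1 - y ^ N)).
    { assert (E : (1 - y ^ N) * cden N false l x = l * x ^ N).
      { replace ((1 - y ^ N) * cden N false l x) with (cden N false l x - y ^ N * cden N false l x) by ring.
        unfold on_chart in KX. rewrite KX. unfold cden. ring. }
      rewrite <- E. field. auto. }
    rewrite Dn, <- Py. assert (HNn := RtoC_INR_neq0 N ltac:(lia)). field. auto.
  - destruct (onE_fin N l x0 y0 HN1 H Y0) as [_ [A K]].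
    destruct (GG_fin_D1 N a b l x0 y0 HN1 H Y0) as [r1 [Hr1 P1]].
    destruct (prim_Hf1_D1 N a b l x0 y0 HN1 A Y0 K) as [r2 [Hr2 P2]].
    destruct (D1_cont _ _ _ (P2 x0 ltac:(rewrite Cmod_diag; lra)) r0 He) as [r3 [Hr3 P3]].
    rewrite prim_center in P3.
    exists (Rmin r1 r3). split; [now apply Rmin_pos|]. intros x y Hxy X Y Bx By.
    assert (m1 := Rmin_l r1 r3). assert (m2 := Rmin_r r1 r3).
    exists (prim (Hf1 N a b false y0) x0 l x). split; [apply P1; auto; lra|].
    replace (prim (Hf1 N a b false y0) x0 l x) with (prim (Hf1 N a b false y0) x0 l x - 0) by ring.
    apply P3. lra.
Qed.

Lemma Psi_small (N a b : nat) (q : C * point) (e : R) : (2 <= N)%nat ->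
  (1 <= a <= N - 1)%nat -> (1 <= b <= N - 1)%nat -> onE N q -> (0 < e)%R ->
  exists r, (0 < r)%R /\ forall p, qball r q (fst q, p) -> (Cmod (Psi N a b q (fst q) p) < e)%R.
Proof.
  intros HN Ha Hb H He. destruct (chart_change_near N a b q HN Ha Hb H) as [r0 [Hr0 [D _]]].
  destruct q as [l p0]. cbn [fst snd] in *.
  set (sw := kind_sw p0) in *. set (inf := kind_inf p0) in *.
  assert (Z : forall w : C, (Cmod (w - w) < r0)%R) by (intros; rewrite Cmod_diag; lra).
  destruct (D2_cont _ _ _ _ _ (D l (pz p0) (Z _) (Z _)) e He) as [r [Hr P]].
  exists r. split; auto. intros p Hp. apply (qball_chart N (l, p0)) in Hp; auto; [|lia].
  cbn [fst snd] in Hp. fold sw inf in Hp. destruct Hp as [B1 [_ [B2 _]]].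
  specialize (P l (zc sw inf p) B1 B2). unfold Psi. cbn [snd]. fold sw inf.
  unfold CI at 2 in P. rewrite prim_center in P.
  replace (CI N a b sw inf (pz p0) (po p0) l (zc sw inf p)) with
    (CI N a b sw inf (pz p0) (po p0) l (zc sw inf p) - csgn sw * 0) by ring. exact P.
Qed.

(** The family [h] of germs gives both integrals. Its value at [l] is a primitive of [omega] along
    the path; its derivative in [l], called [dh], is a primitive of [nu]. Inside the interval both
    are checked in the chart [x]; at the ends only continuity has to be seen. *)
Lemma smooth_integrals (N a b : nat) (l : C) (sg : path) (T : C -> C) (x y dx dy : R -> C) :
  (2 <= N)%nat -> (1 <= a <= N - 1)%nat -> (1 <= b <= N - 1)%nat ->
  (forall s, unit_interval s -> onE N (l, sg s)) ->
  (forall s, unit_interval s -> forall r, (0 < r)%R -> exists d, (0 < d)%R /\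
     forall s', unit_interval s' -> (Rabs (s' - s) < d)%R -> qball r (l, sg s) (l, sg s')) ->
  smooth_coordinates sg x y dx dy -> PG (GG N a b) l sg 0 1 T ->
  @is_RInt_gen C_R_NormedModule (fun s => omega N a b (x s) (y s) (dx s) (dy s)) (at_right 0) (at_left 1) (T l) /\
  exists T', D1 T l T' /\
  @is_RInt_gen C_R_NormedModule (fun s => nu l a b (x s) (y s) (dx s) (dy s)) (at_right 0) (at_left 1) T'.
Proof.
  intros HN Ha Hb HE Hc [Hxy Hsm] [h [Hh HT]]. assert (HN1 : (1 <= N)%nat) by lia.
  assert (L : l <> 0) by (apply (HE 0%R); unfold unit_interval; lra).
  assert (Hder : forall s, exists v, unit_interval s -> D1 (h s) l v).
  { intros s. destruct (classic (unit_interval s)) as [Hs|Hs].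
    - destruct (Hh s Hs) as [[r [f' [Hr K]]] _]. exists (f' l). intros _. apply K. rewrite Cmod_diag; lra.
    - exists 0. easy. }
  set (dh := fun s => proj1_sig (constructive_indefinite_description _ (Hder s))).
  assert (Hdh : forall s, unit_interval s -> D1 (h s) l (dh s)).
  { intros s. unfold dh. destruct (constructive_indefinite_description _ (Hder s)) as [v Hv]. exact Hv. }
  assert (U : forall s, (0 < s < 1)%R -> unit_interval s) by (unfold unit_interval; intros; lra).
  assert (Hinc : forall s, unit_interval s -> exists d, (0 < d)%R /\ forall s', unit_interval s' ->
     (Rabs (s' - s) < d)%R -> h s' l - h s l = Psi N a b (l, sg s) l (sg s') /\
       D1 (GG N a b (l, sg s) (l, sg s')) l (dh s' - dh s)).
  { intros s Hs. destruct (Hh s Hs) as [_ [d [Hd P]]]. exists d. split; auto. intros s' Hs' Hd'.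
    assert (Q := P s' Hs' Hd'). split.
    - apply eq_near_at in Q. rewrite Q. unfold GG.
      assert (Ep := pt_self N (l, sg s') HN1 (HE s' Hs')). cbn [fst snd] in Ep. now rewrite Ep.
    - destruct Q as [r [Hr Q]]. apply (D1_ext_near (fun x => h s' x - h s x) _ _ _ r Hr); auto.
      apply D1_sub; auto. }
  assert (Hcx : forall s, unit_interval s -> forall r, (0 < r)%R -> exists d, (0 < d)%R /\ forall s', unit_interval s' ->
     (Rabs (s' - s) < d)%R -> (Cmod (x s' - x s) < r)%R /\ (Cmod (y s' - y s) < r)%R).
  { intros s Hs r Hr. destruct (Hc s Hs r Hr) as [d [Hd P]]. exists d. split; auto. intros s' Hs' Hss.
    specialize (P s' Hs' Hss). rewrite !Hxy in P by auto. destruct P as [_ [P1 P2]]. split; [exact P1|exact P2]. }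
  assert (cE : forall s, unit_interval s -> ccont01 (fun s => h s l) s).
  { intros s Hs e He. destruct (Psi_small N a b (l, sg s) e HN Ha Hb (HE s Hs) He) as [r [Hr P]].
    destruct (Hc s Hs r Hr) as [d1 [Hd1 P1]]. destruct (Hinc s Hs) as [d2 [Hd2 P2]].
    exists (Rmin d1 d2). split; [now apply Rmin_pos|].
    assert (m1 := Rmin_l d1 d2). assert (m2 := Rmin_r d1 d2). intros s' Hs' Hss.
    destruct (P2 s' Hs' ltac:(lra)) as [E _]. rewrite E. apply P, P1; auto; lra. }
  (* An end may be a branch point with [y = 0], while nearby points of the path are not;
     [GG_deriv_small] covers both situations. *)
  assert (cD : forall s, (s = 0 \/ s = 1)%R -> ccont01 dh s).
  { intros s Hs01 e He. assert (Hs : unit_interval s) by (unfold unit_interval; lra).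
    assert (HEs := HE s Hs). rewrite Hxy in HEs by auto.
    destruct (GG_deriv_small N a b l (x s) (y s) 0 e HN Ha Hb HEs He) as [r [Hr P]].
    destruct (Hcx s Hs r Hr) as [d1 [Hd1 P1]]. destruct (Hinc s Hs) as [d2 [Hd2 P2]].
    exists (Rmin (Rmin d1 d2) (/ 2)). split; [repeat apply Rmin_pos; auto; lra|].
    assert (m1 := Rmin_l d1 d2). assert (m2 := Rmin_r d1 d2).
    assert (m3 := Rmin_l (Rmin d1 d2) (/ 2)). assert (m4 := Rmin_r (Rmin d1 d2) (/ 2)).
    intros s' Hs' Hss. destruct (Req_dec s' s) as [->|ne]; [rewrite Cmod_diag; lra|].
    assert (Hi : (0 < s' < 1)%R).
    { unfold unit_interval in Hs'. apply Rabs_def2 in Hss. destruct Hs01; subst s; lra. }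
    destruct (Hsm s' Hi) as [X [Y _]]. destruct (P1 s' Hs' ltac:(lra)) as [Bx By].
    destruct (P2 s' Hs' ltac:(lra)) as [_ D]. rewrite !Hxy in D by auto.
    assert (HEs' := HE s' Hs'). rewrite Hxy in HEs' by auto.
    destruct (P (x s') (y s') HEs' X Y Bx By) as [v [Dv Bv]].
    now rewrite (D1_unique _ _ _ _ D Dv). }
  (* Near [s] the function [y] must follow the branch over [x], so [dy] is forced by [dx]; this
     eliminates [dy] from [nu]. *)
  assert (Int : forall s, (0 < s < 1)%R -> exists X0 : x s <> 0, exists Y0 : y s <> 0,
     rder x s (dx s) /\ rder y s (dy s) /\ 1 - x s ^ N <> 0 /\ on_chart N false l (x s) (y s) /\
     dy s = ybr_z N false (y s) l (x s) * dx s).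
  { intros s Hs. destruct (Hsm s Hs) as [X [Y [Dx [Dy _]]]]. exists X, Y.
    apply rder_is_derive in Dx. apply rder_is_derive in Dy.
    assert (HEs := HE s (U s Hs)). rewrite Hxy in HEs by auto.
    destruct (onE_fin N l (x s) (y s) HN1 HEs Y) as [_ [A K]]. repeat split; auto.
    destruct (chart_disc N a b false l (x s) (y s) HN1 A Y K) as [r [Hr [P Br]]].
    destruct (ybr_center N false l (x s) (y s) HN1 A Y K) as [Ec Hok].
    destruct (Hcx s (U s Hs) r Hr) as [d [Hd Pd]].
    apply (rder_unique y s); auto.
    apply (rder_ext_near (fun s' => ybr N false (y s) l (x s')) y s (Rmin d (Rmin s (1 - s)))).
    - repeat apply Rmin_pos; lra.
    - intros s' Hs'. assert (m1 := Rmin_l d (Rmin s (1 - s))). assert (m2 := Rmin_r d (Rmin s (1 - s))).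
      assert (m3 := Rmin_l s (1 - s)). assert (m4 := Rmin_r s (1 - s)).
      assert (Hi : unit_interval s') by (apply U; apply Rabs_def2 in Hs'; lra).
      destruct (Pd s' Hi ltac:(lra)) as [Bx By]. apply Br; auto; [rewrite Cmod_diag; lra|].
      apply (on_curve_mk N l (x s') (y s') false false HN1).
      assert (Q := HE s' Hi). rewrite Hxy in Q by auto. apply Q.
    - apply (rder_D1 (fun z => ybr N false (y s) l z)); auto.
      eapply D2_slice2. now apply ybr_D2. }
  assert (rE : forall s, (0 < s < 1)%R -> rder (fun s => h s l) s (omega N a b (x s) (y s) (dx s) (dy s))).
  { intros s Hs. destruct (Int s Hs) as [X [Y [Dx [Dy [A [K _]]]]]].
    destruct (Hinc s (U s Hs)) as [d [Hd P]].
    apply (rder_ext_near (fun s' => prim (Hf N a b false (y s)) (x s) l (x s') + h s l) _ s (Rmin d (Rmin s (1 - s)))).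
    - repeat apply Rmin_pos; lra.
    - intros s' Hs'. assert (m1 := Rmin_l d (Rmin s (1 - s))). assert (m2 := Rmin_r d (Rmin s (1 - s))).
      assert (m3 := Rmin_l s (1 - s)). assert (m4 := Rmin_r s (1 - s)).
      assert (Hi : (0 < s' < 1)%R) by (apply Rabs_def2 in Hs'; lra).
      destruct (P s' (U s' Hi) ltac:(lra)) as [E _].
      replace (h s' l) with (h s' l - h s l + h s l) by ring. rewrite E. f_equal.
      destruct (Hsm s' Hi) as [X' [Y' _]].
      rewrite !Hxy by auto. unfold Psi. cbn [snd].
      destruct (finite_kind (x s) (y s) Y) as [k1 [k2 [k3 k4]]]. rewrite k1, k2, k3, k4.
      unfold CI, cm, ck, csgn, zc. cbn [fst snd cfin]. ring.
    - destruct (chart_disc N a b false l (x s) (y s) HN1 A Y K) as [r [Hr [Pc _]]].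
      destruct (Pc l (x s)) as [_ DP]; try (rewrite Cmod_diag; lra).
      destruct (ybr_center N false l (x s) (y s) HN1 A Y K) as [Ec _].
      eapply rder_eq.
      + apply rder_add; [|apply rder_const].
        apply (rder_D1 (fun z => prim (Hf N a b false (y s)) (x s) l z)); [eapply D2_slice2, DP|exact Dx].
      + unfold omega, Hf. rewrite Ec. rewrite <- (Cpow_pred_mul (x s) a) by lia. field. auto. }
  assert (rD : forall s, (0 < s < 1)%R -> rder dh s (nu l a b (x s) (y s) (dx s) (dy s))).
  { intros s Hs. destruct (Int s Hs) as [X [Y [Dx [Dy [A [K Edy]]]]]].
    assert (HEs := HE s (U s Hs)). rewrite Hxy in HEs by auto.
    destruct (Hinc s (U s Hs)) as [d [Hd P]].
    destruct (GG_fin_D1 N a b l (x s) (y s) HN1 HEs Y) as [r [Hr Pr]].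
    destruct (Hcx s (U s Hs) r Hr) as [d2 [Hd2 P2]].
    apply (rder_ext_near (fun s' => prim (Hf1 N a b false (y s)) (x s) l (x s') + dh s) _ s
       (Rmin (Rmin d d2) (Rmin s (1 - s)))).
    - repeat apply Rmin_pos; lra.
    - intros s' Hs'. assert (m1 := Rmin_l (Rmin d d2) (Rmin s (1 - s))).
      assert (m2 := Rmin_r (Rmin d d2) (Rmin s (1 - s))).
      assert (m3 := Rmin_l s (1 - s)). assert (m4 := Rmin_r s (1 - s)).
      assert (m5 := Rmin_l d d2). assert (m6 := Rmin_r d d2).
      assert (Hi : (0 < s' < 1)%R) by (apply Rabs_def2 in Hs'; lra).
      destruct (P s' (U s' Hi) ltac:(lra)) as [_ D]. destruct (Hsm s' Hi) as [X' [Y' _]].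
      rewrite !Hxy in D by auto. destruct (P2 s' (U s' Hi) ltac:(lra)) as [Bx _].
      rewrite (D1_unique _ _ _ _ (Pr (x s') (y s') Bx Y') D). ring.
    - destruct (prim_Hf1_D1 N a b l (x s) (y s) HN1 A Y K) as [r2 [Hr2 Pc]].
      assert (DP := Pc (x s) ltac:(rewrite Cmod_diag; lra)).
      destruct (ybr_center N false l (x s) (y s) HN1 A Y K) as [Ec Hok].
      eapply rder_eq.
      + apply rder_add; [|apply rder_const].
        apply (rder_D1 (fun z => prim (Hf1 N a b false (y s)) (x s) l z)); [exact DP|exact Dx].
      + unfold nu. rewrite Edy. destruct (ybr_z_sym N (y s) l (x s) HN1 L X Hok) as [YN Ez]. rewrite Ec in YN, Ez.
        assert (XN := Cpow_nz (x s) N X).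
        assert (B := on_chart_den_neq0 _ _ _ _ _ A K).
        assert (E1 : (1 - y s ^ N) * cden N false l (x s) = l * x s ^ N).
        { replace ((1 - y s ^ N) * cden N false l (x s)) with (cden N false l (x s) - y s ^ N * cden N false l (x s)) by ring.
          unfold on_chart in K. rewrite K. unfold cden. ring. }
        assert (E2 : ybr_z N false (y s) l (x s) = - (y s * (l * x s ^ N / cden N false l (x s))) / (x s * (1 - x s ^ N))).
        { rewrite <- E1.
          replace (y s * ((1 - y s ^ N) * cden N false l (x s) / cden N false l (x s))) with (y s * (1 - y s ^ N))
            by (field; auto).
          rewrite <- Ez. field. auto. }
        rewrite E2. unfold Hf1, cden_l. rewrite Ec. rewrite <- (Cpow_pred_mul (x s) a) by lia.
        field. repeat split; auto. }
  assert (Q0 : unit_interval 0) by (unfold unit_interval; lra).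
  assert (Q1 : unit_interval 1) by (unfold unit_interval; lra).
  assert (Cin : forall s, (0 < s < 1)%R -> ccont x s /\ ccont y s /\ ccont dx s /\ ccont dy s).
  { intros s Hs. destruct (Int s Hs) as [X [Y [Dx [Dy _]]]]. destruct (Hsm s Hs) as [_ [_ [_ [_ [C1 C2]]]]].
    repeat split; try (eapply rder_ccont; eauto; fail); now apply ccont_continuous. }
  split.
  - rewrite <- (eq_near_at _ _ _ HT). apply (is_RInt_gen_primitive (fun s => h s l)); auto.
    intros s Hs. destruct (Int s Hs) as [X [Y [_ [_ [A _]]]]]. destruct (Cin s Hs) as [c1 [c2 [c3 c4]]].
    unfold omega. apply ccont_mul; [apply ccont_mul; [apply ccont_const|]|apply ccont_mul; [auto|now apply ccont_inv]].
    apply ccont_mul; [apply ccont_mul; now apply ccont_pow|apply ccont_inv; auto].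
    apply ccont_sub; [apply ccont_const|now apply ccont_pow].
  - exists (dh 1%R - dh 0%R). split.
    + destruct HT as [r [Hr HT]]. apply (D1_ext_near (fun x => h 1%R x - h 0%R x) _ _ _ r Hr); auto.
      apply D1_sub; auto.
    + apply is_RInt_gen_primitive; auto.
      intros s Hs. destruct (Int s Hs) as [X [Y [_ [_ [A _]]]]]. destruct (Cin s Hs) as [c1 [c2 [c3 c4]]].
      unfold nu. apply ccont_mul; [apply ccont_mul; [apply ccont_const|]|apply ccont_mul; [auto|now apply ccont_inv]].
      apply ccont_mul; now apply ccont_pow.
Qed.

(** * Gamma and beta functions *)

Local Open Scope R_scope.

(** A common frame for the half-line of [Gamma] and the unit interval of [Beta]; [Fa] and [Fb] are
    the filters of the two ends. *)
Definition improper_interval (I : R -> Prop) (Fa Fb : (R -> Prop) -> Prop) : Prop :=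
  (forall x y z, I x -> I z -> x <= y <= z -> I y) /\ (exists c, I c) /\
  (forall c, I c -> Fa (fun x => I x /\ x <= c)) /\ (forall c, I c -> Fb (fun x => I x /\ c <= x)).

Lemma improper_half_line : improper_interval (fun x => 0 < x) (at_right 0) (Rbar_locally p_infty).
Proof.
  split; [intros; lra|]. split; [exists 1; lra|]. split; intros c Hc.
  - exists (mkposreal c Hc). intros x Hx Hx0. split; auto. unfold ball in Hx; simpl in Hx.
    unfold AbsRing_ball, abs, minus, plus, opp in Hx; simpl in Hx. apply Rabs_def2 in Hx. lra.
  - exists c. intros x Hx. split; lra.
Qed.

Lemma improper_unit : improper_interval (fun x => 0 < x < 1) (at_right 0) (at_left 1).
Proof.
  split; [intros; lra|]. split; [exists (/ 2); lra|]. split; intros c Hc.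
  - assert (H0 : 0 < c) by lra.
    exists (mkposreal c H0). intros x Hx Hx0. unfold ball in Hx; simpl in Hx.
    unfold AbsRing_ball, abs, minus, plus, opp in Hx; simpl in Hx. apply Rabs_def2 in Hx. lra.
  - assert (H0 : 0 < 1 - c) by lra.
    exists (mkposreal _ H0). intros x Hx Hx0. unfold ball in Hx; simpl in Hx.
    unfold AbsRing_ball, abs, minus, plus, opp in Hx; simpl in Hx. apply Rabs_def2 in Hx. lra.
Qed.

Lemma is_RInt_on (I : R -> Prop) (f : R -> R) (x y : R) :
  (forall x y z, I x -> I z -> x <= y <= z -> I y) ->
  (forall t, I t -> continuous f t) -> I x -> I y -> x <= y -> is_RInt f x y (RInt f x y).
Proof.
  intros Hc Hf Hx Hy Hxy. apply (RInt_correct (V := R_CompleteNormedModule)).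
  apply (ex_RInt_continuous (V := R_CompleteNormedModule)).
  intros t Ht. rewrite Rmin_left, Rmax_right in Ht by lra. apply Hf. apply (Hc x t y); auto.
Qed.

(* Monotone convergence against an explicit bounded primitive [G] of a majorant. *)
Lemma is_RInt_gen_dominated (I : R -> Prop) (Fa Fb : (R -> Prop) -> Prop) (f g G : R -> R) (K : R) :
  improper_interval I Fa Fb -> 0 <= K ->
  (forall t, I t -> continuous f t) -> (forall t, I t -> continuous g t) ->
  (forall t, I t -> is_derive G t (g t)) -> (forall t, I t -> Rabs (G t) <= 1) ->
  (forall t, I t -> 0 <= f t <= K * g t) ->
  exists S, is_RInt_gen f Fa Fb S /\ forall x y, I x -> I y -> x <= y -> RInt f x y <= S.
Proof.
  intros [Hc [[c Ic] [HFa HFb]]] HK Hf Hg HG HB Hfg.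
  assert (Bd : forall x y, I x -> I y -> x <= y -> RInt f x y <= 2 * K).
  { intros x y Hx Hy Hxy.
    assert (A : RInt f x y <= K * (G y - G x)).
    { apply (is_RInt_le f (fun t => K * g t) x y); auto.
      - now apply (is_RInt_on I).
      - apply (is_RInt_scal (V := R_NormedModule)).
        apply (is_RInt_derive (V := R_CompleteNormedModule)); rewrite Rmin_left, Rmax_right by lra;
          intros t Ht; [apply HG|apply Hg]; apply (Hc x t y); auto.
      - intros t Ht. apply Hfg, (Hc x t y); auto; lra. }
    assert (B1 := HB x Hx). assert (B2 := HB y Hy). apply Rabs_le_between in B1, B2.
    assert (K * (G y - G x) <= K * 2) by (apply Rmult_le_compat_l; lra). lra. }
  set (E := fun v => exists x y, I x /\ I y /\ x <= y /\ v = RInt f x y).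
  destruct (completeness E) as [S [HS1 HS2]].
  { exists (2 * K). intros v [x [y [Hx [Hy [Hxy ->]]]]]. now apply Bd. }
  { exists (RInt f c c), c, c. repeat split; auto; lra. }
  exists S. split.
  - intros P [eps HP].
    assert (Q : exists x y, I x /\ I y /\ x <= y /\ S - eps < RInt f x y).
    { apply NNPP. intros N. assert (S <= S - eps); [|generalize (cond_pos eps); lra].
      apply HS2. intros v [x [y [Hx [Hy [Hxy ->]]]]]. apply Rnot_lt_le. intros M. apply N.
      exists x, y. auto. }
    destruct Q as [x0 [y0 [Hx0 [Hy0 [Hxy0 HQ]]]]].
    apply Filter_prod with (fun x => I x /\ x <= x0) (fun y => I y /\ y0 <= y); auto.
    intros x y [Hx Hxx] [Hy Hyy]. cbn [fst snd]. exists (RInt f x y).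
    assert (J := is_RInt_on I f x y Hc Hf Hx Hy ltac:(lra)). split; auto.
    apply HP. unfold ball; simpl. unfold AbsRing_ball, abs, minus, plus, opp; simpl.
    assert (L1 : RInt f x y <= S) by (apply HS1; exists x, y; repeat split; auto; lra).
    assert (Nn : forall u v, I u -> I v -> u <= v -> 0 <= RInt f u v).
    { intros u v Hu Hv Huv. apply RInt_ge_0; auto.
      - eexists. now apply (is_RInt_on I).
      - intros t Ht. apply Hfg, (Hc u t v); auto; lra. }
    assert (E1 : RInt f x y = RInt f x x0 + RInt f x0 y0 + RInt f y0 y).
    { apply (is_RInt_unique (V := R_CompleteNormedModule)).
      apply (is_RInt_Chasles (V := R_NormedModule)) with y0.
      - apply (is_RInt_Chasles (V := R_NormedModule)) with x0; apply (is_RInt_on I); auto.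
      - now apply (is_RInt_on I). }
    assert (N1 := Nn x x0 Hx Hx0 Hxx). assert (N2 := Nn y0 y Hy0 Hy Hyy).
    apply Rabs_def1; lra.
  - intros x y Hx Hy Hxy. apply HS1. exists x, y. auto.
Qed.

Lemma is_RInt_gen_FTC (I : R -> Prop) (Fa Fb : (R -> Prop) -> Prop) (f F : R -> R) (la lb : R) :
  improper_interval I Fa Fb -> Filter Fa -> Filter Fb ->
  (forall t, I t -> is_derive F t (f t)) -> (forall t, I t -> continuous f t) ->
  (forall e, 0 < e -> Fa (fun x => I x /\ Rabs (F x - la) < e)) ->
  (forall e, 0 < e -> Fb (fun x => I x /\ Rabs (F x - lb) < e)) ->
  is_RInt_gen f Fa Fb (lb - la).
Proof.
  intros [Hc _] FFa FFb HF Hf Ha Hb P [eps HP].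
  assert (He : 0 < eps / 2) by (generalize (cond_pos eps); lra).
  apply Filter_prod with (1 := Ha _ He) (2 := Hb _ He).
  intros x y [Hx Hxl] [Hy Hyl]. cbn [fst snd]. exists (F y - F x). split.
  - assert (Hin : forall t, Rmin x y <= t <= Rmax x y -> I t).
    { intros t. unfold Rmin, Rmax. destruct (Rle_dec x y); intros Ht;
        [apply (Hc x t y)|apply (Hc y t x)]; auto. }
    apply (is_RInt_derive (V := R_CompleteNormedModule)); auto.
  - apply HP. unfold ball; simpl. unfold AbsRing_ball, abs, minus, plus, opp; simpl.
    apply Rabs_def2 in Hxl, Hyl. apply Rabs_def1; lra.
Qed.

Lemma Rpower_derive (p t : R) : 0 < t ->
  is_derive (fun t => Rpower t p) t (p * Rpower t (p - 1)).
Proof. intros Ht. apply is_derive_Reals. now apply derivable_pt_lim_power. Qed.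

Lemma Rpower_continuous (p t : R) : 0 < t -> continuous (fun t => Rpower t p) t.
Proof. intros Ht. apply (ex_derive_continuous (V := R_NormedModule)). eexists. now apply Rpower_derive. Qed.

Lemma Rpower_minus1 (t p : R) : 0 < t -> t * Rpower t (p - 1) = Rpower t p.
Proof.
  intros Ht. rewrite <- (Rpower_1 t) at 1 by auto. rewrite <- Rpower_plus. f_equal. ring.
Qed.

Lemma Rpower_lt1 (t p : R) : 0 < t <= 1 -> 0 < p -> Rpower t p <= 1.
Proof.
  intros Ht Hp. rewrite <- (Rpower_O t) by lra. unfold Rpower. rewrite Rmult_0_l, exp_0.
  rewrite <- exp_0. destruct (Req_dec t 1) as [->|n].
  - rewrite ln_1. right. f_equal. ring.
  - left. apply exp_increasing. assert (ln t < 0) by (rewrite <- ln_1; apply ln_increasing; lra). nra.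
Qed.

Lemma Rpower_small (p e : R) : 0 < p -> 0 < e -> exists d, 0 < d /\ forall t, 0 < t < d -> 0 < Rpower t p < e.
Proof.
  intros Hp He. exists (Rpower e (/ p)). split; [apply exp_pos|]. intros t Ht. split; [apply exp_pos|].
  replace e with (Rpower (Rpower e (/ p)) p).
  - unfold Rpower at 1. unfold Rpower at 1. apply exp_increasing. apply Rmult_lt_compat_l; auto.
    apply ln_increasing; lra.
  - rewrite Rpower_mult, Rinv_l by lra. now apply Rpower_1.
Qed.

(** After replacing [p] by an integer [k >= p], this is the [k]-th power of [1 + x <= exp x]. The
    rate [t / 2] is chosen because the bound gets squared for [Gamma]. *)
Lemma Rpower_exp_bound (p : R) : 0 < p -> exists K, 0 < K /\ forall t, 0 < t -> 1 + Rpower t p <= K * exp (t / 2).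
Proof.
  intros Hp. destruct (nfloor_ex p) as [n [_ Hn]]; [lra|].
  set (k := S n). assert (Hk : 1 <= INR k) by (unfold k; rewrite S_INR; generalize (pos_INR n); lra).
  assert (Hpk : p <= INR k) by (unfold k; rewrite S_INR; lra).
  exists ((1 + (2 * INR k) ^ k) * exp (/ 2)).
  assert (P2 : 0 < (2 * INR k) ^ k) by (apply pow_lt; lra).
  split; [apply Rmult_lt_0_compat; [lra|apply exp_pos]|].
  intros t Ht. set (u := (1 + t) / 2).
  replace ((1 + (2 * INR k) ^ k) * exp (/ 2) * exp (t / 2)) with ((1 + (2 * INR k) ^ k) * exp u).
  2:{ rewrite Rmult_assoc, <- exp_plus. unfold u. do 2 f_equal. field. }
  assert (H1 : 1 <= exp u) by (generalize (exp_ineq1 u); unfold u in *; lra).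
  assert (H2 : Rpower t p <= (1 + t) ^ k).
  { rewrite <- (Rpower_pow k (1 + t)) by lra. apply Rle_trans with (Rpower (1 + t) p).
    - unfold Rpower. left. apply exp_increasing. apply Rmult_lt_compat_l; auto. apply ln_increasing; lra.
    - apply Rle_Rpower; lra. }
  assert (H3 : (1 + t) ^ k <= (2 * INR k) ^ k * exp u).
  { replace (1 + t) with ((2 * INR k) * (u / INR k)) by (unfold u; field; lra).
    rewrite Rpow_mult_distr. apply Rmult_le_compat_l; [lra|].
    replace u with (INR k * (u / INR k)) at 2 by (field; lra).
    assert (Q : 0 <= u / INR k) by (apply Rmult_le_pos; [unfold u; lra|left; apply Rinv_0_lt_compat; lra]).
    apply Rle_trans with (exp (u / INR k) ^ k).
    - apply pow_incr. split; auto. generalize (exp_ineq1_le (u / INR k)). lra.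
    - right. rewrite <- (Rpower_pow k (exp (u / INR k))) by apply exp_pos. unfold Rpower. now rewrite ln_exp. }
  nra.
Qed.

Definition gamma_w (p t : R) : R := Rpower t (p - 1) * exp (- t).

Lemma gamma_w_continuous (p t : R) : 0 < t -> continuous (gamma_w p) t.
Proof.
  intros Ht. apply (continuous_mult (K := R_AbsRing)); [now apply Rpower_continuous|].
  apply (ex_derive_continuous (V := R_NormedModule)). auto_derive. auto.
Qed.

(** The integrand is at most a constant times the derivative of the bounded function
    [- / (1 + Rpower t p)]. This single majorant controls both ends. *)
Lemma Gamma_is_RInt (p : R) : 0 < p ->
  is_RInt_gen (gamma_w p) (at_right 0) (Rbar_locally p_infty) (Gamma p) /\ 0 < Gamma p.
Proof.
  intros Hp. destruct (Rpower_exp_bound p Hp) as [K [HK PK]].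
  set (g := fun t => p * Rpower t (p - 1) / ((1 + Rpower t p) * (1 + Rpower t p))).
  assert (pos : forall t q, 0 < Rpower t q) by (intros; apply exp_pos).
  destruct (is_RInt_gen_dominated (fun x => 0 < x) (at_right 0) (Rbar_locally p_infty)
    (gamma_w p) g (fun t => - / (1 + Rpower t p)) (K * K / p)) as [S [HS HS']].
  - apply improper_half_line.
  - apply Rmult_le_pos; [nra|left; now apply Rinv_0_lt_compat].
  - intros t Ht. now apply gamma_w_continuous.
  - intros t Ht. unfold g. apply (continuous_mult (K := R_AbsRing)).
    + apply (continuous_mult (K := R_AbsRing)); [apply continuous_const|now apply Rpower_continuous].
    + apply (continuous_comp (fun t => (1 + Rpower t p) * (1 + Rpower t p)) Rinv).
      * assert (C1 : continuous (fun t => 1 + Rpower t p) t)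
          by (apply (continuous_plus (V := R_NormedModule)); [apply continuous_const|now apply Rpower_continuous]).
        now apply (continuous_mult (K := R_AbsRing)).
      * apply continuous_Rinv. specialize (pos t p). nra.
  - intros t Ht. unfold g. assert (D := Rpower_derive p t Ht).
    replace (p * Rpower t (p - 1) / ((1 + Rpower t p) * (1 + Rpower t p)))
      with (opp (- (p * Rpower t (p - 1)) / (1 + Rpower t p) ^ 2))
      by (unfold opp; simpl; field; specialize (pos t p); lra).
    apply (is_derive_opp (V := R_NormedModule) (fun t => / (1 + Rpower t p))).
    apply (is_derive_inv (fun t => 1 + Rpower t p)); [|specialize (pos t p); lra].
    replace (p * Rpower t (p - 1)) with (0 + p * Rpower t (p - 1)) by ring.
    apply (is_derive_plus (V := R_NormedModule) (fun _ => 1) (fun t => Rpower t p)); [exact (is_derive_const (V := R_NormedModule) 1 t)|exact D].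
  - intros t Ht. rewrite Rabs_Ropp, Rabs_pos_eq by (left; apply Rinv_0_lt_compat; specialize (pos t p); lra).
    rewrite <- Rinv_1. apply Rinv_le_contravar; specialize (pos t p); lra.
  - intros t Ht. specialize (PK t Ht). assert (A := pos t (p - 1)). assert (B := pos t p).
    assert (E := exp_pos (- t)). unfold gamma_w, g. split; [nra|].
    apply Rmult_le_reg_r with ((1 + Rpower t p) * (1 + Rpower t p)); [nra|].
    replace (K * K / p * (p * Rpower t (p - 1) / ((1 + Rpower t p) * (1 + Rpower t p))) *
      ((1 + Rpower t p) * (1 + Rpower t p))) with (Rpower t (p - 1) * (K * K)) by (field; lra).
    rewrite Rmult_assoc. apply Rmult_le_compat_l; [lra|].
    assert (Ee : exp (t / 2) * exp (t / 2) * exp (- t) = 1).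
    { rewrite <- !exp_plus. replace (t / 2 + t / 2 + - t) with 0 by field. apply exp_0. }
    assert ((1 + Rpower t p) * (1 + Rpower t p) <= (K * exp (t / 2)) * (K * exp (t / 2)))
      by (apply Rmult_le_compat; lra).
    apply Rle_trans with (exp (- t) * ((K * exp (t / 2)) * (K * exp (t / 2)))).
    + apply Rmult_le_compat_l; lra.
    + right. replace (exp (- t) * (K * exp (t / 2) * (K * exp (t / 2))))
        with (K * K * (exp (t / 2) * exp (t / 2) * exp (- t))) by ring. rewrite Ee. ring.
  - assert (E : Gamma p = S) by (exact (is_RInt_gen_unique (V := R_CompleteNormedModule) (Fa := at_right 0) (Fb := Rbar_locally p_infty) (gamma_w p) S HS)).
    rewrite E. split; auto. apply Rlt_le_trans with (RInt (gamma_w p) 1 2); [|apply HS'; lra].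
    apply RInt_gt_0; [lra| |].
    + intros x _. apply Rmult_lt_0_compat; [apply pos|apply exp_pos].
    + intros x Hx. apply gamma_w_continuous. lra.
Qed.

(** Integration by parts: the combination of integrands is the derivative of [t^p exp(-t)], which
    tends to 0 at both ends. *)
Lemma Gamma_succ (p : R) : 0 < p -> Gamma (p + 1) = p * Gamma p.
Proof.
  intros Hp. destruct (Gamma_is_RInt p Hp) as [H1 _]. destruct (Gamma_is_RInt (p + 1) ltac:(lra)) as [H2 _].
  assert (pos : forall t q, 0 < Rpower t q) by (intros; apply exp_pos).
  assert (H3 : is_RInt_gen (fun t => minus (scal p (gamma_w p t)) (gamma_w (p + 1) t))
     (at_right 0) (Rbar_locally p_infty) (minus (scal p (Gamma p)) (Gamma (p + 1)))).
  { apply (is_RInt_gen_minus (V := R_NormedModule)); auto. now apply (is_RInt_gen_scal (V := R_NormedModule)). }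
  assert (H4 : is_RInt_gen (fun t => minus (scal p (gamma_w p t)) (gamma_w (p + 1) t))
     (at_right 0) (Rbar_locally p_infty) (0 - 0)).
  { apply (is_RInt_gen_FTC (fun x => 0 < x) _ _ _ (fun t => Rpower t p * exp (- t))).
    - apply improper_half_line.
    - apply filter_filter.
    - apply filter_filter.
    - intros t Ht. unfold minus, plus, opp, scal; simpl. unfold mult; simpl. unfold gamma_w.
      replace (p + 1 - 1) with p by ring.
      replace (p * (Rpower t (p - 1) * exp (- t)) + - (Rpower t p * exp (- t)))
        with (p * Rpower t (p - 1) * exp (- t) + Rpower t p * (- exp (- t))) by ring.
      apply (is_derive_mult (K := R_AbsRing) (fun t => Rpower t p) (fun t => exp (- t)) t
         (p * Rpower t (p - 1)) (- exp (- t))).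
      + now apply Rpower_derive.
      + auto_derive; auto. ring.
      + intros n m. apply Rmult_comm.
    - intros t Ht. apply (continuous_minus (V := R_NormedModule)); [|apply gamma_w_continuous; lra].
      apply (continuous_scal_r (V := R_NormedModule)). now apply gamma_w_continuous.
    - intros e He. destruct (Rpower_small p e Hp He) as [d [Hd P]].
      exists (mkposreal d Hd). intros x Hx Hx0. unfold ball in Hx; simpl in Hx.
      unfold AbsRing_ball, abs, minus, plus, opp in Hx; simpl in Hx. apply Rabs_def2 in Hx.
      split; auto. specialize (P x ltac:(lra)). assert (E := exp_pos (- x)).
      assert (E1 : exp (- x) <= 1) by (rewrite <- exp_0; left; apply exp_increasing; lra).
      rewrite Rminus_0_r, Rabs_pos_eq by nra. nra.
    - intros e He. destruct (Rpower_exp_bound p Hp) as [K [HK PK]].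
      exists (2 * K / e). intros x Hx.
      assert (Hx0 : 0 < x).
      { eapply Rlt_trans; [|exact Hx]. apply Rdiv_lt_0_compat; lra. }
      split; auto. specialize (PK x Hx0). assert (A := pos x p). assert (E := exp_pos (- x)).
      rewrite Rminus_0_r, Rabs_pos_eq by nra.
      apply Rle_lt_trans with (K * exp (x / 2) * exp (- x)); [apply Rmult_le_compat_r; lra|].
      rewrite Rmult_assoc, <- exp_plus. replace (x / 2 + - x) with (- (x / 2)) by field.
      rewrite exp_Ropp. assert (E2 := exp_ineq1_le (x / 2)).
      apply Rle_lt_trans with (K * / (x / 2)).
      + apply Rmult_le_compat_l; [lra|]. apply Rinv_le_contravar; lra.
      + apply Rmult_lt_reg_r with (x / 2); [lra|].
        replace (K * / (x / 2) * (x / 2)) with K by (field; lra).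
        apply Rmult_lt_compat_r with (r := e) in Hx; auto.
        replace (2 * K / e * e) with (2 * K) in Hx by (field; lra). lra. }
  assert (E3 := is_RInt_gen_unique (V := R_CompleteNormedModule) (Fa := at_right 0) _ _ H3).
  assert (E4 := is_RInt_gen_unique (V := R_CompleteNormedModule) (Fa := at_right 0) _ _ H4).
  rewrite E3 in E4. unfold minus, plus, opp, scal in E4; simpl in E4. unfold mult in E4; simpl in E4. lra.
Qed.

Fixpoint rp (p : R) (n : nat) : R := match n with O => 1 | S m => rp p m * (p + INR m) end.

Lemma rp_pos (p : R) (n : nat) : 0 < p -> 0 < rp p n.
Proof.
  intros Hp. induction n as [|n IH]; cbn [rp]; [lra|]. generalize (pos_INR n). intros.
  apply Rmult_lt_0_compat; lra.
Qed.

Lemma pochhammer_rp (p : R) (n : nat) : 0 < p -> pochhammer p n = rp p n.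
Proof.
  intros Hp. unfold pochhammer. destruct (Gamma_is_RInt p Hp) as [_ G0].
  assert (E : Gamma (p + INR n) = rp p n * Gamma p).
  { induction n as [|n IH].
    - simpl. rewrite Rplus_0_r. ring.
    - rewrite S_INR, <- Rplus_assoc, Gamma_succ, IH; [cbn [rp]; ring|]. generalize (pos_INR n). lra. }
  rewrite E. field. lra.
Qed.

Lemma bcoef_rp (b : R) (n : nat) : bcoef b n = rp b n / rp 1 n.
Proof.
  induction n as [|n IH]; cbn [bcoef rp]; [field|].
  rewrite IH. assert (0 < rp 1 n) by (apply rp_pos; lra). generalize (pos_INR n). intros.
  field. split; lra.
Qed.

Definition beta_w (p q t : R) : R := Rpower t (p - 1) * Rpower (1 - t) (q - 1).

Lemma Rpower_1mt_derive (q t : R) : t < 1 ->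
  is_derive (fun t => Rpower (1 - t) q) t (- (q * Rpower (1 - t) (q - 1))).
Proof.
  intros Ht.
  replace (- (q * Rpower (1 - t) (q - 1))) with (scal (- (1)) (q * Rpower (1 - t) (q - 1)))
    by (unfold scal; simpl; unfold mult; simpl; ring).
  apply (is_derive_comp (V := R_NormedModule) (fun u => Rpower u q) (fun t => 1 - t)).
  - apply Rpower_derive. lra.
  - auto_derive; auto; ring.
Qed.

Lemma Rpower_1mt_continuous (q t : R) : t < 1 -> continuous (fun t => Rpower (1 - t) q) t.
Proof. intros Ht. apply (ex_derive_continuous (V := R_NormedModule)). eexists. now apply Rpower_1mt_derive. Qed.

Lemma beta_w_continuous (p q t : R) : 0 < t < 1 -> continuous (beta_w p q) t.
Proof.
  intros Ht. apply (continuous_mult (K := R_AbsRing)); [apply Rpower_continuous; lra|apply Rpower_1mt_continuous; lra].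
Qed.

(** With [A = t^p] and [B = (1-t)^q], the bounded function [A / (A + B)] has derivative [beta_w p q
    t * (p * (1 - t) + q * t) / (A + B)^2]. The numerator factor is at least [m] and the denominator
    at most 4, whence the constant [4 / m]. *)
Lemma Beta_is_RInt (p q : R) : 0 < p -> 0 < q ->
  is_RInt_gen (beta_w p q) (at_right 0) (at_left 1) (Beta p q).
Proof.
  intros Hp Hq.
  set (A := fun t => Rpower t p). set (B := fun t => Rpower (1 - t) q).
  assert (pos : forall t r, 0 < Rpower t r) by (intros; apply exp_pos).
  assert (AB : forall t, 0 < A t + B t) by (intros t; unfold A, B; generalize (pos t p) (pos (1 - t) q); lra).
  set (m := Rmin p q). assert (Hm : 0 < m) by now apply Rmin_pos.
  assert (mp : m <= p) by apply Rmin_l. assert (mq : m <= q) by apply Rmin_r.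
  set (g := fun t => (p * Rpower t (p - 1) * (A t + B t) - A t * (p * Rpower t (p - 1) + - (q * Rpower (1 - t) (q - 1))))
     / (A t + B t) ^ 2).
  destruct (is_RInt_gen_dominated (fun x => 0 < x < 1) (at_right 0) (at_left 1)
    (beta_w p q) g (fun t => A t / (A t + B t)) (4 / m)) as [S [HS _]].
  - apply improper_unit.
  - apply Rmult_le_pos; [lra|left; now apply Rinv_0_lt_compat].
  - intros t Ht. now apply beta_w_continuous.
  - intros t Ht. assert (CA : forall r, continuous (fun t => Rpower t r) t) by (intros; apply Rpower_continuous; lra).
    assert (CB : forall r, continuous (fun t => Rpower (1 - t) r) t) by (intros; apply Rpower_1mt_continuous; lra).
    assert (C1 : continuous (fun t => p * Rpower t (p - 1)) t)
      by (apply (continuous_mult (K := R_AbsRing)); [apply continuous_const|apply CA]).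
    assert (C2 : continuous (fun t => - (q * Rpower (1 - t) (q - 1))) t)
      by (apply (continuous_opp (V := R_NormedModule)), (continuous_mult (K := R_AbsRing)); [apply continuous_const|apply CB]).
    assert (C3 : continuous (fun t => A t + B t) t)
      by (apply (continuous_plus (V := R_NormedModule)); [apply CA|apply CB]).
    unfold g. apply (continuous_mult (K := R_AbsRing)).
    + apply (continuous_minus (V := R_NormedModule)); apply (continuous_mult (K := R_AbsRing)); auto.
      * apply CA.
      * now apply (continuous_plus (V := R_NormedModule)).
    + apply (continuous_comp (fun t => (A t + B t) ^ 2) Rinv).
      * simpl. apply (continuous_mult (K := R_AbsRing)); auto.
        apply (continuous_mult (K := R_AbsRing)); auto. apply continuous_const.
      * apply continuous_Rinv. generalize (pow_lt _ 2 (AB t)). lra.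
  - intros t Ht. apply (is_derive_div A (fun t => A t + B t)); [apply Rpower_derive; lra| |generalize (AB t); lra].
    apply (is_derive_plus (V := R_NormedModule)); [apply Rpower_derive; lra|apply Rpower_1mt_derive; lra].
  - intros t Ht. assert (AB1 := AB t). assert (A1 : 0 < A t) by apply pos. assert (B1 : 0 < B t) by apply pos.
    rewrite Rabs_pos_eq.
    + apply Rmult_le_reg_r with (A t + B t); auto. unfold Rdiv. rewrite Rmult_assoc, Rinv_l; lra.
    + apply Rmult_le_pos; [lra|left; now apply Rinv_0_lt_compat].
  - intros t Ht. assert (AB1 := AB t). assert (A1 : 0 < A t <= 1) by (split; [apply pos|apply Rpower_lt1; lra]).
    assert (B1 : 0 < B t <= 1) by (split; [apply pos|apply Rpower_lt1; lra]).
    assert (W : 0 < beta_w p q t) by (apply Rmult_lt_0_compat; apply pos).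
    split; [lra|].
    assert (E : g t = beta_w p q t * (p * (1 - t) + q * t) / (A t + B t) ^ 2).
    { unfold g, beta_w. f_equal.
      assert (E1 : A t = t * Rpower t (p - 1)) by (unfold A; now rewrite Rpower_minus1 by lra).
      assert (E2 : B t = (1 - t) * Rpower (1 - t) (q - 1)) by (unfold B; now rewrite Rpower_minus1 by lra).
      rewrite E1, E2. ring. }
    rewrite E.
    assert (L : m <= p * (1 - t) + q * t) by nra.
    assert (D : 0 < (A t + B t) ^ 2 <= 4) by (split; [now apply pow_lt|simpl; nra]).
    apply Rmult_le_reg_r with ((A t + B t) ^ 2); [lra|].
    replace (4 / m * (beta_w p q t * (p * (1 - t) + q * t) / (A t + B t) ^ 2) * (A t + B t) ^ 2)
      with (beta_w p q t * (4 * ((p * (1 - t) + q * t) / m))) by (field; lra).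
    apply Rmult_le_compat_l; [lra|].
    assert (1 <= (p * (1 - t) + q * t) / m).
    { apply Rmult_le_reg_r with m; auto. unfold Rdiv. rewrite Rmult_assoc, Rinv_l; lra. }
    lra.
  - assert (E : Beta p q = S) by (exact (is_RInt_gen_unique (V := R_CompleteNormedModule) (Fa := at_right 0) (Fb := at_left 1) (beta_w p q) S HS)).
    now rewrite E.
Qed.

(** The derivative of [t^p (1-t)^q], a function tending to 0 at both ends, is [p * beta_w p q t - (p
    + q) * beta_w (p + 1) q t]. *)
Lemma Beta_succ (p q : R) : 0 < p -> 0 < q -> Beta (p + 1) q = p / (p + q) * Beta p q.
Proof.
  intros Hp Hq. assert (H1 := Beta_is_RInt p q Hp Hq). assert (H2 := Beta_is_RInt (p + 1) q ltac:(lra) Hq).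
  assert (pos : forall t r, 0 < Rpower t r) by (intros; apply exp_pos).
  assert (H3 : is_RInt_gen (fun t => minus (scal p (beta_w p q t)) (scal (p + q) (beta_w (p + 1) q t)))
     (at_right 0) (at_left 1) (minus (scal p (Beta p q)) (scal (p + q) (Beta (p + 1) q)))).
  { apply (is_RInt_gen_minus (V := R_NormedModule)); now apply (is_RInt_gen_scal (V := R_NormedModule)). }
  assert (H4 : is_RInt_gen (fun t => minus (scal p (beta_w p q t)) (scal (p + q) (beta_w (p + 1) q t)))
     (at_right 0) (at_left 1) (0 - 0)).
  { apply (is_RInt_gen_FTC (fun x => 0 < x < 1) _ _ _ (fun t => Rpower t p * Rpower (1 - t) q)).
    - apply improper_unit.
    - apply filter_filter.
    - apply filter_filter.
    - intros t Ht. unfold minus, plus, opp, scal; simpl. unfold mult; simpl. unfold beta_w.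
      replace (p + 1 - 1) with p by ring.
      assert (E1 := Rpower_minus1 t p ltac:(lra)). assert (E2 := Rpower_minus1 (1 - t) q ltac:(lra)).
      replace (p * (Rpower t (p - 1) * Rpower (1 - t) (q - 1)) + - ((p + q) * (Rpower t p * Rpower (1 - t) (q - 1))))
        with (p * Rpower t (p - 1) * Rpower (1 - t) q + Rpower t p * (- (q * Rpower (1 - t) (q - 1))))
        by (rewrite <- E1, <- E2; ring).
      apply (is_derive_mult (K := R_AbsRing) (fun t => Rpower t p) (fun t => Rpower (1 - t) q) t
         (p * Rpower t (p - 1)) (- (q * Rpower (1 - t) (q - 1)))).
      + apply Rpower_derive; lra.
      + apply Rpower_1mt_derive; lra.
      + intros n m. apply Rmult_comm.
    - intros t Ht. apply (continuous_minus (V := R_NormedModule));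
        apply (continuous_scal_r (V := R_NormedModule)); now apply beta_w_continuous.
    - intros e He. destruct (Rpower_small p e Hp He) as [d [Hd P]].
      assert (Hm : 0 < Rmin d 1) by (apply Rmin_pos; lra).
      assert (m1 := Rmin_l d 1). assert (m2 := Rmin_r d 1).
      exists (mkposreal _ Hm). intros x Hx Hx0. unfold ball in Hx; simpl in Hx.
      unfold AbsRing_ball, abs, minus, plus, opp in Hx; simpl in Hx. apply Rabs_def2 in Hx.
      split; [lra|]. specialize (P x ltac:(lra)). assert (E := pos (1 - x) q).
      assert (E1 := Rpower_lt1 (1 - x) q ltac:(lra) Hq).
      rewrite Rminus_0_r, Rabs_pos_eq by nra. nra.
    - intros e He. destruct (Rpower_small q e Hq He) as [d [Hd P]].
      assert (Hm : 0 < Rmin d 1) by (apply Rmin_pos; lra).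
      assert (m1 := Rmin_l d 1). assert (m2 := Rmin_r d 1).
      exists (mkposreal _ Hm). intros x Hx Hx0. unfold ball in Hx; simpl in Hx.
      unfold AbsRing_ball, abs, minus, plus, opp in Hx; simpl in Hx. apply Rabs_def2 in Hx.
      split; [lra|]. specialize (P (1 - x) ltac:(lra)). assert (E := pos x p).
      assert (E1 := Rpower_lt1 x p ltac:(lra) Hp).
      rewrite Rminus_0_r, Rabs_pos_eq by nra. nra. }
  assert (E3 := is_RInt_gen_unique (V := R_CompleteNormedModule) (Fa := at_right 0) _ _ H3).
  assert (E4 := is_RInt_gen_unique (V := R_CompleteNormedModule) (Fa := at_right 0) _ _ H4).
  rewrite E3 in E4. unfold minus, plus, opp, scal in E4; simpl in E4. unfold mult in E4; simpl in E4.
  apply Rmult_eq_reg_l with (p + q); [|lra].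
  replace ((p + q) * (p / (p + q) * Beta p q)) with (p * Beta p q) by (field; lra). lra.
Qed.

Lemma Beta_rp (p q : R) (n : nat) : 0 < p -> 0 < q ->
  Beta (p + INR n) q = Beta p q * (rp p n / rp (p + q) n).
Proof.
  intros Hp Hq. induction n as [|n IH].
  - simpl. rewrite Rplus_0_r. field.
  - assert (Hn := pos_INR n). assert (0 < rp (p + q) n) by (apply rp_pos; lra).
    rewrite S_INR, <- Rplus_assoc, Beta_succ, IH by lra. cbn [rp]. field. split; lra.
Qed.

Lemma Beta_moment (p q : R) (n : nat) : 0 < p -> 0 < q ->
  is_RInt_gen (fun t => t ^ n * beta_w p q t) (at_right 0) (at_left 1) (Beta p q * (rp p n / rp (p + q) n)).
Proof.
  intros Hp Hq. rewrite <- Beta_rp by auto.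
  assert (H := Beta_is_RInt (p + INR n) q ltac:(generalize (pos_INR n); lra) Hq).
  revert H. apply is_RInt_gen_ext.
  apply Filter_prod with (fun x => 0 < x < 1) (fun x => 0 < x < 1).
  - destruct improper_unit as [_ [_ [H _]]]. specialize (H (/ 2) ltac:(lra)).
    revert H. apply filter_imp. tauto.
  - destruct improper_unit as [_ [_ [_ H]]]. specialize (H (/ 2) ltac:(lra)).
    revert H. apply filter_imp. tauto.
  - intros x y Hx Hy t Ht. cbn [fst snd] in Ht.
    assert (0 < t) by (revert Ht; unfold Rmin, Rmax; destruct (Rle_dec x y); lra).
    unfold beta_w. rewrite <- (Rpower_pow n t) by auto. rewrite <- Rmult_assoc, <- Rpower_plus.
    do 2 f_equal. ring.
Qed.

Local Open Scope C_scope.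

(** * The hypergeometric series *)

Lemma CSeries_ext (u v : nat -> C) : (forall n, u n = v n) -> CSeries u = CSeries v.
Proof. intros H. unfold CSeries. f_equal; apply Series_ext; intros n; now rewrite H. Qed.

(** Hypergeometric coefficients, for third parameter 1 here and [al + be] in [gco]. They are
    factored through [bcoef], the coefficients of the integrand that is expanded: the remaining
    factor is what term-by-term integration yields. *)
Definition fco (al be : R) (n : nat) : R := (bcoef al n * bcoef be n)%R.
Definition gco (al be : R) (n : nat) : R := (bcoef be n * (rp al n / rp (al + be) n))%R.

Lemma f_series_cps (N a b : nat) (z : C) : (1 <= a)%nat -> (1 <= b)%nat -> (1 <= N)%nat ->
  f_series N a b z = 2 * PI * Ci * cps (fun n => RtoC (fco (INR a / INR N) (INR b / INR N) n)) z.
Proof.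
  intros Ha Hb HN. assert (0 < INR N)%R by (apply lt_0_INR; lia).
  assert (A : (0 < INR a / INR N)%R) by (apply Rdiv_lt_0_compat; auto; apply lt_0_INR; lia).
  assert (B : (0 < INR b / INR N)%R) by (apply Rdiv_lt_0_compat; auto; apply lt_0_INR; lia).
  unfold f_series. f_equal. apply CSeries_ext. intros n. f_equal. f_equal.
  rewrite !pochhammer_rp by lra. unfold fco. rewrite !bcoef_rp.
  assert (0 < rp 1 n)%R by (apply rp_pos; lra). field. lra.
Qed.

Lemma g_series_cps (N a b : nat) (z : C) : (1 <= a)%nat -> (1 <= b)%nat -> (1 <= N)%nat ->
  g_series N a b z = Beta (INR a / INR N) (INR b / INR N)
    * cps (fun n => RtoC (gco (INR a / INR N) (INR b / INR N) n)) (1 - z).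
Proof.
  intros Ha Hb HN. assert (0 < INR N)%R by (apply lt_0_INR; lia).
  assert (A : (0 < INR a / INR N)%R) by (apply Rdiv_lt_0_compat; auto; apply lt_0_INR; lia).
  assert (B : (0 < INR b / INR N)%R) by (apply Rdiv_lt_0_compat; auto; apply lt_0_INR; lia).
  unfold g_series. f_equal. apply CSeries_ext. intros n. f_equal. f_equal.
  rewrite !pochhammer_rp by lra. unfold gco. rewrite !bcoef_rp.
  assert (0 < rp 1 n)%R by (apply rp_pos; lra).
  assert (0 < rp (INR a / INR N + INR b / INR N) n)%R by (apply rp_pos; lra).
  field. lra.
Qed.

Lemma frac_bounds (N a : nat) : (1 <= a <= N - 1)%nat -> (0 < INR a / INR N < 1)%R.
Proof.
  intros H. assert (0 < INR N)%R by (apply lt_0_INR; lia).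
  assert (0 < INR a)%R by (apply lt_0_INR; lia). assert (INR a < INR N)%R by (apply lt_INR; lia).
  split; [now apply Rdiv_lt_0_compat|]. apply Rmult_lt_reg_r with (INR N); auto.
  unfold Rdiv. rewrite Rmult_assoc, Rinv_l; lra.
Qed.

Lemma fco_le1 (al be : R) (n : nat) : (0 < al < 1)%R -> (0 < be < 1)%R ->
  (Cmod (RtoC (fco al be n)) <= 1)%R.
Proof.
  intros A B. unfold fco. rewrite RtoC_mult, Cmod_mult.
  rewrite <- (Rmult_1_l 1). apply Rmult_le_compat; try apply Cmod_ge_0;
    apply bcoef_le1; rewrite Rabs_pos_eq; lra.
Qed.

Lemma gco_le1 (al be : R) (n : nat) : (0 < al < 1)%R -> (0 < be < 1)%R ->
  (Cmod (RtoC (gco al be n)) <= 1)%R.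
Proof.
  intros A B. unfold gco. rewrite RtoC_mult, Cmod_mult.
  rewrite <- (Rmult_1_l 1). apply Rmult_le_compat; try apply Cmod_ge_0.
  - apply bcoef_le1; rewrite Rabs_pos_eq; lra.
  - assert (P1 : (0 < rp al n)%R) by (apply rp_pos; lra).
    assert (P2 : (0 < rp (al + be) n)%R) by (apply rp_pos; lra).
    assert (P3 : (rp al n <= rp (al + be) n)%R).
    { clear P1 P2. induction n as [|n IH]; cbn [rp]; [lra|].
      assert (P1 : (0 < rp al n)%R) by (apply rp_pos; lra). assert (H := pos_INR n).
      apply Rmult_le_compat; lra. }
    rewrite Cmod_R, Rabs_pos_eq.
    + apply Rmult_le_reg_r with (rp (al + be) n); auto. unfold Rdiv. rewrite Rmult_assoc, Rinv_l; lra.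
    + apply Rmult_le_pos; [lra|left; now apply Rinv_0_lt_compat].
Qed.

Lemma f_series_holo (N a b : nat) (z : C) : (1 <= a <= N - 1)%nat -> (1 <= b <= N - 1)%nat ->
  (Cmod z < 1)%R -> holo_near (f_series N a b) z.
Proof.
  intros Ha Hb Hz. assert (A := frac_bounds N a Ha). assert (B := frac_bounds N b Hb).
  set (c := fun n => RtoC (fco (INR a / INR N) (INR b / INR N) n)).
  exists (1 - Cmod z)%R, (fun w => 2 * PI * Ci * cps' c w). split; [lra|]. intros w Hw.
  apply (D1_ext (fun w => 2 * PI * Ci * cps c w)).
  - intros v. rewrite f_series_cps by lia. easy.
  - eapply D1_eq; [apply D1_mul; [apply (D1_const (2 * PI * Ci))|apply cps_D1]|cring].
    + intros n. now apply fco_le1.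
    + generalize (Cmod_triangle (w - z) z). replace (w - z + z) with w by ring. lra.
Qed.

Lemma g_series_holo (N a b : nat) (z : C) : (1 <= a <= N - 1)%nat -> (1 <= b <= N - 1)%nat ->
  (Cmod (1 - z) < 1)%R -> holo_near (g_series N a b) z.
Proof.
  intros Ha Hb Hz. assert (A := frac_bounds N a Ha). assert (B := frac_bounds N b Hb).
  set (c := fun n => RtoC (gco (INR a / INR N) (INR b / INR N) n)).
  exists (1 - Cmod (1 - z))%R, (fun w => Beta (INR a / INR N) (INR b / INR N) * (cps' c (1 - w) * - (1))).
  split; [lra|]. intros w Hw.
  apply (D1_ext (fun w => Beta (INR a / INR N) (INR b / INR N) * cps c (1 - w))).
  - intros v. rewrite g_series_cps by lia. easy.
  - eapply D1_eq; [apply D1_mul; [apply (D1_const (RtoC (Beta (INR a / INR N) (INR b / INR N))))|]|].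
    + apply (D1_comp (cps c) (fun w => 1 - w)).
      * apply cps_D1; [intros n; now apply gco_le1|].
        generalize (Cmod_tri_sub 1 z w). rewrite (Cmod_minus_sym z w). lra.
      * eapply D1_eq; [apply D1_sub; [apply (D1_const 1)|apply D1_id]|]. instantiate (1 := - (1)). ring.
    + cring.
Qed.

Lemma cps_remainder (a : nat -> C) (v : C) (x : R) (M : nat) : (forall n, (Cmod (a n) <= 1)%R) ->
  (Cmod v <= x)%R -> (0 <= x < 1)%R -> (Cmod (cps a v - psum a v M) <= x ^ M / (1 - x))%R.
Proof.
  intros Ha Hv Hx.
  apply ctends_Cmod_le with (fun n => psum a v n - psum a v M).
  - apply ctends_sub; [apply cps_ctends; auto; lra|apply ctends_const].
  - exists M. intros n Hn. replace n with (M + (n - M))%nat by lia. generalize (n - M)%nat as k. intros k.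
    assert (E : psum a v (M + k) - psum a v M = v ^ M * csum (fun j => a (M + j)%nat * v ^ j) k).
    { induction k as [|k IH]; cbn [csum].
      - rewrite Nat.add_0_r. ring.
      - rewrite Nat.add_succ_r. cbn [psum]. rewrite Cpow_add_r.
        replace (psum a v (M + k) + a (M + k)%nat * (v ^ M * v ^ k) - psum a v M)
          with ((psum a v (M + k) - psum a v M) + a (M + k)%nat * (v ^ M * v ^ k)) by ring.
        rewrite IH. ring. }
    rewrite E, Cmod_mult, Cmod_pow. unfold Rdiv. apply Rmult_le_compat.
    + apply pow_le, Cmod_ge_0.
    + apply Cmod_ge_0.
    + apply pow_incr. split; auto using Cmod_ge_0.
    + replace (/ (1 - x))%R with (1 / (1 - x))%R by (field; lra).
      apply csum_Cmod; auto. intros j. rewrite Cmod_mult, Cmod_pow.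
      apply Rmult_le_compat; auto using Cmod_ge_0, pow_le. apply pow_incr. split; auto using Cmod_ge_0.
Qed.

Lemma is_RInt_gen_C_unique (w : R -> C) (u v : C) :
  @is_RInt_gen C_R_NormedModule w (at_right 0) (at_left 1) u ->
  @is_RInt_gen C_R_NormedModule w (at_right 0) (at_left 1) v -> u = v.
Proof.
  intros A B. apply (is_RInt_gen_unique (V := C_R_CompleteNormedModule)) in A, B. now rewrite A in B.
Qed.

Lemma is_RInt_gen_ext01 (f g : R -> C) (v : C) :
  (forall t, (0 < t < 1)%R -> f t = g t) ->
  @is_RInt_gen C_R_NormedModule f (at_right 0) (at_left 1) v ->
  @is_RInt_gen C_R_NormedModule g (at_right 0) (at_left 1) v.
Proof.
  intros E. apply is_RInt_gen_ext. destruct improper_unit as [_ [_ [Ha Hb]]].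
  apply Filter_prod with (fun x => (0 < x < 1)%R) (fun x => (0 < x < 1)%R).
  - generalize (Ha (/ 2)%R ltac:(lra)). apply filter_imp. tauto.
  - generalize (Hb (/ 2)%R ltac:(lra)). apply filter_imp. tauto.
  - intros x y Hx Hy t Ht. apply E. cbn [fst snd] in Ht.
    revert Ht. unfold Rmin, Rmax. destruct (Rle_dec x y); lra.
Qed.

Lemma is_RInt_gen_Cscal (f : R -> C) (c v : C) :
  @is_RInt_gen C_R_NormedModule f (at_right 0) (at_left 1) v ->
  @is_RInt_gen C_R_NormedModule (fun t => c * f t) (at_right 0) (at_left 1) (c * v).
Proof.
  intros H P HP. apply locally_C_iff in HP. destruct HP as [r [Hr HP]].
  destruct (D1_cont _ _ _ (D1_mul _ _ v _ _ (D1_const c v) (D1_id v)) r Hr) as [d [Hd Q]].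
  assert (L : locally (T := C_UniformSpace) v (fun u => P (c * u))).
  { apply locally_C_iff. exists d. split; auto. }
  specialize (H _ L). revert H. unfold filtermapi. apply filter_imp.
  intros [x y] [u [Hu Pu]]. exists (c * u). split; auto. now apply is_RInt_Cmult.
Qed.

Lemma is_RInt_gen_RtoC (f : R -> R) (v : R) :
  is_RInt_gen f (at_right 0) (at_left 1) v ->
  @is_RInt_gen C_R_NormedModule (fun t => RtoC (f t)) (at_right 0) (at_left 1) (RtoC v).
Proof.
  intros H P HP. apply locally_C_iff in HP. destruct HP as [r [Hr HP]].
  assert (L : locally v (fun u => P (RtoC u))).
  { exists (mkposreal r Hr). intros u Hu. apply HP. rewrite <- RtoC_minus, Cmod_R. apply Hu. }
  specialize (H _ L). revert H. unfold filtermapi. apply filter_imp.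
  intros [x y] [u [Hu Pu]]. exists (RtoC u). split; auto. cbn [fst snd] in *.
  apply (is_RInt_fct_extend_pair (U := R_NormedModule) (V := R_NormedModule)); auto.
  cbn [fst snd]. generalize (is_RInt_const (V := R_NormedModule) x y 0).
  unfold scal; simpl. unfold mult; simpl. now rewrite Rmult_0_r.
Qed.

Lemma is_RInt_gen_cint (w : R -> C) : (forall t, ccont w t) ->
  @is_RInt_gen C_R_NormedModule w (at_right 0) (at_left 1) (cint w).
Proof.
  intros Hw. set (W := (fun s => RInt (V := C_R_CompleteNormedModule) w 0 s) : R -> C).
  assert (HD : forall s, rder W s (w s)).
  { intros s. apply rder_is_derive.
    apply (is_derive_RInt (V := C_R_NormedModule) w W 0).
    - exists (mkposreal 1 Rlt_0_1). intros x _. apply (RInt_correct (V := C_R_CompleteNormedModule)).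
      apply (ex_RInt_continuous (V := C_R_CompleteNormedModule)). intros t _. now apply ccont_continuous.
    - now apply ccont_continuous. }
  replace (cint w) with (W 1%R - W 0%R).
  - apply is_RInt_gen_primitive; auto.
    + intros e He. destruct (rder_ccont _ _ _ (HD 0%R) e He) as [d [Hd P]]. exists d. auto.
    + intros e He. destruct (rder_ccont _ _ _ (HD 1%R) e He) as [d [Hd P]]. exists d. auto.
  - assert (E : W 0%R = RtoC 0) by apply (RInt_point (V := C_R_CompleteNormedModule)).
    rewrite E. unfold W, cint. ring.
Qed.

(** The product of the series at [v * s] with [(1 - v * s)^be] has zero derivative in [s] and equals
    1 at [s = 0]. *)
Lemma Bin_real (be v : R) : (0 <= be <= 1)%R -> (0 <= v < 1)%R ->
  Bin be (RtoC v) = RtoC (Rpower (1 - v) (- be)).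
Proof.
  intros Hb Hv. assert (A : (Rabs be <= 1)%R) by (rewrite Rabs_pos_eq; lra).
  set (F := fun s => Bin be (RtoC (v * s)) * RtoC (Rpower (1 - v * s) be)).
  assert (HF : forall s, (0 <= s <= 1)%R -> rder F s 0).
  { intros s Hs. assert (Hvs : (0 <= v * s < 1)%R) by nra. unfold F.
    assert (Cv : (Cmod (RtoC (v * s)) < 1)%R) by (rewrite Cmod_R, Rabs_pos_eq; lra).
    assert (R1 : rder (fun s => RtoC (v * s)) s (RtoC v)).
    { apply (rder_ext_near (fun s => 0 + RtoC s * RtoC v) _ s 1 _ Rlt_0_1); [|apply rder_line].
      intros. rewrite RtoC_mult. ring. }
    assert (R2 : rder (fun s => RtoC (Rpower (1 - v * s) be)) s (RtoC (- v * (be * Rpower (1 - v * s) (be - 1))))).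
    { apply (rder_of_re_im _ s (- v * (be * Rpower (1 - v * s) (be - 1))) 0); unfold Re, Im; simpl.
      - apply (is_derive_comp (V := R_NormedModule) (fun u => Rpower u be) (fun s => (1 - v * s)%R)).
        + apply Rpower_derive. lra.
        + auto_derive; auto. ring.
      - apply (is_derive_const (V := R_NormedModule) 0%R). }
    eapply rder_eq; [apply rder_mul; [apply (rder_D1 (Bin be)); [now apply Bin_D1|exact R1]|exact R2]|].
    cbv beta. rewrite <- (Rpower_minus1 (1 - v * s) be) by lra.
    assert (N1 : 1 - RtoC (v * s) <> 0) by now apply one_minus_neq0.
    rewrite !RtoC_mult, RtoC_minus, RtoC_opp, !RtoC_mult in *. field. easy. }
  assert (E : F 0%R = F 1%R).
  { apply rder_zero_const; [lra| |].
    - intros t Ht. apply HF. lra.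
    - intros t Ht. eapply rder_ccont, HF. lra. }
  unfold F in E. rewrite Rmult_0_r, Rmult_1_r, Bin_0, Rminus_0_r in E by auto.
  unfold Rpower at 1 in E. rewrite ln_1, Rmult_0_r, exp_0 in E.
  assert (Hp : (0 < Rpower (1 - v) be)%R) by apply exp_pos.
  rewrite Rpower_Ropp, RtoC_inv by lra.
  assert (Hn : RtoC (Rpower (1 - v) be) <> 0) by (apply RtoC_neq; lra).
  replace (Bin be (RtoC v)) with (Bin be (RtoC v) * RtoC (Rpower (1 - v) be) * / RtoC (Rpower (1 - v) be))
    by (field; auto).
  rewrite <- E. field. auto.
Qed.

(** Term-by-term integration against the moments of the beta weight; the remainder after [M] terms
    is at most [rho^M / (1 - rho)] uniformly in [t]. Convergence of the integral is taken as
    hypothesis, since the period will provide it. *)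
Lemma euler_integral (al be rho : R) (V : C) : (0 < al < 1)%R -> (0 < be < 1)%R -> (0 < rho < 1)%R ->
  @is_RInt_gen C_R_NormedModule (fun t => RtoC (beta_w al be t) * Bin be (RtoC (rho * t)))
    (at_right 0) (at_left 1) V ->
  V = RtoC (Beta al be) * cps (fun n => RtoC (gco al be n)) (RtoC rho).
Proof.
  intros A B Hr H.
  assert (Cr : Cmod (RtoC rho) = rho) by (rewrite Cmod_R, Rabs_pos_eq; lra).
  set (c := fun n => RtoC (bcoef be n)).
  assert (Hc : forall n, (Cmod (c n) <= 1)%R) by (intros; apply bcoef_le1; rewrite Rabs_pos_eq; lra).
  set (g := fun n => RtoC (gco al be n)).
  assert (HV : forall M, @is_RInt_gen C_R_NormedModule (fun t => RtoC (beta_w al be t) * psum c (RtoC (rho * t)) M)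
    (at_right 0) (at_left 1) (RtoC (Beta al be) * psum g (RtoC rho) M)).
  { intros M. induction M as [|M IH]; cbn [psum].
    - rewrite Cmult_0_r. apply (is_RInt_gen_ext01 (fun _ => 0)); [intros; ring|].
      assert (Z := is_RInt_gen_cint (fun _ => 0) (fun t => ccont_const 0 t)).
      rewrite cint_const in Z. exact Z.
    - rewrite Cmult_plus_distr_l.
      apply (is_RInt_gen_ext01 (fun t => RtoC (beta_w al be t) * psum c (RtoC (rho * t)) M
         + (c M * RtoC rho ^ M) * RtoC (t ^ M * beta_w al be t))).
      { intros t Ht. rewrite !RtoC_mult, Cpow_mult_l, <- RtoC_pow. rewrite (RtoC_pow t). ring. }
      apply (is_RInt_gen_plus (V := C_R_NormedModule) _ _ _ _ IH).
      replace (RtoC (Beta al be) * (g M * RtoC rho ^ M))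
        with ((c M * RtoC rho ^ M) * RtoC (Beta al be * (rp al M / rp (al + be) M)))
        by (unfold g, gco, c; rewrite !RtoC_mult; ring).
      apply is_RInt_gen_Cscal, is_RInt_gen_RtoC, Beta_moment; lra. }
  assert (HB := Beta_is_RInt al be ltac:(lra) ltac:(lra)).
  assert (T1 : ctends (fun M => RtoC (Beta al be) * psum g (RtoC rho) M) (RtoC (Beta al be) * cps g (RtoC rho))).
  { apply ctends_scal, cps_ctends; [intros; now apply gco_le1|lra]. }
  symmetry. apply (ctends_unique _ _ _ T1).
  apply ctends_of_le with (/ (1 - rho) * Beta al be)%R rho; [lra|]. intros M.
  assert (HD : @is_RInt_gen C_R_NormedModule (fun t => minus (RtoC (beta_w al be t) * psum c (RtoC (rho * t)) M)
       (RtoC (beta_w al be t) * Bin be (RtoC (rho * t)))) (at_right 0) (at_left 1)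
     (minus (RtoC (Beta al be) * psum g (RtoC rho) M) V)).
  { apply (is_RInt_gen_minus (V := C_R_NormedModule)); auto. }
  replace (/ (1 - rho) * Beta al be * rho ^ M)%R with (rho ^ M / (1 - rho) * Beta al be)%R by (field; lra).
  assert (HG : is_RInt_gen (fun t => scal (rho ^ M / (1 - rho)) (beta_w al be t))%R (at_right 0) (at_left 1)
     (scal (rho ^ M / (1 - rho)) (Beta al be))%R) by (now apply (is_RInt_gen_scal (V := R_NormedModule))).
  change (rho ^ M / (1 - rho) * Beta al be)%R with (scal (rho ^ M / (1 - rho))%R (Beta al be)).
  change (RtoC (Beta al be) * psum g (RtoC rho) M - V)
    with (@minus C_R_NormedModule (RtoC (Beta al be) * psum g (RtoC rho) M) V).
  rewrite <- C_R_norm.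
  destruct improper_unit as [_ [_ [Fa Fb]]].
  refine (RInt_gen_norm (V := C_R_CompleteNormedModule) (Fa := at_right 0) (Fb := at_left 1) _ _ _ _ _ _ HD HG).
  - apply Filter_prod with (1 := Fa (/ 2)%R ltac:(lra)) (2 := Fb (/ 2)%R ltac:(lra)).
    intros x y [Hx1 Hx2] [Hy1 Hy2]. cbn [fst snd]. lra.
  - apply Filter_prod with (1 := Fa (/ 2)%R ltac:(lra)) (2 := Fb (/ 2)%R ltac:(lra)).
    intros x y [Hx1 Hx2] [Hy1 Hy2] t Ht. cbn [fst snd] in Ht. rewrite C_R_norm.
    assert (Ht1 : (0 < t < 1)%R) by lra.
    assert (W : (0 < beta_w al be t)%R) by (apply Rmult_lt_0_compat; apply exp_pos).
    match goal with |- (Cmod ?x <= _)%R =>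
      assert (Ex : @eq C x (RtoC (beta_w al be t) * - (Bin be (RtoC (rho * t)) - psum c (RtoC (rho * t)) M))) end.
    { transitivity (RtoC (beta_w al be t) * psum c (RtoC (rho * t)) M - RtoC (beta_w al be t) * Bin be (RtoC (rho * t)));
        [reflexivity|ring]. }
    rewrite Ex.
    rewrite Cmod_mult, Cmod_opp, Cmod_R, Rabs_pos_eq by lra.
    unfold scal; simpl. unfold mult; simpl. rewrite Rmult_comm. apply Rmult_le_compat_r; [lra|].
    apply cps_remainder; auto; [|lra]. rewrite Cmod_R, Rabs_pos_eq by nra. nra.
Qed.

(** * The initial germs *)

Definition path_ok (N : nat) (l : C) (sg : path) : Prop :=
  (forall s, unit_interval s -> onE N (l, sg s)) /\
  forall s, unit_interval s -> forall r, (0 < r)%R -> exists d, (0 < d)%R /\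
    forall s', unit_interval s' -> (Rabs (s' - s) < d)%R -> qball r (l, sg s) (l, sg s').

Lemma good_family_path_ok (N : nat) (gam : R -> C) (fam : chain_family) (u : R) :
  good_family (onE N) gam fam -> unit_interval u ->
  List.Forall (fun m => path_ok N (gam u) (snd m)) (chain_at fam u).
Proof.
  intros [H _] Hu. apply Forall_map. revert H. apply Forall_impl. intros m Hm. cbn [snd]. split.
  - intros s Hs. now apply Hm.
  - intros s Hs r Hr. destruct (Hm u s Hu Hs) as [_ Hc]. destruct (Hc r Hr) as [d [Hd P]].
    exists d. split; auto. intros s' Hs' Hss. apply P; auto.
    replace (u - u)%R with 0%R by ring. now rewrite Rabs_R0.
Qed.

Lemma Tot_integrals (N a b : nat) (l : C) (c : chain) (F : C -> C) : (2 <= N)%nat ->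
  (1 <= a <= N - 1)%nat -> (1 <= b <= N - 1)%nat ->
  List.Forall (fun m => path_ok N l (snd m)) c -> smooth_chain c -> Tot (GG N a b) l c F ->
  is_chain_integral (omega N a b) c (F l) /\
  exists F', D1 F l F' /\ is_chain_integral (nu l a b) c F'.
Proof.
  intros HN Ha Hb Hok Hsm. revert F. induction Hok as [|[n sg] c [HE Hc] Hok IH]; intros F HF.
  - cbn [Tot is_chain_integral] in *. split; [now apply eq_near_at in HF|].
    exists 0. split; auto. destruct HF as [r [Hr HF]].
    apply (D1_ext_near (fun _ => 0) _ _ _ r Hr); [|apply D1_const]. intros; symmetry; auto.
  - inversion Hsm as [|m c' [x [y [dx [dy Hs]]]] Hsm']; subst.
    cbn [Tot] in HF. destruct HF as [T [F1 [A [B E]]]]. cbn [snd] in *.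
    destruct (smooth_integrals N a b l sg T x y dx dy HN Ha Hb HE Hc Hs A) as [I1 [T' [DT I2]]].
    destruct (IH Hsm' F1 B) as [J1 [F1' [DF J2]]]. cbn [is_chain_integral]. split.
    + exists (T l), (F1 l). repeat split; auto; [exists x, y, dx, dy; auto|]. now apply eq_near_at in E.
    + exists (IZR n * T' + F1'). split.
      * destruct E as [r [Hr E]]. apply (D1_ext_near (fun x => IZR n * T x + F1 x) _ _ _ r Hr).
        { intros; symmetry; auto. }
        apply D1_add; auto. eapply D1_eq; [apply D1_mul; [apply (D1_const (RtoC (IZR n)))|exact DT]|cring].
      * exists T', F1'. repeat split; auto. exists x, y, dx, dy; auto.
Qed.

(** A germ at [eps] is determined by its values on a real segment issuing from [eps]. The explicit
    family shows that one germ is the period at all nearby times; its values agree with [f] at real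
    points accumulating at [eps]. *)
Lemma Tot_init (N a b : nat) (eps rho : R) (fam : chain_family) (f : C -> C) : (2 <= N)%nat ->
  (1 <= a <= N - 1)%nat -> (1 <= b <= N - 1)%nat -> (0 < rho)%R ->
  good_family (onE N) (fun v => RtoC (eps + v * rho)) fam -> holo_near f (RtoC eps) ->
  (forall v F, unit_interval v -> Tot (GG N a b) (RtoC (eps + v * rho)) (chain_at fam v) F ->
     F (RtoC (eps + v * rho)) = f (RtoC (eps + v * rho))) ->
  Tot (GG N a b) (RtoC eps) (chain_at fam 0) f.
Proof.
  intros HN Ha Hb Hrho Hf Hol Hval.
  assert (U0 : unit_interval 0) by (unfold unit_interval; lra).
  destruct (Tot_family _ _ _ _ 0 (GG_local_cocycle N a b HN Ha Hb) Hf U0) as [F0 [HF0 [d [Hd P]]]].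
  cbv beta in *. assert (E0 : (eps + 0 * rho)%R = eps) by ring. rewrite E0 in HF0.
  assert (T0 := P 0%R U0). rewrite E0 in T0.
  apply Tot_eq with F0; [|apply T0; rewrite Rminus_0_r, Rabs_R0; lra].
  apply holo_near_identity; auto using holo_near_psr. intros e He.
  set (v := (Rmin (Rmin d 1) (e / rho) / 2)%R).
  assert (Her : (0 < e / rho)%R) by now apply Rdiv_lt_0_compat.
  assert (m1 := Rmin_l (Rmin d 1) (e / rho)). assert (m2 := Rmin_r (Rmin d 1) (e / rho)).
  assert (m3 := Rmin_l d 1). assert (m4 := Rmin_r d 1).
  assert (Hm : (0 < Rmin (Rmin d 1) (e / rho))%R) by (repeat apply Rmin_pos; lra).
  assert (Hv : (0 < v)%R) by (unfold v; lra).
  assert (Hv2 : (v * rho < e)%R).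
  { apply Rmult_lt_reg_r with (/ rho)%R; [now apply Rinv_0_lt_compat|].
    rewrite Rmult_assoc, Rinv_r by lra. unfold v. unfold Rdiv in *. lra. }
  assert (Uv : unit_interval v) by (unfold unit_interval, v in *; lra).
  exists (RtoC (eps + v * rho)). split; [|split].
  - apply RtoC_neq. nra.
  - rewrite <- RtoC_minus, Cmod_R, Rabs_pos_eq; [lra|nra].
  - apply Hval; auto. apply P; auto. rewrite Rminus_0_r, Rabs_pos_eq; unfold v; lra.
Qed.

(** * The period over alpha for small real parameter *)

Lemma cint_reflect (f : R -> C) : ccontI f -> cint (fun s => f (1 - s)%R) = cint f.
Proof.
  intros Hf. apply cint_unique.
  assert (H := cint_correct f Hf). apply (is_RInt_swap (V := C_R_NormedModule)) in H.
  assert (K : is_RInt (V := C_R_NormedModule) f (-1 * 0 + 1) (-1 * 1 + 1) (opp (cint f))).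
  { replace (-1 * 0 + 1)%R with 1%R by ring. replace (-1 * 1 + 1)%R with 0%R by ring. exact H. }
  apply (is_RInt_comp_lin (V := C_R_NormedModule)) in K.
  apply (is_RInt_opp (V := C_R_NormedModule)) in K.
  match type of K with is_RInt _ _ _ ?v => replace v with (cint f) in K by (change (cint f = - - cint f); ring) end.
  revert K. apply (is_RInt_ext (V := C_R_NormedModule)). intros s _.
  change (opp (scal (-1)%R (f (-1 * s + 1)%R)))
    with (- (@scal R_AbsRing C_R_NormedModule (-1)%R (f (-1 * s + 1)%R))).
  rewrite C_R_scal. replace (-1 * s + 1)%R with (1 - s)%R by ring.
  replace (RtoC (-1)) with (- (1)) by (now rewrite <- RtoC_opp).
  change (- (- (1) * f (1 - s)%R) = f (1 - s)%R). ring.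
Qed.

(** On the curve [y ^ N = 1 / (1 + l * tau N x)], so [tau] is the variable in which powers of [y]
    become binomial series. *)
Definition tau (N : nat) (x : C) : C := x ^ N / (1 - x ^ N).

Lemma alpha_radius (N : nat) : (2 <= N)%nat -> exists r0, (0 < r0 <= / 8)%R /\
  (forall x, (Cmod (x - 1) < r0)%R -> (Cmod (x - 1) <= Cmod (1 - x ^ N))%R /\
     (Cmod (x ^ N) <= 2)%R /\ x <> 0) /\
  forall v y, (Cmod v <= 4 * r0)%R -> (Cmod (y - 1) < r0)%R ->
    y ^ N = Bin (1 / INR N) v ^ N -> y = Bin (1 / INR N) v.
Proof.
  intros HN. assert (HN1 : (1 <= N)%nat) by lia.
  assert (HNr : (2 <= INR N)%R) by (change 2%R with (INR 2); now apply le_INR).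
  assert (Ab : (Rabs (1 / INR N) <= 1)%R).
  { rewrite Rabs_pos_eq.
    - apply Rmult_le_reg_r with (INR N); [lra|]. field_simplify; lra.
    - apply Rmult_le_pos; [lra|left; apply Rinv_0_lt_compat; lra]. }
  assert (DP : D1 (fun w => w ^ N) 1 (RtoC (INR N))).
  { eapply D1_eq; [apply D1_pow, D1_id|]. rewrite Cpow_one. ring. }
  (* The power has derivative [N] at 1; with tolerance [N / 2] it expands distances by at least
     [N / 2 >= 1], which is where [2 <= N] enters. *)
  destruct (proj1 (D1_char _ _ _) DP (INR N / 2)%R) as [d1 [Hd1 P1]]; [lra|].
  destruct (D1_cont _ _ _ DP 1 Rlt_0_1) as [d2 [Hd2 P2]].
  assert (N1 : RtoC 1 <> 0) by (apply RtoC_neq; lra).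
  destruct (root_locally_unique N 1 HN1 N1) as [d3 [Hd3 P3]].
  assert (DB := Bin_D1 (1 / INR N) 0 Ab ltac:(rewrite Cmod_0; lra)).
  destruct (D1_cont _ _ _ DB d3 Hd3) as [d4 [Hd4 P4]]. rewrite Bin_0 in P4 by auto.
  (* The [/ 8] makes [4 * r] at most one half, the bound wanted for [l * tau]; the [d4 / 5] makes
     [4 * r0] smaller than [d4], so that the binomial series stays in the zone where roots are
     unique. *)
  set (r0 := Rmin (/ 8) (Rmin (Rmin d1 d2) (Rmin d3 (d4 / 5)))).
  assert (Hr : (0 < r0)%R) by (unfold r0; repeat apply Rmin_pos; lra).
  assert (Hr' : (r0 <= / 8 /\ r0 <= d1 /\ r0 <= d2 /\ r0 <= d3 /\ r0 <= d4 / 5)%R).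
  { unfold r0. assert (q1 := Rmin_l (/ 8) (Rmin (Rmin d1 d2) (Rmin d3 (d4 / 5)))).
    assert (q2 := Rmin_r (/ 8) (Rmin (Rmin d1 d2) (Rmin d3 (d4 / 5)))).
    assert (q3 := Rmin_l (Rmin d1 d2) (Rmin d3 (d4 / 5))). assert (q4 := Rmin_r (Rmin d1 d2) (Rmin d3 (d4 / 5))).
    assert (q5 := Rmin_l d1 d2). assert (q6 := Rmin_r d1 d2).
    assert (q7 := Rmin_l d3 (d4 / 5)). assert (q8 := Rmin_r d3 (d4 / 5)). lra. }
  exists r0. split; [lra|]. split.
  - intros x Hx. repeat split.
    + specialize (P1 x 1 ltac:(lra) ltac:(rewrite Cmod_diag; lra)). cbv beta in P1. rewrite Cpow_one in P1.
      assert (A := Cmod_ge_sub (INR N * (x - 1)) (INR N * (x - 1) - (x ^ N - 1))).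
      replace (INR N * (x - 1) - (INR N * (x - 1) - (x ^ N - 1))) with (- (1 - x ^ N)) in A by ring.
      replace (INR N * (x - 1) - (x ^ N - 1)) with (- (x ^ N - 1 - INR N * (x - 1))) in A by ring.
      rewrite !Cmod_opp, Cmod_mult, Cmod_R, (Rabs_pos_eq (INR N)) in A by lra.
      assert (B := Cmod_ge_0 (x - 1)). nra.
    + specialize (P2 x ltac:(lra)). cbv beta in P2. rewrite Cpow_one in P2.
      generalize (Cmod_triangle (x ^ N - 1) 1). replace (x ^ N - 1 + 1) with (x ^ N) by ring.
      rewrite Cmod_1. lra.
    + intros E. rewrite E in Hx. replace (0 - 1) with (- (1)) in Hx by ring. rewrite Cmod_m1 in Hx. lra.
  - intros v y Hv Hy E. apply P3; auto; [lra|]. apply P4. replace (v - 0) with v by ring. lra.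
Qed.

Section AlphaData.
Variables (N a b : nat) (r r0 : R).
Hypothesis HN : (2 <= N)%nat.
Hypothesis Ha : (1 <= a <= N - 1)%nat.
Hypothesis Hb : (1 <= b <= N - 1)%nat.
Hypothesis Hr : (0 < r < r0)%R.
Hypothesis Hr0 : (r0 <= / 8)%R.
Hypothesis Hrad : forall x, (Cmod (x - 1) < r0)%R -> (Cmod (x - 1) <= Cmod (1 - x ^ N))%R /\
     (Cmod (x ^ N) <= 2)%R /\ x <> 0.

Let X (t : R) : C := 1 + circ r t.

Lemma alpha_X (t : R) : X t <> 0 /\ 1 - X t ^ N <> 0 /\ (Cmod (tau N (X t)) <= 2 / r)%R.
Proof.
  assert (E : Cmod (X t - 1) = r).
  { unfold X. replace (1 + circ r t - 1) with (circ r t) by ring. apply Cmod_circ. lra. }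
  destruct (Hrad (X t)) as [A [B D]]; [lra|]. rewrite E in A.
  assert (N0 : 1 - X t ^ N <> 0) by (apply Cmod_gt_0; lra).
  repeat split; auto. unfold tau. rewrite Cmod_div by auto.
  unfold Rdiv. apply Rmult_le_compat; auto; try apply Cmod_ge_0.
  - left. apply Rinv_0_lt_compat. lra.
  - apply Rinv_le_contravar; lra.
Qed.

Lemma alpha_X_rder (t : R) : rder X t (2 * PI * Ci * circ r t).
Proof. eapply rder_eq; [apply rder_add; [apply rder_const|apply rder_circ]|ring]. Qed.

Lemma tau_D1 (x : C) : x <> 0 -> 1 - x ^ N <> 0 ->
  D1 (tau N) x (INR N * x ^ N / (x * ((1 - x ^ N) * (1 - x ^ N)))).
Proof.
  intros X0 X1. unfold tau. eapply D1_eq.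
  - apply D1_div; [exact X1|apply D1_pow, D1_id|].
    apply D1_sub; [apply (D1_const 1)|apply D1_pow, D1_id].
  - cbv beta. rewrite <- (INR_pow_pred x N). field. auto.
Qed.

(* The coefficients, up to constants, of the expansion in [l] of [omega] on alpha. *)
Let phi (n : nat) (x : C) : C := x ^ a * tau N x ^ n / (1 - x ^ N) / x.

Lemma phi_ccont (n : nat) (t : R) : ccont (fun t => phi n (X t) * circ r t) t.
Proof.
  destruct (alpha_X t) as [X0 [X1 _]].
  assert (CX : ccont X t) by (eapply rder_ccont, alpha_X_rder).
  apply ccont_mul; [|eapply rder_ccont, rder_circ].
  unfold phi, tau. repeat apply ccont_mul; auto.
  - now apply ccont_pow.
  - apply ccont_pow. apply ccont_mul; [now apply ccont_pow|]. apply ccont_inv; auto.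
    apply ccont_sub; [apply ccont_const|now apply ccont_pow].
  - apply ccont_inv; auto. apply ccont_sub; [apply ccont_const|now apply ccont_pow].
  - now apply ccont_inv.
Qed.

Let A (n : nat) : C := cint (fun t => phi n (X t) * circ r t).

(** As [1 / (1 - x^N) = 1 + tau], the derivative of [x^a tau^n / (1 - x^N)] is
    [(a + n N) phi n + N (n + 1) phi (S n)]; its integral over a circle vanishes. *)
Lemma phi_exact (n : nat) :
  (INR a + INR n * INR N) * A n + INR N * (INR n + 1) * A (S n) = 0.
Proof.
  set (h := fun t => X t ^ a * tau N (X t) ^ n / (1 - X t ^ N)).
  set (g := fun t => (2 * PI * Ci) * ((INR a + INR n * INR N) * (phi n (X t) * circ r t)
     + INR N * (INR n + 1) * (phi (S n) (X t) * circ r t))).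
  assert (E1 : forall k, ccontI (fun t => phi k (X t) * circ r t)) by (intros k t _; apply phi_ccont).
  assert (E2 : ccontI (fun t => (INR a + INR n * INR N) * (phi n (X t) * circ r t)))
    by (intros t Ht; apply ccont_mul; [apply ccont_const|now apply E1]).
  assert (E3 : ccontI (fun t => INR N * (INR n + 1) * (phi (S n) (X t) * circ r t)))
    by (intros t Ht; apply ccont_mul; [apply ccont_const|now apply E1]).
  assert (E4 : ccontI (fun t => (INR a + INR n * INR N) * (phi n (X t) * circ r t)
     + INR N * (INR n + 1) * (phi (S n) (X t) * circ r t)))
    by (intros t Ht; apply ccont_add; [now apply E2|now apply E3]).
  assert (E : cint g = h 1%R - h 0%R).
  { apply cint_FTC.
    - intros t _. destruct (alpha_X t) as [X0 [X1 _]].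
      apply (rder_eq h t ((INR a * X t ^ pred a * 1 * tau N (X t) ^ n + X t ^ a * (INR n * tau N (X t) ^ pred n
          * (INR N * X t ^ N / (X t * ((1 - X t ^ N) * (1 - X t ^ N)))))) / (1 - X t ^ N) * (2 * PI * Ci * circ r t)
          + X t ^ a * tau N (X t) ^ n * (INR N * X t ^ pred N / ((1 - X t ^ N) * (1 - X t ^ N))) * (2 * PI * Ci * circ r t))).
      + unfold h. eapply rder_eq; [apply (rder_D1 (fun x => x ^ a * tau N x ^ n / (1 - x ^ N)) X); [|apply alpha_X_rder]|].
        * apply D1_div; [exact X1| |apply D1_sub; [apply (D1_const 1)|apply D1_pow, D1_id]].
          apply D1_mul; [apply D1_pow, D1_id|]. apply (D1_pow (tau N)). now apply tau_D1.
        * cbv beta. field. auto.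
      + unfold g, phi. rewrite Cpow_S.
        assert (P1 : INR a * X t ^ pred a = INR a * X t ^ a / X t) by (rewrite <- INR_pow_pred; field; auto).
        assert (P2 : INR N * X t ^ pred N = INR N * X t ^ N / X t) by (rewrite <- INR_pow_pred; field; auto).
        assert (P3 : INR n * tau N (X t) ^ pred n * (X t ^ N / (1 - X t ^ N)) = INR n * tau N (X t) ^ n)
          by (fold (tau N (X t)); apply INR_pow_pred).
        rewrite P1, P2.
        replace (INR n * tau N (X t) ^ pred n * (INR N * X t ^ N / (X t * ((1 - X t ^ N) * (1 - X t ^ N)))))
          with ((INR n * tau N (X t) ^ pred n * (X t ^ N / (1 - X t ^ N))) * (INR N / (X t * (1 - X t ^ N))))
          by (field; auto).
        rewrite P3. set (T := tau N (X t) ^ n). unfold tau. field. auto.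
    - intros t Ht. apply ccont_mul; [apply ccont_const|now apply E4]. }
  unfold g in E. rewrite cint_scal in E by auto.
  rewrite cint_add, !cint_scal in E by auto. fold (A n) (A (S n)) in E.
  assert (Eh : h 1%R = h 0%R) by (unfold h, X; now rewrite circ_periodic).
  rewrite Eh, Csub_diag in E. apply NNPP. intros N'. exact (Cmult_neq_0 _ _ two_pi_i_neq0 N' E).
Qed.

Lemma psum_one_D1 (m : nat) : exists S' : C -> C, forall x, D1 (fun x => psum (fun _ => 1) x m) x (S' x).
Proof.
  induction m as [|m [S' IH]]; cbn [psum].
  - exists (fun _ => 0). intros x. apply D1_const.
  - eexists. intros x. apply D1_add; [apply IH|]. apply D1_mul; [apply (D1_const 1)|apply D1_pow, D1_id].
Qed.

Lemma psum_one_geom (m : nat) (x : C) : psum (fun _ => 1) x m * (x - 1) = x ^ m - 1.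
Proof. induction m as [|m IH]; cbn [psum]; [rewrite Cpow_zero; ring|]. rewrite Cpow_S, Cmult_plus_distr_r, IH. ring. Qed.

Lemma psum_one_1 (m : nat) : psum (fun _ => 1) 1 m = RtoC (INR m).
Proof.
  induction m as [|m IH]; cbn [psum]; [reflexivity|]. rewrite IH, Cpow_one, S_INR, RtoC_plus. ring.
Qed.

(* At [x = 1] the form has a simple pole, whose residue comes from the mean
   value property applied to [x^(a-1) / (1 + x + ... + x^(N-1))]. *)
Lemma phi_residue : INR N * A 0 = - (1).
Proof.
  destruct (psum_one_D1 N) as [S' HS].
  set (G := fun x => x ^ (a - 1) / psum (fun _ => 1) x N).
  assert (HNn := RtoC_INR_neq0 N ltac:(lia)).
  assert (NS : forall x, (Cmod (x - 1) < r0)%R -> psum (fun _ => 1) x N <> 0).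
  { intros x Hx. destruct (Ceq_dec x 1) as [->|n].
    - now rewrite psum_one_1.
    - intros E. assert (P := psum_one_geom N x). rewrite E in P.
      destruct (Hrad x Hx) as [B _]. assert (0 < Cmod (x - 1))%R by (apply Cmod_gt_0; now apply Csub_neq0).
      replace (1 - x ^ N) with (- (x ^ N - 1)) in B by ring. rewrite <- P in B.
      replace (- (0 * (x - 1))) with (RtoC 0) in B by ring. rewrite Cmod_0 in B. lra. }
  assert (DG : exists G' : C -> C, forall x, (Cmod (x - 1) < r0)%R -> D1 G x (G' x)).
  { eexists. intros x Hx. apply D1_div; [now apply NS|apply D1_pow, D1_id|apply HS]. }
  destruct DG as [G' DG].
  assert (M := mean_value G G' 1 r r0 (proj1 Hr) (proj2 Hr) DG).
  assert (G1 : G 1 = / INR N) by (unfold G; rewrite psum_one_1, Cpow_one; field; auto).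
  rewrite G1 in M.
  replace (A 0) with (cint (fun t => - (1) * G (1 + circ r t))).
  - rewrite cint_scal, M; [field; auto|].
    intros t _. apply (ccont_D1 G X t (G' (X t))).
    + apply DG. unfold X. replace (1 + circ r t - 1) with (circ r t) by ring. rewrite Cmod_circ; lra.
    + eapply rder_ccont, alpha_X_rder.
  - apply cint_ext. intros t _. destruct (alpha_X t) as [X0 [X1 _]].
    unfold phi, G. fold (X t). rewrite Cpow_zero.
    assert (P := psum_one_geom N (X t)).
    assert (Hc : circ r t = X t - 1) by (unfold X; ring). rewrite Hc.
    assert (NSt : psum (fun _ => 1) (X t) N <> 0).
    { apply NS. rewrite <- Hc, Cmod_circ; lra. }
    assert (E : 1 - X t ^ N = - (psum (fun _ => 1) (X t) N * (X t - 1))) by (rewrite P; ring).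
    assert (X1' : X t - 1 <> 0) by (rewrite <- Hc; apply circ_neq0; lra).
    rewrite E, <- (Cpow_pred_mul (X t) a) by lia. field. repeat split; auto.
Qed.

(** [phi_exact] is, up to the sign [(-1)^n], the recursion defining [bcoef (a / N)], and
    [phi_residue] is its initial value. *)
Lemma phi_integral (n : nat) : INR N * A n = - ((- (1)) ^ n * RtoC (bcoef (INR a / INR N) n)).
Proof.
  assert (HNn := RtoC_INR_neq0 N ltac:(lia)). assert (HNr : INR N <> 0%R) by (apply not_0_INR; lia).
  induction n as [|n IH].
  - rewrite phi_residue. cbn [bcoef]. rewrite Cpow_zero. ring.
  - assert (E := phi_exact n). assert (Hn : RtoC (INR n) + 1 <> 0).
    { rewrite <- RtoC_plus. apply RtoC_neq. generalize (pos_INR n). lra. }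
    cbn [bcoef]. rewrite Cpow_S, RtoC_mult.
    rewrite RtoC_div by (generalize (pos_INR n); lra).
    rewrite !RtoC_plus, RtoC_div by auto.
    assert (E' : INR N * A (S n) = - ((INR a + INR n * INR N) * (INR N * A n)) / (INR N * (INR n + 1))).
    { replace (INR N * A (S n)) with ((INR N * (INR n + 1) * A (S n)) / (INR n + 1)) by (field; auto).
      replace (INR N * (INR n + 1) * A (S n)) with (- ((INR a + INR n * INR N) * A n)).
      - field. auto.
      - replace (INR N * (INR n + 1) * A (S n)) with
          (((INR a + INR n * INR N) * A n + INR N * (INR n + 1) * A (S n)) - (INR a + INR n * INR N) * A n) by ring.
        rewrite E. ring. }
    rewrite E', IH. field. auto.
Qed.

(** [W] is [omega] on the circle, with a minus sign because alpha runs clockwise. The range of [l]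
    ends at twice [eps = r * r], and there [l * tau] has modulus at most [4 * r <= / 2], so the
    binomial series may be integrated term by term. *)
Lemma alpha_period (l : R) : (0 < l <= 2 * (r * r))%R ->
  let W := fun t => - (2 * PI * Ci) * INR N * (phi 0 (X t) * circ r t) * Bin (INR b / INR N) (- (RtoC l * tau N (X t))) in
  (forall t, ccont W t) /\ cint W = f_series N a b (RtoC l).
Proof.
  intros Hl W. assert (Fa := frac_bounds N a Ha). assert (Fb := frac_bounds N b Hb).
  assert (Bl : forall t, (Cmod (- (RtoC l * tau N (X t))) <= / 2)%R).
  { intros t. destruct (alpha_X t) as [_ [_ B]]. rewrite Cmod_opp, Cmod_mult, Cmod_R, Rabs_pos_eq by lra.
    apply Rle_trans with (2 * (r * r) * (2 / r))%R.
    - apply Rmult_le_compat; try lra. apply Cmod_ge_0.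
    - replace (2 * (r * r) * (2 / r))%R with (4 * r)%R by (field; lra). lra. }
  set (V := fun t => - (RtoC l * tau N (X t))) in *.
  set (c := fun n => RtoC (bcoef (INR b / INR N) n)).
  assert (Hc : forall n, (Cmod (c n) <= 1)%R) by (intros; apply bcoef_le1; rewrite Rabs_pos_eq; lra).
  set (U := fun t => - (2 * PI * Ci) * INR N * (phi 0 (X t) * circ r t)).
  assert (CU : forall t, ccont U t) by (intros t; apply ccont_mul; [apply ccont_const|apply phi_ccont]).
  assert (CX : forall t, ccont X t) by (intros t; eapply rder_ccont, alpha_X_rder).
  assert (CV : forall t, ccont V t).
  { intros t. destruct (alpha_X t) as [X0 [X1 _]].
    apply (ccont_D1 (fun x => - (RtoC l * tau N x)) X t _ (D1_opp _ _ _ (D1_mul _ _ _ _ _ (D1_const (RtoC l) (X t)) (tau_D1 (X t) X0 X1)))).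
    apply CX. }
  assert (CW : forall t, ccont W t).
  { intros t. apply ccont_mul; [apply CU|].
    assert (Ab : (Rabs (INR b / INR N) <= 1)%R) by (rewrite Rabs_pos_eq; lra).
    assert (Vl : (Cmod (V t) < 1)%R) by (eapply Rle_lt_trans; [apply Bl|lra]).
    apply (ccont_D1 (Bin (INR b / INR N)) V t _ (Bin_D1 _ _ Ab Vl)). apply CV. }
  split; auto.
  (* The sign [(-1)^n] of [V t ^ n] cancels that of [phi_integral]. Together with the binomial
     coefficients of the exponent [b / N] this yields the product in [fco]. *)
  assert (HV : forall n, cint (fun t => U t * V t ^ n) = 2 * PI * Ci * (RtoC (bcoef (INR a / INR N) n) * RtoC l ^ n)).
  { intros n. rewrite (cint_ext _ (fun t => (- (2 * PI * Ci) * ((- (1)) ^ n * RtoC l ^ n)) * (INR N * (phi n (X t) * circ r t)))).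
    - assert (C1 : ccontI (fun t => phi n (X t) * circ r t)) by (intros t _; apply phi_ccont).
      rewrite cint_scal by (intros t Ht; apply ccont_mul; [apply ccont_const|now apply C1]).
      rewrite cint_scal by auto. fold (A n). rewrite phi_integral.
      assert (S1 : (- (1)) ^ n * (- (1)) ^ n = 1).
      { rewrite <- Cpow_mult_l. replace (- (1) * - (1)) with (RtoC 1) by ring. apply Cpow_one. }
      transitivity (2 * PI * Ci * (RtoC (bcoef (INR a / INR N) n) * RtoC l ^ n) * ((- (1)) ^ n * (- (1)) ^ n)); [ring|].
      rewrite S1. ring.
    - intros t _. unfold U, V, phi. rewrite Cpow_zero.
      replace (- (RtoC l * tau N (X t))) with (- (1) * (RtoC l * tau N (X t))) by ring.
      rewrite !Cpow_mult_l. destruct (alpha_X t) as [X0 [X1 _]]. field. auto. }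
  assert (CI' : forall M, ccontI (fun t => U t * psum c (V t) M)).
  { intros M t Ht. apply ccont_mul; [apply CU|]. induction M as [|M IH]; cbn [psum]; [apply ccont_const|].
    apply ccont_add; auto. apply ccont_mul; [apply ccont_const|now apply ccont_pow]. }
  assert (HP : forall M, cint (fun t => U t * psum c (V t) M)
     = 2 * PI * Ci * psum (fun n => RtoC (fco (INR a / INR N) (INR b / INR N) n)) (RtoC l) M).
  { intros M. induction M as [|M IH]; cbn [psum].
    - rewrite (cint_ext _ (fun _ => 0)) by (intros; ring). rewrite cint_const. ring.
    - assert (C1 : ccontI (fun t => c M * (U t * V t ^ M)))
        by (intros t Ht; apply ccont_mul; [apply ccont_const|apply ccont_mul; [apply CU|apply ccont_pow, CV]]).
      rewrite (cint_ext _ (fun t => U t * psum c (V t) M + c M * (U t * V t ^ M))) by (intros; ring).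
      rewrite cint_add, IH by auto.
      rewrite cint_scal by (intros t Ht; apply ccont_mul; [apply CU|apply ccont_pow, CV]).
      rewrite HV. unfold c, fco. rewrite RtoC_mult. ring. }
  rewrite f_series_cps by lia.
  destruct (ccontI_bounded U (fun t _ => CU t)) as [B [HB BU]].
  assert (l1 : (l < 1)%R) by nra.
  apply ctends_unique with (fun M => cint (fun t => U t * psum c (V t) M)).
  - apply ctends_of_le with (B * 2)%R (/ 2)%R; [lra|]. intros M.
    rewrite Cmod_minus_sym, <- cint_sub; auto; [|intros t _; apply CW].
    apply cint_bound.
    + intros t Ht. apply ccont_sub; [apply CW|now apply CI'].
    + intros t Ht. change (W t) with (U t * Bin (INR b / INR N) (V t)).
      replace (U t * Bin (INR b / INR N) (V t) - U t * psum c (V t) M)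
        with (U t * (Bin (INR b / INR N) (V t) - psum c (V t) M)) by ring.
      rewrite Cmod_mult, Rmult_assoc. apply Rmult_le_compat; try apply Cmod_ge_0; auto.
      eapply Rle_trans; [apply (cps_remainder c (V t) (/ 2) M); auto; [apply Bl|lra]|]. apply Req_le. field.
  - apply ctends_ext with (fun M => 2 * PI * Ci * psum (fun n => RtoC (fco (INR a / INR N) (INR b / INR N) n)) (RtoC l) M).
    { intros M. now rewrite HP. }
    apply ctends_scal, cps_ctends; [intros n; now apply fco_le1|]. rewrite Cmod_R, Rabs_pos_eq; lra.
Qed.

End AlphaData.

(** * The explicit family of cycles extending alpha *)

Definition cc2 (f : R -> R -> C) (u s : R) : Prop :=
  forall e, (0 < e)%R -> exists d, (0 < d)%R /\ forall u' s', unit_interval u' -> unit_interval s' ->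
    (Rabs (u' - u) < d)%R -> (Rabs (s' - s) < d)%R -> (Cmod (f u' s' - f u s) < e)%R.

Lemma cc2_of_fst (f : R -> C) (u s : R) : ccont f u -> cc2 (fun u _ => f u) u s.
Proof. intros H e He. destruct (H e He) as [d [Hd P]]. exists d. split; auto. Qed.

Lemma cc2_of_snd (f : R -> C) (u s : R) : ccont f s -> cc2 (fun _ s => f s) u s.
Proof. intros H e He. destruct (H e He) as [d [Hd P]]. exists d. split; auto. Qed.

Lemma cc2_D2 (f : C -> C -> C) (p q : R -> R -> C) (u s : R) (a b : C) :
  D2 f (p u s) (q u s) a b -> cc2 p u s -> cc2 q u s -> cc2 (fun u s => f (p u s) (q u s)) u s.
Proof.
  intros H P Q e He. destruct (D2_cont _ _ _ _ _ H e He) as [d [Hd K]].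
  destruct (P d Hd) as [d1 [Hd1 P1]]. destruct (Q d Hd) as [d2 [Hd2 P2]].
  exists (Rmin d1 d2). split; [now apply Rmin_pos|].
  assert (m1 := Rmin_l d1 d2). assert (m2 := Rmin_r d1 d2).
  intros u' s' Hu Hs' Hu' Hs2. apply K; [apply P1|apply P2]; auto; lra.
Qed.

Lemma qcont2_fin (l : R -> C) (x y : R -> R -> C) (u s : R) :
  ccont l u -> cc2 x u s -> cc2 y u s -> qcont2 (fun u s => (l u, (Fin (x u s), Fin (y u s)))) u s.
Proof.
  intros L X Y r Hr. destruct (L r Hr) as [d1 [Hd1 P1]]. destruct (X r Hr) as [d2 [Hd2 P2]].
  destruct (Y r Hr) as [d3 [Hd3 P3]]. exists (Rmin d1 (Rmin d2 d3)).
  assert (m1 := Rmin_l d1 (Rmin d2 d3)). assert (m2 := Rmin_r d1 (Rmin d2 d3)).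
  assert (m3 := Rmin_l d2 d3). assert (m4 := Rmin_r d2 d3).
  split; [repeat apply Rmin_pos; auto|]. intros u' s' Hu Hs' Hu' Hs2.
  repeat split; cbn [fst snd pb]; [apply P1; lra|apply P2|apply P3]; auto; lra.
Qed.

Lemma ccont_affine (p q : R) (t : R) : ccont (fun v => RtoC (p + v * q)) t.
Proof.
  apply (ccont_ext_near (fun v => RtoC p + RtoC v * RtoC q) _ t 1 Rlt_0_1).
  - intros s _. now rewrite RtoC_plus, RtoC_mult.
  - apply ccont_add; [apply ccont_const|apply ccont_mul; [apply ccont_RtoC|apply ccont_const]].
Qed.

Lemma circ_reflect (r s : R) : circ r (1 - s) = RtoC r * cis (- (2 * PI * s)).
Proof.
  unfold circ. f_equal. replace (2 * PI * (1 - s))%R with (2 * PI + - (2 * PI * s))%R by ring.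
  rewrite cis_add, cis_2PI. ring.
Qed.

Lemma circ_reflect_rder (r t : R) : rder (fun s => circ r (1 - s)) t (- (2 * PI * Ci * circ r (1 - t))).
Proof.
  apply (rder_ext_near (fun s => RtoC r * cis (- (2 * PI) * s)) _ t 1 _ Rlt_0_1).
  - intros s _. rewrite circ_reflect. do 2 f_equal. ring.
  - eapply rder_eq; [apply rder_mul; [apply rder_const|apply rder_cis]|].
    cbv beta. rewrite circ_reflect. replace (- (2 * PI) * t)%R with (- (2 * PI * t))%R by ring.
    rewrite RtoC_opp, RtoC_mult. ring.
Qed.

Definition alpha_y (N : nat) (l x : C) : C := Bin (1 / INR N) (- (l * tau N x)).

Lemma inv_INR_le1 (N : nat) : (1 <= N)%nat -> (0 < 1 / INR N <= 1)%R.
Proof.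
  intros HN. assert (1 <= INR N)%R by (change 1%R with (INR 1); now apply le_INR).
  split; [apply Rdiv_lt_0_compat; lra|]. apply Rmult_le_reg_r with (INR N); [lra|]. field_simplify; lra.
Qed.

Lemma alpha_y_D2 (N : nat) (l x : C) : (1 <= N)%nat -> x <> 0 -> 1 - x ^ N <> 0 ->
  (Cmod (l * tau N x) < 1)%R ->
  exists A, D2 (alpha_y N) l x A ((1 / INR N)%R * alpha_y N l x / (1 + l * tau N x) *
    - (l * (INR N * x ^ N / (x * ((1 - x ^ N) * (1 - x ^ N)))))).
Proof.
  intros HN X0 X1 Hl. destruct (inv_INR_le1 N HN) as [I0 I1].
  assert (Ab : (Rabs (1 / INR N) <= 1)%R) by (rewrite Rabs_pos_eq; lra).
  eexists. unfold alpha_y. eapply D2_eq.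
  - apply (D2_of_D1 (Bin (1 / INR N)) (fun l x => - (l * tau N x))).
    + apply Bin_D1; auto. now rewrite Cmod_opp.
    + apply D2_opp, D2_mul; [apply D2_fst|]. apply (D2_of_D1 (tau N) (fun _ x => x)); [|apply D2_snd].
      now apply tau_D1.
  - reflexivity.
  - cbv beta. replace (1 - - (l * tau N x)) with (1 + l * tau N x) by ring. 
    assert (N1 : 1 + l * tau N x <> 0).
    { replace (1 + l * tau N x) with (1 - - (l * tau N x)) by ring. apply one_minus_neq0. now rewrite Cmod_opp. }
    field. auto.
Qed.

Lemma alpha_y_iff (N : nat) (l x y : C) : (1 <= N)%nat -> 1 - x ^ N <> 0 -> (Cmod (l * tau N x) < 1)%R ->
  on_curve N l (Fin x, Fin y) <-> y ^ N = alpha_y N l x ^ N.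
Proof.
  intros HN X1 Hl. unfold on_curve. cbn [fst snd hom]. rewrite !Cpow_one.
  assert (B := Bin_root N (- (l * tau N x)) HN ltac:(now rewrite Cmod_opp)). fold (alpha_y N l x) in B.
  assert (N1 : 1 - - (l * tau N x) <> 0) by (apply one_minus_neq0; now rewrite Cmod_opp).
  assert (E : (1 - x ^ N) * (1 - - (l * tau N x)) = 1 - x ^ N + l * x ^ N) by (unfold tau; field; auto).
  split; intros H.
  - assert (H' : y ^ N * ((1 - x ^ N) * (1 - - (l * tau N x))) = 1 - x ^ N).
    { rewrite E. replace (1 - x ^ N) with ((1 - x ^ N) * (1 - y ^ N) + (1 - x ^ N) * y ^ N) at 2 by ring.
      rewrite H. ring. }
    assert (K : y ^ N * (1 - - (l * tau N x)) = 1).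
    { replace (y ^ N * (1 - - (l * tau N x))) with (y ^ N * ((1 - x ^ N) * (1 - - (l * tau N x))) / (1 - x ^ N))
        by (field; auto). rewrite H'. field; auto. }
    replace (y ^ N) with (y ^ N * (1 - - (l * tau N x)) / (1 - - (l * tau N x))) by (field; auto).
    rewrite K. transitivity (alpha_y N l x ^ N * (1 - - (l * tau N x)) / (1 - - (l * tau N x))); [now rewrite B|field; auto].
  - rewrite H. set (Y := alpha_y N l x ^ N) in *.
    replace (l * (x ^ N * Y)) with (Y * (1 - x ^ N + l * x ^ N) - Y * (1 - x ^ N)) by ring.
    rewrite <- E. replace (Y * ((1 - x ^ N) * (1 - - (l * tau N x)))) with ((Y * (1 - - (l * tau N x))) * (1 - x ^ N)) by ring.
    rewrite B. ring.
Qed.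

(** The circle described by [x] stays fixed while [l] varies, and only [y] follows. The reflected
    parameter gives the clockwise orientation of alpha. *)
Definition alpha_model (N : nat) (r l : R) : path := fun s =>
  (Fin (1 + circ r (1 - s)), Fin (alpha_y N l (1 + circ r (1 - s)))).

Lemma ccont_reflect (f : R -> C) (t : R) : ccont f (1 - t) -> ccont (fun s => f (1 - s)%R) t.
Proof.
  intros H e He. destruct (H e He) as [d [Hd P]]. exists d. split; auto. intros s Hs.
  apply P. replace (1 - s - (1 - t))%R with (- (s - t))%R by ring. now rewrite Rabs_Ropp.
Qed.

Section AlphaModel.
Variables (N : nat) (r r0 : R).
Hypothesis HN : (2 <= N)%nat.
Hypothesis Hr : (0 < r < r0)%R.
Hypothesis Hr0 : (r0 <= / 8)%R.
Hypothesis Hrad : forall x, (Cmod (x - 1) < r0)%R -> (Cmod (x - 1) <= Cmod (1 - x ^ N))%R /\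
     (Cmod (x ^ N) <= 2)%R /\ x <> 0.

Lemma alpha_small (l t : R) : (0 < l <= 2 * (r * r))%R ->
  (Cmod (l * tau N (1 + circ r t)%C) < 1)%R.
Proof.
  intros Hl. destruct (alpha_X N r r0 Hr Hrad t) as [_ [_ B]]. rewrite Cmod_mult, Cmod_R, Rabs_pos_eq by lra.
  apply Rle_lt_trans with (2 * (r * r) * (2 / r))%R.
  - apply Rmult_le_compat; try lra. apply Cmod_ge_0.
  - replace (2 * (r * r) * (2 / r))%R with (4 * r)%R by (field; lra). lra.
Qed.

Lemma alpha_model_onE (l s : R) : (0 < l <= 2 * (r * r))%R -> (l < 1)%R ->
  onE N (RtoC l, alpha_model N r l s).
Proof.
  intros Hl L1. destruct (alpha_X N r r0 Hr Hrad (1 - s)) as [_ [X1 _]].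
  repeat split; cbn [fst snd].
  - apply alpha_y_iff; auto; [lia|now apply alpha_small].
  - apply RtoC_neq; lra.
  - apply RtoC_neq; lra.
Qed.

Lemma alpha_model_qcont2 (u s : R) : unit_interval u ->
  qcont2 (fun v s => (RtoC (r * r + v * (r * r)), alpha_model N r (r * r + v * (r * r)) s)) u s.
Proof.
  intros Hu. destruct (alpha_X N r r0 Hr Hrad (1 - s)) as [X0 [X1 _]].
  assert (CX : cc2 (fun _ s => 1 + circ r (1 - s)) u s).
  { apply (cc2_of_snd (fun s => 1 + circ r (1 - s))). apply ccont_add; [apply ccont_const|].
    eapply rder_ccont, circ_reflect_rder. }
  unfold alpha_model. apply qcont2_fin; auto; [apply ccont_affine|].
  destruct (alpha_y_D2 N (RtoC (r * r + u * (r * r))) (1 + circ r (1 - s))) as [A DY]; auto; [lia| |].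
  - apply alpha_small. unfold unit_interval in Hu. nra.
  - apply (cc2_D2 (alpha_y N) (fun u _ => RtoC (r * r + u * (r * r))) (fun _ s => 1 + circ r (1 - s)) u s _ _ DY); auto.
    apply (cc2_of_fst (fun u => RtoC (r * r + u * (r * r)))), ccont_affine.
Qed.

Lemma alpha_model_good :
  good_family (onE N) (fun v => RtoC (r * r + v * (r * r)))
    ((1%Z, fun v => alpha_model N r (r * r + v * (r * r))) :: nil).
Proof.
  split.
  - constructor; [|constructor]. intros u s Hu Hs'. cbn [snd]. split.
    + unfold unit_interval in Hu. apply alpha_model_onE; nra.
    + now apply alpha_model_qcont2.
  - intros u _ p. cbn [chain_at map boundary fst snd]. unfold alpha_model.
    replace (1 - 1)%R with 0%R by ring. replace (1 - 0)%R with 1%R by ring.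
    rewrite circ_periodic. lia.
Qed.

Lemma alpha_model_smooth (l : R) : (0 < l <= 2 * (r * r))%R ->
  exists dy, smooth_coordinates (alpha_model N r l) (fun s => 1 + circ r (1 - s))
    (fun s => alpha_y N l (1 + circ r (1 - s))) (fun s => - (2 * PI * Ci * circ r (1 - s))) dy.
Proof.
  intros Hl. set (x := fun s => 1 + circ r (1 - s)). set (dx := fun s => - (2 * PI * Ci * circ r (1 - s))).
  assert (Dx : forall s, rder x s (dx s)).
  { intros s. eapply rder_eq; [apply rder_add; [apply rder_const|apply circ_reflect_rder]|unfold dx; ring]. }
  assert (Cx : forall s, ccont x s) by (intros s; eapply rder_ccont, Dx).
  assert (Cdx : forall s, ccont dx s).
  { intros s. apply (ccont_ext_near (fun s => - (2 * PI * Ci) * circ r (1 - s)) dx s 1 Rlt_0_1).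
    - intros; unfold dx; ring.
    - apply ccont_mul; [apply ccont_const|]. eapply rder_ccont, circ_reflect_rder. }
  set (y := fun s => alpha_y N l (x s)).
  set (yx := fun s => (1 / INR N)%R * y s / (1 + l * tau N (x s)) *
    - (l * (INR N * x s ^ N / (x s * ((1 - x s ^ N) * (1 - x s ^ N)))))).
  assert (Dy : forall s, rder y s (yx s * dx s)).
  { intros s. destruct (alpha_X N r r0 Hr Hrad (1 - s)) as [X0 [X1 _]].
    destruct (alpha_y_D2 N l (x s)) as [A DY]; auto; [lia|now apply alpha_small|].
    apply D2_slice2 in DY. exact (rder_D1 (alpha_y N l) x s _ _ DY (Dx s)). }
  assert (Cy : forall s, ccont y s) by (intros s; eapply rder_ccont, Dy).
  exists (fun s => yx s * dx s). split; [reflexivity|]. intros s _.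
  destruct (alpha_X N r r0 Hr Hrad (1 - s)) as [X0 [X1 _]]. fold (x s) in X0, X1.
  assert (Sm := alpha_small l (1 - s) Hl). fold (x s) in Sm.
  assert (N1 : 1 + l * tau N (x s) <> 0).
  { replace (1 + l * tau N (x s)) with (1 - - (l * tau N (x s))) by ring. apply one_minus_neq0. now rewrite Cmod_opp. }
  assert (Ct : ccont (fun s => tau N (x s)) s) by (apply (ccont_D1 (tau N) x s _ (tau_D1 N (x s) X0 X1)), Cx).
  split; [exact X0|]. split; [|split; [|split; [|split]]].
  - apply rt_base_neq0; [lia|]. now rewrite Cmod_opp.
  - apply rder_is_derive, Dx.
  - apply rder_is_derive, Dy.
  - apply ccont_continuous, Cdx.
  - apply ccont_continuous. apply ccont_mul; [|apply Cdx]. unfold yx.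
    apply ccont_mul; [apply ccont_mul; [apply ccont_mul; [apply ccont_const|apply Cy]|]|].
    + apply ccont_inv; auto. apply ccont_add; [apply ccont_const|]. apply ccont_mul; [apply ccont_const|exact Ct].
    + apply (ccont_ext_near (fun s => (- (1) * l * INR N) * (x s ^ N * / (x s * ((1 - x s ^ N) * (1 - x s ^ N))))) _ s 1 Rlt_0_1).
      { intros t _. unfold Cdiv. ring. }
      assert (C1 : ccont (fun s => 1 - x s ^ N) s) by (apply ccont_sub; [apply ccont_const|now apply ccont_pow]).
      apply ccont_mul; [apply ccont_const|]. apply ccont_mul; [now apply ccont_pow|].
      apply ccont_inv; [repeat apply Cmult_neq_0; auto|]. apply ccont_mul; auto. apply ccont_mul; auto.
Qed.

Lemma alpha_model_period (a b : nat) (l : R) (F : C -> C) : (1 <= a <= N - 1)%nat -> (1 <= b <= N - 1)%nat ->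
  (0 < l <= 2 * (r * r))%R -> (l < 1)%R ->
  List.Forall (fun m => path_ok N l (snd m)) ((1%Z, alpha_model N r l) :: nil) ->
  Tot (GG N a b) l ((1%Z, alpha_model N r l) :: nil) F -> F l = f_series N a b l.
Proof.
  intros Ha Hb Hl L1 Hok [T [F' [HT [HF' E]]]]. cbn [Tot] in HF'. apply eq_near_at in E, HF'. rewrite E, HF'.
  inversion Hok as [|m c [K1 K2] _]; subst. cbn [snd] in *.
  destruct (alpha_model_smooth l Hl) as [dy Hs'].
  destruct (smooth_integrals N a b l _ T _ _ _ dy HN Ha Hb K1 K2 Hs' HT) as [I _].
  destruct (alpha_period N a b r r0 HN Ha Hb Hr Hr0 Hrad l Hl) as [CW EW].
  match type of EW with cint ?W = _ => set (w := W) in * end.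
  assert (T l = cint (fun s => w (1 - s)%R)) as ->.
  { apply (is_RInt_gen_C_unique (fun s => w (1 - s)%R)).
    - revert I. apply is_RInt_gen_ext01. intros s _. unfold omega, w.
      destruct (alpha_X N r r0 Hr Hrad (1 - s)) as [X0 [X1 _]]. cbv beta zeta in X0, X1.
      rewrite <- (Bin_pow N b) by (try lia; rewrite Cmod_opp; now apply alpha_small).
      fold (alpha_y N l (1 + circ r (1 - s))). rewrite Cpow_zero. field. auto.
    - apply is_RInt_gen_cint. intros t. apply ccont_reflect, CW. }
  (* The path is clockwise, the integral of [alpha_period] counterclockwise with the sign built
     in. *)
  rewrite cint_reflect by (intros t _; apply CW). rewrite EW. ring.
Qed.

End AlphaModel.

Lemma alpha_initial (N : nat) : (2 <= N)%nat -> exists eps0, (0 < eps0 <= / 4)%R /\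
  forall (eps : R) (alpha : path) (a b : nat), (0 < eps < eps0)%R -> is_alpha N eps alpha ->
    (1 <= a <= N - 1)%nat -> (1 <= b <= N - 1)%nat ->
    Tot (GG N a b) (RtoC eps) (alpha_chain alpha) (f_series N a b).
Proof.
  intros HN. destruct (alpha_radius N HN) as [r0 [Hr0 [Hrad Huniq]]].
  exists (r0 * r0)%R. split; [nra|]. intros eps alpha a b Heps Hal Ha Hb.
  set (r := sqrt eps). assert (Err : (r * r)%R = eps) by (apply sqrt_sqrt; lra).
  assert (Hr : (0 < r < r0)%R).
  { split; [apply sqrt_lt_R0; lra|]. unfold r. rewrite <- (sqrt_square r0) by lra. apply sqrt_lt_1_alt. lra. }
  set (fam := (1%Z, fun v => alpha_model N r (r * r + v * (r * r))) :: nil : chain_family).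
  assert (Hfam := alpha_model_good N r r0 HN Hr (proj2 Hr0) Hrad). fold fam in Hfam.
  assert (M : Tot (GG N a b) (RtoC (r * r)) (chain_at fam 0) (f_series N a b)).
  { apply (Tot_init N a b (r * r) (r * r) fam); auto; [nra| |].
    - apply f_series_holo; auto. rewrite Cmod_R, Rabs_pos_eq; nra.
    - intros v F Hv HF. assert (Hok := good_family_path_ok N _ fam v Hfam Hv).
      unfold unit_interval in Hv.
      apply (alpha_model_period N r r0 HN Hr (proj2 Hr0) Hrad a b); auto; nra. }
  rewrite Err in M. revert M. apply Tot_same.
  constructor; [|constructor]. cbn [fst snd]. split; auto. intros s Hs'.
  (* [is_alpha] gives [y] only as some root close to 1, separately for each [s]; uniqueness of that
     root identifies it with the binomial series, so the two paths coincide. *)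
  destruct (Hal s Hs') as [y [E [Hc Hy]]]. rewrite E in Hc |- *.
  assert (Ex : 1 + RtoC (sqrt eps) * cis (- (2 * PI * s)) = 1 + circ r (1 - s)) by now rewrite circ_reflect.
  rewrite Ex in *. unfold alpha_model. replace (r * r + 0 * (r * r))%R with eps by (rewrite Err; ring).
  do 2 f_equal. destruct (alpha_X N r r0 Hr Hrad (1 - s)) as [X0 [X1 B]]. cbv beta zeta in *.
  symmetry. apply Huniq; [|fold r in Hy; lra|].
  - rewrite Cmod_opp, Cmod_mult, Cmod_R, Rabs_pos_eq by lra.
    apply Rle_trans with (eps * (2 / r))%R; [apply Rmult_le_compat_l; lra|].
    rewrite <- Err. replace (r * r * (2 / r))%R with (2 * r)%R by (field; lra). lra.
  - apply alpha_y_iff in Hc; auto; [lia|]. apply (alpha_small N r r0); try tauto. lra.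
Qed.

(** * The period over beta for small real parameter *)

Lemma ccont_RtoC_comp (g : R -> R) (t : R) : continuous g t -> ccont (fun s => RtoC (g s)) t.
Proof.
  intros H e He. destruct (proj1 (filterlim_locally g (g t)) H (mkposreal e He)) as [d P].
  exists d. split; [apply cond_pos|]. intros s Hs. rewrite <- RtoC_minus, Cmod_R. exact (P s Hs).
Qed.

Lemma rder_RtoC_comp (g : R -> R) (t v : R) : is_derive g t v -> rder (fun s => RtoC (g s)) t (RtoC v).
Proof.
  intros H. apply rder_of_re_im; cbn [Re Im fst snd RtoC]; auto. apply (is_derive_const (V := R_NormedModule)).
Qed.

Lemma nth_root_pos (N : nat) (t : R) : (0 < t)%R -> nth_root N t = Rpower t (/ INR N).
Proof. intros H. unfold nth_root. destruct (Rlt_dec 0 t); [auto|lra]. Qed.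

Lemma nth_root_0 (N : nat) : nth_root N 0 = 0%R.
Proof. unfold nth_root. destruct (Rlt_dec 0 0); [lra|auto]. Qed.

Lemma nth_root_1 (N : nat) : nth_root N 1 = 1%R.
Proof. rewrite nth_root_pos by lra. unfold Rpower. rewrite ln_1, Rmult_0_r. apply exp_0. Qed.

Lemma nth_root_pow (N k : nat) (t : R) : (0 < t)%R -> (nth_root N t ^ k)%R = Rpower t (INR k / INR N).
Proof.
  intros H. rewrite nth_root_pos, <- Rpower_pow, Rpower_mult by (auto; apply exp_pos). f_equal.
  unfold Rdiv. ring.
Qed.

Lemma nth_root_powN (N : nat) (t : R) : (1 <= N)%nat -> (0 <= t)%R -> (nth_root N t ^ N)%R = t.
Proof.
  intros HN [H|<-].
  - rewrite nth_root_pow by auto. unfold Rdiv. rewrite Rinv_r by (apply not_0_INR; lia). now apply Rpower_1.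
  - rewrite nth_root_0. apply pow_i. lia.
Qed.

(** The root is not differentiable at 0, so the continuity of delta at its ends needs this separate
    argument; being 0 on negative numbers makes it two-sided. *)
Lemma nth_root_ccont (N : nat) (t : R) : (1 <= N)%nat -> ccont (fun t => RtoC (nth_root N t)) t.
Proof.
  intros HN. assert (HNr : (0 < / INR N)%R) by (apply Rinv_0_lt_compat, lt_0_INR; lia).
  destruct (Rtotal_order t 0) as [H|[->|H]].
  - apply (ccont_ext_near (fun _ => 0) _ t (- t)); [lra| |apply ccont_const].
    intros s Hs. apply Rabs_def2 in Hs. unfold nth_root. destruct (Rlt_dec 0 s); [lra|auto].
  - intros e He. destruct (Rpower_small (/ INR N) e HNr He) as [d [Hd P]]. exists d. split; auto.
    intros s Hs. rewrite Rminus_0_r in Hs. apply Rabs_def2 in Hs. rewrite nth_root_0, <- RtoC_minus, Cmod_R, Rminus_0_r.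
    unfold nth_root. destruct (Rlt_dec 0 s); [|rewrite Rabs_R0; lra].
    assert (K := P s ltac:(lra)). rewrite Rabs_pos_eq; lra.
  - apply (ccont_ext_near (fun t => RtoC (Rpower t (/ INR N)%R)) _ t t H).
    + intros s Hs. apply Rabs_def2 in Hs. now rewrite nth_root_pos by lra.
    + now apply ccont_RtoC_comp, Rpower_continuous.
Qed.

Lemma nth_root_derive (N : nat) (t : R) : (0 < t)%R ->
  is_derive (nth_root N) t (/ INR N * Rpower t (/ INR N - 1))%R.
Proof.
  intros H. apply (is_derive_ext_loc (fun t => Rpower t (/ INR N)%R)); [|now apply Rpower_derive].
  exists (mkposreal t H). intros s Hs. apply Rabs_def2 in Hs. simpl in Hs. unfold minus, plus, opp in Hs. simpl in Hs.
  symmetry. apply nth_root_pos. lra.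
Qed.

(* The [N]-th power of the second coordinate of [delta]. *)
Definition delta_q (l t : R) : R := ((1 - t) / (1 - (1 - l) * t))%R.

Lemma delta_den (l t : R) : (0 < l < 1)%R -> unit_interval t -> (l <= 1 - (1 - l) * t)%R.
Proof. intros Hl Ht. unfold unit_interval in Ht. nra. Qed.

Lemma delta_q_pos (l t : R) : (0 < l < 1)%R -> unit_interval t -> (0 <= delta_q l t)%R.
Proof.
  intros Hl Ht. assert (D := delta_den l t Hl Ht). unfold unit_interval in Ht. unfold delta_q, Rdiv.
  apply Rmult_le_pos; [lra|]. left. apply Rinv_0_lt_compat. lra.
Qed.

Definition delta_image (N : nat) (z1 z2 : C) (l : R) : path := fun s =>
  (Fin (z1 * nth_root N s), Fin (z2 * nth_root N (delta_q l s))).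

Lemma delta_image_onE (N : nat) (z1 z2 : C) (l s : R) : (1 <= N)%nat -> z1 ^ N = 1 -> z2 ^ N = 1 ->
  (0 < l < 1)%R -> unit_interval s -> onE N (RtoC l, delta_image N z1 z2 l s).
Proof.
  intros HN E1 E2 Hl Hs'. assert (D := delta_den l s Hl Hs').
  split; [|split; cbn [fst]; apply RtoC_neq; lra].
  unfold on_curve. cbn [fst snd delta_image hom].
  rewrite !Cpow_one, !Cpow_mult_l, E1, E2, <- !RtoC_pow.
  rewrite !nth_root_powN by (auto; try apply delta_q_pos; auto; unfold unit_interval in Hs'; lra).
  rewrite !Cmult_1_l. unfold delta_q. 
  rewrite <- !RtoC_minus, <- !RtoC_mult. f_equal. field. lra.
Qed.

Lemma cc2_ext (f g : R -> R -> C) (u s : R) : unit_interval u -> unit_interval s ->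
  (forall u s, unit_interval u -> unit_interval s -> f u s = g u s) -> cc2 f u s -> cc2 g u s.
Proof.
  intros Hu Hs' E H e He. destruct (H e He) as [d [Hd P]]. exists d. split; auto.
  intros u' s' A B A' B'. rewrite <- !E by auto. auto.
Qed.

Lemma cc2_comp (h : R -> C) (g : R -> R -> R) (u s : R) :
  ccont h (g u s) -> cc2 (fun u s => RtoC (g u s)) u s -> cc2 (fun u s => h (g u s)) u s.
Proof.
  intros H K e He. destruct (H e He) as [d [Hd P]]. destruct (K d Hd) as [d' [Hd' Q]].
  exists d'. split; auto. intros u' s' A B A' B'. apply P.
  rewrite <- Cmod_R, RtoC_minus. now apply Q.
Qed.

Lemma cc2_scal (c : C) (f : R -> R -> C) (u s : R) : cc2 f u s -> cc2 (fun u s => c * f u s) u s.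
Proof.
  intros H. apply (cc2_D2 (fun _ x => c * x) f f u s (0 * f u s + c * 0) (0 * f u s + c * 1)); auto.
  apply (D2_mul (fun _ _ => c) (fun _ x => x)); [apply D2_const|apply D2_snd].
Qed.

Lemma delta_image_qcont2 (N : nat) (z1 z2 : C) (p q u s : R) : (1 <= N)%nat -> 
  (forall v, unit_interval v -> (0 < p + v * q < 1)%R) -> unit_interval u -> unit_interval s ->
  qcont2 (fun v s => (RtoC (p + v * q), delta_image N z1 z2 (p + v * q) s)) u s.
Proof.
  intros HN Hl Hu Hs'. unfold delta_image. apply qcont2_fin; [apply ccont_affine| |].
  - apply cc2_scal. apply (cc2_of_snd (fun s => RtoC (nth_root N s))). now apply nth_root_ccont.
  - apply cc2_scal. apply (cc2_comp (fun t => RtoC (nth_root N t)) (fun v s => delta_q (p + v * q) s)); [now apply nth_root_ccont|].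
    apply (cc2_ext (fun v s => (1 - RtoC s) / (1 - (1 - RtoC (p + v * q)) * RtoC s))); auto.
    { intros v t Hv Ht. assert (D := delta_den _ t (Hl v Hv) Ht). assert (P := Hl v Hv). unfold delta_q.
      rewrite RtoC_div by lra. now rewrite !RtoC_minus, RtoC_mult, RtoC_minus. }
    eapply (cc2_D2 (fun l t => (1 - t) / (1 - (1 - l) * t)) (fun v _ => RtoC (p + v * q)) (fun _ s => RtoC s)).
    + apply (D2_div (fun _ t => 1 - t) (fun l t => 1 - (1 - l) * t)).
      * cbv beta. assert (D := delta_den _ s (Hl u Hu) Hs'). assert (P := Hl u Hu).
        rewrite <- RtoC_minus, <- RtoC_mult, <- RtoC_minus. apply RtoC_neq. lra.
      * apply (D2_sub (fun _ _ => 1) (fun _ t => t)); [apply D2_const|apply D2_snd].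
      * apply (D2_sub (fun _ _ => 1) (fun l t => (1 - l) * t)); [apply D2_const|].
        apply (D2_mul (fun l _ => 1 - l) (fun _ t => t)); [|apply D2_snd].
        apply (D2_sub (fun _ _ => 1) (fun l _ => l)); [apply D2_const|apply D2_fst].
    + apply (cc2_of_fst (fun v => RtoC (p + v * q))), ccont_affine.
    + apply (cc2_of_snd RtoC), ccont_RtoC.
Qed.

Definition delta_dx (N : nat) (s : R) : R := (/ INR N * Rpower s (/ INR N - 1))%R.

Definition delta_dy (N : nat) (l s : R) : R :=
  (/ INR N * Rpower (delta_q l s) (/ INR N - 1) * (- l / (1 - (1 - l) * s) ^ 2))%R.

Lemma delta_q_derive (l s : R) : (0 < l < 1)%R -> (0 < s < 1)%R ->
  is_derive (delta_q l) s (- l / (1 - (1 - l) * s) ^ 2)%R.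
Proof.
  intros Hl Hs'. assert (D := delta_den l s Hl). assert (U : unit_interval s) by (unfold unit_interval; lra).
  specialize (D U). unfold delta_q. auto_derive; [lra|]. field. lra.
Qed.

Lemma delta_image_smooth (N : nat) (z1 z2 : C) (l : R) : (1 <= N)%nat -> z1 <> 0 -> z2 <> 0 -> (0 < l < 1)%R ->
  smooth_coordinates (delta_image N z1 z2 l) (fun s => z1 * nth_root N s) (fun s => z2 * nth_root N (delta_q l s))
    (fun s => z1 * delta_dx N s) (fun s => z2 * delta_dy N l s).
Proof.
  intros HN Z1 Z2 Hl. split; [reflexivity|]. intros s Hs'.
  assert (U : unit_interval s) by (unfold unit_interval; lra).
  assert (D := delta_den l s Hl U).
  assert (Q : (0 < delta_q l s)%R) by (apply Rdiv_lt_0_compat; lra).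
  assert (Hq := delta_q_derive l s Hl Hs').
  assert (Cq : continuous (delta_q l) s) by (apply (ex_derive_continuous (V := R_NormedModule)); eexists; exact Hq).
  split; [|split; [|split; [|split; [|split]]]].
  - apply Cmult_neq_0; auto. rewrite nth_root_pos by lra. apply RtoC_neq. generalize (exp_pos (/ INR N * ln s)%R). unfold Rpower; lra.
  - apply Cmult_neq_0; auto. rewrite nth_root_pos by lra. apply RtoC_neq.
    generalize (exp_pos (/ INR N * ln (delta_q l s))%R). unfold Rpower; lra.
  - apply rder_is_derive. eapply rder_eq; [apply rder_mul; [apply rder_const|apply rder_RtoC_comp, nth_root_derive; lra]|].
    unfold delta_dx. ring.
  - apply rder_is_derive. eapply rder_eq.
    + apply rder_mul; [apply rder_const|apply (rder_RtoC_comp (fun s => nth_root N (delta_q l s)))].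
      apply (is_derive_comp (nth_root N) (delta_q l)); [now apply nth_root_derive|exact Hq].
    + unfold delta_dy. unfold scal; simpl; unfold mult; simpl. rewrite Cmult_0_l, Cplus_0_l. do 2 f_equal. ring.
  - apply ccont_continuous. apply ccont_mul; [apply ccont_const|]. apply ccont_RtoC_comp. unfold delta_dx.
    apply (continuous_mult (K := R_AbsRing) (fun _ => / INR N)%R); [apply continuous_const|apply Rpower_continuous; lra].
  - apply ccont_continuous. apply ccont_mul; [apply ccont_const|]. apply ccont_RtoC_comp. unfold delta_dy.
    apply (continuous_mult (K := R_AbsRing) (fun s => / INR N * Rpower (delta_q l s) (/ INR N - 1))%R).
    + apply (continuous_mult (K := R_AbsRing) (fun _ => / INR N)%R); [apply continuous_const|].
      apply (continuous_comp (delta_q l) (fun t => Rpower t (/ INR N - 1)%R)); auto. now apply Rpower_continuous.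
    + apply (ex_derive_continuous (V := R_NormedModule)). auto_derive. simpl. nra.
Qed.

(** The parameter of delta is [t = x^N], so [N dx / x] is [dt / t], while [y^b] equals
    [(1-t)^(b/N) (1-(1-l)t)^(-b/N)] on delta. A rotation by roots of unity only contributes the
    constant [z1^a z2^b]. *)
Lemma delta_image_omega (N a b : nat) (z1 z2 : C) (l s : R) : (2 <= N)%nat -> (1 <= b <= N - 1)%nat ->
  z1 ^ N = 1 -> z1 <> 0 -> (0 < l < 1)%R -> (0 < s < 1)%R ->
  omega N a b (z1 * nth_root N s) (z2 * nth_root N (delta_q l s)) (z1 * delta_dx N s) (z2 * delta_dy N l s)
  = z1 ^ a * z2 ^ b * (RtoC (beta_w (INR a / INR N) (INR b / INR N) s) * Bin (INR b / INR N) (RtoC ((1 - l) * s)%R)).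
Proof.
  intros HN Hb E1 Z1 Hl Hs'. assert (Fb := frac_bounds N b Hb).
  assert (U : unit_interval s) by (unfold unit_interval; lra). assert (D := delta_den l s Hl U).
  assert (HNr : (0 < INR N)%R) by (apply lt_0_INR; lia).
  unfold omega. rewrite !Cpow_mult_l, E1, Bin_real by (try lra; nra).
  rewrite <- !RtoC_pow, nth_root_powN by (try lia; lra).
  rewrite !nth_root_pow by (try apply Rdiv_lt_0_compat; lra).
  unfold delta_q. rewrite nth_root_pos by lra. unfold delta_dx, beta_w.
  set (al := (INR a / INR N)%R). set (be := (INR b / INR N)%R).
  assert (R1 : Rpower s al = (s * Rpower s (al - 1))%R) by (now rewrite Rpower_minus1 by lra).
  assert (R2 : Rpower s (/ INR N) = (s * Rpower s (/ INR N - 1))%R) by (now rewrite Rpower_minus1 by lra).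
  assert (R3 : Rpower (1 - s) be = ((1 - s) * Rpower (1 - s) (be - 1))%R) by (now rewrite Rpower_minus1 by lra).
  assert (R4 : Rpower ((1 - s) / (1 - (1 - l) * s)) be = (Rpower (1 - s) be * Rpower (1 - (1 - l) * s) (- be))%R).
  { unfold Rpower. rewrite <- exp_plus. f_equal. unfold Rdiv.
    rewrite ln_mult by (try apply Rinv_0_lt_compat; lra). rewrite ln_Rinv by lra. ring. }
  rewrite R4, R1, R2, R3. assert (P : (0 < Rpower s (/ INR N - 1))%R) by apply exp_pos.
  rewrite !RtoC_mult, RtoC_inv by lra. rewrite RtoC_minus.
  assert (RtoC s <> 0) by (apply RtoC_neq; lra). assert (RtoC (Rpower s (/ INR N - 1)) <> 0) by (apply RtoC_neq; lra).
  assert (1 - RtoC s <> 0) by (rewrite <- RtoC_minus; apply RtoC_neq; lra). assert (RtoC (INR N) <> 0) by (apply RtoC_neq; lra).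
  rewrite !Cmult_1_l. field. auto.
Qed.

Lemma zeta_pow (N : nat) : (1 <= N)%nat -> zeta N ^ N = 1.
Proof.
  intros HN. unfold zeta. rewrite cis_pow. replace (INR N * (2 * PI / INR N))%R with (2 * PI)%R.
  - apply cis_2PI.
  - field. apply not_0_INR. lia.
Qed.

Lemma zeta_neq0 (N : nat) : zeta N <> 0.
Proof. apply Cmod_gt_0. unfold zeta. rewrite Cmod_cis. lra. Qed.

(** The expansion of [(1 - xi) (1 - eta)] applied to delta, with the parameter of the fibre left
    free. *)
Definition beta_family (N : nat) (l : R -> R) : chain_family :=
  (1%Z, fun v => delta_image N 1 1 (l v)) :: ((-1)%Z, fun v => delta_image N 1 (zeta N) (l v))
  :: ((-1)%Z, fun v => delta_image N (zeta N) 1 (l v)) :: (1%Z, fun v => delta_image N (zeta N) (zeta N) (l v)) :: nil.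

Lemma beta_family_same (N : nat) (l : R -> R) (v : R) : same_chain (chain_at (beta_family N l) v) (beta_chain N (l v)).
Proof.
  unfold beta_chain, beta_family. cbn [chain_at chain_sub push map app fst snd].
  repeat (apply Forall2_cons; [|]); try apply Forall2_nil; cbn [fst snd]; (split; [reflexivity|]); intros s _; unfold delta_image, delta, act, delta_q; cbn [fst snd P1_scale xi eta];
    (apply f_equal2; apply f_equal; ring).
Qed.

(** The path rotated by [(z1, z2)] runs from [(0, z2)] to [(z1, 0)]. Each end is thus shared by two
    of the four paths, with opposite signs. *)
Lemma beta_family_cycle (N : nat) (l : R -> R) (v : R) : (0 < l v < 1)%R -> is_cycle (chain_at (beta_family N l) v).
Proof.
  intros Hl p. unfold beta_family. cbn [chain_at map boundary fst snd]. unfold delta_image.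
  assert (Q0 : delta_q (l v) 0 = 1%R) by (unfold delta_q; field; lra).
  assert (Q1 : delta_q (l v) 1 = 0%R) by (unfold delta_q; field; lra).
  rewrite Q0, Q1, nth_root_0, nth_root_1, !Cmult_0_r, !Cmult_1_r.
  repeat destruct (point_eq_dec _ p); lia.
Qed.

Lemma delta_image_period (N a b : nat) (z1 z2 : C) (l : R) (T : C -> C) : (2 <= N)%nat ->
  (1 <= a <= N - 1)%nat -> (1 <= b <= N - 1)%nat -> z1 ^ N = 1 -> z1 <> 0 -> z2 <> 0 -> (0 < l < 1)%R ->
  path_ok N l (delta_image N z1 z2 l) -> PG (GG N a b) l (delta_image N z1 z2 l) 0 1 T ->
  @is_RInt_gen C_R_NormedModule (fun t => z1 ^ a * z2 ^ b *
    (RtoC (beta_w (INR a / INR N) (INR b / INR N) t) * Bin (INR b / INR N) (RtoC ((1 - l) * t))))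
    (at_right 0) (at_left 1) (T l).
Proof.
  intros HN Ha Hb E1 Z1 Z2 Hl [K1 K2] HT.
  assert (Sm := delta_image_smooth N z1 z2 l ltac:(lia) Z1 Z2 Hl).
  destruct (smooth_integrals N a b l _ T _ _ _ _ HN Ha Hb K1 K2 Sm HT) as [I _].
  revert I. apply is_RInt_gen_ext01. intros t Ht. now apply delta_image_omega.
Qed.

Lemma beta_period (N a b : nat) (l : R -> R) (v : R) (F : C -> C) : (2 <= N)%nat ->
  (1 <= a <= N - 1)%nat -> (1 <= b <= N - 1)%nat -> (0 < l v < 1)%R ->
  List.Forall (fun m => path_ok N (l v) (snd m)) (chain_at (beta_family N l) v) ->
  Tot (GG N a b) (l v) (chain_at (beta_family N l) v) F ->
  F (RtoC (l v)) = (1 - zeta N ^ a) * (1 - zeta N ^ b) * g_series N a b (l v).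
Proof.
  intros HN Ha Hb Hl Hok HF. assert (Fa := frac_bounds N a Ha). assert (Fb := frac_bounds N b Hb).
  unfold beta_family in *. cbn [chain_at map fst snd Tot] in *.
  destruct HF as [T1 [F1 [A1 [[T2 [F2 [A2 [[T3 [F3 [A3 [[T4 [F4 [A4 [B4 E4]]]] E3]]]] E2]]]] E1]]]].
  apply eq_near_at in E1, E2, E3, E4, B4. rewrite E1, E2, E3, E4, B4.
  apply Forall_cons_iff in Hok as [O1 Hok]. apply Forall_cons_iff in Hok as [O2 Hok].
  apply Forall_cons_iff in Hok as [O3 Hok]. apply Forall_cons_iff in Hok as [O4 _]. cbn [snd] in *.
  assert (Zn := zeta_neq0 N). assert (Zp := zeta_pow N ltac:(lia)).
  assert (one : RtoC 1 <> 0) by (apply RtoC_neq; lra). assert (onep := Cpow_one N).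
  apply delta_image_period in A1, A2, A3, A4; auto.
  assert (I : forall c V, @is_RInt_gen C_R_NormedModule (fun t => c *
    (RtoC (beta_w (INR a / INR N) (INR b / INR N) t) * Bin (INR b / INR N) (RtoC ((1 - l v) * t))))
    (at_right 0) (at_left 1) V -> V = c * T1 (RtoC (l v))).
  { intros c V HV. apply (is_RInt_gen_C_unique _ _ _ HV). apply is_RInt_gen_Cscal. revert A1.
    apply is_RInt_gen_ext01. intros t _. rewrite !Cpow_one. ring. }
  assert (G1 : T1 (RtoC (l v)) = g_series N a b (l v)).
  { rewrite g_series_cps by lia. rewrite <- RtoC_minus. apply euler_integral; auto; [lra|].
    revert A1. apply is_RInt_gen_ext01. intros t _. rewrite !Cpow_one. ring. }
  apply I in A2, A3, A4. rewrite A2, A3, A4, G1, !Cpow_one. ring.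
Qed.

Lemma beta_initial (N a b : nat) (eps : R) : (2 <= N)%nat -> (1 <= a <= N - 1)%nat -> (1 <= b <= N - 1)%nat ->
  (0 < eps < 1)%R ->
  Tot (GG N a b) (RtoC eps) (beta_chain N eps) (fun z => (1 - zeta N ^ a) * (1 - zeta N ^ b) * g_series N a b z).
Proof.
  intros HN Ha Hb Heps. set (rho := ((1 - eps) / 2)%R). set (l := fun v => (eps + v * rho)%R).
  assert (Hl : forall v, unit_interval v -> (0 < l v < 1)%R) by (intros v [V0 V1]; unfold l, rho; nra).
  assert (Zn := zeta_neq0 N). assert (Zp := zeta_pow N ltac:(lia)). assert (onep := Cpow_one N).
  assert (Hfam : good_family (onE N) (fun v => RtoC (l v)) (beta_family N l)).
  { split; [|intros u Hu; apply beta_family_cycle; auto].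
    unfold beta_family. repeat apply Forall_cons; try apply Forall_nil; intros u s Hu Hs'; cbn [snd];
      (split; [apply delta_image_onE; auto; lia|apply delta_image_qcont2; auto; lia]). }
  assert (S := beta_family_same N l 0). replace (l 0%R) with eps in S by (unfold l; ring).
  apply (Tot_same _ _ _ _ _ S). apply (Tot_init N a b eps rho); auto; [unfold rho; lra| |].
  - apply holo_near_scal, g_series_holo; auto. rewrite <- RtoC_minus, Cmod_R, Rabs_pos_eq; lra.
  - intros v F Hv HF. apply (beta_period N a b l v); auto.
    exact (good_family_path_ok N _ _ v Hfam Hv).
Qed.

(** * Passage to the notions of the statement, and conclusion *)

Lemma D1_is_derive (f : C -> C) (z v : C) : D1 f z v -> @is_derive C_AbsRing C_NormedModule f z v.
Proof.
  intros H. split; [apply is_linear_scal_l|].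
  intros x Hx e.
  assert (Ex : z = x) by exact (is_filter_lim_locally_unique (K := C_AbsRing) (V := AbsRing_NormedModule C_AbsRing) z x Hx).
  subst x. destruct (proj1 (D1_char _ _ _) H e (cond_pos e)) as [d [Hd P]]. exists (mkposreal d Hd).
  intros w Hw. change (Cmod (f w - f z - (w - z) * v) <= e * Cmod (w - z))%R.
  rewrite (Cmult_comm (w - z)). apply P; auto. now rewrite Cmod_diag.
Qed.

Lemma psum_sum_n (c : nat -> C) (u : C) (n : nat) :
  psum c u (S n) = @sum_n C_NormedModule (fun k => @scal C_AbsRing C_NormedModule (@pow_n C_AbsRing u k) (c k)) n.
Proof.
  assert (P : forall k, @pow_n C_AbsRing u k = u ^ k).
  { intros k. induction k as [|k IH]; [reflexivity|]. rewrite Cpow_S, <- IH. reflexivity. }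
  induction n as [|n IH].
  - rewrite sum_O, P. cbn [psum]. change (0 + c 0%nat * u ^ 0 = u ^ 0 * c 0%nat). ring.
  - rewrite sum_Sn, <- IH, P. cbn [psum].
    change (psum c u n + c n * u ^ n + c (S n) * u ^ S n = psum c u n + c n * u ^ n + u ^ S n * c (S n)).
    ring.
Qed.

Lemma is_pseries_ctends (c : nat -> C) (u L : C) : @is_pseries C_AbsRing C_NormedModule c u L -> ctends (psum c u) L.
Proof.
  intros H e He.
  destruct (H (fun w => (Cmod (w - L) < e)%R)) as [n0 Hn].
  { apply locally_C_iff. exists e. auto. }
  exists (S n0). intros [|n] Hn'; [lia|]. rewrite psum_sum_n. apply Hn. lia.
Qed.

Lemma ctends_terms_bounded (c : nat -> C) (u L : C) : ctends (psum c u) L ->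
  exists M, forall n, (Cmod (c n) * Cmod u ^ n <= M)%R.
Proof.
  intros H. destruct (H 1%R Rlt_0_1) as [n0 Hn].
  assert (B : forall m, exists M, forall n, (n < m)%nat -> (Cmod (c n) * Cmod u ^ n <= M)%R).
  { induction m as [|m [M IH]]; [exists 0%R; intros; lia|].
    exists (Rmax M (Cmod (c m) * Cmod u ^ m)). intros n Hm. destruct (Nat.eq_dec n m) as [->|Hne]; [apply Rmax_r|].
    eapply Rle_trans; [apply IH; lia|apply Rmax_l]. }
  destruct (B n0) as [M HM]. exists (Rmax M 2). intros n.
  destruct (le_lt_dec n0 n) as [Hle|Hlt]; [|eapply Rle_trans; [now apply HM|apply Rmax_l]].
  eapply Rle_trans; [|apply Rmax_r].
  rewrite <- Cmod_pow, <- Cmod_mult.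
  replace (c n * u ^ n) with (psum c u (S n) - psum c u n) by (cbn [psum]; ring).
  assert (A1 := Hn n Hle). assert (A2 := Hn (S n) ltac:(lia)). rewrite Cmod_minus_sym in A1.
  generalize (Cmod_tri_sub (psum c u (S n)) L (psum c u n)). lra.
Qed.

(** Convergence at one point at distance [r / 2] bounds the terms there, which is the Cauchy
    estimate that [psr] carries. *)
Lemma analytic_at_psr (f : C -> C) (z0 : C) : analytic_at f z0 -> psr f z0.
Proof.
  intros [c [r [Hr H]]]. 
  assert (E0 : z0 + RtoC (r / 2) - z0 = RtoC (r / 2)) by ring.
  assert (Er : Cmod (RtoC (r / 2)) = (r / 2)%R) by (rewrite Cmod_R, Rabs_pos_eq; lra).
  assert (K := is_pseries_ctends _ _ _ (H (z0 + RtoC (r / 2)) ltac:(rewrite E0, Er; lra))).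
  rewrite E0 in K. destruct (ctends_terms_bounded _ _ _ K) as [M HM]. rewrite Er in HM.
  exists c, (r / 2)%R, M. split; [lra|]. split; auto.
  intros w Hw. apply is_pseries_ctends, H. lra.
Qed.

Lemma psr_scal (k : C) (f : C -> C) (z0 : C) : psr f z0 -> psr (fun z => k * f z) z0.
Proof.
  intros [c [rho [M [Hr [HM H]]]]]. exists (fun n => k * c n), rho, (Cmod k * M)%R. split; auto. split.
  - intros n. rewrite Cmod_mult, Rmult_assoc. apply Rmult_le_compat_l; auto. apply Cmod_ge_0.
  - intros w Hw. apply ctends_ext with (fun n => k * psum c (w - z0) n).
    + intros n. induction n as [|n IH]; cbn [psum]; [ring|]. rewrite <- IH. ring.
    + now apply ctends_scal, H.
Qed.

Lemma pb_P1_locally (r : R) (P : P1) : (0 < r)%R -> P1_locally P (pb r P).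
Proof. intros Hr. destruct P as [z|]; cbn [P1_locally pb]; [exists r; auto|]. split; auto. exists (/ r)%R. auto. Qed.

Lemma square_P1_near (h : R -> R -> P1) (u s r : R) : (0 < r)%R ->
  filterlim (fun q : R * R => h (fst q) (snd q)) (within unit_square (locally (u, s))) (P1_locally (h u s)) ->
  exists d, (0 < d)%R /\ forall u' s', unit_interval u' -> unit_interval s' ->
    (Rabs (u' - u) < d)%R -> (Rabs (s' - s) < d)%R -> pb r (h u s) (h u' s').
Proof.
  intros Hr H. destruct (H _ (pb_P1_locally r (h u s) Hr)) as [d P]. exists d. split; [apply cond_pos|].
  intros u' s' A B A' B'. apply (P (u', s')); split; cbn [fst snd]; auto.
Qed.

Lemma parameter_path_cont (gam : R -> C) (u e : R) : parameter_path gam -> unit_interval u -> (0 < e)%R ->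
  exists d, (0 < d)%R /\ forall v, unit_interval v -> (Rabs (v - u) < d)%R -> (Cmod (gam v - gam u) < e)%R.
Proof.
  intros Hg Hu He. destruct (Hg u Hu) as [H _].
  destruct (H (fun w => (Cmod (w - gam u) < e)%R)) as [d P].
  { apply locally_C_iff. exists e. auto. }
  exists d. split; [apply cond_pos|]. intros v Hv A. apply P; auto.
Qed.

Lemma good_family_of_continuous (N : nat) (gam : R -> C) (fam : chain_family) : parameter_path gam ->
  List.Forall (fun m => continuous_on_square (snd m)
     /\ forall u s, unit_interval u -> unit_interval s -> on_curve N (gam u) (snd m u s)) fam ->
  (forall u, unit_interval u -> is_cycle (chain_at fam u)) -> good_family (onE N) gam fam.
Proof.
  intros Hg Hfam Hcyc. split; auto. revert Hfam. apply Forall_impl. intros [n h] [Hc Ho] u s Hu Hs'.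
  cbn [snd] in *. split.
  - destruct (Hg u Hu) as [_ [G0 G1]]. repeat split; cbn [fst snd]; auto.
  - intros r Hr. destruct (Hc u s Hu Hs') as [K1 K2].
    destruct (square_P1_near (fun u s => fst (h u s)) u s r Hr K1) as [d1 [Hd1 P1]].
    destruct (square_P1_near (fun u s => snd (h u s)) u s r Hr K2) as [d2 [Hd2 P2]].
    destruct (parameter_path_cont gam u r Hg Hu Hr) as [d3 [Hd3 P3]].
    exists (Rmin d1 (Rmin d2 d3)).
    assert (m1 := Rmin_l d1 (Rmin d2 d3)). assert (m2 := Rmin_r d1 (Rmin d2 d3)).
    assert (m3 := Rmin_l d2 d3). assert (m4 := Rmin_r d2 d3).
    split; [repeat apply Rmin_pos; auto|]. intros u' s' A B A' B'.
    split; [|split]; cbn [fst snd]; [apply P3|apply P1|apply P2]; auto; lra.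
Qed.

Lemma same_chain_sym (c d : chain) : same_chain c d -> same_chain d c.
Proof.
  induction 1 as [|m m' c d [E1 E2] H IH]; [constructor|]. constructor; auto. split; auto.
  intros s Hs'. symmetry. auto.
Qed.

Lemma same_chain_path_ok (N : nat) (l : C) (c d : chain) : same_chain c d ->
  List.Forall (fun m => path_ok N l (snd m)) c -> List.Forall (fun m => path_ok N l (snd m)) d.
Proof.
  induction 1 as [|m m' c d [E1 E2] H IH]; intros K; [constructor|].
  apply Forall_cons_iff in K as [[K1 K2] K]. constructor; auto. split.
  - intros s Hs'. rewrite <- E2; auto.
  - intros s Hs' r Hr. destruct (K2 s Hs' r Hr) as [d' [Hd P]]. exists d'. split; auto.
    intros s' A B. rewrite <- !E2; auto.
Qed.

(** Continuity of the family suffices for the transport; smoothness of [c1] serves to turn the final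
    germ and its derivative into integrals. *)
Lemma continuation_integrals (N a b : nat) (gam : R -> C) (c0 c1 : chain) (F : R -> C -> C) : (2 <= N)%nat ->
  (1 <= a <= N - 1)%nat -> (1 <= b <= N - 1)%nat -> parameter_path gam ->
  cycle_continuation N gam c0 c1 -> smooth_chain c1 -> Tot (GG N a b) (gam 0%R) c0 (F 0%R) ->
  (forall u, unit_interval u -> psr (F u) (gam u)) ->
  (forall u, unit_interval u -> exists d, (0 < d)%R /\ forall v, unit_interval v ->
     (Rabs (v - u) < d)%R -> eq_near (F v) (F u) (gam v)) ->
  is_chain_integral (omega N a b) c1 (F 1%R (gam 1%R)) /\
  exists F', D1 (F 1%R) (gam 1%R) F' /\ is_chain_integral (nu (gam 1%R) a b) c1 F'.
Proof.
  intros HN Ha Hb Hg [fam [S0 [S1 [Hfam Hcyc]]]] Hsm T0 Hpsr Hcomp.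
  assert (U1 : unit_interval 1) by (unfold unit_interval; lra).
  assert (Gf := good_family_of_continuous N gam fam Hg Hfam Hcyc).
  apply (Tot_integrals N a b); auto.
  - apply (same_chain_path_ok _ _ _ _ S1). now apply good_family_path_ok.
  - apply (Tot_same _ _ _ _ _ S1).
    apply (Tot_continuation (onE N) (GG N a b) gam fam F); auto.
    + now apply GG_local_cocycle.
    + intros u Hu e He. now apply parameter_path_cont.
    + apply (Tot_same _ _ c0); auto. now apply same_chain_sym.
Qed.

(** The real part of [zeta N ^ a] is [1 - 2 sin(PI a / N)^2], and the sine is positive. The constant
    of the beta period can therefore be divided out. *)
Lemma zeta_pow_neq1 (N a : nat) : (1 <= a <= N - 1)%nat -> 1 - zeta N ^ a <> 0.
Proof.
  intros Ha. assert (Fa := frac_bounds N a Ha). apply Csub_neq0. intros E.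
  unfold zeta in E. rewrite cis_pow in E.
  replace (INR a * (2 * PI / INR N))%R with (2 * (PI * (INR a / INR N)))%R in E.
  2: { field. apply not_0_INR. lia. }
  set (t := (PI * (INR a / INR N))%R) in *. assert (P := PI_RGT_0).
  assert (C1 : cos (2 * t) = 1%R) by (apply (f_equal fst) in E; symmetry; exact E).
  rewrite cos_2a_sin in C1. assert (0 < sin t)%R by (apply sin_gt_0; unfold t; nra). nra.
Qed.

Theorem theorem2p7 :
  forall N : nat, (2 <= N)%nat ->
  exists eps0 : R, (0 < eps0)%R /\
  forall (eps : R) (alpha : path) (gam : R -> C) (cA cB : chain) (a b : nat),
    (0 < eps < eps0)%R ->
    is_alpha N eps alpha ->
    parameter_path gam -> gam 0%R = RtoC eps ->
    cycle_continuation N gam (alpha_chain alpha) cA -> smooth_chain cA ->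
    cycle_continuation N gam (beta_chain N eps) cB -> smooth_chain cB ->
    (1 <= a <= N - 1)%nat -> (1 <= b <= N - 1)%nat ->
    (forall F G : R -> C -> C,
       analytic_continuation gam (f_series N a b) F ->
       analytic_continuation gam (g_series N a b) G ->
       period_identity N a b (gam 1%R) cA cB (F 1%R) (G 1%R))
    /\
    (forall lam : R, (0 < lam < 1)%R ->
       (forall u, unit_interval u -> gam u = RtoC (eps + u * (lam - eps))%R) ->
       period_identity N a b (RtoC lam) cA cB
         (f_series N a b) (g_series N a b)).
Proof.
  intros N HN. destruct (alpha_initial N HN) as [eps0 [He0 Halpha]].
  exists eps0. split; [lra|].
  intros eps alpha gam cA cB a b Heps Hal Hg Hg0 HcA HsA HcB HsB Ha Hb.
  assert (TA := Halpha eps alpha a b Heps Hal Ha Hb).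
  assert (TB := beta_initial N a b eps HN Ha Hb ltac:(lra)). rewrite <- Hg0 in TA, TB.
  (* Common core of both claims: the germs along the path are only required to be power series that
     fit together. *)
  assert (Key : forall F G : R -> C -> C,
    eq_near (F 0%R) (f_series N a b) (gam 0%R) -> eq_near (G 0%R) (g_series N a b) (gam 0%R) ->
    (forall u, unit_interval u -> psr (F u) (gam u)) -> (forall u, unit_interval u -> psr (G u) (gam u)) ->
    (forall u, unit_interval u -> exists d, (0 < d)%R /\ forall v, unit_interval v ->
       (Rabs (v - u) < d)%R -> eq_near (F v) (F u) (gam v)) ->
    (forall u, unit_interval u -> exists d, (0 < d)%R /\ forall v, unit_interval v ->
       (Rabs (v - u) < d)%R -> eq_near (G v) (G u) (gam v)) ->
    period_identity N a b (gam 1%R) cA cB (F 1%R) (G 1%R)).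
  { intros F G F0 G0 PF PG' CF CG.
    set (k := (1 - zeta N ^ a) * (1 - zeta N ^ b)) in *.
    assert (Hk : k <> 0) by (apply Cmult_neq_0; now apply zeta_pow_neq1).
    destruct (continuation_integrals N a b gam _ cA F HN Ha Hb Hg HcA HsA) as [IA [df [DA JA]]]; auto.
    { apply (Tot_eq _ _ _ (f_series N a b)); auto. now apply eq_near_sym. }
    destruct (continuation_integrals N a b gam _ cB (fun u z => k * G u z) HN Ha Hb Hg HcB HsB)
      as [IB [dk [DB JB]]].
    - apply (Tot_eq _ _ _ (fun z => k * g_series N a b z)); auto.
      apply eq_near_sym. apply (eq_near_op2 Cmult (fun _ => k) (fun _ => k)); auto. apply eq_near_refl.
    - intros u Hu. now apply psr_scal, PG'.
    - intros u Hu. destruct (CG u Hu) as [d [Hd P]]. exists d. split; auto. intros v Hv A.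
      apply (eq_near_op2 Cmult (fun _ => k) (fun _ => k)); auto. apply eq_near_refl.
    - cbv beta in *. exists df, (/ k * dk). fold k. split; [|split; [|split; [|split; [|split]]]]; auto.
      + now apply D1_is_derive.
      (* The transport differentiates the beta period, which is [k * G]; dividing by [k] gives the
         derivative of [G] itself. *)
      + apply D1_is_derive. apply (D1_ext (fun z => / k * (k * G 1%R z))); [intros z; field; auto|].
        eapply D1_eq; [apply D1_mul; [apply (D1_const (/ k))|exact DB]|cring].
      + replace (k * (/ k * dk)) with dk by (field; auto). exact JB. }
  split.
  - intros F G [F0 [F1 F2]] [G0 [G1 G2]]. apply Key; auto; intros u Hu; apply analytic_at_psr; auto.
  - intros lam Hlam Hgam. assert (U1 : unit_interval 1) by (unfold unit_interval; lra).
    assert (E1 : gam 1%R = RtoC lam) by (rewrite (Hgam 1%R U1); f_equal; ring).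
    (* On the real segment the parameter stays in both discs of convergence, so each series is its
       own continuation and the families of germs are constant. *)
    rewrite <- E1. apply (Key (fun _ => f_series N a b) (fun _ => g_series N a b)); try apply eq_near_refl.
    + intros u Hu. rewrite Hgam by auto. apply holo_near_psr, f_series_holo; auto.
      unfold unit_interval in Hu. rewrite Cmod_R, Rabs_pos_eq; nra.
    + intros u Hu. rewrite Hgam by auto. apply holo_near_psr, g_series_holo; auto.
      unfold unit_interval in Hu. rewrite <- RtoC_minus, Cmod_R, Rabs_pos_eq; nra.
    + intros u Hu. exists 1%R. split; [lra|]. intros. apply eq_near_refl.
    + intros u Hu. exists 1%R. split; [lra|]. intros. apply eq_near_refl.
Qed.
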